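(* Fix an integer $k\geq 1$ and let $n=3\cdot 2^k$. There exist $c',C'>0$ such that for all $X\geq 3$ we have $$c'X\log X\leq\sum_{|d|\leq X}h_n(d)\leq C'X\log X,$$ where the sum is over the fundamental discriminants $d$ (positive and negative) of quadratic fields with $|d|\leq X$.
   Context: For an integer $n\geq 1$ and a fundamental discriminant $d$ of a quadratic field, $h_n(d):=\#\mathrm{Cl}(\mathbb{Q}(\sqrt d))[n]$ is the size of the $n$-torsion subgroup of the (ordinary) class group of $\mathbb{Q}(\sqrt d)$. *)

(* Defs.v *)
From HB Require Import structures.
From mathcomp Require Import all_boot all_order all_algebra all_field finmap.
From mathcomp Require Import boolp classical_sets functions cardinality fsbigop.
From mathcomp Require Import reals.

Set Implicit Arguments.
Unset Strict Implicit.
Unset Printing Implicit Defensive.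

Import Order.TTheory GRing.Theory Num.Theory.
Local Open Scope classical_set_scope.
Local Open Scope ring_scope.

Definition squarefree (m : int) : Prop :=
  forall p : nat, prime p -> ~~ (p ^ 2 %| `|m|)%N.

(* [d = 1], the discriminant of the rationals, is excluded. *)
Definition fundamental_discriminant (d : int) : Prop :=
  [/\ (d %% 4)%Z = 1, squarefree d & d <> 1] \/
  (exists m : int, [/\ d = 4 * m, squarefree m &
                       (m %% 4)%Z = 2 \/ (m %% 4)%Z = 3]).

Definition quadratic_field (d : int) : set algC :=
  [set x | exists a b : rat, x = ratr a + ratr b * sqrtC d%:~R].

Section ClassGroup.

(* [K] is meant to be a number field, given as a subfield of [algC]. *)
Variable K : set algC.

Definition ring_of_integers : set algC := [set x | K x /\ x \in Aint].

Record fractional_ideal (I : set algC) : Prop := FractionalIdeal {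
  fractional_ideal_sub : I `<=` K;
  fractional_ideal_neq0 : exists2 x, I x & x != 0;
  fractional_ideal_add : forall x y, I x -> I y -> I (x + y);
  fractional_ideal_scale : forall a x, ring_of_integers a -> I x -> I (a * x);
  fractional_ideal_denom : exists r,
    [/\ ring_of_integers r, r != 0 & forall x, I x -> ring_of_integers (r * x)]
}.

Definition ideal_mul (I J : set algC) : set algC :=
  [set z | exists (m : nat) (x y : 'I_m -> algC),
     [/\ forall i, I (x i), forall i, J (y i) & z = \sum_(i < m) x i * y i]].

(* The coset of [I] modulo the nonzero principal fractional ideals: since
   (x)I = xI, it consists of the xI for nonzero [x] in [K]. *)
Definition ideal_class (I : set algC) : set (set algC) :=
  [set J | exists x, [/\ K x, x != 0 & J = [set x * y | y in I]]].

Definition class_group : set (set (set algC)) :=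
  [set ideal_class I | I in fractional_ideal].

Definition class_mul (c1 c2 : set (set algC)) : set (set algC) :=
  [set ideal_mul I J | I in c1 & J in c2].

Definition class_one : set (set algC) := ideal_class ring_of_integers.

Definition class_exp (c : set (set algC)) (n : nat) : set (set algC) :=
  iter n (class_mul c) class_one.

Definition class_group_torsion (n : nat) : set (set (set algC)) :=
  [set c | class_group c /\ class_exp c n = class_one].

End ClassGroup.

(* [fset_set] sends infinite sets to the empty one; this default is harmless
   here because class groups of number fields are finite. *)
Definition h (n : nat) (d : int) : nat :=
  #|` fset_set (class_group_torsion (quadratic_field d) n)|.

(* Main.v *)
Require Import Defs.
From HB Require Import structures.
From mathcomp Require Import all_boot all_order all_algebra all_fingroup all_solvable all_field finmap.
From mathcomp Require Import ring lra zify.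
From mathcomp Require Import boolp classical_sets functions cardinality fsbigop reals exp sequences.
Set Implicit Arguments. Unset Strict Implicit. Unset Printing Implicit Defensive.
Import Order.TTheory GRing.Theory Num.Theory.
Local Open Scope ring_scope.

(** Upper bound, algebra. The group Cl[3 2^k] has at most #Cl[3] #Cl[2^k] elements, and #Cl[2^k] is
    at most the (k-1)-st power of the number of squares in Cl[2], times #Cl[2] ([bnd_3_2pow],
    [bnd_2pow]). By genus theory a class of order 2 is, up to bounded multiplicity, given by a
    divisor e of d ([twist_stable]); if the class is a square, then e satisfies a norm equation,
    hence conditions on Legendre symbols at the odd primes of d. For a set A of primes exactly
    dividing d, the number of such e is at most the size [Kc] of a kernel of Redei type over A,
    times a bounded factor for each prime of d outside A ([bnd_gt2_sq]).

    A nontrivial class of order 3, with J^3 = (delta), yields binary cubic forms of discriminant d: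
    the sqrt d-components of the products x^(3-j) y^j / delta for a basis x, y of J. With a reduced
    basis the coefficients lie in an explicit box. Its shape depends on a level j; a class of level
    j yields 2^j forms, and a form comes from at most two classes ([class_forms], [gt3_levels]). All
    the boxes have volume O(N). Since the sum of 2^-j converges, it suffices to bound the sum of the
    weight [gnum], the size of the 2^k-torsion, over d and over the discriminants of the forms of
    one box by O(N log N), uniformly in j ([gnum_sum], [level_sum], [upper_large]).

    Upper bound, analysis. [core] follows the method of Nair and Tenenbaum. In each value D the
    product of the smallest primes is split off, giving a set A with product at most z; the
    remaining primes are large, so they are few. For given A and given signs of D at the primes of
    A, Selberg's sieve ([sieve_count]) counts the points, saving log z and a factor 2^|A| for the
    signs. There remains the average of Kc^m over A and over the signs, which is O((log z)^2) for
    every m ([moment_bound]).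

    This moment is expanded as by Heath-Brown and Fouvry-Kluners: it becomes a sum over squarefree
    variables indexed by the pairs (u, w) of orthogonal vectors of F_2^m, of products of Jacobi
    symbols between linked indices. If two linked variables are both nontrivial, their symbol
    oscillates: [regime_small] uses that nonprincipal characters have bounded Euler products up to a
    logarithm, [regime_large] uses bilinear estimates ([dyadic_bound]). Therefore only unlinked sets
    of indices matter ([multi_bound]). They have at most 2^m elements ([unlinked_card]), and each
    variable has total mass of order (log z)^(2/2^m).

    Lower bound. For d = -n with n squarefree and n = 3 mod 4, the divisors e of n with e^2 < n give
    distinct classes of order dividing 2 ([okd_inj], [lower_h]). The number of pairs (e, f) with e <
    f and ef = n at most N is of order N log N by an elementary sieve ([gpair_sum]). *)

(** * Positivity automation and notation *)

Ltac pos_hook := fail.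

Ltac pos := solve [ done | assumption | apply/ltW;assumption |
 match goal with
 | |- is_true (Order.le _ _) => first [ apply: ler0n | apply: sqrtr_ge0 | apply: normr_ge0 | apply: expR_ge0 | apply: sqr_ge0
  | apply: mulr_ge0;pos | apply: exprn_ge0;pos | rewrite invr_ge0;pos | apply: addr_ge0;pos
  | apply: sumr_ge0 => ? ?;pos | apply: prodr_ge0 => ? ?;pos | pos_hook | apply: ltW;pos ]
 | |- is_true (Order.lt _ _) => first [ apply: expR_gt0 | apply: mulr_gt0;pos | apply: exprn_gt0;pos | rewrite invr_gt0;pos
  | apply: addr_gt0;pos | apply: ltr_wpDr;pos | apply: ltr_wpDl;pos | apply: prodr_gt0 => ? ?;pos | rewrite ltr0n;pos ]
 | |- is_true (leq _ _) => first [ rewrite muln_gt0;apply/andP;split;pos | rewrite expn_gt0;apply/orP;left;pos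
  | apply: prime_gt0;pos | pos_hook | apply: ltnW;assumption ]
 | |- is_true (negb (eq_op _ _)) => first [ apply: lt0r_neq0;pos | apply: mulf_neq0;pos | apply: expf_neq0;pos
  | rewrite intr_eq0;pos | rewrite gt_eqF;pos]
 end ].

Tactic Notation "via" uconstr(X) :=
 match goal with
 | |- is_true (leq ?x ?z) => refine (@leq_trans X x z _ _)
 | |- is_true (@Order.le ?d ?T ?x ?z) => refine (@le_trans d T X x z _ _)
 end.
Tactic Notation "letr" uconstr(H) :=
 match goal with
 | |- is_true (leq _ _) => refine (leq_trans H _)
 | |- is_true (Order.le _ _) => refine (le_trans H _)
 end.
Tactic Notation "eqbig" ident(x) := apply: eq_bigr => x _.
Tactic Notation "lesum" ident(x) := apply: ler_sum => x _.

Lemma eqler (d : Order.disp_t) (T : porderType d) (x y : T) : x = y -> (x <= y)%O.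
by move->. Qed.

Notation pset z := {set 'I_z.+1}.
Notation "\sum_pr ( p <= z ) F" := (\sum_(0 <= p < z.+1 | prime p) F)
 (at level 41, F at level 41, p at level 50, z at level 50, format "\sum_pr ( p  <=  z )  F").


(** * The Legendre symbol *)

(** Euler's criterion taken as a definition: multiplicativity is then that of powers in ['F_p]. At p
    = 2 the value at odd integers is 1. *)
Definition leg (p : nat) (a : int) : int :=
 if (a%:~R : 'F_p) == 0 then 0
 else if (a%:~R : 'F_p) ^+ p.-1./2 == 1 then 1 else -1.

Section Legendre.
Variable p : nat.
Hypotheses (p_pr : prime p) (p_odd : odd p).

Lemma Fp_halfpow (x : 'F_p) : x != 0 -> (x ^+ p.-1./2 == 1) || (x ^+ p.-1./2 == -1).
move=> x0;rewrite -eqf_sqr expr1n -exprM muln2 halfK.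
have -> : odd p.-1 = false by lia.
rewrite subn0.
have : x ^+ p = x by have := expf_card x;rewrite card_Fp.
have -> : x ^+ p = x * x ^+ p.-1 by rewrite -exprS prednK// prime_gt0.
move=> h.
by apply/eqP;apply: (mulfI x0);rewrite mulr1 -[RHS]h.
Qed.

Lemma Fp_one_neq_opp : (1 : 'F_p) != -1.
rewrite -subr_eq0 opprK -[1 + 1]/(2%:R) -(dvdn_pcharf (pchar_Fp p_pr)).
by apply/negP => /dvdn_leq => /(_ isT);move: p_pr p_odd;case: (p) => [|[|[|q]]].
Qed.

Lemma leg_Fp a : (leg p a)%:~R = (a%:~R : 'F_p) ^+ p.-1./2.
rewrite /leg;case: eqP => [->|/eqP a0].
 rewrite expr0n;have -> : (p.-1./2 == 0)%N = false;last by [].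
 move: p_pr p_odd;case: (p) => [|[|[|[|q]]]]//=.
case: eqP => [->|/eqP n1]//.
by case/orP: (Fp_halfpow a0) => [/eqP h|/eqP ->]//;rewrite h in n1.
Qed.

Lemma leg_val a : leg p a \in [:: 0;1;-1].
by rewrite /leg;case: ifP => // _;case: ifP. Qed.

Lemma sgn_inj x y : x \in [:: 0;1;-1] -> y \in [:: 0;1;-1] ->
 (x%:~R : 'F_p) = y%:~R -> x = y.
have h1 := Fp_one_neq_opp;have h0 := oner_neq0 'F_p.
rewrite !inE => /or3P[]/eqP-> /or3P[]/eqP-> // /eqP;rewrite ?rmorphN ?rmorph0 ?rmorph1/=;
 by rewrite ?(eq_sym (-1)) ?(eq_sym 0) ?oppr_eq0 ?(negbTE h0) ?(negbTE h1).
Qed.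

Lemma legM a b : leg p (a * b) = leg p a * leg p b.
apply: sgn_inj;rewrite ?leg_val//.
 have := leg_val a;have := leg_val b.
 by rewrite !inE => /or3P[]/eqP -> /or3P[]/eqP ->.
by rewrite [in RHS]rmorphM/= !leg_Fp// rmorphM exprMn.
Qed.

Lemma leg_eq0 a : (leg p a == 0) = (p %| a)%Z.
have <- : ((a%:~R : 'F_p) == 0) = (p %| a)%Z.
 case: (intP a) => [|n|n].
 - by rewrite dvdz0 eqxx.
 - by rewrite -(dvdn_pcharf (pchar_Fp p_pr)).
 - by rewrite rmorphN oppr_eq0 -(dvdn_pcharf (pchar_Fp p_pr)) dvdzE abszN.
by rewrite /leg;case: ifP => // h;case: ifP.
Qed.

Lemma leg_mod a b : (a = b %[mod p])%Z -> leg p a = leg p b.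
move=> /eqP;rewrite eqz_mod_dvd -leg_eq0 -(inj_eq (@intr_inj int)) => /eqP.
have: (p %| a - b)%Z -> (a%:~R : 'F_p) = b%:~R.
 case/dvdzP => q e;apply/eqP;rewrite -subr_eq0 -rmorphB e rmorphM/=.
 by rewrite -[X in _ * X]/(p%:R) pchar_Fp_0// mulr0.
by move=> h /intr_inj/eqP;rewrite leg_eq0 => /h e;rewrite /leg e.
Qed.

Lemma leg1 : leg p 1 = 1.
by rewrite /leg expr1n. Qed.

Lemma leg_sqr a : ~~ (p %| a)%Z -> leg p (a * a) = 1.
rewrite -leg_eq0 legM => h;move: (leg_val a) h;rewrite !inE.
lia.
Qed.

Lemma leg_sq1 a : ~~ (p %| a)%Z -> leg p a * leg p a = 1.
by move=> h;rewrite -legM leg_sqr. Qed.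

(* At most half of the units are roots of X^((p-1)/2) = c. *)
Lemma card_leg_le (c : int) : c != 0 -> 
 (#|[set x : 'F_p | leg p (val x)%:Z == c]| <= p.-1./2)%N.
move=> c0;set A := [set _ | _].
have hp : (0 < p.-1./2)%N by move: p_pr p_odd;case: (p) => [|[|[|[|q]]]].
have sz := size_XnsubC (c%:~R : 'F_p) hp.
have P0 : 'X^(p.-1./2) - (c%:~R : 'F_p)%:P != 0 by rewrite -size_poly_eq0 sz.
have := max_poly_roots P0 (rs := enum A);rewrite sz ltnS -cardE;apply;last exact: enum_uniq.
apply/allP => x;rewrite mem_enum inE => /eqP h.
rewrite rootE !hornerE -h leg_Fp subr_eq0 eq_sym.
by rewrite -[(val x)%:Z%:~R]/((val x)%:R : 'F_p) natr_Zp.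
Qed.

(** Otherwise all p - 1 units would be roots of X^((p-1)/2) - 1. *)
Lemma ex_nonres : exists a : nat, leg p a = -1.
case: (pickP (fun x : 'F_p => leg p (val x)%:Z == -1)) => [x /eqP h|h0];first by exists (val x).
have hsub : [set~ 0] \subset [set x : 'F_p | leg p (val x)%:Z == 1].
 apply/fintype.subsetP => x;rewrite !inE;have := leg_val (val x);rewrite !inE h0 orbF => /orP[h|//].
 by move: h;rewrite leg_eq0 dvdzE/= (dvdn_pcharf (pchar_Fp p_pr)) natr_Zp => ->.
have := leq_trans (subset_leq_card hsub) (card_leg_le (oner_neq0 _)).
by rewrite cardsC1 card_Fp//;have := prime_gt1 p_pr;lia.
Qed.

End Legendre.

(** * Quadratic reciprocity from Gauss sums in characteristic q *)

Section Gauss.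
Variables p q : nat.
Hypotheses (p_pr : prime p) (p_odd : odd p) (q_pr : prime q) (q_odd : odd q) (pq : p != q).

Let p1 : (1 < p)%N := prime_gt1 p_pr.

Definition rep (x : 'F_p) : nat := x.
Arguments rep : simpl never.

Lemma rep_nat n : rep n%:R = (n %% p)%N.
exact: val_Fp_nat. Qed.

Lemma rep_D (x y : 'F_p) : rep (x + y)%R = rep x + rep y %[mod p].
by rewrite -{1}(natr_Zp x) -{1}(natr_Zp y) -natrD rep_nat modn_mod. Qed.

Lemma rep_M (x y : 'F_p) : rep (x * y)%R = (rep x * rep y)%N %[mod p].
by rewrite -{1}(natr_Zp x) -{1}(natr_Zp y) -natrM rep_nat modn_mod. Qed.

Lemma leg_rep_mod (x : 'F_p) n : rep x = n %[mod p] -> leg p (rep x) = leg p n.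
by move=> h;apply: leg_mod => //;rewrite !modz_nat h. Qed.

Lemma lt_rep (x : 'F_p) : (rep x < p)%N.
by rewrite /rep -[X in (_ < X)%N](Fp_cast p_pr) ltn_ord. Qed.

Lemma leg_FpM (x y : 'F_p) : leg p (rep (x * y)) = leg p (rep x) * leg p (rep y).
by rewrite (leg_rep_mod (rep_M x y)) PoszM legM. Qed.

Lemma leg_F0 (x : 'F_p) : (leg p (rep x) == 0) = (x == 0).
rewrite leg_eq0// dvdzE/=;apply/idP/eqP => [h|->];last exact: dvdn0.
by apply: val_inj => /=;apply/eqP;rewrite -[_ == _]negbK -lt0n;apply/negP => /dvdn_leq/(_ h);rewrite leqNgt lt_rep.
Qed.

Lemma sum_leg_Fp : \sum_(x : 'F_p) leg p (rep x) = 0.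
have [a ha] := ex_nonres p_pr p_odd.
have u0 : (a%:R : 'F_p) != 0 by apply/eqP => /eqP;rewrite -(dvdn_pcharf (pchar_Fp p_pr)) => h;move/eqP: ha;rewrite eq_sym;have /eqP -> : leg p a == 0 by rewrite leg_eq0.
set S := \sum_(_ | _) _.
have : S = - S.
 rewrite /S [LHS](reindex_inj (mulfI u0))/= -sumrN;eqbig x.
 rewrite leg_FpM (leg_rep_mod (n := a)) ?ha ?mulN1r//.
 by rewrite rep_nat modn_mod.
by move/eqP;rewrite -addr_eq0 -mulr2n mulrn_eq0 => /eqP.
Qed.

Variables (L : fieldType) (z : L).
Hypotheses (Lq : q \in [pchar L]) (zp : p.-primitive_root z).

Let chi (x : 'F_p) : L := (leg p (rep x))%:~R.
Definition gauss_sum : L := \sum_(x : 'F_p) chi x * z ^+ rep x.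

Lemma zD (x y : 'F_p) : z ^+ rep (x + y) = z ^+ rep x * z ^+ rep y.
by rewrite -exprD;apply/eqP;rewrite (eq_prim_root_expr zp);apply/eqP/rep_D. Qed.

Lemma sum_z (y : 'F_p) : \sum_(x : 'F_p) z ^+ rep (x * y) = if y == 0 then p%:R else 0.
case: eqP => [->|/eqP y0].
 by under eq_bigr => x _ do rewrite mulr0;rewrite sumr_const card_Fp.
rewrite -(reindex_inj (mulIf y0) (P := predT) (F := fun x => z ^+ rep x))/=.
set S := \sum_(_ | _) _.
have : z ^+ rep (1 : 'F_p) * S = S.
 rewrite /S mulr_sumr [RHS](reindex_inj (addrI 1))/=;eqbig x.
 by rewrite -zD.
have -> : z ^+ rep (1 : 'F_p) = z by [].
move/eqP;rewrite -subr_eq0 -{2}[S]mul1r -mulrBl mulf_eq0 subr_eq0 => /orP[]/eqP// z1.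
by have := prim_order_dvd zp 1;rewrite z1 eqxx dvdn1 => /eqP e;move: (p1);rewrite e.
Qed.

(** Substitute y = xc in the double sum over x and y: the symbols of x cancel and x remains only in
    the power of z with exponent x(1 + c). Summing over x first leaves p times the term c = -1,
    minus the full sum of the symbol, which is 0. *)
Lemma gauss_sqr : gauss_sum * gauss_sum = (leg p (-1))%:~R * p%:R.
rewrite /gauss_sum mulr_suml.
transitivity (\sum_(x : 'F_p) \sum_(c : 'F_p) chi c * (if x == 0 then 0 else 1) * z ^+ rep (x * (1 + c))).
 eqbig x;case: eqP => [->|/eqP x0].
  rewrite [RHS]big1 => [|c _];last ring.
  ring.
 rewrite mulr_sumr (reindex_inj (mulfI x0))/=;eqbig c.
 rewrite mulr1 /chi leg_FpM intrM mulrDr mulr1 zD.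
 have h1 : (leg p (rep x))%:~R * (leg p (rep x))%:~R = 1 :> L by rewrite -intrM leg_sq1// -leg_eq0// leg_F0.
 transitivity (((leg p (rep x))%:~R * (leg p (rep x))%:~R : L) *
   ((leg p (rep c))%:~R * (z ^+ rep x * z ^+ rep (x * c))));first ring.
 by rewrite h1 mul1r.
rewrite exchange_big/=.
transitivity (\sum_(c : 'F_p) chi c * ((if 1 + c == 0 then p%:R else 0) - 1)).
 eqbig c;rewrite -sum_z [LHS](bigD1 0)//= ?eqxx mulr0 mul0r add0r.
 rewrite [in RHS](bigD1 0)//= mul0r expr0 addrAC subrr add0r mulr_sumr.
 by apply: eq_bigr => x /negbTE ->;rewrite mulr1.
under eq_bigr => c _ do rewrite mulrBr mulr1.
rewrite sumrB /chi -rmorph_sum/= sum_leg_Fp subr0 (bigD1 (-1))//= subrr eqxx.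
rewrite big1 ?addr0 => [|c hc];last by rewrite addrC addr_eq0 (negbTE hc) mulr0.
congr (_%:~R * _);apply: leg_mod => //;apply/eqP;rewrite eqz_mod_dvd opprK.
by rewrite -PoszD dvdzE/= (dvdn_pcharf (pchar_Fp p_pr)) natrD natr_Zp addNr.
Qed.

Lemma gauss_frob : gauss_sum ^+ q = (leg p q)%:~R * gauss_sum.
rewrite -(pFrobenius_autE Lq) /gauss_sum rmorph_sum/= mulr_sumr.
have q0 : (q%:R : 'F_p) != 0 by rewrite -(dvdn_pcharf (pchar_Fp p_pr)) dvdn_prime2.
rewrite [RHS](reindex_inj (mulfI q0))/=;eqbig x.
rewrite rmorphM/= !pFrobenius_autE -exprM.
have -> : chi x ^+ q = chi x.
 rewrite /chi;have := leg_val p (rep x);rewrite !inE => /or3P[]/eqP->.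
 - by rewrite expr0n;case: (q) q_pr.
 - by rewrite expr1n.
 - by rewrite -signr_odd q_odd.
rewrite /chi leg_FpM (leg_rep_mod (x := q%:R) (n := q));last by rewrite rep_nat modn_mod.
rewrite intrM !mulrA -intrM leg_sq1// ?mul1r;last by rewrite dvdzE dvdn_prime2.
congr (_ * _);apply/eqP;rewrite (eq_prim_root_expr zp);apply/eqP.
by rewrite rep_M mulnC rep_nat modnMml.
Qed.

(** The power G^(q-1) is computed twice: it is (q/p) by Frobenius, and it is the (q-1)/2-th power of
    G^2 = (-1/p) p, which is a symbol modulo q by Euler's criterion. *)
Lemma gauss_rec : leg q (leg p (-1) * p) = leg p q.
have g0 : gauss_sum != 0.
 apply/eqP => h;have := gauss_sqr;rewrite h mul0r => /eqP;rewrite eq_sym mulf_eq0.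
 rewrite -[in X in _ || X](dvdn_pcharf Lq) (dvdn_prime2 q_pr p_pr) [q == p]eq_sym (negbTE pq) orbF.
 have := leg_val p (-1);rewrite !inE => /or3P[]/eqP e.
 - by move/eqP: e;rewrite leg_eq0// dvdzE/= dvdn1;case: eqP p1 => // ->.
 - by rewrite e oner_eq0.
 - by rewrite e oppr_eq0 oner_eq0.
apply: (sgn_inj q_pr q_odd);rewrite ?leg_val//.
have h1 : (leg p q)%:~R = ((leg p (-1) * p)%:~R : L) ^+ q.-1./2.
 apply: (mulfI g0);rewrite [LHS]mulrC -gauss_frob intrM -gauss_sqr -expr2 -exprM mul2n.
 rewrite -exprS;congr (_ ^+ _).
 lia.
rewrite leg_Fp//.
have inj (a b : int) : (a%:~R : L) = b%:~R -> (a%:~R : 'F_q) = b%:~R.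
 move=> /eqP;rewrite -subr_eq0 -rmorphB/= => h;apply/eqP;rewrite -subr_eq0 -rmorphB/=.
 move: h;case: (a - b) => n;rewrite ?NegzE ?rmorphN ?oppr_eq0/= -!pmulrn => h.
  by rewrite -(dvdn_pcharf (pchar_Fp q_pr)) (dvdn_pcharf Lq).
 by rewrite -(dvdn_pcharf (pchar_Fp q_pr)) (dvdn_pcharf Lq).
by rewrite -rmorphXn;apply: inj;rewrite h1 rmorphXn.
Qed.

End Gauss.

(** The field of characteristic q is a splitting field of X^p - 1 over F_q; this polynomial is
    separable because p is not q, so its p roots contain a primitive one. *)
Lemma leg_prec p q : prime p -> odd p -> prime q -> odd q -> p != q ->
 leg q (leg p (-1) * p) = leg p q.
move=> p_pr p_odd q_pr q_odd pq.
have P0 : 'X^p - 1 != 0 :> {poly 'F_q} by rewrite -size_poly_eq0 size_XnsubC ?prime_gt0.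
have [L [rs /eqpP[[c1 c2]/= /andP[c10 c20] Hrs] _]] := FinSplittingFieldFor P0.
have Lq : q \in [pchar L] by rewrite pchar_lalg pchar_Fp.
have Prs : all p.-unity_root rs.
 apply/allP => x xrs;rewrite unity_rootE -subr_eq0.
 have : (c2 *: \prod_(z <- rs) ('X - z%:P)).[x] = 0 by rewrite hornerZ;apply/eqP;rewrite mulf_eq0 -/(root _ _) root_prod_XsubC xrs orbT.
 rewrite -Hrs hornerZ => /eqP;rewrite mulf_eq0 (negbTE c10)/=.
 by rewrite rmorphB rmorph1/= map_polyXn !hornerE.
have Ers : map_poly (in_alg L) ('X^p - 1) = \prod_(z <- rs) ('X - z%:P).
 have h : monic_pred (map_poly (in_alg L) ('X^p - 1)) by rewrite rmorphB rmorph1/= map_polyXn;apply: monicXnsubC;apply: prime_gt0.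
 have h2 : c1 = c2.
  have := congr1 lead_coef Hrs;rewrite !lead_coefZ.
  by rewrite (monicP h) (monicP (monic_prod_XsubC _ _ _)) !mulr1.
 by move: Hrs;rewrite h2;apply: scalerI.
have sz : size rs = p.
 have := congr1 (@size _ \o val) Ers;rewrite /= size_prod_XsubC rmorphB rmorph1/= map_polyXn.
 by rewrite size_XnsubC ?prime_gt0// => -[].
have Urs : uniq rs.
 rewrite -separable_prod_XsubC -Ers separable_map;apply: separable_Xn_sub_1.
 by rewrite -(dvdn_pcharf (pchar_Fp q_pr)) dvdn_prime2// eq_sym.
have : has p.-primitive_root rs by apply: has_prim_root;rewrite ?prime_gt0 ?sz.
by case/hasP => z _ zp;apply: (gauss_rec p_pr p_odd q_pr q_odd pq Lq zp).
Qed.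

Lemma leg_N1 p : prime p -> odd p -> leg p (-1) = if (p %% 4 == 3)%N then -1 else 1.
move=> pp po;apply: (sgn_inj pp po);rewrite ?leg_val//;first by case: ifP.
rewrite leg_Fp// rmorphN1 -signr_odd.
have -> : odd p.-1./2 = (p %% 4 == 3)%N by lia.
by case: eqP.
Qed.

(** For odd m and n this is (-1)^((m-1)(n-1)/4), the sign of the reciprocity law. *)
Definition rsgn (m n : nat) : int := if (m %% 4 == 3)%N && (n %% 4 == 3)%N then -1 else 1.

Lemma qrec p q : prime p -> odd p -> prime q -> odd q ->
 leg q p = leg p q * rsgn p q.
move=> pp po qp qo;case: (eqVneq p q) => [<-|pq].
 have /eqP -> : leg p p == 0 by rewrite leg_eq0// dvdzz.
 lia.
rewrite -(leg_prec pp po qp qo pq) legM// leg_N1// /rsgn.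
case: ifP => _;last by rewrite leg1 mul1r mulr1.
rewrite leg_N1// andTb mulrAC;case: ifP => _;first lia.
lia.
Qed.

(** * The Jacobi symbol and its reciprocity law *)

Definition jac (a : int) (n : nat) : int := \prod_(p <- primes n) leg p a ^+ logn p n.

Lemma jac1 a : jac a 1 = 1.
by rewrite /jac big_nil. Qed.

Lemma jac_prime a p : prime p -> jac a p = leg p a.
by move=> pp;rewrite /jac primes_prime// big_seq1 logn_prime// eqxx. Qed.

Lemma jac_widen a n N : (0 < n <= N)%N ->
 jac a n = \prod_(0 <= p < N.+1 | prime p) leg p a ^+ logn p n.
move=> /andP[n0 nN];rewrite /jac.
rewrite (bigID (fun p => p %| n)%N)/= [X in _ * X]big1 ?mulr1;last first.
 by move=> p /negbTE h;rewrite lognE h !andbF.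
rewrite [RHS](bigID (fun p => p %| n)%N)/= [X in _ = _ * X]big1 ?mulr1;last first.
 by move=> p /andP[_ /negbTE h];rewrite lognE h !andbF.
rewrite -big_filter -[RHS]big_filter;apply: perm_big;apply: uniq_perm.
- by rewrite filter_uniq// primes_uniq.
- by rewrite filter_uniq// iota_uniq.
move=> p;rewrite !mem_filter mem_primes mem_index_iota n0/= ltnS.
case: (prime p) => //=;case h: (p %| n)%N => //=.
by rewrite (leq_trans (dvdn_leq n0 h) nN).
Qed.

Lemma jacMr a m n : (0 < m)%N -> (0 < n)%N -> jac a (m * n) = jac a m * jac a n.
move=> m0 n0;have mn0 : (0 < m * n)%N by lia.
rewrite (@jac_widen _ _ (m * n)%N) ?mn0 ?leqnn// (@jac_widen _ m (m * n)%N) ?m0 ?leq_pmulr//.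
rewrite (@jac_widen _ n (m * n)%N) ?n0 ?leq_pmull// -big_split/=.
by apply: eq_bigr => p pp;rewrite lognM// exprD.
Qed.

Lemma jacMl a b n : odd n -> jac (a * b) n = jac a n * jac b n.
move=> no;rewrite /jac -big_split/= big_seq [RHS]big_seq;apply: eq_bigr => p.
rewrite mem_primes => /and3P[pp n0 pn];rewrite -exprMn legM//.
exact: dvdn_odd pn no.
Qed.

Lemma prime_div_ind (P : nat -> Prop) : P 1%N ->
 (forall p n, prime p -> (0 < n)%N -> P n -> P (p * n)%N) -> forall n, (0 < n)%N -> P n.
move=> P1 PM;elim/ltn_ind => n IH n0;case: (ltngtP n 1) => [|n1|->]//;first lia.
have pp := pdiv_prime n1;have pn := pdiv_dvd n;rewrite -(divnK pn) mulnC.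
have h : (0 < n %/ pdiv n)%N by lia.
by apply: PM => //;apply: IH => //;rewrite ltn_Pdiv ?prime_gt1.
Qed.

Lemma jac_mod a b n : odd n -> (a = b %[mod n])%Z -> jac a n = jac b n.
move=> no /eqP;rewrite eqz_mod_dvd => h;rewrite /jac !big_seq;apply: eq_bigr => p.
rewrite mem_primes => /and3P[pp n0 pn];congr (_ ^+ _).
apply: leg_mod => //.
by apply/eqP;rewrite eqz_mod_dvd;apply: dvdz_trans h;rewrite dvdzE.
Qed.

Lemma jac_val a n : (0 < n)%N -> jac a n \in [:: 0;1;-1].
move: n;apply: prime_div_ind => [|p n pp n0];first by rewrite jac1.
rewrite (jacMr _ (prime_gt0 pp) n0) (jac_prime _ pp);move: (leg_val p a).
by rewrite !inE => /or3P[]/eqP-> /or3P[]/eqP->.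
Qed.

Lemma jac_norm_le a n : (0 < n)%N -> `|jac a n| <= 1.
by move/(jac_val a);rewrite !inE => /or3P[]/eqP->. Qed.

Lemma jac_coprime (a n : nat) : (0 < n)%N -> (jac a n == 0) = ~~ coprime a n.
move: n;apply: prime_div_ind => [|p n pp n0 IH];first by rewrite jac1 coprimen1.
rewrite (jacMr _ (prime_gt0 pp) n0) (jac_prime _ pp) mulf_eq0 leg_eq0// IH coprimeMr negb_and.
by rewrite [coprime a p]coprime_sym (prime_coprime _ pp) negbK dvdzE.
Qed.

Lemma rsgnMr m n1 n2 : odd n1 -> odd n2 -> rsgn m (n1 * n2) = rsgn m n1 * rsgn m n2.
move=> o1 o2;rewrite /rsgn.
have h1 : (n1 %% 4 = 1 \/ n1 %% 4 = 3)%N by lia.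
have h2 : (n2 %% 4 = 1 \/ n2 %% 4 = 3)%N by lia.
rewrite -(modnMml n1) -(modnMmr _ n2).
by case: h1 => ->;case: h2 => ->;case: (m %% 4 == 3)%N.
Qed.

Lemma rsgnC m n : rsgn m n = rsgn n m.
by rewrite /rsgn andbC. Qed.

Lemma rsgn1 n : rsgn n 1 = 1.
by rewrite /rsgn andbF. Qed.

Lemma jac1l n : odd n -> jac 1 n = 1.
move=> no;rewrite /jac big_seq big1// => p;rewrite mem_primes => /and3P[pp _ pn].
by rewrite leg1 expr1n.
Qed.

Lemma jac_rec_prime p m : prime p -> odd p -> (0 < m)%N -> odd m ->
 jac m p = jac p m * rsgn p m.
move=> pp po;move: m;apply: prime_div_ind => [|q m qp m0 IH].
 by rewrite jac1 rsgn1 jac1l.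
rewrite oddM => /andP[qo mo];rewrite (jacMr _ (prime_gt0 qp) m0) PoszM jacMl// IH// rsgnMr//.
rewrite (jac_prime _ pp) (jac_prime _ qp) (qrec qp qo pp po) (rsgnC q p);ring.
Qed.

Lemma jac_rec m n : (0 < m)%N -> odd m -> (0 < n)%N -> odd n ->
 jac m n = jac n m * rsgn m n.
move=> m0 mo;move: n;apply: prime_div_ind => [|p n pp n0 IH].
 by rewrite jac1 rsgn1 jac1l.
rewrite oddM => /andP[po no];rewrite (jacMr _ (prime_gt0 pp) n0) PoszM jacMl// IH// rsgnMr//.
rewrite (jac_rec_prime pp po m0 mo) (rsgnC p m);ring.
Qed.

(** * Sums of Jacobi symbols over intervals *)

Lemma sum_nat_period (f : nat -> int) (q a : nat) :
 (forall x, f (x + q)%N = f x) -> \sum_(a <= g < a + q) f g = \sum_(0 <= g < q) f g.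
move=> per;elim: a => [|a IH]//;rewrite -IH.
case: q per {IH} => [|q] per;first by rewrite !addn0 !big_geq.
rewrite addSn addnS [RHS]big_nat_recl ?leq_addr// [LHS]big_nat_recr/=;last lia.
have -> : f (a + q).+1 = f a by rewrite -addnS per.
by rewrite addrC big_add1.
Qed.

(** Full periods contribute nothing, and what is left has fewer than q terms. *)
Lemma sum_interval_bound (f : nat -> int) (q : nat) : (0 < q)%N ->
 (forall x, f (x + q)%N = f x) -> (forall x, `|f x| <= 1) ->
 \sum_(0 <= g < q) f g = 0 -> forall a n, `|\sum_(a <= g < a + n) f g| <= q%:Z.
move=> q0 per f1 f0 a n;elim/ltn_ind: n a => n IH a;case: (ltnP n q) => h.
 letr (ler_norm_sum _ _ _).
 via (\sum_(a <= g < a + n) (1 : int)).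
  by lesum i;apply: f1.
 by rewrite sumr_const_nat addnC addnK -[1 *+ n]/(n%:R) natz lez_nat ltnW.
rewrite (@big_cat_nat _ _ _ (a + q)%N) ?leq_addr ?leq_add2l//= sum_nat_period// f0 add0r.
have -> : (a + n = (a + q) + (n - q))%N by lia.
by apply: IH;rewrite ltn_subrL q0 (leq_trans q0 h).
Qed.

(** Multiplication by u permutes the residues modulo q and changes the sign of the sum. *)
Lemma sum_period_zero (f : nat -> int) (q u : nat) : (0 < q)%N -> coprime u q ->
 (forall x y, (x = y %[mod q])%N -> f x = f y) -> (forall x, f (u * x)%N = - f x) ->
 \sum_(0 <= g < q) f g = 0.
case: q => // q _ cu fm fu;rewrite big_mkord.
pose s (i : 'I_q.+1) : 'I_q.+1 := inord ((u * i) %% q.+1).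
have s_inj : injective s.
 move=> i j /(congr1 val);rewrite /= !inordK ?ltn_mod// => /eqP.
 wlog ij : i j / (j <= i)%N.
  by move=> H h;case/orP: (leq_total j i) => ij;[|apply/esym];apply: H => //;rewrite eq_sym.
 rewrite eqn_mod_dvd ?leq_mul2l ?ij ?orbT// -mulnBr Gauss_dvdr;last by rewrite coprime_sym.
 case: (posnP (i - j)) => [/eqP h0 _|h0 /(dvdn_leq h0)].
  by apply: val_inj;apply/eqP;rewrite eqn_leq -subn_eq0 h0.
 by rewrite leqNgt (leq_ltn_trans (leq_subr _ _)).
set S := \sum_(_ | _) _.
have : S = - S.
 rewrite {1}/S (reindex_inj s_inj)/= -sumrN;eqbig i.
 by rewrite -fu;apply: fm;rewrite inordK ?ltn_mod// modn_mod.
lia.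
Qed.

(** The character is not principal: by the Chinese remainder theorem some integer is a nonresidue
    modulo p and 1 modulo m, and the symbol there is -1. *)
Lemma jac_interval (p m : nat) : prime p -> odd p -> (0 < m)%N -> odd m -> coprime p m ->
 forall a n, `|\sum_(a <= g < a + n) jac g (p * m)| <= (p * m)%N%:Z.
move=> pp po m0 mo pm;have pm0 : (0 < p * m)%N by lia.
have pmo : odd (p * m) by lia.
apply: sum_interval_bound => //.
- by move=> x;apply: jac_mod => //;rewrite !modz_nat modnDr.
- by move=> x;apply: jac_norm_le.
have [b hb] := ex_nonres pp po.
have e1 : jac (chinese p m b 1)%N (p * m) = -1.
 rewrite (jacMr _ (prime_gt0 pp) m0) (jac_prime _ pp).
 rewrite (leg_mod pp (b := b)) ?modz_nat ?chinese_modl// hb.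
 by rewrite (jac_mod mo (b := 1)) ?modz_nat ?chinese_modr// jac1l// mulr1.
apply: (sum_period_zero (u := chinese p m b 1)) => //.
- by rewrite -[coprime _ _]negbK -jac_coprime// e1.
- by move=> x y h;apply: jac_mod => //;rewrite !modz_nat h.
- by move=> x;rewrite PoszM jacMl// e1 mulN1r.
Qed.

(** * Chebyshev and Mertens estimates, Rankin's trick *)

Lemma ln_nat_ge0 (R : realType) n : 0 <= ln (n%:R : R).
by case: n => [|n];[rewrite ln0 | rewrite ln_ge0// ler1n]. Qed.
Ltac pos_hook ::= apply: ln_nat_ge0.

Section Primes.
Variable R : realType.
Implicit Types x y : R.

Lemma ln_le_sub1 x : 0 < x -> ln x <= x - 1.
move=> x0;have := expR_ge1Dx (ln x);rewrite lnK//;lra.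
Qed.

Lemma ln_nat_le m n : (0 < m <= n)%N -> ln (m%:R : R) <= ln n%:R.
by move=> /andP[m0 mn];rewrite ler_ln ?posrE ?ltr0n ?ler_nat// (leq_trans m0). Qed.

Lemma ln2_ge : 1 / 2 <= ln (2 : R).
have h : 0 < (2^-1 : R) by lra.
by have := ln_le_sub1 h;rewrite lnV ?posrE;lra.
Qed.

Lemma ln_nat_gt0 n : (2 <= n)%N -> 0 < ln (n%:R : R).
by move=> h;rewrite ln_gt0// ltr1n. Qed.

Lemma sumr_le_nat (m n : nat) (P : pred nat) (F G : nat -> R) :
 (forall i, (m <= i < n)%N -> P i -> F i <= G i) ->
 \sum_(m <= i < n | P i) F i <= \sum_(m <= i < n | P i) G i.
move=> h;rewrite big_nat_cond [leRHS]big_nat_cond.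
by apply: ler_sum => i /andP[hi Pi];apply: h.
Qed.

Lemma prodr_le_nat (m n : nat) (P : pred nat) (F G : nat -> R) :
 (forall i, (m <= i < n)%N -> P i -> 0 <= F i <= G i) ->
 \prod_(m <= i < n | P i) F i <= \prod_(m <= i < n | P i) G i.
move=> h;rewrite big_nat_cond [leRHS]big_nat_cond.
by apply: ler_prod => i /andP[hi Pi];apply: h.
Qed.

Lemma harmonic_ge n : ln (n.+1%:R : R) <= \sum_(1 <= k < n.+1) (k%:R)^-1.
elim: n => [|n IH];first by rewrite ln1 big_geq.
rewrite big_nat_recr//=.
have h : 0 < (n.+1%:R : R) by [].
have -> : (n.+2%:R : R) = n.+1%:R * (1 + n.+1%:R^-1) by rewrite mulrDr mulr1 mulfV ?gt_eqF// natr1.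
have hi : 0 < (n.+1%:R^-1 : R) by pos.
have h2 : 0 < 1 + (n.+1%:R^-1 : R) by pos.
rewrite lnM//;have := ln_le_sub1 h2;move: IH;set u := n.+1%:R^-1;set v := ln n.+1%:R;set S := \sum_(_ <= _ < _) _;lra.
Qed.

Lemma harmonic_le n : (0 < n)%N -> \sum_(1 <= k < n.+1) (k%:R : R)^-1 <= 1 + ln n%:R.
case: n => // n _;elim: n => [|n IH];first by rewrite ln1 big_nat1 invr1 addr0.
rewrite big_nat_recr//=.
have h : 0 < (n.+1%:R : R) by [].
have h' : 0 < (n.+2%:R : R) by [].
have e1 : n.+1%:R = n.+2%:R * (1 - n.+2%:R^-1) :> R by rewrite mulrBr mulr1 mulfV ?gt_eqF// -[n.+2%:R]natr1 addrK.
have h2 : 0 < 1 - (n.+2%:R^-1 : R) by rewrite subr_gt0 invf_lt1// ltr1n.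
have := ln_le_sub1 h2;have : ln (n.+1%:R : R) = ln n.+2%:R + ln (1 - n.+2%:R^-1) by rewrite {1}e1 lnM.
move: IH;set S := \sum_(_ <= _ < _) _;set u := (n.+2%:R)^-1;set v := ln n.+1%:R;set w := ln n.+2%:R;lra.
Qed.

Lemma ln_prodn (I : Type) (r : seq I) (P : pred I) (F : I -> nat) : (forall i, P i -> 0 < F i)%N ->
 ln ((\prod_(i <- r | P i) F i)%N%:R : R) = \sum_(i <- r | P i) ln (F i)%:R.
move=> h;suff [] : (0 < \prod_(i <- r | P i) F i)%N /\
 ln ((\prod_(i <- r | P i) F i)%N%:R : R) = \sum_(i <- r | P i) ln (F i)%:R by [].
apply: (big_ind2 (fun a b => (0 < a)%N /\ ln (a%:R : R) = b)).
- by rewrite ln1.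
- by move=> a b c d [a0 <-] [c0 <-];rewrite muln_gt0 a0 natrM lnM ?posrE ?ltr0n.
- by move=> i Pi;split => //;apply: h.
Qed.

Lemma ln_prod_logn n N : (0 < n <= N)%N ->
 ln (n%:R : R) = \sum_(0 <= p < N.+1 | prime p) (logn p n)%:R * ln p%:R.
move=> /andP[n0 nN].
rewrite -{1}(partnT n0) (widen_partn _ nN) ln_prodn => [|p _];last first.
 by [].
rewrite (bigID prime)/= addrC big1 ?add0r => [|p /negbTE h];last by rewrite lognE h ln1.
apply: eq_bigr => p pp;rewrite natrX lnXn ?ltr0n ?prime_gt0//;lra.
Qed.

Lemma ln_fact_le n : ln (n`!%:R : R) <= n%:R * ln n%:R.
elim: n => [|n IH];first by rewrite fact0 ln1 mul0r.
rewrite factS natrM lnM ?posrE ?ltr0n ?fact_gt0//.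
have h : n%:R * ln n%:R <= n%:R * ln (n.+1%:R : R) by case: (n) => [|m];[rewrite !mul0r | rewrite ler_wpM2l// ln_nat_le// ltnS leqnSn].
lra.
Qed.

Lemma divn_ge_half n p : (0 < p <= n)%N -> (n%:R : R) / p%:R <= 2 * (n %/ p)%N%:R.
move=> /andP[p0 pn];rewrite ler_pdivrMr ?ltr0n// -!natrM ler_nat.
have h1 : (1 <= n %/ p)%N by lia.
have := ltn_mod n p;rewrite p0 => h2;rewrite {1}(divn_eq n p);nia.
Qed.

(* Compares the exponent of p in n!, at least floor (n/p) >= n/(2p), with ln (n!) <= n ln n. *)
Lemma sum_ln_prime_div n :
 \sum_(0 <= p < n.+1 | prime p) ln p%:R / p%:R <= 2 * ln (n%:R : R).
case: (posnP n) => [->|n0].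
 by rewrite big_mkcond big_nat1 ln0// mulr0.
have nr : 0 < (n%:R : R) by pos.
suff : n%:R * \sum_(0 <= p < n.+1 | prime p) ln p%:R / p%:R <= 2 * (n%:R * ln (n%:R : R)) by rewrite mulrCA ler_pM2l.
apply: le_trans (ler_wpM2l _ (ln_fact_le n));last lra.
have nf : (n <= n`!)%N by apply: fact_geq.
rewrite (ln_prod_logn (N := n`!)) ?fact_gt0 ?leqnn//.
rewrite [X in _ <= 2 * X](big_cat_nat (n := n.+1))//= mulrDr ler_wpDr//.
 by rewrite mulr_ge0// sumr_ge0// => p _;rewrite mulr_ge0// ln_nat_ge0.
rewrite !mulr_sumr;apply: sumr_le_nat => p /andP[_ pn] pp;rewrite ltnS in pn.
via (2 * ((n %/ p)%N%:R * ln p%:R));last first.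
 by rewrite ler_wpM2l// ler_wpM2r ?ln_nat_ge0// ler_nat logn_fact// big_ltn// leq_addr.
rewrite [ln _ / _]mulrC [X in X <= _]mulrA [X in _ <= X]mulrA ler_wpM2r ?ln_nat_ge0//.
by apply: divn_ge_half;rewrite prime_gt0.
Qed.

(* exp t <= 1 + t exp K for 0 <= t <= K *)
Lemma expR_le_lin x K : 0 <= x <= K -> expR x <= 1 + x * expR K.
move=> /andP[x0 xK].
have h : 1 - x <= expR (- x) by have := expR_ge1Dx (- x);lra.
have h1 : expR x * expR (- x) = 1 by rewrite -expRD subrr expR0.
have h2 : expR x <= expR K by rewrite ler_expR.
have := expR_gt0 x;nra.
Qed.

Lemma sum_inv_sqr2 n : \sum_(2 <= p < n.+2) (p%:R : R)^-1 ^+ 2 <= 1.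
suff : \sum_(2 <= p < n.+2) (p%:R : R)^-1 ^+ 2 <= 1 - n.+1%:R^-1 by move=> h;letr h;rewrite gerBl invr_ge0.
elim: n => [|n IH];first by rewrite big_geq// invr1 subrr.
rewrite big_nat_recr//=;set S := \sum_(_ <= _ < _) _ in IH *.
have h2 : 0 < (n.+2%:R : R) by [].
suff : n.+2%:R^-1 ^+ 2 <= n.+1%:R^-1 - n.+2%:R^-1 :> R.
 move: IH;set u := n.+2%:R^-1;set v := n.+1%:R^-1;lra.
have -> : n.+1%:R^-1 - n.+2%:R^-1 = n.+1%:R^-1 * n.+2%:R^-1 :> R.
 have e : n.+2%:R = n.+1%:R + 1 :> R by lra.
 have h1 : 0 < (n.+1%:R : R) by [].
 by rewrite e;field;lra.
by rewrite expr2 ler_wpM2r ?invr_ge0 ?(ltW h2)// lef_pV2 ?posrE// ler_nat.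
Qed.

Lemma sum_inv_sqr n : \sum_(0 <= p < n.+1 | prime p) (p%:R : R)^-1 ^+ 2 <= 1.
apply: le_trans (sum_inv_sqr2 n);rewrite [leRHS]big_geq_mkord.
rewrite -(big_mkord (fun p => 2 <= p)%N (fun p => p%:R^-1 ^+ 2)) big_mkcond [leRHS]big_mkcond [leRHS]big_nat_recr//=.
rewrite ler_wpDr//;first by case: ifP => // _;rewrite exprn_ge0 ?invr_ge0.
apply: ler_sum => p _.
by case: ifP => [/prime_gt1 ->|_]//;case: ifP => // _;rewrite exprn_ge0 ?invr_ge0.
Qed.

Lemma ln1D_ge x : 0 <= x -> x - x ^+ 2 <= ln (1 + x).
move=> x0;have p0 : 0 < 1 + x by lra.
have h : 0 < (1 + x)^-1 by pos.
have := ln_le_sub1 h;rewrite lnV//.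
have e : (1 + x)^-1 * (1 + x) = 1 by rewrite mulVf ?gt_eqF.
have : (1 + x)^-1 = 1 - x * (1 + x)^-1 by lra.
nra.
Qed.

Lemma prod_expR (I : Type) (r : seq I) (P : pred I) (F : I -> R) :
 \prod_(i <- r | P i) expR (F i) = expR (\sum_(i <- r | P i) F i).
by apply: (big_ind2 (fun a b => a = expR b)) => [|a b c d -> ->|//];rewrite ?expR0 ?expRD.
Qed.

(* The products of 1 + w_p and the exponential of the sum of the w_p have the same order. *)
Lemma expR_sum_le_prod n (w : nat -> R) :
 (forall p, (0 < p)%N -> 0 <= w p <= 2 / p%:R) ->
 expR (\sum_(0 <= p < n.+1 | prime p) w p) <= expR 4 * \prod_(0 <= p < n.+1 | prime p) (1 + w p).
move=> hw.
have -> : \prod_(0 <= p < n.+1 | prime p) (1 + w p) =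
  expR (\sum_(0 <= p < n.+1 | prime p) ln (1 + w p)).
 rewrite -prod_expR;apply: eq_bigr => p pp;rewrite lnK// posrE.
 by case/andP: (hw p (prime_gt0 pp)) => h _;rewrite ltr_wpDr.
rewrite -expRD ler_expR -lerBlDr -sumrB.
via (\sum_(0 <= p < n.+1 | prime p) 4 * p%:R^-1 ^+ 2).
 apply: sumr_le_nat => p _ pp;have /andP[h1 h2] := hw p (prime_gt0 pp).
 have := ln1D_ge h1;rewrite -div1r in h2 *;set u := 1 / p%:R in h2 *.
 rewrite mulrA mulr1 in h2.
 have u0 : 0 <= u by pos.
 have h3 : 2 / p%:R = 2 * u by rewrite /u mul1r.
 rewrite h3 in h2;nra.
rewrite -mulr_sumr;have := sum_inv_sqr n;lra.
Qed.

Lemma prod_le_expR (I : Type) (r : seq I) (P : pred I) (w : I -> R) :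
 (forall i, P i -> 0 <= w i) ->
 \prod_(i <- r | P i) (1 + w i) <= expR (\sum_(i <- r | P i) w i).
move=> h;rewrite -prod_expR;apply: ler_prod => i Pi.
by rewrite addr_ge0 ?h//= expR_ge1Dx.
Qed.

(** A squarefree integer with prime factors below n is encoded by the set A of these primes; sums
    over such integers then expand Euler products, see [prod1D_set]. *)
Definition pr n (A : {set 'I_n}) : nat := \prod_(i in A) i.
Definition all_prime n (A : {set 'I_n}) : bool := [forall (i | i \in A), prime i].

Lemma all_primeP n (A : {set 'I_n}) : reflect (forall i, i \in A -> prime i) (all_prime A).
exact: 'forall_implyP. Qed.

Lemma pr_gt0 n (A : {set 'I_n}) : all_prime A -> (0 < pr A)%N.
by move/all_primeP => h;rewrite prodn_cond_gt0// => i /h/prime_gt0. Qed.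

Lemma prime_dvd_pr n (A : {set 'I_n}) (p : 'I_n) : all_prime A -> prime p ->
 (p %| pr A)%N = (p \in A).
move=> /all_primeP h pp;apply/idP/idP => [|pA];last by rewrite /pr (bigD1 p)//= dvdn_mulr.
rewrite /pr big_seq_cond (Euclid_dvd_prod _ _ _ pp) -big_seq_cond big_has_cond => /hasP[i _ /andP[iA]].
by rewrite dvdn_prime2 ?(h _ iA)// => /eqP/val_inj ->.
Qed.

Lemma pr_inj n (A B : {set 'I_n}) : all_prime A -> all_prime B -> pr A = pr B -> A = B.
move=> hA hB e;apply/setP => p;case pp : (prime p).
 by rewrite -(prime_dvd_pr hA)// -(prime_dvd_pr hB)// e.
by rewrite (contraFF (elimT (all_primeP A) hA p) pp) (contraFF (elimT (all_primeP B) hB p) pp).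
Qed.

Lemma prod1D_sub (I : finType) (k : {set I}) (x : I -> R) :
 \prod_(p in k) (1 + x p) = \sum_(l : {set I} | l \subset k) \prod_(p in l) x p.
rewrite big_mkcond (eq_bigr (fun p => (if p \in k then x p else 0) + 1)) => [|p _].
 rewrite bigA_distr [RHS]big_mkcond;eqbig l;rewrite -big_mkcond.
 case: ifP => [lk|/negbT/fintype.subsetPn[p pl /negbTE pk]];last by rewrite (bigD1 p)//= pk mul0r.
 by apply: eq_bigr => p /(fintype.subsetP lk) ->.
by case: ifP;rewrite ?add0r 1?addrC.
Qed.

Lemma prod1D_set n (w : nat -> R) :
 \prod_(0 <= p < n | prime p) (1 + w p) =
 \sum_(A : {set 'I_n} | all_prime A) \prod_(i in A) w i.
rewrite big_mkord (eq_bigl (fun i : 'I_n => i \in [set i : 'I_n | prime i])) => [|i];last by rewrite inE.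
rewrite prod1D_sub;apply: eq_bigl => A;apply/fintype.subsetP/all_primeP => h i /h;rewrite inE//.
Qed.

Lemma ler_sum_inj (I J : finType) (P : pred I) (Q : pred J) (h : I -> J) (g : I -> R) (f : J -> R) :
 {in P &, injective h} -> (forall i, P i -> Q (h i)) -> (forall i, P i -> g i <= f (h i)) ->
 (forall j, Q j -> 0 <= f j) -> \sum_(i | P i) g i <= \sum_(j | Q j) f j.
move=> hi hQ hg f0;letr (ler_sum _ hg).
have -> : \sum_(i | P i) f (h i) = \sum_(j in h @: [set i | P i]) f j.
 rewrite big_imset => [|i j];last by rewrite !inE;apply: hi.
 by apply: eq_bigl => i;rewrite inE.
rewrite big_mkcond [leRHS]big_mkcond;lesum j.
case: imsetP => [[i]|_];first by rewrite inE => Pi ->;rewrite hQ.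
by case: ifP => // /f0.
Qed.

Lemma big_nat1_ord N (f : nat -> R) : \sum_(1 <= k < N.+1) f k = \sum_(k < N.+1 | (0 < k)%N) f k.
by rewrite big_geq_mkord. Qed.

Lemma sum_pr_le n N (f : nat -> R) : (forall k, 0 <= f k) ->
 \sum_(A : {set 'I_n} | all_prime A && (pr A <= N)%N) f (pr A) <= \sum_(1 <= k < N.+1) f k.
move=> f0;rewrite big_nat1_ord.
apply: (ler_sum_inj (h := fun A : {set 'I_n} => inord (pr A) : 'I_N.+1)).
- move=> A B /andP[hA hN] /andP[hB hN2] /(congr1 val);rewrite /= !inordK ?ltnS//.
 exact: pr_inj.
- by move=> A /andP[hA hN];rewrite inordK ?ltnS// pr_gt0.
- by move=> A /andP[hA hN];rewrite inordK ?ltnS.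
- by [].
Qed.

(* Rankin's trick: the weight of A is multiplied by (pr A / x) ^ (K / ln z), which is at least 1. *)
Lemma rankin z (w : nat -> R) (K x : R) : (2 <= z)%N -> 0 <= K -> 0 < x ->
 (forall p, (0 < p)%N -> 0 <= w p <= 2 / p%:R) ->
 \sum_(A : pset z | all_prime A && (x < (pr A)%:R)) \prod_(i in A) w i <=
 expR (4 * K * expR K - K * ln x / ln z%:R) * \prod_(0 <= p < z.+1 | prime p) (1 + w p).
move=> z2 K0 x0 hw;have lz := ln_nat_gt0 z2.
pose b := K / ln z%:R;have b0 : 0 <= b by pos.
pose w' p := w p * expR (b * ln p%:R).
have wge0 p : prime p -> 0 <= w p by move=> /prime_gt0/hw/andP[].
via (\sum_(A : pset z | all_prime A) expR (- b * ln x) * \prod_(i in A) w' i).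
 rewrite big_mkcondr/=;apply: ler_sum => A /all_primeP hA.
 have e : \prod_(i in A) w' i = (\prod_(i in A) w i) * expR (b * ln (pr A)%:R).
  rewrite big_split/= prod_expR /pr ln_prodn => [|i /hA/prime_gt0//].
  by rewrite -mulr_sumr.
 have p0 : 0 <= \prod_(i in A) w i by apply: prodr_ge0 => i /hA/wge0.
 case: ifP => [hx|_];last by rewrite e mulr_ge0 ?expR_ge0// mulr_ge0// expR_ge0.
 rewrite e mulrCA -expRD ler_peMr// -[leLHS]expR0 ler_expR mulNr addrC subr_ge0 ler_wpM2l//.
 by rewrite ler_ln ?posrE ?ltW// (lt_trans x0).
rewrite -mulr_sumr -prod1D_set.
have -> : 4 * K * expR K - K * ln x / ln z%:R = - b * ln x + 4 * K * expR K by rewrite /b;ring.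
rewrite expRD -mulrA ler_wpM2l ?expR_ge0//.
via (\prod_(0 <= p < z.+1 | prime p) ((1 + w p) * expR (b * expR K * (w p * ln p%:R)))).
 apply: prodr_le_nat => p /andP[_ pz] pp;have h := wge0 p pp.
 rewrite addr_ge0 ?mulr_ge0 ?expR_ge0//=.
 have lp : 0 <= b * ln p%:R <= K.
  rewrite mulr_ge0 ?ln_nat_ge0//= /b mulrAC ler_pdivrMr// ler_wpM2l// ln_nat_le//.
  by rewrite prime_gt0//.
 have h1 := expR_le_lin lp.
 have h2 := expR_ge1Dx (b * expR K * (w p * ln p%:R)).
 via ((1 + w p) * (1 + b * expR K * (w p * ln p%:R)));last by rewrite ler_wpM2l// addr_ge0.
 have h3 : w' p <= w p * (1 + b * ln p%:R * expR K) by rewrite /w' ler_wpM2l.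
 have h4 : 0 <= w p * (b * expR K * (w p * ln p%:R)) by apply: mulr_ge0 => //;apply: mulr_ge0;apply: mulr_ge0;rewrite ?expR_ge0 ?ln_nat_ge0.
 lra.
rewrite big_split/= mulrC ler_wpM2r//.
 by apply: prodr_ge0 => p pp;rewrite addr_ge0// wge0.
rewrite prod_expR ler_expR -mulr_sumr.
have h : \sum_pr(p <= z) w p * ln p%:R <= 2 * (2 * ln z%:R).
 via (\sum_pr(p <= z) 2 * (ln p%:R / p%:R)).
  apply: sumr_le_nat => p _ pp;have /andP[_ h] := hw p (prime_gt0 pp).
  have -> : 2 * (ln p%:R / p%:R) = 2 / p%:R * ln p%:R :> R by ring.
  by rewrite ler_wpM2r// ln_nat_ge0.
 by rewrite -mulr_sumr ler_wpM2l// sum_ln_prime_div.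
letr (ler_wpM2l _ h);first pos.
rewrite /b;apply: eqler;field;lra.
Qed.

(** [rankin] with K = 1 and x = z^B bounds the part of the Euler product with pr A > z^B by exp(4e -
    B) times the whole. For B at least 4e + 1 this is at most half of it. *)
Lemma ex_rankin_exponent : exists B : nat, forall z (w : nat -> R), (2 <= z)%N ->
 (forall p, (0 < p)%N -> 0 <= w p <= 2 / p%:R) ->
 \prod_(0 <= p < z.+1 | prime p) (1 + w p) <=
 2 * \sum_(A : pset z | all_prime A && (pr A <= z ^ B)%N) \prod_(i in A) w i.
have [B hB] : exists B : nat, 4 * expR 1 + 1 <= (B%:R : R).
 exists (Num.bound (4 * expR 1 + 1 : R));apply/ltW/archi_boundP.
 pos.
exists B => z w z2 hw.
have z0 : (0 < z)%N by lia.
have x0 : 0 < ((z ^ B)%N%:R : R) by pos.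
have := rankin z2 (ler01 : 0 <= 1) x0 hw;set T := \sum_(A | _) _ => hT.
rewrite {1 2}prod1D_set in hT *.
set W := \sum_(A | all_prime A) _ in hT *;set S := \sum_(A | _) _.
have e : W = S + T.
 rewrite /W (bigID (fun A : pset z => pr A <= z ^ B)%N)/=;congr (_ + _).
 by apply: eq_bigl => A;rewrite -ltnNge ltr_nat.
have W0 : 0 <= W.
 apply: sumr_ge0 => A /all_primeP hA;apply: prodr_ge0 => i /hA/prime_gt0/hw;lra.
suff : expR (4 * 1 * expR 1 - 1 * ln (z ^ B)%:R / ln z%:R) <= 1 / 2 :> R by move=> h;nra.
rewrite natrX lnXn ?ltr0n// -[ln _ *+ B]mulr_natr mul1r mulr1 mulrAC divff ?mul1r ?gt_eqF ?ln_nat_gt0//.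
via (expR (-1));first by rewrite ler_expR;lra.
rewrite ?div1r expRN lef_pV2 ?posrE ?expR_gt0//.
by have := expR_ge1Dx (1 : R);lra.
Qed.

(** Up to constants the exponential is the product of the 1 + 1/p, of which at least half comes from
    squarefree integers at most z^B; these are part of a harmonic sum of size B log z. *)
Lemma mertens_upper : exists C : R, 0 < C /\ forall z, (2 <= z)%N ->
 expR (\sum_pr(p <= z) p%:R^-1) <= C * ln z%:R.
have [B hB] := ex_rankin_exponent.
exists (expR 4 * 2 * (B%:R + 2));split;first pos.
move=> z z2;have lz := ln_nat_gt0 z2.
have h1 : 1 / 2 <= ln z%:R :> R by letr ln2_ge;rewrite ln_nat_le.
have hw p : (0 < p)%N -> 0 <= (p%:R^-1 : R) <= 2 / p%:R by move=> _;rewrite invr_ge0 ler0n ler_peMl ?invr_ge0// ler1n.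
letr (expR_sum_le_prod z hw).
rewrite -2!mulrA ler_wpM2l ?expR_ge0//;letr (hB z _ z2 hw).
rewrite ler_wpM2l//.
via (\sum_(A : pset z | all_prime A && (pr A <= z ^ B)%N) (pr A)%:R^-1).
 by lesum A;rewrite natr_prod prodfV.
letr (sum_pr_le _ _ (f := fun k => k%:R^-1) _);first by move=> k;rewrite invr_ge0.
have z0 : (0 < z)%N by lia.
letr (harmonic_le _);first lia.
rewrite natrX lnXn ?ltr0n// -[ln _ *+ B]mulr_natl;nra.
Qed.

(** The integer k is the largest one whose square divides n. *)
Lemma sqfree_part n : (0 < n)%N -> exists A : {set 'I_n.+1}, all_prime A /\
 exists2 k : nat, (0 < k)%N & n = (pr A * k ^ 2)%N.
move=> n0;have ex : exists k, (0 < k)%N && (k ^ 2 %| n)%N by exists 1%N;rewrite exp1n dvd1n.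
have ub k : (0 < k)%N && (k ^ 2 %| n)%N -> (k <= n)%N by move=> /andP[k0 /dvdn_leq];move=> /(_ n0);nia.
case: (ex_maxnP ex ub) => k /andP[k0 /dvdnP[s e]] kmax.
have s0 : (0 < s)%N by lia.
have sn : (s <= n)%N by rewrite e leq_pmulr// expn_gt0 k0.
exists [set p : 'I_n.+1 | prime p && (p %| s)%N];split.
 by apply/all_primeP => p;rewrite inE => /andP[].
exists k => //;rewrite {1}e;congr (_ * _)%N.
rewrite -{1}(partnT s0) (widen_partn _ sn) big_mkord /pr (bigID (fun p : 'I_n.+1 => prime p && (p %| s)%N))/= mulnC big1 ?mul1n.
 apply: eq_big => [p|p /andP[pp ps]];first by rewrite inE.
 suff -> : logn p s = 1%N by [].
 apply/eqP;rewrite eqn_leq -pfactor_dvdn// ps leqNgt -pfactor_dvdn// andbT;apply/negP => h.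
 have := kmax (p * k)%N;rewrite muln_gt0 prime_gt0// k0 [X in (_ %| X)%N]e expnMn dvdn_pmul2r ?expn_gt0 ?k0// => /(_ h).
 by have := prime_gt1 pp;nia.
by move=> p;rewrite negb_and => /orP[/negbTE h|/negbTE h];rewrite lognE h ?andbF.
Qed.

Lemma sum_inv_sqr_ord n : \sum_(k < n.+1 | (0 < k)%N) (k%:R : R)^-1 ^+ 2 <= 2.
rewrite -(big_nat1_ord n (fun k => k%:R^-1 ^+ 2)).
case: n => [|n];first by rewrite big_geq.
by rewrite big_ltn// invr1 expr1n -natr1 addrC lerD2r sum_inv_sqr2.
Qed.

(* Every n <= z is the product of a squarefree z-smooth integer and a square. *)
Lemma harmonic_le_sqfree z :
 ln (z.+1%:R : R) <= 2 * \sum_(A : pset z | all_prime A && (pr A <= z)%N) (pr A)%:R^-1.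
letr (harmonic_ge z).
via ((\sum_(A : pset z | all_prime A && (pr A <= z)%N) (pr A)%:R^-1) *
  (\sum_(k < z.+1 | (0 < k)%N) (k%:R : R)^-1 ^+ 2));last first.
 by rewrite mulrC;apply: ler_wpM2r;[apply: sumr_ge0 => A _;rewrite invr_ge0|exact: sum_inv_sqr_ord].
rewrite big_distrlr/= pair_big_dep/= big_nat1_ord.
have ex (n : 'I_z.+1) : exists x : pset z * 'I_z.+1, (0 < n)%N ->
  [/\ all_prime x.1 && (pr x.1 <= z)%N, (0 < x.2)%N & n = (pr x.1 * x.2 ^ 2)%N :> nat].
 case: (posnP n) => [->|n0];first by exists (finset.set0, n).
 have [A [hA [k k0 e]]] := sqfree_part n0.
 have kz : (k < z.+1)%N.
  apply: leq_ltn_trans (ltn_ord n);rewrite e;apply: leq_trans (leq_pmull _ (pr_gt0 hA)).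
  by rewrite -{1}(expn1 k) leq_pexp2l.
 have nz : (n.+1 <= z.+1)%N by [].
 have eA : pr [set widen_ord nz i | i in A] = pr A by rewrite /pr big_imset => [//|i j _ _ /(congr1 val)/= /val_inj//].
 exists ([set widen_ord nz i | i in A], Ordinal kz) => _;split => //=;last by rewrite eA.
 apply/andP;split;last first.
  by rewrite eA;apply: leq_ltn_trans (ltn_ord n);rewrite [X in (_ <= X)%N]e leq_pmulr// expn_gt0 k0.
 by apply/all_primeP => i /imsetP[j jA ->]/=;apply: (elimT (all_primeP A) hA).
pose f n := projT1 (cid (ex n)).
have hf n := projT2 (cid (ex n));rewrite -/f in hf.
apply: (ler_sum_inj (h := f)).
- move=> m n /(hf m)[_ _ em] /(hf n)[_ _ en] e.
 by apply: val_inj;rewrite /= em en -/(f m) -/(f n) e.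
- by move=> n /(hf n)[h1 h2 _];rewrite -/(f n) h1.
- move=> n /(hf n)[h1 h2 e];rewrite -/(f n) in h1 h2 e.
 by rewrite {1}e natrM natrX invfM exprVn.
- by move=> x _;rewrite mulr_ge0 ?exprn_ge0// invr_ge0.
Qed.

Lemma mertens_lower z : (1 <= z)%N ->
 ln (z%:R : R) <= 2 * expR (\sum_pr(p <= z) p%:R^-1).
move=> z1;via (ln z.+1%:R);first by rewrite ln_nat_le// z1/=.
letr (harmonic_le_sqfree z);apply: ler_wpM2l => //.
apply: le_trans (prod_le_expR _ _);last by move=> p _;rewrite invr_ge0.
rewrite prod1D_set big_mkcondr;lesum A.
rewrite natr_prod prodfV;case: ifP => // _;by rewrite invr_ge0 prodr_ge0.
Qed.

(** * Real characters and sums over primes *)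

Lemma abel_bound (f : nat -> R) (u : nat -> R) (Q : R) (m : nat) :
 (forall n, (m <= n)%N -> `|\sum_(m <= a < n) f a| <= Q) ->
 (forall a, (m <= a)%N -> 0 <= u a.+1 <= u a) ->
 forall n, (m <= n)%N -> `|\sum_(m <= a < n) f a * u a| <= Q * u m.
move=> hQ hu n mn.
pose S n := \sum_(m <= a < n) f a.
have e : \sum_(m <= a < n) f a * u a = S n * u n + \sum_(m <= a < n) S a.+1 * (u a - u a.+1).
 elim: n mn => [|n IH].
  by rewrite leqn0 => /eqP ->;rewrite /S !big_geq// mul0r addr0.
 rewrite leq_eqVlt => /orP[/eqP em|].
  by rewrite /S em [LHS]big_geq// [X in X * _]big_geq// [X in _ + X]big_geq// mul0r addr0.
 rewrite ltnS => mn;rewrite !big_nat_recr//= IH// /S big_nat_recr//=;ring.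
have Q0 : 0 <= Q by apply: le_trans (hQ m (leqnn m)).
rewrite e;letr (ler_normD _ _).
have h1 : `|S n * u n| <= Q * u n.
 have un : 0 <= u n.
  move: mn;rewrite leq_eqVlt => /orP[/eqP <-|];first by case/andP: (hu m (leqnn m)) => h /(le_trans h).
  by case: n {e} => // n;rewrite ltnS => /hu/andP[].
 by rewrite normrM (ger0_norm un) ler_wpM2r// hQ.
have h2 : `|\sum_(m <= a < n) S a.+1 * (u a - u a.+1)| <= Q * (u m - u n).
 letr (ler_norm_sum _ _ _).
 rewrite -[u m - u n]opprB -telescope_sumr// -sumrN mulr_sumr big_nat_cond [leRHS]big_nat_cond.
 apply: ler_sum => a /andP[/andP[ma an] _];case/andP: (hu a ma) => h3 h4.
 by rewrite opprB normrM [ `|u a - _|]ger0_norm ?subr_ge0// ler_wpM2r ?subr_ge0// hQ// leqW.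
lra.
Qed.

Section RealChar.
Variable chi : nat -> R.
Hypothesis chiM : forall m n, chi (m * n)%N = chi m * chi n.
Hypothesis chi1 : chi 1 = 1.
Hypothesis chi_ge : forall n, -1 <= chi n <= 1.

(** The convolution of 1 and [chi], that is, the coefficients of zeta(s) L(s, chi); nonnegative
    because [chi] is completely multiplicative with values in [-1, 1]. *)
Let rr n := \sum_(d <- divisors n) chi d.

Lemma chiX p k : chi (p ^ k) = chi p ^+ k.
by elim: k => [|k IH];rewrite // expnS chiM IH exprS. Qed.

Lemma rr_step p k m : prime p -> (0 < m)%N -> ~~ (p %| m)%N ->
 rr (p ^ k.+1 * m) = rr (p ^ k * m) + chi p ^+ k.+1 * rr m.
move=> pp m0 pm;have p0 := prime_gt0 pp.
have g0 j : (0 < p ^ j * m)%N by lia.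
have -> : rr (p ^ k.+1 * m) = \sum_(d <- divisors (p ^ k * m) ++ [seq (p ^ k.+1 * e)%N | e <- divisors m]) chi d.
 apply: perm_big;apply: uniq_perm;first exact: divisors_uniq.
  rewrite cat_uniq divisors_uniq/= map_inj_uniq ?divisors_uniq ?andbT;last first.
   by move=> x y /eqP;rewrite eqn_pmul2l ?expn_gt0 ?p0// => /eqP.
  apply/hasPn => _ /mapP[e he ->];rewrite -dvdn_divisors//;apply/negP => h.
  have := dvdn_leq_log p (g0 k) h;rewrite !lognM ?expn_gt0 ?p0//;last first.
   lia.
  rewrite !pfactorK// (lognE p m) (negbTE pm) !andbF addn0;lia.
 move=> d;rewrite mem_cat -!dvdn_divisors//.
 apply/idP/orP => [h|[h|/mapP[e he ->]]].
 - case: (boolP (p ^ k.+1 %| d)%N) => [/dvdnP[e ed]|h2].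
   right;apply/mapP;exists e;last lia.
   by rewrite -dvdn_divisors;move: h;rewrite ed mulnC dvdn_pmul2l// expn_gt0 p0.
  left;have d0 : (0 < d)%N by lia.
  apply/(dvdn_partP _ d0) => q;rewrite mem_primes => /and3P[qp _ qd].
  have hq := dvdn_leq_log q (g0 k.+1) h.
  rewrite p_part pfactor_dvdn//.
  case: (eqVneq q p) hq => [->|qp'] hq.
   move: h2;rewrite pfactor_dvdn// -ltnNge ltnS => h2;letr h2.
   by rewrite lognM ?expn_gt0 ?p0// pfactorK// leq_addr.
  letr hq;rewrite !lognM ?expn_gt0 ?p0// !lognX.
  by rewrite (logn_prime q pp) (negbTE qp') !muln0.
 - by apply: dvdn_trans h _;rewrite dvdn_pmul2r// dvdn_exp2l.
 - by rewrite dvdn_pmul2l ?expn_gt0 ?p0// dvdn_divisors.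
rewrite big_cat/= big_map;congr (_ + _);rewrite /rr mulr_sumr.
by eqbig e;rewrite chiM chiX.
Qed.

Lemma rr_pow p k m : prime p -> (0 < m)%N -> ~~ (p %| m)%N ->
 rr (p ^ k * m) = (\sum_(j < k.+1) chi p ^+ j) * rr m.
move=> pp m0 pm;elim: k => [|k IH];first by rewrite big_ord1 expr0 expn0 !mul1n mul1r.
by rewrite rr_step// IH [in RHS]big_ord_recr/= [in RHS]mulrDl.
Qed.

Lemma sum_pow_ge0 (x : R) k : -1 <= x <= 1 -> 0 <= \sum_(j < k.+1) x ^+ j.
move=> /andP[h1 h2].
(* The second inequality says that the next partial sum is nonnegative; it is carried along because
   that sum is 1 + x times the present one. *)
suff : 0 <= \sum_(j < k.+1) x ^+ j /\ 0 <= 1 + x * \sum_(j < k.+1) x ^+ j by case.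
elim: k => [|k [IH1 IH2]].
 by rewrite big_ord1;split;lra.
have e : \sum_(j < k.+2) x ^+ j = 1 + x * \sum_(j < k.+1) x ^+ j.
 rewrite big_ord_recl expr0 mulr_sumr;congr (_ + _).
 by eqbig i;rewrite exprS.
rewrite e;split => //;set y := \sum_(_ | _) _ in IH1 IH2 *.
case: (lerP 0 x) => x0;first by nra.
have : 1 + x * y <= 1 by nra.
nra.
Qed.

Lemma rr_ge0 n : (0 < n)%N -> 0 <= rr n.
elim/ltn_ind: n => n IH n0;case: (ltngtP n 1) => [|n1|->].
- by rewrite ltnS leqn0 => /eqP e;rewrite e in n0.
- have pp := pdiv_prime n1;have [m pm e] := pfactor_coprime pp n0.
 have pm' : ~~ (pdiv n %| m)%N by rewrite -prime_coprime.
 have m0 : (0 < m)%N by lia.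
 rewrite e mulnC rr_pow// mulr_ge0 ?sum_pow_ge0//;apply: IH => //.
 rewrite [X in (_ < X)%N]e ltn_Pmulr// -{1}(expn0 (pdiv n)) ltn_exp2l ?prime_gt1//.
 by rewrite logn_gt0 mem_primes pp n0 pdiv_dvd.
- by rewrite /rr (_ : divisors 1 = [:: 1%N])// big_seq1 chi1.
Qed.

Lemma rr_pr n (A : {set 'I_n}) : all_prime A -> rr (pr A) = \prod_(p in A) (1 + chi p).
elim: {A}#|A| {-2}A (erefl #|A|) => [|k IH] A cA hA.
 have -> : A = finset.set0 by apply/eqP;rewrite -cards_eq0 cA.
 by rewrite /pr !big_set0 /rr (_ : divisors 1 = [:: 1%N])// big_seq1 chi1.
have /card_gt0P[p pA] : (0 < #|A|)%N by lia.
have hA' : all_prime (A :\ p) by apply/all_primeP => i;rewrite in_setD1 => /andP[_];apply: (elimT (all_primeP A) hA).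
have pp := elimT (all_primeP A) hA p pA.
rewrite (big_setD1 p)//= /pr (big_setD1 p)//= -/(pr (A :\ p)) -[X in rr (X * _)](expn1).
rewrite rr_pow ?pr_gt0//;last by rewrite prime_dvd_pr// in_setD1 eqxx.
rewrite IH// ?big_ord_recr ?big_ord0/= ?add0r//.
by move: cA;rewrite (cardsD1 p) pA add1n => -[].
Qed.

Lemma sum_divisors (F : nat -> R) n N : (0 < n <= N)%N ->
 \sum_(d <- divisors n) F d = \sum_(1 <= d < N.+1) if (d %| n)%N then F d else 0.
move=> /andP[n0 nN];rewrite -big_mkcond -[RHS]big_filter;apply: perm_big;apply: uniq_perm.
- exact: divisors_uniq.
- by rewrite filter_uniq// iota_uniq.
move=> d;rewrite -dvdn_divisors// mem_filter mem_index_iota ltnS;case h: (d %| n)%N => //=.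
by rewrite (dvdn_gt0 n0 h) (leq_trans (dvdn_leq n0 h) nN).
Qed.

Lemma sum_mult (g : nat -> R) a n : (0 < a)%N ->
 \sum_(1 <= m < n.+1 | (a %| m)%N) g m = \sum_(1 <= m < (n %/ a).+1) g (a * m)%N.
move=> a0;elim: n => [|n IH];first by rewrite div0n !big_geq.
rewrite [LHS]big_mkcond big_nat_recr//= -big_mkcond IH divnS//;case: ifP => an;rewrite ?addr0//.
have e : (a * (n %/ a).+1)%N = n.+1 by rewrite -[RHS](divnK an) divnS// an mulnC.
by rewrite [RHS]big_nat_recr//= e.
Qed.

Lemma sum_le_div (f : nat -> R) a n : (0 < a)%N ->
 \sum_(1 <= b < (n %/ a).+1) f b = \sum_(1 <= b < n.+1) if (a * b <= n)%N then f b else 0.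
move=> a0;rewrite [RHS](big_cat_nat (n := (n %/ a).+1)) ?ltnS ?leq_div//=.
rewrite [X in _ + X]big_nat_cond [X in _ + X]big1 ?addr0 => [|b /andP[/andP[h _] _]].
 by apply: eq_big_nat => b /andP[_ h];rewrite mulnC -leq_divRL// -ltnS h.
by rewrite mulnC -leq_divRL// leqNgt h.
Qed.

Lemma rr_hyperbola N : \sum_(1 <= n < N.+1) rr n / n%:R =
 \sum_(1 <= b < N.+1) (\sum_(1 <= a < (N %/ b).+1) chi a / a%:R) / b%:R.
transitivity (\sum_(1 <= n < N.+1) \sum_(1 <= a < N.+1) if (a %| n)%N then chi a / n%:R else 0).
 apply: eq_big_nat => n hn;rewrite /rr (@sum_divisors chi n N)// mulr_suml.
 by eqbig a;case: ifP;rewrite ?mul0r.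
rewrite exchange_big/=.
transitivity (\sum_(1 <= a < N.+1) \sum_(1 <= b < N.+1) if (a * b <= N)%N then chi a / (a * b)%N%:R else 0).
 by apply: eq_big_nat => a /andP[a0 _];rewrite -big_mkcond (sum_mult (fun n => chi a / n%:R))// sum_le_div.
rewrite exchange_big/=;apply: eq_big_nat => b /andP[b0 _].
rewrite mulr_suml sum_le_div//;eqbig a;rewrite mulnC;case: ifP => // _.
by rewrite natrM invfM;ring.
Qed.

(** The terms a at most q are bounded by the harmonic sum, the later ones by partial summation,
    where the bound q for interval sums is compensated by 1/a. *)
Lemma sum_chi_div q M : (0 < q)%N ->
 (forall m n, `|\sum_(m <= a < n) chi a| <= q%:R) ->
 `|\sum_(1 <= a < M.+1) chi a / a%:R| <= 2 + ln q%:R.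
move=> q0 hq;have lq := ln_nat_ge0 R q.
have triv m : (0 < m <= q)%N -> `|\sum_(1 <= a < m.+1) chi a / a%:R| <= 1 + ln q%:R.
 move=> /andP[m0 mq];via (1 + ln m%:R);last by rewrite lerD2l ln_nat_le// m0.
 apply: le_trans (harmonic_le m0);letr (ler_norm_sum _ _ _).
 lesum a;rewrite normrM [ `|_^-1|]ger0_norm ?invr_ge0// ler_piMl ?invr_ge0//.
 by rewrite ler_norml.
case: (posnP M) => [->|M0];first by rewrite big_geq// normr0 addr_ge0.
case: (leqP M q) => h.
 by letr (triv M _);rewrite ?M0//;lra.
rewrite (big_cat_nat (n := q.+1))//= ?ltnS ?(ltnW h)//.
have -> : 2 + ln q%:R = (1 + ln q%:R) + 1 :> R by ring.
letr (ler_normD _ _);apply: lerD;first by apply: triv;rewrite q0/=.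
letr (@abel_bound chi (fun a => a%:R^-1) q%:R q.+1 _ _ M.+1 _) => //.
- by move=> a ha;rewrite invr_ge0 ler0n/= lef_pV2 ?posrE ?ltr0n ?ler_nat// (leq_trans _ ha).
- by rewrite ltnS ltnW.
by rewrite ler_pdivrMr// mul1r ler_nat.
Qed.

End RealChar.

(* W = prod (1 + (1 + chi p)/p) is at most twice a sum of r(n)/n over n <= z^B, where r = 1 * chi >= 0;
   this sum is O(log z log q), and dividing by exp (sum 1/p) >> log z leaves O(log q). *)
Lemma char_prime_sum : exists C : R, 0 < C /\ forall (chi : nat -> R) (q z : nat),
 (forall m n, chi (m * n)%N = chi m * chi n) -> chi 1 = 1 -> (forall n, -1 <= chi n <= 1) ->
 (0 < q)%N -> (forall m n, `|\sum_(m <= a < n) chi a| <= q%:R) -> (2 <= z)%N ->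
 expR (\sum_pr(p <= z) chi p / p%:R) <= C * (2 + ln q%:R).
have [B hB] := ex_rankin_exponent.
exists (4 * expR 4 * (B%:R + 2));split;first pos.
move=> chi q z chiM chi1 chi_ge q0 hq z2;have lz := ln_nat_gt0 z2;have lq := ln_nat_ge0 R q.
have z0 : (0 < z)%N by lia.
pose w p := (1 + chi p) / p%:R.
have hw p : (0 < p)%N -> 0 <= w p <= 2 / p%:R.
 move=> p0;have /andP[h1 h2] := chi_ge p;rewrite /w divr_ge0//=;last lra.
 by rewrite ler_wpM2r ?invr_ge0//;lra.
set S := \sum_(_ <= _ < _ | _) _;set L := ln z%:R in lz.
have e1 : expR (\sum_pr(p <= z) w p) = expR (\sum_pr(p <= z) p%:R^-1) * expR S.
 rewrite -expRD -big_split/=;congr expR;eqbig p.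
 by rewrite /w mulrDl mul1r.
have h1 := mertens_lower z0;rewrite -/L in h1.
have h2 : expR (\sum_pr(p <= z) w p) <= expR 4 * (2 * ((1 + B%:R * L) * (2 + ln q%:R))).
 letr (expR_sum_le_prod z hw);rewrite ler_wpM2l ?expR_ge0//.
 letr (hB z w z2 hw);rewrite ler_wpM2l//.
 pose f n := (if (0 < n)%N then (\sum_(d <- divisors n) chi d) / n%:R else 0).
 via (\sum_(A : pset z | all_prime A && (pr A <= z ^ B)%N) f (pr A)).
  apply: ler_sum => A /andP[hA _];rewrite /f pr_gt0// (rr_pr chiM chi1 hA).
  by rewrite big_split prodfV natr_prod.
 letr (sum_pr_le _ _ _).
  by move=> k;rewrite /f;case: ifP => // k0;rewrite divr_ge0// (rr_ge0 chiM chi1 chi_ge).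
 rewrite (eq_big_nat _ _ (F2 := fun n => (\sum_(d <- divisors n) chi d) / n%:R));last first.
  by move=> n /andP[n0 _];rewrite /f n0.
 rewrite rr_hyperbola.
 via (\sum_(1 <= b < (z ^ B).+1) (2 + ln q%:R) * b%:R^-1).
  rewrite big_nat_cond [leRHS]big_nat_cond;lesum b.
  rewrite ler_wpM2r ?invr_ge0//;letr (ler_norm _).
  exact: sum_chi_div.
 rewrite -mulr_sumr mulrC ler_wpM2r ?addr_ge0//.
 letr (harmonic_le _);first lia.
 by rewrite natrX lnXn ?ltr0n// -[ln _ *+ B]mulr_natl.
have hL : 1 / 2 <= L by letr ln2_ge;rewrite ln_nat_le.
rewrite e1 in h2.
have h3 : L * expR S <= 2 * (expR 4 * (2 * ((1 + B%:R * L) * (2 + ln q%:R)))).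
 via (2 * (expR (\sum_pr(p <= z) p%:R^-1) * expR S)).
  by rewrite mulrA ler_wpM2r// expR_ge0.
 lra.
rewrite -(ler_pM2l lz);letr h3.
have -> : L * (4 * expR 4 * (B%:R + 2) * (2 + ln q%:R)) = (4 * expR 4 * (2 + ln q%:R)) * (L * B%:R + 2 * L) by ring.
have -> : 2 * (expR 4 * (2 * ((1 + B%:R * L) * (2 + ln q%:R)))) = (4 * expR 4 * (2 + ln q%:R)) * (1 + B%:R * L) by ring.
rewrite ler_wpM2l ?mulr_ge0 ?expR_ge0//;lra.
Qed.

End Primes.

Ltac pos_hook ::= first [apply: ln_nat_ge0 | apply: pr_gt0;pos].

(** * Odd squarefree integers and the number of prime factors *)

Definition sqfreeb (n : nat) : bool := (0 < n)%N && all (fun p => logn p n == 1)%N (primes n).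
Definition oddsf (n : nat) : bool := odd n && sqfreeb n.

Lemma oddsf_odd n : oddsf n -> odd n. Proof. by case/andP. Qed.
Lemma oddsf_gt0 n : oddsf n -> (0 < n)%N. Proof. by case/andP => _ /andP[]. Qed.

Lemma sqfree_logn n p : sqfreeb n -> prime p -> (p %| n)%N -> logn p n = 1%N.
by move=> /andP[n0 /allP h] pp pn;apply/eqP/h;rewrite mem_primes pp n0.
Qed.

Lemma sqfree_prod n : sqfreeb n -> n = (\prod_(p <- primes n) p)%N.
move=> sf;have n0 : (0 < n)%N by case/andP: sf.
rewrite {1}(prod_prime_decomp n0) prime_decompE big_map big_seq [RHS]big_seq.
apply: eq_bigr => p hp;move: (hp);rewrite mem_primes => /and3P[pp _ pn].
by rewrite /= (sqfree_logn sf) ?expn1.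
Qed.

Lemma sqfree_neq e f : sqfreeb e -> sqfreeb f -> e != f ->
 exists p, prime p /\ ((p %| e)%N != (p %| f)%N).
move=> se sf nef;case: (boolP (all (fun p => p %| f)%N (primes e) && all (fun p => p %| e)%N (primes f))).
 move=> /andP[/allP h1 /allP h2];case/eqP: nef.
 rewrite (sqfree_prod se) (sqfree_prod sf);apply: perm_big;apply: uniq_perm;rewrite ?primes_uniq//.
 move=> p;apply/idP/idP => h;have := h;rewrite !mem_primes => /and3P[pp _ _].
  by rewrite pp h1// andbT;case/andP: sf.
 by rewrite pp h2// andbT;case/andP: se.
rewrite negb_and => /orP[] /allPn[p];rewrite mem_primes => /and3P[pp _ pe] /negbTE h;exists p.
 lia.
lia.
Qed.

(** Some prime p divides exactly one of e and f, and it divides it once; so the modulus ef is p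
    times an integer prime to p, as [jac_interval] requires. *)
Lemma jac_oddsf_interval e f a n : oddsf e -> oddsf f -> e != f ->
 `|\sum_(a <= g < a + n) jac g (e * f)| <= (e * f)%N%:Z.
move=> se sf nef.
have [p [pp hp]] := sqfree_neq (proj2 (andP se)) (proj2 (andP sf)) nef.
wlog pe : e f se sf nef hp / (p %| e)%N.
 move=> H;case pe : (p %| e)%N;first exact: H.
 by rewrite mulnC;apply: (H f e);rewrite 1?eq_sym;move: hp;rewrite pe;case: (p %| f)%N.
have pf : ~~ (p %| f)%N by move: hp;rewrite pe;case: (p %| f)%N.
have e0 := oddsf_gt0 se;have f0 := oddsf_gt0 sf.
have ee : e = (p * (e %/ p))%N by lia.
have m0 : (0 < e %/ p)%N by lia.
have po : odd p by apply: dvdn_odd pe (oddsf_odd se).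
have mo : odd (e %/ p) by have := oddsf_odd se;rewrite {1}ee oddM => /andP[].
rewrite {1 2}ee -mulnA;apply: jac_interval => //.
- by rewrite muln_gt0 m0.
- by rewrite oddM mo oddsf_odd.
rewrite coprimeMr !prime_coprime// pf andbT.
apply/negP => /dvdnP[c ec];have := sqfree_logn (proj2 (andP se)) pp pe.
have c0 : (0 < c)%N by lia.
have p0 := prime_gt0 pp;rewrite {1}ee ec !lognM ?muln_gt0 ?p0 ?c0// (logn_prime _ pp) eqxx;lia.
Qed.

(** Fewer than M + 1 prime factors lie below M, and for each of the others the factor M is at most
    p. *)
Lemma omega_pow_le M n : (0 < n)%N -> (M ^ size (primes n) <= M ^ M * n)%N.
case: M => [|M] n0;first by rewrite expn0 mul1n;case: (size _) => [|k];rewrite ?expn0 ?exp0n.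
have -> : (M.+1 ^ size (primes n) = \prod_(p <- primes n) M.+1)%N by rewrite big_const_seq iter_muln_1 count_predT.
rewrite (bigID (fun p => p < M.+1)%N)/=;apply: leq_mul.
 rewrite -big_filter big_const_seq iter_muln_1 count_predT leq_pexp2l//.
 rewrite -[X in (_ <= X)%N](size_iota 0);apply: uniq_leq_size;first by rewrite filter_uniq// primes_uniq.
 by move=> p;rewrite mem_filter mem_iota => /andP[].
via (\prod_(p <- primes n | ~~ (p < M.+1)%N) p)%N.
 by apply: leq_prod => p;rewrite -leqNgt.
via (\prod_(p <- primes n) p)%N.
 rewrite [leqRHS](bigID (fun p => p < M.+1)%N)/= leq_pmull//.
 by rewrite big_seq_cond prodn_cond_gt0// => p /andP[];rewrite mem_primes => /and3P[/prime_gt0].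
rewrite [leqRHS](prod_prime_decomp n0) prime_decompE big_map big_seq [leqRHS]big_seq.
apply: leq_prod => p/=;rewrite mem_primes => /and3P[pp _ pn].
by rewrite -{1}(expn1 p) leq_exp2l ?prime_gt1// logn_gt0 mem_primes pp n0.
Qed.

(** A squarefree divisor is determined by the set of primes dividing it. *)
Lemma count_oddsf_dvd n N : (0 < n)%N -> (#|[set e : 'I_N | oddsf e && (e %| n)%N]| <= 2 ^ size (primes n))%N.
move=> n0.
pose f (e : 'I_N) : {set seq_sub (primes n)} := [set q | ssval q %| e]%N.
have finj : {in [set e : 'I_N | oddsf e && (e %| n)%N] &, injective f}.
 move=> e e';rewrite !inE => /andP[/andP[_ se] en] /andP[/andP[_ se'] en'] h.
 apply/val_inj/eqP;apply: contraT => /= ne;have [p [pp]] := sqfree_neq se se' ne.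
 have hp : ((p %| e) || (p %| e'))%N -> p \in primes n by move=> /orP[] h';rewrite mem_primes pp n0 (dvdn_trans h').
 case: (boolP ((p %| e) || (p %| e'))%N) => [/hp hp'|].
  by move/setP/(_ (SeqSub hp')): h;rewrite !inE => ->;rewrite eqxx.
 by rewrite negb_or => /andP[/negbTE -> /negbTE ->].
rewrite -(card_in_imset finj);letr (max_card _).
by rewrite -cardsT -powersetT card_powerset cardsT card_seq_sub ?primes_uniq.
Qed.

(** * Bilinear sums of Jacobi symbols over dyadic ranges *)

Section Bilinear.
Variable R : realType.

Definition jacR (a n : nat) : R := (jac a n)%:~R.

Lemma J_le1 a n : (0 < n)%N -> `|jacR a n| <= 1.
by move=> n0;rewrite /jacR -intr_norm -[1]/(1%:~R) ler_int jac_norm_le. Qed.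

Lemma JMl a b n : odd n -> jacR (a * b) n = jacR a n * jacR b n.
by move=> no;rewrite /jacR PoszM jacMl// intrM. Qed.

Lemma JMr a m n : (0 < m)%N -> (0 < n)%N -> jacR a (m * n) = jacR a m * jacR a n.
by move=> m0 n0;rewrite /jacR jacMr// intrM. Qed.

(** Lagrange's identity: the difference of the two sides is half the displayed double sum of
    squares. *)
Lemma cauchy_weighted (I : Type) (r : seq I) (P : pred I) (w a b : I -> R) :
 (forall i, P i -> 0 <= w i) ->
 (\sum_(i <- r | P i) w i * (a i * b i)) ^+ 2 <=
 (\sum_(i <- r | P i) w i * a i ^+ 2) * (\sum_(i <- r | P i) w i * b i ^+ 2).
move=> w0;set X := \sum_(_ <- _ | _) _;set U := \sum_(_ <- _ | _) _;set V := \sum_(_ <- _ | _) _.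
have h : 0 <= \sum_(i <- r | P i) \sum_(j <- r | P j) w i * w j * (a i * b j - a j * b i) ^+ 2.
 apply: sumr_ge0 => i Pi;apply: sumr_ge0 => j Pj.
 by rewrite mulr_ge0 ?sqr_ge0// mulr_ge0 ?w0.
have e : \sum_(i <- r | P i) \sum_(j <- r | P j) w i * w j * (a i * b j - a j * b i) ^+ 2 =
  2 * (U * V) - 2 * X ^+ 2.
 transitivity (\sum_(i <- r | P i) \sum_(j <- r | P j) ((w i * a i ^+ 2) * (w j * b j ^+ 2) +
   (w i * b i ^+ 2) * (w j * a j ^+ 2) - 2 * ((w i * (a i * b i)) * (w j * (a j * b j))))).
  by eqbig i;eqbig j;ring.
 under eq_bigr => i _ do rewrite !big_split/= sumrN -!mulr_sumr.
 rewrite !big_split/= sumrN -!mulr_suml -mulr_sumr -mulr_suml -/U -/V -/X;ring.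
lra.
Qed.

Lemma cauchy_card (I : finType) (P : pred I) (a : I -> R) :
 (\sum_(i | P i) a i) ^+ 2 <= #|P|%:R * \sum_(i | P i) a i ^+ 2.
have := @cauchy_weighted I (index_enum I) P (fun=> 1) (fun=> 1) a (fun _ _ => ler01).
rewrite (eq_bigr a) => [|i _];last lra.
rewrite [X in X * _](eq_bigr (fun=> 1)) => [|i _];last lra.
by rewrite sumr_const [X in _ * X](eq_bigr (fun i => a i ^+ 2))// => i _;rewrite mul1r.
Qed.

Definition dyad (i : nat) (e : nat) : bool := oddsf e && (2 ^ i <= e)%N.

Lemma card_dyad i : (#|[pred e : 'I_(2 ^ i.+1) | dyad i e]| <= 2 ^ i)%N.
via (#|[pred e : 'I_(2 ^ i.+1) | (2 ^ i <= e)%N]|)%N.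
 by apply: subset_leq_card;apply/fintype.subsetP => e /andP[].
rewrite -sum1_card (eq_bigl (fun e : 'I__ => true && (2 ^ i <= e)%N))//.
by rewrite -(big_geq_mkord _ _ xpredT (fun=> 1%N)) sum_nat_const_nat muln1 expnS mul2n -addnn addnK.
Qed.

Lemma J_dyad_interval i (e f : 'I_(2 ^ i.+1)) a n : dyad i e -> dyad i f -> e != f ->
 `|\sum_(a <= g < a + n) jacR g e * jacR g f| <= 4 * 4 ^+ i.
move=> /andP[oe _] /andP[of_ _] nef.
rewrite (eq_bigr (fun g : nat => (jac g (e * f))%:~R : R)) => [|g _];last first.
 by rewrite -intrM -jacMr// oddsf_gt0.
rewrite -rmorph_sum -intr_norm;via ((e * f)%N%:R).
 by rewrite -[(e * f)%:R]/((e * f)%N%:Z%:~R) ler_int jac_oddsf_interval.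
have h : (e * f <= 2 ^ i.+1 * 2 ^ i.+1)%N by rewrite leq_mul// ltnW.
apply: le_trans (_ : ((2 ^ i.+1 * 2 ^ i.+1)%N%:R <= _));first by rewrite ler_nat.
by rewrite -expnD natrX -[4]/((2 * 2)%N%:R) natrM -exprS -[2 * 2]expr2 -!exprM;apply: eqler;congr (_ ^+ _);lia.
Qed.

Section Dyadic.
Variables (i j : nat) (y : nat -> R).
Hypothesis y1 : forall e, `|y e| <= 1.

Let A (g : nat) : R := \sum_(e < 2 ^ i.+1 | dyad i e) y e * jacR g e.
Let T : R := \sum_(g < 2 ^ j.+1 | dyad j g) `|A g|.

(** The range of g is long compared with that of e. After Cauchy-Schwarz, g is allowed to run over
    all integers of its dyadic interval. In the opened square the diagonal gives 2^i 2^j, and each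
    off-diagonal pair is an interval sum of a nonprincipal character, bounded by its modulus. *)
Lemma dyadic_far : (5 * i <= 2 * j)%N -> T ^+ 2 <= 5 * (2 ^+ i * 2 ^+ j) ^+ 2 * (2^-1 ^+ (i %/ 2)).
move=> ij.
have h1 : T ^+ 2 <= 2 ^+ j * \sum_(g < 2 ^ j.+1 | dyad j g) A g ^+ 2.
 letr (cauchy_card _ _).
 rewrite (eq_bigr (fun g : 'I__ => A g ^+ 2)) => [|g _];last by rewrite real_normK ?num_real.
 apply: ler_wpM2r;first pos.
 by rewrite -natrX ler_nat card_dyad.
have h2 : \sum_(g < 2 ^ j.+1 | dyad j g) A g ^+ 2 <= 2 ^+ i * 2 ^+ j + 2 ^+ i * 2 ^+ i * (4 * 4 ^+ i).
 via (\sum_(2 ^ j <= g < 2 ^ j + 2 ^ j) A g ^+ 2).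
  rewrite addnn -mul2n -expnS big_geq_mkord big_mkcond [leRHS]big_mkcond;lesum g.
  by rewrite /dyad andbC;case: (2 ^ j <= g)%N;case: (oddsf g);rewrite //= sqr_ge0.
 have e : \sum_(2 ^ j <= g < 2 ^ j + 2 ^ j) A g ^+ 2 =
  \sum_(e < 2 ^ i.+1 | dyad i e) \sum_(f < 2 ^ i.+1 | dyad i f) y e * y f *
    \sum_(2 ^ j <= g < 2 ^ j + 2 ^ j) jacR g e * jacR g f.
  transitivity (\sum_(2 ^ j <= g < 2 ^ j + 2 ^ j) \sum_(e < 2 ^ i.+1 | dyad i e) \sum_(f < 2 ^ i.+1 | dyad i f)
    y e * y f * (jacR g e * jacR g f)).
   eqbig g;rewrite expr2 /A mulr_suml;eqbig e.
   rewrite mulr_sumr;eqbig f;ring.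
  rewrite exchange_big/=;eqbig e;rewrite exchange_big/=.
  by eqbig f;rewrite mulr_sumr.
 rewrite e;via (\sum_(e < 2 ^ i.+1 | dyad i e) (2 ^+ j + \sum_(f < 2 ^ i.+1 | dyad i f) 4 * 4 ^+ i)).
  apply: ler_sum => e' he;rewrite (bigD1 e')//=;apply: lerD.
   letr (ler_norm _);rewrite !normrM.
   via (1 * 1 * 2 ^+ j);last lra.
   rewrite ler_pM ?mulr_ge0 ?ler_pM//;letr (ler_norm_sum _ _ _).
   via (\sum_(2 ^ j <= g < 2 ^ j + 2 ^ j) 1).
    by lesum g;rewrite normrM mulr_ile1 ?J_le1// oddsf_gt0;case/andP: he.
   by rewrite sumr_const_nat addnK natrX.
  via (\sum_(f < 2 ^ i.+1 | dyad i f && (f != e')) 4 * 4 ^+ i);last first.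
   by rewrite [leRHS](bigD1 e')//= ler_wpDl// mulr_ge0// exprn_ge0.
  apply: ler_sum => f /andP[hf nf];letr (ler_norm _);rewrite !normrM.
  via (1 * 1 * (4 * 4 ^+ i));last lra.
  apply: ler_pM;rewrite ?mulr_ge0 ?ler_pM//.
  by apply: J_dyad_interval;rewrite // eq_sym.
 set K := 4 * 4 ^+ i;have K0 : 0 <= K by pos.
 rewrite sumr_const sumr_const -[X in X <= _]mulr_natl -[K *+ _]mulr_natl.
 have hc : #|[pred e : 'I_(2 ^ i.+1) | dyad i e]|%:R <= 2 ^+ i :> R by rewrite -natrX ler_nat card_dyad.
 rewrite mulrDr mulrA;apply: lerD;first by rewrite ler_wpM2r ?exprn_ge0.
 by rewrite ler_wpM2r// ler_pM.
letr h1;letr (ler_wpM2l _ h2);first pos.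
have e4 : 4 ^+ i = 2 ^+ i * 2 ^+ i :> R by rewrite -expr2 -exprM mulnC exprM;congr (_ ^+ _);ring.
rewrite e4;set a := 2 ^+ i;set b := 2 ^+ j;set c := 2^-1 ^+ (i %/ 2).
have a0 : 0 < a by pos.
have b0 : 0 < b by pos.
have c0 : 0 <= c by pos.
have k1 : 1 <= a * c.
 rewrite /a /c -{1}(subnK (leq_div i 2)) exprD -mulrA -exprMn mulfV ?pnatr_eq0// expr1n mulr1.
 by rewrite exprn_ege1// ler1n.
have k2 : a * a <= b * c.
 rewrite /a /b /c -exprD -[leLHS]mulr1 -(subnK (_ : i + i <= j)%N);last lia.
 rewrite [_ ^+ (j - _ + _)]exprD [X in _ <= X * _]mulrC -mulrA ler_wpM2l ?exprn_ge0//.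
 rewrite -(subnK (_ : i %/ 2 <= j - (i + i))%N);last lia.
 rewrite exprD -mulrA -exprMn mulfV ?pnatr_eq0// expr1n mulr1.
 by rewrite exprn_ege1// ler1n.
have -> : b * (a * b + a * a * (4 * (a * a))) = b * a * b * 1 + 4 * (b * a * a) * (a * a) by ring.
have -> : 5 * (a * b) ^+ 2 * c = b * a * b * (a * c) + 4 * (b * a * a) * (b * c) by ring.
by apply: lerD;rewrite ler_wpM2l ?mulr_ge0// ltW.
Qed.

Let E := [pred e : 'I_(2 ^ i.+1) | dyad i e].
Let nf (f : {ffun 'I_8 -> 'I_(2 ^ i.+1)}) : nat := (\prod_k f k)%N.

(** The two ranges may be too close for a direct use of Cauchy-Schwarz. Taking eighth powers
    replaces e by products of eight such integers, a variable of size up to N = 2^(8(i+1)). *)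
Lemma A_pow8 g : A g ^+ 8 = \sum_(f in ffun_on E) (\prod_k y (f k)) * jacR g (nf f).
have -> : A g ^+ 8 = \prod_(k < 8) \sum_(e | E e) y e * jacR g e by rewrite prodr_const card_ord.
rewrite bigA_distr_big/=;apply: eq_bigr => f /ffun_onP hf.
rewrite big_split/=;congr (_ * _).
suff : (0 < nf f)%N /\ \prod_(k < 8) jacR g (f k) = jacR g (nf f) by case.
rewrite /nf;apply: (big_ind2 (fun a b => (0 < b)%N /\ a = jacR g b)).
- by rewrite /jacR jac1.
- by move=> a b c d [b0 ->] [d0 ->];rewrite muln_gt0 b0 JMr.
- by move=> k _;split => //;case/andP: (hf k) => /oddsf_gt0.
Qed.

Let S (n : nat) : R := \sum_(g < 2 ^ j.+1 | dyad j g) jacR g n.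
Let N := ((2 ^ i.+1) ^ 8)%N.

Lemma nf_lt f : f \in ffun_on E -> odd (nf f) && (0 < nf f < N)%N.
move=> /ffun_onP hf;rewrite /nf.
have ho k : odd (f k) by case/andP: (hf k) => /oddsf_odd.
have -> : odd (\prod_k f k)%N by elim/big_ind: _ => //= a b oa ob;rewrite oddM oa.
have -> : (0 < \prod_k f k)%N by rewrite prodn_gt0// => k;have := ho k;case: (nat_of_ord _).
rewrite /= /N;have -> : ((2 ^ i.+1) ^ 8 = \prod_(k < 8) 2 ^ i.+1)%N by rewrite prod_nat_const card_ord.
rewrite [in X in (X < _)%N]big_ord_recl [in X in (_ < X)%N]big_ord_recl.
apply: leq_ltn_trans (_ : f ord0 * \prod_(k < 7) 2 ^ i.+1 < _)%N.
 by rewrite leq_mul2l;apply/orP;right;apply: leq_prod => k _;apply: ltnW.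
by rewrite ltn_mul2r ltn_ord prodn_gt0// => k;rewrite expn_gt0.
Qed.

Variable rho : nat.
Hypothesis rhoP : forall n, (0 < n < N)%N -> ((2 ^ size (primes n)) ^ 8 <= rho)%N.

(** Each of the eight factors is one of the at most 2^omega(n) odd squarefree divisors of n. *)
Lemma card_nf n : (0 < n < N)%N -> (#|[pred f in ffun_on E | nf f == n]| <= rho)%N.
move=> hn;apply: leq_trans (rhoP hn).
have n0 : (0 < n)%N by lia.
via (#|(ffun_on [set e : 'I_(2 ^ i.+1) | oddsf e && (e %| n)%N] : {pred {ffun 'I_8 -> 'I_(2 ^ i.+1)}})|)%N.
 apply: subset_leq_card;apply/fintype.subsetP => f;rewrite inE => /andP[/ffun_onP hf /eqP e].
 apply/ffun_onP => k;rewrite inE;case/andP: (hf k) => -> _/=.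
 by rewrite -e /nf (bigD1 k)//= dvdn_mulr.
by rewrite card_ffun_on card_ord leq_exp2r// count_oddsf_dvd.
Qed.

(** Reciprocity turns (g/n) into (n/g); the sign depends only on n once the class of g modulo 4 is
    fixed, hence the two sums [Sc]. Then n may run over all integers below N, and the off-diagonal
    sums are bounded by the moduli. The condition 2j at most 5i makes them as small as the
    diagonal. *)
Lemma sum_S_sqr : (4 * i >= j)%N -> (2 * j <= 5 * i)%N ->
 \sum_(n < N | odd n) S n ^+ 2 <= 20 * (2 ^+ j * N%:R).
move=> _ ij.
pose Sc (c : nat) (n : nat) : R := \sum_(g < 2 ^ j.+1 | dyad j g && (g %% 4 == c)%N) jacR n g.
have hS n : odd n -> S n ^+ 2 <= 2 * (Sc 1%N n ^+ 2 + Sc 3%N n ^+ 2).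
 move=> no;have n0 : (0 < n)%N by lia.
 have -> : S n = Sc 1%N n + (rsgn n 3)%:~R * Sc 3%N n.
  rewrite /S (bigID (fun g : 'I__ => g %% 4 == 1)%N)/=;congr (_ + _).
   apply: eq_bigr => g /andP[/andP[sg _] /eqP g1].
   rewrite /jacR (jac_rec (oddsf_gt0 sg) (oddsf_odd sg) n0 no) /rsgn g1 mulr1//.
  rewrite /Sc mulr_sumr;apply: eq_big => [g|g /andP[/andP[sg _] g1]].
   case hg : (dyad j g) => //=;have := oddsf_odd (proj1 (andP hg));lia.
  rewrite /jacR (jac_rec (oddsf_gt0 sg) (oddsf_odd sg) n0 no) intrM mulrC;congr (_%:~R * _).
  rewrite /rsgn andbC;congr (if _ && _ then _ else _);have := oddsf_odd sg;lia.
 have : (rsgn n 3)%:~R ^+ 2 = 1 :> R by rewrite /rsgn;case: ifP => _;rewrite ?sqrrN expr1n.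
 move: (Sc _ _) (Sc _ _) (_%:~R) => a b r hr.
 have := sqr_ge0 (a - r * b);nra.
have hSc c : \sum_(n < N) Sc c n ^+ 2 <= 5 * (2 ^+ j * N%:R).
 have e : \sum_(n < N) Sc c n ^+ 2 = \sum_(g < 2 ^ j.+1 | dyad j g && (g %% 4 == c)%N)
   \sum_(g' < 2 ^ j.+1 | dyad j g' && (g' %% 4 == c)%N) \sum_(0 <= n < 0 + N) jacR n g * jacR n g'.
  transitivity (\sum_(n < N) \sum_(g < 2 ^ j.+1 | dyad j g && (g %% 4 == c)%N)
   \sum_(g' < 2 ^ j.+1 | dyad j g' && (g' %% 4 == c)%N) jacR n g * jacR n g').
   eqbig n;rewrite expr2 /Sc mulr_suml;eqbig g.
   by rewrite mulr_sumr.
  rewrite exchange_big/=;eqbig g;rewrite exchange_big/=.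
  by apply: eq_bigr => g' _;rewrite big_mkord.
 set K := 4 * 4 ^+ j : R;have K0 : 0 <= K by pos.
 rewrite e;via (\sum_(g < 2 ^ j.+1 | dyad j g && (g %% 4 == c)%N)
   (N%:R + \sum_(g' < 2 ^ j.+1 | dyad j g') K)).
  apply: ler_sum => g hg;rewrite (bigD1 g)//=;apply: lerD.
   letr (ler_norm _);letr (ler_norm_sum _ _ _).
   via (\sum_(0 <= n < 0 + N) 1).
    by lesum n;rewrite normrM mulr_ile1 ?J_le1// oddsf_gt0;case/andP: hg => /andP[].
   by rewrite sumr_const_nat subn0.
  via (\sum_(g' < 2 ^ j.+1 | dyad j g' && (g' %% 4 == c)%N && (g' != g)) K).
   apply: ler_sum => g' /andP[/andP[hg' _] ng];letr (ler_norm _).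
   by apply: J_dyad_interval => //;[case/andP: hg | rewrite eq_sym].
  rewrite big_mkcond [leRHS]big_mkcond;apply: ler_sum => g' _.
  by case: (dyad j g');rewrite //=;case: ifP.
 via (\sum_(g < 2 ^ j.+1 | dyad j g) (N%:R + \sum_(g' < 2 ^ j.+1 | dyad j g') K)).
  rewrite big_mkcond [leRHS]big_mkcond;lesum g.
  case: (dyad j g) => //=;case: ifP => // _;rewrite addr_ge0//;apply: sumr_ge0 => *;exact: K0.
 rewrite sumr_const sumr_const -[X in X <= _]mulr_natl -[K *+ _]mulr_natl.
 have hc : #|[pred e : 'I_(2 ^ j.+1) | dyad j e]|%:R <= 2 ^+ j :> R by rewrite -natrX ler_nat card_dyad.
 via (2 ^+ j * (N%:R + 2 ^+ j * K)).
  apply: ler_pM => //;first pos.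
  by apply: lerD => //;apply: ler_wpM2r.
 rewrite [X in _ <= X]mulrCA ler_wpM2l ?exprn_ge0//.
 suff : 2 ^+ j * K <= 4 * N%:R by lra.
 rewrite /K mulrCA ler_wpM2l// /N -[4]/((2 ^ 2)%N%:R) -natrX -natrX -natrM ler_nat.
 rewrite -!expnM -expnD leq_exp2l;lia.
via (\sum_(n < N) 2 * (Sc 1%N n ^+ 2 + Sc 3%N n ^+ 2)).
 rewrite big_mkcond;lesum n;case: ifP => [/hS//|_].
 pos.
rewrite -mulr_sumr big_split/=;have := hSc 1%N;have := hSc 3%N;lra.
Qed.

(** Three applications of Cauchy-Schwarz pass from |A| to its eighth power; a fourth one, over the
    eightfold products n, separates their multiplicity, at most [rho], from the mean square of
    [S]. *)
Lemma dyadic_near : (i <= j)%N -> (2 * j <= 5 * i)%N ->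
 T ^+ 16 <= (2 ^+ j) ^+ 14 * ((2 ^+ i) ^+ 8 * (rho%:R * (20 * (2 ^+ j * N%:R)))).
move=> ij1 ij2.
have T2 (k : nat) : (\sum_(g < 2 ^ j.+1 | dyad j g) `|A g| ^+ k) ^+ 2 <=
  2 ^+ j * \sum_(g < 2 ^ j.+1 | dyad j g) `|A g| ^+ (2 * k).
 letr (cauchy_card _ _).
 rewrite (eq_bigr (fun g : 'I__ => `|A g| ^+ (2 * k))) => [|g _];last by rewrite mulnC exprM.
 apply: ler_wpM2r;first pos.
 by rewrite -natrX ler_nat card_dyad.
have pos k : 0 <= \sum_(g < 2 ^ j.+1 | dyad j g) `|A g| ^+ k by pos.
have b0 : 0 <= 2 ^+ j :> R by pos.
have T8 : T ^+ 8 <= (2 ^+ j) ^+ 7 * \sum_(g < 2 ^ j.+1 | dyad j g) A g ^+ 8.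
 have -> : \sum_(g < 2 ^ j.+1 | dyad j g) A g ^+ 8 = \sum_(g < 2 ^ j.+1 | dyad j g) `|A g| ^+ 8 by eqbig g;rewrite -[8%N]/(2 * 4)%N !exprM real_normK ?num_real.
 have t1 : T ^+ 2 <= 2 ^+ j * \sum_(g < 2 ^ j.+1 | dyad j g) `|A g| ^+ 2 := T2 1%N.
 have t2 := T2 2%N;have t4 := T2 4%N.
 move: t1 t2 t4 (pos 2%N) (pos 4%N) (pos 8%N);rewrite /=.
 have T0 : 0 <= T by pos.
 set B := 2 ^+ j in b0 *;set a := \sum_(_ | _) _;set b := \sum_(_ | _) _;set c := \sum_(_ | _) _.
 move=> t1 t2 t4 a0 b0' c0.
 have s1 : T ^+ 4 <= B ^+ 3 * b.
  via ((B * a) ^+ 2);first by rewrite -[4%N]/(2 * 2)%N exprM ler_pXn2r// nnegrE ?sqr_ge0// mulr_ge0.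
  by rewrite exprMn [B ^+ 3]exprSr -mulrA ler_wpM2l// exprn_ge0.
 via ((B ^+ 3 * b) ^+ 2).
  by rewrite -[8%N]/(4 * 2)%N exprM ler_pXn2r// nnegrE ?exprn_ge0// mulr_ge0// exprn_ge0.
 by rewrite exprMn -exprM [B ^+ 7]exprSr -mulrA ler_wpM2l// exprn_ge0.
have A8 : \sum_(g < 2 ^ j.+1 | dyad j g) A g ^+ 8 <= \sum_(f in ffun_on E) `|S (nf f)|.
 have -> : \sum_(g < 2 ^ j.+1 | dyad j g) A g ^+ 8 = \sum_(f in ffun_on E) (\prod_k y (f k)) * S (nf f).
  under eq_bigr => g _ do rewrite A_pow8.
  by rewrite exchange_big;eqbig f;rewrite mulr_sumr.
 lesum f;letr (ler_norm _);rewrite normrM ler_piMl//.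
 by rewrite normr_prod;apply: prodr_ile1 => k _;rewrite normr_ge0 y1.
have A16 : (\sum_(f in ffun_on E) `|S (nf f)|) ^+ 2 <= (2 ^+ i) ^+ 8 * (rho%:R * (20 * (2 ^+ j * N%:R))).
 letr (cauchy_card _ _).
 apply: ler_pM => //;first pos.
  rewrite (_ : #|_| = (#|E| ^ #|'I_8|)%N);last by rewrite -card_ffun_on;apply: eq_card => f.
  rewrite card_ord natrX;apply: lerXn2r;rewrite ?nnegrE ?exprn_ge0//.
  by rewrite -natrX ler_nat card_dyad.
 via (\sum_(n < N | odd n) rho%:R * S n ^+ 2);last first.
  by rewrite -mulr_sumr ler_wpM2l// sum_S_sqr;lia.
 via (\sum_(f in ffun_on E) \sum_(n < N | odd n && (nf f == n)) S n ^+ 2).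
  apply: ler_sum => f /nf_lt /andP[o1 /andP[_ lt]].
  rewrite (big_pred1 (Ordinal lt))/= ?real_normK ?num_real// => n.
  rewrite -[RHS]/(n == Ordinal lt) -[RHS](inj_eq val_inj)/= eq_sym;case: eqP => [->|];rewrite ?o1 ?andbF//.
 rewrite (exchange_big_dep (fun n : 'I_N => odd n))/=;last by move=> f n _ /andP[].
 apply: ler_sum => n no;rewrite sumr_const -[_ *+ _]mulr_natl ler_wpM2r ?sqr_ge0// ler_nat.
 apply: leq_trans (card_nf (_ : 0 < n < N)%N);last by rewrite ltn_ord andbT;case: (nat_of_ord n) no.
 by apply: subset_leq_card;apply/fintype.subsetP => f;rewrite !unfold_in => /andP[h1 /andP[_ h2]];rewrite h2 andbT.
rewrite [T ^+ 16](exprM _ 8 2).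
via (((2 ^+ j) ^+ 7 * \sum_(f in ffun_on E) `|S (nf f)|) ^+ 2).
 have T0 : 0 <= T by pos.
 rewrite ler_pXn2r ?nnegrE//;first by letr T8;rewrite ler_wpM2l// exprn_ge0.
 - exact: exprn_ge0.
 - by rewrite mulr_ge0 ?exprn_ge0// sumr_ge0.
rewrite exprMn [(2 ^+ j) ^+ 14](exprM _ 7 2) ler_wpM2l//;exact: sqr_ge0.
Qed.

End Dyadic.

Lemma ex_omega_bound k : exists K : nat, (0 < K)%N /\ forall n, (0 < n)%N -> ((2 ^ size (primes n)) ^ k <= K * n)%N.
exists ((2 ^ k) ^ (2 ^ k))%N;split;first lia.
by move=> n n0;rewrite -expnM mulnC expnM;apply: omega_pow_le.
Qed.

(** This is 2^(-1/32). *)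
Definition theta : R := expR (- (ln 2 / 32)).

Lemma theta_gt0 : 0 < theta. Proof. pos. Qed.
Lemma theta_lt1 : theta < 1.
by rewrite -[1]expR0 ltr_expR;have := ln2_ge R;lra. Qed.
Lemma theta32 : theta ^+ 32 = 2^-1.
rewrite -expRM_natl mulrN mulrCA mulfV ?mulr1 ?pnatr_eq0//.
by rewrite expRN lnK// posrE.
Qed.

(** With a = 2^i and b = 2^j, [dyadic_far] saves about 2^(-i/4). Otherwise [dyadic_near] gives T^16
    b = O((ab)^16 rho), where rho^16 = O(a^8) by the bound for omega. Taking the 16th power and
    using that a is at most b gives T^256 = O((ab)^256 a^-8), and a^-8 = theta^(256 i). *)
Lemma dyadic_bound : exists C : R, 0 < C /\ forall (i j : nat) (y : nat -> R),
 (i <= j)%N -> (forall e, `|y e| <= 1) ->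
 \sum_(g < 2 ^ j.+1 | dyad j g) `|\sum_(e < 2 ^ i.+1 | dyad i e) y e * jacR g e| <=
 C * (2 ^+ i * 2 ^+ j * theta ^+ i).
have [K [K0 hK]] := ex_omega_bound (8 * 16).
have [D [D4 hD]] : exists D : R, 4 <= D /\ (20 * 2 ^+ 8) ^+ 16 * (K%:R * 2 ^+ 8) <= D.
 exists (4 + (20 * 2 ^+ 8) ^+ 16 * (K%:R * 2 ^+ 8));rewrite lerDl lerDr;split => //.
 by apply: mulr_ge0;[apply: exprn_ge0|];apply: mulr_ge0 => //;apply: exprn_ge0.
exists D;split=> [|i j y ij y1];first lra.
have th0 := theta_gt0;have th1 := theta_lt1.
set T := \sum_(g < _ | _) _;have T0 : 0 <= T by pos.
set X := 2 ^+ i * 2 ^+ j;have X0 : 0 < X by pos.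
have Xt : 0 < X * theta ^+ i by pos.
case: (leqP (5 * i) (2 * j)) => hij.
 have h1 := dyadic_far y1 hij;rewrite -/T -/X in h1.
 have h2 : (2^-1 : R) ^+ (i %/ 2) * 2^-1 <= (theta ^+ i) ^+ 2 by rewrite -theta32 -!exprM -exprD;apply: ler_wiXn2l;[exact: ltW | exact: ltW | lia].
 via (4 * (X * theta ^+ i));last by rewrite ler_wpM2r// ltW.
 have p4 : 0 <= 4 * (X * theta ^+ i) by lra.
 rewrite -(ler_pXn2r (n := 2))//.
 letr h1;have -> : (4 * (X * theta ^+ i)) ^+ 2 = 16 * (X ^+ 2 * (theta ^+ i) ^+ 2) by ring.
 move: h2 (sqr_ge0 X) (sqr_ge0 (theta ^+ i)).
 move: (X ^+ 2) (theta ^+ i ^+ 2) (2^-1 ^+ (i %/ 2)) => v w u h2 v0 w0.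
 have h3 : 0 <= 2 * w - u by lra.
 have := mulr_ge0 v0 h3;have := mulr_ge0 v0 w0;nra.
pose rho := (\max_(n < (2 ^ i.+1) ^ 8 | (0 < n)%N) (2 ^ size (primes n)) ^ 8)%N.
have hrho n : (0 < n < (2 ^ i.+1) ^ 8)%N -> ((2 ^ size (primes n)) ^ 8 <= rho)%N.
 move=> /andP[n0 nN].
 exact: (@leq_bigmax_cond _ (fun n : 'I_((2 ^ i.+1) ^ 8) => 0 < n)%N (fun n : 'I_((2 ^ i.+1) ^ 8) => (2 ^ size (primes n)) ^ 8)%N (Ordinal nN)).
have hrho16 : (rho ^ 16 <= K * (2 ^ i.+1) ^ 8)%N.
 rewrite /rho;elim/big_ind: _ => [|a b ha hb|n n0].
 - by rewrite exp0n.
 - by rewrite /maxn;case: ifP.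
 - rewrite -expnM;letr (hK n n0);rewrite leq_mul2l;apply/orP;right;exact: ltnW.
have h1 := dyadic_near y1 hrho ij (ltnW hij);rewrite -/T in h1.
have hr : (rho%:R : R) ^+ 16 <= K%:R * (2 ^+ 8 * (2 ^+ i) ^+ 8) by rewrite -natrX -exprMn -[2 * _]exprS -!natrX -natrM ler_nat.
have e1 : (theta ^+ i) ^+ (16 * 16) * (2 ^+ i) ^+ 8 = 1.
 have -> : (theta ^+ i) ^+ (16 * 16) = (theta ^+ 32) ^+ (i * 8) by rewrite -!exprM;congr (_ ^+ _);lia.
 by rewrite theta32 -exprM -exprMn mulVf ?expr1n// pnatr_eq0.
have eN : ((2 ^ i.+1) ^ 8)%N%:R = 2 ^+ 8 * (2 ^+ i) ^+ 8 :> R by rewrite !natrX [2 ^+ i.+1]exprS exprMn.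
rewrite eN in h1.
have ab : (2 ^+ i : R) <= 2 ^+ j by rewrite ler_eXn2l// ltr1n.
have a0 : 0 < (2 ^+ i : R) by pos.
have b0 : 0 < (2 ^+ j : R) by pos.
move: h1 hr e1 ab a0 b0;rewrite /X in X0 Xt *.
move: (2 ^+ i) (2 ^+ j) (theta ^+ i) (rho%:R : R) (ler0n R rho) X0 Xt => a b t r r0 X0 Xt h1 hr e1 ab a0 b0.
have h2 : T ^+ 16 * b <= (20 * 2 ^+ 8) * ((a * b) ^+ 16 * r).
 letr (ler_wpM2r (ltW b0) h1);apply: eqler;ring.
have h3 : (T ^+ 16 * b) ^+ 16 <= ((20 * 2 ^+ 8) * ((a * b) ^+ 16 * r)) ^+ 16.
 apply: lerXn2r => //;rewrite nnegrE.
  by apply: mulr_ge0;[apply: exprn_ge0|apply: ltW].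
 by apply: mulr_ge0;apply: mulr_ge0 => //;apply: exprn_ge0;rewrite ltW.
have h4 : a ^+ 16 <= b ^+ 16 by apply: lerXn2r => //;rewrite nnegrE ltW.
rewrite -(ler_pXn2r (n := 16 * 16))//;last by apply: mulr_ge0;[lra|apply: ltW].
rewrite [leRHS]exprMn;via (D * (a * b * t) ^+ (16 * 16));last first.
 by apply: ler_wpM2r;[apply: exprn_ge0;apply: ltW | rewrite -{1}[D]expr1 ler_weXn2l//;lra].
have bp : 0 < b ^+ 16 * a ^+ 8 by rewrite mulr_gt0 ?exprn_gt0.
rewrite -(ler_pM2r bp).
have -> : T ^+ (16 * 16) * (b ^+ 16 * a ^+ 8) = (T ^+ 16 * b) ^+ 16 * a ^+ 8 by ring.
have -> : D * (a * b * t) ^+ (16 * 16) * (b ^+ 16 * a ^+ 8) = D * ((a * b) ^+ 16) ^+ 16 * b ^+ 16.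
 rewrite exprMn -exprM -[in RHS](mulr1 (_ ^+ 16)) -[1 in RHS]e1;move: (t ^+ _) ((a * b) ^+ _) => u v;ring.
letr (ler_wpM2r (exprn_ge0 8 (ltW a0)) h3).
rewrite [(20 * _ * _) ^+ 16]exprMn [((a * b) ^+ 16 * r) ^+ 16]exprMn.
move: hD h4 hr;move: ((a * b) ^+ 16 ^+ 16) (exprn_ge0 16 (exprn_ge0 16 (ltW X0))) => v v0.
have u0 : 0 <= (20 * 2 ^+ 8) ^+ 16 :> R by apply: exprn_ge0;apply: mulr_ge0 => //;apply: exprn_ge0.
move: ((20 * 2 ^+ 8) ^+ 16) u0 => u u0 hD h4 hr.
have -> : u * (v * r ^+ 16) * a ^+ 8 = v * (u * (r ^+ 16 * a ^+ 8)) by ring.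
have -> : D * v * b ^+ 16 = v * (D * b ^+ 16) by ring.
rewrite ler_wpM2l//.
via (u * (K%:R * (2 ^+ 8 * a ^+ 8) * a ^+ 8)).
 by rewrite ler_wpM2l// ler_wpM2r// exprn_ge0// ltW.
have -> : u * (K%:R * (2 ^+ 8 * a ^+ 8) * a ^+ 8) = (u * (K%:R * 2 ^+ 8)) * a ^+ 16 by ring.
apply: ler_pM => //;last by apply: exprn_ge0;apply: ltW.
by apply: mulr_ge0 => //;apply: mulr_ge0 => //;apply: exprn_ge0.
Qed.
End Bilinear.

(** * Multiplicative weights on odd squarefree integers *)

Section Weights.
Variable R : realType.
Variables (z : nat) (kappa : R).
Hypotheses (z2 : (2 <= z)%N) (k0 : 0 < kappa) (k1 : kappa <= 1).

Let L : R := ln z%:R.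
(** The factor p^(-1/log z) is a smooth truncation that stays multiplicative: on pr A at most z it
    costs at most a factor e, and it makes sums over all dyadic ranges converge. *)
Definition wt (p : nat) : R := if odd p then kappa * (p%:R^-1 * expR (- (ln p%:R / ln z%:R))) else 0.
Definition wtS (A : pset z) : R := \prod_(p in A) wt p.
Definition wF : R := \prod_(0 <= p < z.+1 | prime p) (1 + wt p).

Lemma L_gt0 : 0 < L. Proof. exact: ln_nat_gt0. Qed.

Lemma wt_ge0 p : 0 <= wt p.
by rewrite /wt;case: ifP => // _;rewrite !mulr_ge0 ?invr_ge0 ?expR_ge0// ltW. Qed.

Lemma wt_le p : wt p <= kappa / p%:R.
rewrite /wt;case: ifP => _;last pos.
rewrite ler_wpM2l ?(ltW k0)// ler_piMr ?invr_ge0// -[leRHS]expR0 ler_expR oppr_le0.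
pos.
Qed.

Lemma wtS_ge0 A : 0 <= wtS A. Proof. by apply: prodr_ge0 => p _;apply: wt_ge0. Qed.

Lemma wF_sum : wF = \sum_(A : pset z | all_prime A) wtS A.
exact: prod1D_set. Qed.

Lemma wF_ge1 : 1 <= wF.
rewrite /wF;elim/big_ind: _ => // [x y hx hy|p _].
 by rewrite -[1]mulr1 ler_pM.
by rewrite lerDl wt_ge0.
Qed.

(** The prime 2, which has weight 0, costs at most 1. The smooth factor costs at most the sum of log
    p / (p log z), that is 2, by [sum_ln_prime_div]. *)
Lemma wt_sum_approx (chi : nat -> R) : (forall n, -1 <= chi n <= 1) ->
 `|\sum_pr(p <= z) wt p * chi p - kappa * \sum_pr(p <= z) chi p / p%:R| <= 3.
move=> hc;rewrite mulr_sumr -sumrB;letr (ler_norm_sum _ _ _).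
via (\sum_pr(p <= z) ((if p == 2 then 1 else 0) + (ln p%:R / p%:R) / L)).
 apply: sumr_le_nat => p _ pp.
 have p0 : 0 < (p%:R : R) by pos.
 have pV : 0 <= (p%:R^-1 : R) by pos.
 have lp : 0 <= ln (p%:R : R) / L by pos.
 have hc' : `|chi p| <= 1 by rewrite ler_norml hc.
 have -> : ln p%:R / p%:R / L = p%:R^-1 * (ln p%:R / L) :> R by ring.
 rewrite /wt;case: ifP => po;last first.
  have -> : p = 2%N by case/even_prime: pp => //;rewrite po.
  rewrite mul0r sub0r normrN eqxx !normrM (ger0_norm (ltW k0)) [ `|_^-1|]ger0_norm ?invr_ge0//.
  via (1 * (1 * 1)).
   apply: ler_pM => //;first exact: ltW.
    pos.
   by have := hc 2%N;rewrite -ler_norml;lra.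
  by rewrite !mulr1 lerDl mulr_ge0 ?invr_ge0// divr_ge0 ?ln_nat_ge0 ?(ltW L_gt0).
 have -> : kappa * (p%:R^-1 * expR (- (ln p%:R / ln z%:R))) * chi p - kappa * (chi p / p%:R) =
   - (kappa * chi p * (p%:R^-1 * (1 - expR (- (ln p%:R / L))))) by lra.
 rewrite normrN;via (p%:R^-1 * (ln p%:R / L));last first.
  by rewrite lerDr;case: ifP.
 have h1 := expR_ge1Dx (- (ln p%:R / L)).
 have h2 : expR (- (ln p%:R / L)) <= 1 by rewrite -[leRHS]expR0 ler_expR oppr_le0.
 rewrite !normrM (ger0_norm (ltW k0)) (ger0_norm pV) [ `|1 - _|]ger0_norm ?subr_ge0//.
 via (1 * 1 * (p%:R^-1 * (1 - expR (- (ln p%:R / L))))).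
  apply: ler_wpM2r;first by rewrite mulr_ge0// subr_ge0.
  by apply: ler_pM => //;apply: ltW.
 by rewrite !mul1r ler_wpM2l;lra.
rewrite big_split/= -mulr_suml.
have h1 : \sum_pr(p <= z) (if p == 2 then 1 else 0) = 1 :> R.
 rewrite big_mkcond (bigD1_seq 2%N) ?iota_uniq ?mem_index_iota ?ltnS ?z2//= big1 ?addr0//.
 by move=> i /negbTE ->;case: ifP.
have h2 : (\sum_pr(p <= z) ln p%:R / p%:R) / L <= 2 by rewrite ler_pdivrMr ?L_gt0// sum_ln_prime_div.
lra.
Qed.

(** The sum is an Euler product, compared with the exponential of the sum over primes. *)
Lemma sum_wt_char (chi : nat -> R) : (forall p, -1 <= chi p <= 1) ->
 (forall A : pset z, all_prime A -> chi (pr A) = \prod_(p in A) chi p) ->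
 `|\sum_(A : pset z | all_prime A) wtS A * chi (pr A)| <=
 expR 3 * expR (kappa * \sum_pr(p <= z) chi p / p%:R).
move=> hc hM.
have e : \sum_(A : pset z | all_prime A) wtS A * chi (pr A) =
  \prod_(0 <= p < z.+1 | prime p) (1 + wt p * chi p).
 rewrite (@prod1D_set R z.+1 (fun p => wt p * chi p));apply: eq_bigr => A hA.
 by rewrite hM// -big_split.
rewrite e normr_prod -expRD.
via (expR (\sum_pr(p <= z) wt p * chi p)).
 rewrite -prod_expR;apply: ler_prod => p pp;rewrite normr_ge0/=.
 rewrite ger0_norm ?expR_ge1Dx//.
 have := wt_ge0 p;have : wt p <= 1.
  letr (wt_le p);rewrite ler_pdivrMr ?ltr0n ?prime_gt0// mul1r.
  by letr k1;rewrite ler1n prime_gt0.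
 by have /andP[] := hc p;nra.
rewrite ler_expR;have := wt_sum_approx hc;rewrite ler_norml;lra.
Qed.

Definition dset (i : nat) (A : pset z) : bool := all_prime A && (2 ^ i <= pr A < 2 ^ i.+1)%N.

Lemma oddsf_pr (A : pset z) : all_prime A -> (forall p, p \in A -> odd p) -> oddsf (pr A).
move=> hA ho;apply/andP;split.
 by rewrite /pr;elim/big_ind: _ => // a b;rewrite oddM => -> ->.
rewrite /sqfreeb pr_gt0//=;apply/allP => q;rewrite mem_primes => /and3P[qp _].
have dv (B : pset z) : all_prime B -> (q %| pr B)%N -> exists2 i, i \in B & q = i.
 move=> hB;rewrite /pr big_seq_cond (Euclid_dvd_prod _ _ _ qp) -big_seq_cond big_has_cond => /hasP[i _ /andP[iB]].
 by rewrite dvdn_prime2 ?(elimT (all_primeP B) hB i iB)// => /eqP;exists i.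
case/(dv A hA) => i iA ei.
have hB : all_prime (A :\ i) by apply/all_primeP => j;rewrite in_setD1 => /andP[_];apply: (elimT (all_primeP A) hA).
have e : pr A = (i * pr (A :\ i))%N by rewrite /pr (big_setD1 i).
rewrite e -ei (lognM _ (prime_gt0 qp) (pr_gt0 hB)) (logn_prime q qp) eqxx.
suff -> : logn q (pr (A :\ i)) = 0%N by [].
rewrite lognE;case: ifP => // /and3P[_ _ /(dv _ hB)[j]].
by rewrite in_setD1 => /andP[ji _];rewrite ei => /val_inj e2;move: ji;rewrite e2 eqxx.
Qed.

Lemma wtS_neq0 (A : pset z) : all_prime A -> wtS A != 0 -> oddsf (pr A).
move=> hA hw;apply: oddsf_pr => // p pA;move: hw;apply: contraNT => po.
by rewrite /wtS (bigD1 p)//= /wt (negbTE po) mul0r.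
Qed.

Lemma wtS_le (A : pset z) : all_prime A -> wtS A <= (pr A)%:R^-1 * expR (- (ln (pr A)%:R / L)).
move=> /all_primeP hA;rewrite /pr ln_prodn => [|p /hA/prime_gt0//].
rewrite mulr_suml -sumrN -prod_expR natr_prod -prodfV -big_split/=.
apply: ler_prod => p pA;rewrite wt_ge0/= /wt;case: ifP => _.
 by rewrite ler_piMl// mulr_ge0 ?invr_ge0 ?expR_ge0.
pos.
Qed.

Lemma wtS_le1 (A : pset z) : all_prime A -> wtS A <= (pr A)%:R^-1.
move=> hA;letr (wtS_le hA);rewrite ler_piMr ?invr_ge0//.
by rewrite -[leRHS]expR0 ler_expR oppr_le0 divr_ge0 ?ln_nat_ge0// ltW// L_gt0.
Qed.

Lemma sum_dset_le i (f : nat -> R) : (forall n, 0 <= f n) ->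
 \sum_(A | dset i A) f (pr A) <= \sum_(2 ^ i <= n < 2 ^ i.+1) f n.
move=> f0.
rewrite big_geq_mkord;have hp : (0 < 2 ^ i.+1)%N by rewrite expn_gt0.
apply: (ler_sum_inj (h := fun A => insubd (Ordinal hp) (pr A))).
- move=> A B /andP[hA /andP[_ h1]] /andP[hB /andP[_ h2]] /(congr1 val).
 by rewrite /= !val_insubd h1 h2;apply: pr_inj.
- by move=> A /andP[hA /andP[h1 h2]];rewrite val_insubd h2.
- by move=> A /andP[hA /andP[h1 h2]];rewrite val_insubd h2.
- by move=> *;apply: f0.
Qed.

Lemma sum_dset_inv i : \sum_(A | dset i A) wtS A <= 1.
via (\sum_(A | dset i A) (2 ^+ i)^-1).
 apply: ler_sum => A /andP[hA /andP[h _]];letr (wtS_le1 hA).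
 by rewrite lef_pV2 ?posrE ?ltr0n ?pr_gt0 ?exprn_gt0// -natrX ler_nat.
letr (sum_dset_le i (f := fun=> (2 ^+ i)^-1) _);first by move=> _;rewrite invr_ge0 exprn_ge0.
by rewrite sumr_const_nat expnS mul2n -addnn addnK -[_ *+ _]mulr_natl natrX mulfV// expf_neq0// pnatr_eq0.
Qed.

Lemma sum_dset_inv2 i : \sum_(A | dset i A) wtS A ^+ 2 <= (2 ^+ i)^-1.
via (\sum_(A | dset i A) (2 ^+ i)^-1 * wtS A);last first.
 by rewrite -mulr_sumr ler_piMr ?invr_ge0 ?exprn_ge0// sum_dset_inv.
apply: ler_sum => A /andP[hA /andP[h _]];rewrite expr2 ler_wpM2r ?wtS_ge0//.
letr (wtS_le1 hA).
by rewrite lef_pV2 ?posrE ?ltr0n ?pr_gt0 ?exprn_gt0// -natrX ler_nat.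
Qed.

End Weights.

(** * Weighted bilinear sums with a small or a large variable *)

Section Regimes.
Variable R : realType.

Lemma expR_scale_le (k x : R) : 0 < k -> k <= 1 -> expR (k * x) <= 1 + expR x.
move=> k0 k1;have e0 := expR_gt0 x;case: (lerP 0 x) => hx.
 via (expR x);last lra.
 by rewrite ler_expR ler_piMl.
via (1);last lra.
by rewrite -[leRHS]expR0 ler_expR;nra.
Qed.

(* Cauchy-Schwarz over all g; the off-diagonal terms are Euler products of nonprincipal characters. *)
Lemma regime_small : exists C : R, 0 < C /\ forall z (kappa : R) i (x : pset z -> R),
 (2 <= z)%N -> 0 < kappa -> kappa <= 1 -> (forall A, `|x A| <= wtS kappa A) ->
 (\sum_(G : pset z | all_prime G) wtS kappa G * `|\sum_(A | dset i A) x A * jacR R (pr G) (pr A)|) ^+ 2 <=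
 wF z kappa * (wF z kappa * (2 ^+ i)^-1 + C * (i%:R + 1)).
have [C1 [C10 hC1]] := char_prime_sum R.
exists (expR 3 * (1 + C1 * 4));split;first pos.
move=> z kappa i x z2 k0 k1 hx;set F := wF z kappa;set C := expR 3 * _.
have w0 (G : pset z) : all_prime G -> 0 <= wtS kappa G by move=> _;apply: wtS_ge0.
have := @cauchy_weighted R _ (index_enum _) (fun G : pset z => all_prime G) (wtS kappa) (fun=> 1)
 (fun G => `|\sum_(A | dset i A) x A * jacR R (pr G) (pr A)|) w0.
rewrite (eq_bigr (fun G => wtS kappa G * `|\sum_(A | dset i A) x A * jacR R (pr G) (pr A)|)) => [|G _];last lra.
rewrite [X in _ <= X * _](eq_bigr (wtS kappa)) => [|G _];last lra.
rewrite -wF_sum -/F => /le_trans;apply.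
have F1 : 1 <= F := wF_ge1 z k0.
rewrite ler_wpM2l ?(le_trans ler01)//.
have -> : \sum_(G : pset z | all_prime G) wtS kappa G * `|\sum_(A | dset i A) x A * jacR R (pr G) (pr A)| ^+ 2 =
  \sum_(A | dset i A) \sum_(B | dset i B) x A * x B *
   \sum_(G : pset z | all_prime G) wtS kappa G * (jacR R (pr G) (pr A) * jacR R (pr G) (pr B)).
 transitivity (\sum_(G : pset z | all_prime G) \sum_(A | dset i A) \sum_(B | dset i B)
   x A * x B * (wtS kappa G * (jacR R (pr G) (pr A) * jacR R (pr G) (pr B)))).
  eqbig G;rewrite real_normK ?num_real// expr2 mulr_suml mulr_sumr;eqbig A.
  rewrite !mulr_sumr;eqbig B;ring.
 rewrite exchange_big/=;eqbig A;rewrite exchange_big/=.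
 by eqbig B;rewrite mulr_sumr.
have off A B : dset i A -> dset i B -> A != B ->
  `|x A * x B * \sum_(G : pset z | all_prime G) wtS kappa G * (jacR R (pr G) (pr A) * jacR R (pr G) (pr B))|
  <= wtS kappa A * wtS kappa B * (C * (i%:R + 1)).
 move=> hA hB AB;have [hA1 /andP[_ hA2]] := andP hA;have [hB1 /andP[_ hB2]] := andP hB.
 case: (eqVneq (wtS kappa A) 0) => [e|nA].
  have := hx A;rewrite e normr_le0 => /eqP ->;by rewrite !mul0r normr0.
 case: (eqVneq (wtS kappa B) 0) => [e|nB].
  have := hx B;rewrite e normr_le0 => /eqP ->;by rewrite !mulr0 !mul0r normr0.
 have oA := wtS_neq0 hA1 nA;have oB := wtS_neq0 hB1 nB.
 have A0 := oddsf_gt0 oA;have B0 := oddsf_gt0 oB.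
 rewrite !normrM;apply: ler_pM;rewrite ?mulr_ge0 ?ler_pM//.
 pose chi n := jacR R n (pr A * pr B).
 have oAB : odd (pr A * pr B) by rewrite oddM !oddsf_odd.
 have chiM m n : chi (m * n)%N = chi m * chi n by rewrite /chi JMl.
 have chi_ge n : -1 <= chi n <= 1 by rewrite -ler_norml J_le1// muln_gt0 A0.
 have chi1 : chi 1%N = 1 by rewrite /chi /jacR jac1l.
 have -> : \sum_(G : pset z | all_prime G) wtS kappa G * (jacR R (pr G) (pr A) * jacR R (pr G) (pr B)) =
  \sum_(G : pset z | all_prime G) wtS kappa G * chi (pr G).
  by eqbig G;rewrite /chi JMr.
 letr (sum_wt_char z2 k0 k1 chi_ge _).
  move=> G _;rewrite /pr;elim/big_ind2: _ => // a b c d <- <-;exact: chiM.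
 rewrite /C -mulrA ler_wpM2l ?expR_ge0//.
 letr (expR_scale_le _ k0 k1).
 have nAB : pr A != pr B by apply: contraNneq AB => e;apply/eqP;apply: pr_inj e.
 have := hC1 chi (pr A * pr B)%N z chiM chi1 chi_ge _ _ z2.
 rewrite muln_gt0 A0 B0 => /(_ isT) h.
 have {}h := h _.
 have hint m n : `|\sum_(m <= a < n) chi a| <= (pr A * pr B)%N%:R.
  case: (leqP m n) => mn;last by rewrite big_geq ?normr0// ltnW.
  rewrite -(subnKC mn) /chi /jacR -rmorph_sum -intr_norm -[_%:R]/((pr A * pr B)%N%:Z%:~R) ler_int.
  exact: jac_oddsf_interval.
 have {h}h := h hint.
 have hl : ln (pr A * pr B)%N%:R <= 2 * (i%:R + 1) :> R.
  via (ln ((2 ^ i.+1) * (2 ^ i.+1))%N%:R).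
   by rewrite ln_nat_le// muln_gt0 A0 B0 leq_mul// ltnW.
  rewrite -expnD natrX lnXn// -[_ *+ _]mulr_natl natrD -[i.+1%:R]natr1.
  have : ln (2 : R) <= 1 by have := @ln_le_sub1 R 2;lra.
  have : 0 <= i%:R :> R by [];nra.
 have i0 : 0 <= i%:R :> R by [].
 nra.
have F0 : 0 <= F by lra.
have hC0 : 0 <= C * (i%:R + 1) by apply: mulr_ge0;[apply: mulr_ge0;rewrite ?expR_ge0// addr_ge0// mulr_ge0// ltW | rewrite addr_ge0].
via (\sum_(A : pset z | dset i A) (wtS kappa A ^+ 2 * F + wtS kappa A * (C * (i%:R + 1)) * \sum_(B : pset z | dset i B) wtS kappa B)).
 apply: ler_sum => A hA;rewrite (bigD1 A)//=;apply: lerD.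
  letr (ler_norm _);rewrite normrM -expr2 normrX;apply: ler_pM;rewrite ?exprn_ge0//.
   by apply: lerXn2r;rewrite ?nnegrE ?wtS_ge0//.
  letr (ler_norm_sum _ _ _);rewrite /F wF_sum;apply: ler_sum => G hG.
  rewrite normrM (ger0_norm (wtS_ge0 k0 G)) ler_piMr ?wtS_ge0//.
  by rewrite normrM mulr_ile1 ?J_le1// pr_gt0;case/andP: hA.
 rewrite mulr_sumr;via (\sum_(B | dset i B && (B != A)) wtS kappa A * (C * (i%:R + 1)) * wtS kappa B).
  apply: ler_sum => B /andP[hB BA];letr (ler_norm _).
  rewrite [X in _ <= X]mulrAC;apply: off => //;by rewrite eq_sym.
 rewrite [leRHS](bigD1 A)//= lerDr mulr_ge0 ?wtS_ge0// mulr_ge0 ?wtS_ge0//.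
have s1 := sum_dset_inv z k0 k1 i.
have s0 : 0 <= \sum_(A : pset z | dset i A) wtS kappa A by apply: sumr_ge0 => A _;apply: wtS_ge0.
rewrite big_split/=;apply: lerD.
 by rewrite -mulr_suml mulrC;apply: ler_wpM2l => //;apply: sum_dset_inv2.
rewrite -mulr_suml -mulr_suml.
via (1 * (C * (i%:R + 1)) * 1);last lra.
apply: ler_pM => //;first pos.
by rewrite ler_wpM2r.
Qed.

Lemma geom_le (r : R) n : 0 <= r < 1 -> \sum_(0 <= k < n) r ^+ k <= (1 - r)^-1.
move=> /andP[r0 r1];rewrite -[leRHS]mul1r ler_pdivlMr ?subr_gt0//.
have -> : (\sum_(0 <= k < n) r ^+ k) * (1 - r) = 1 - r ^+ n.
 elim: n => [|n IH];first by rewrite big_geq// mul0r expr0 subrr.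
 rewrite big_nat_recr//= mulrDl IH exprSr;ring.
by rewrite gerBl exprn_ge0.
Qed.

(** For pr G of size 2^j the weights are at most 2^-j r^j with r = exp(-log 2 / log z), and those of
    A are at most 2^-i, so that [dyadic_bound] gives C theta^i r^j. The geometric series in j costs
    1/(1 - r), which is at most 4 log z. *)
Lemma regime_large : exists C : R, 0 < C /\ forall z (kappa : R) i (x : pset z -> R),
 (2 <= z)%N -> 0 < kappa -> kappa <= 1 -> (forall A, `|x A| <= wtS kappa A) ->
 \sum_(G : pset z | all_prime G && (2 ^ i <= pr G)%N)
   wtS kappa G * `|\sum_(A | dset i A) x A * jacR R (pr G) (pr A)| <=
 C * ln z%:R * theta R ^+ i.
have [C [C0 hC]] := dyadic_bound R.
exists (C * 4);split;first lra.
move=> z kappa i x z2 k0 k1 hx;set L := ln z%:R;have L0 : 0 < L := ln_nat_gt0 R z2.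
have L2 : 1 / 2 <= L by letr (ln2_ge R);rewrite ln_nat_le.
have [Jm hJ] : exists Jm : nat, forall G : pset z, (pr G < 2 ^ Jm)%N.
 exists (\max_(G : pset z) pr G).+1 => G;apply: leq_ltn_trans (ltn_expl _ _) => //.
 letr (leq_bigmax G);exact: leqnSn.
pose r := expR (- (ln 2 / L)).
have r0 : 0 < r := expR_gt0 _.
have lu : 0 < ln 2 / L by rewrite divr_gt0//;have := ln2_ge R;lra.
have r1 : r < 1 by rewrite /r -[X in _ < X]expR0 ltr_expR oppr_lt0.
pose y (n : nat) : R := \sum_(A | dset i A && (pr A == n)) 2 ^+ i * x A.
have y1 n : `|y n| <= 1.
 rewrite /y;case: (pickP (fun A : pset z => dset i A && (pr A == n))) => [B hB|h0];last first.
  by rewrite big_pred0 ?normr0.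
 rewrite (big_pred1 B) => [|A];last first.
  case/andP: hB => /andP[hB1 hB2] /eqP eB;rewrite -eB/=;apply/andP/eqP => [[/andP[hA _] /eqP]|->].
   exact: pr_inj.
  by rewrite /dset hB1.
 case/andP: hB => /andP[hB /andP[hB2 _]] _.
 rewrite normrM ger0_norm ?exprn_ge0// mulrC -ler_pdivlMr ?exprn_gt0// mul1r.
 apply: (le_trans (hx B));apply: (le_trans (wtS_le1 k0 k1 hB)).
 by rewrite lef_pV2 ?posrE ?ltr0n ?pr_gt0 ?exprn_gt0// -natrX ler_nat.
have eA g : \sum_(A | dset i A) x A * jacR R g (pr A) =
  (2 ^+ i)^-1 * \sum_(e < 2 ^ i.+1 | dyad i e) y e * jacR R g e.
 rewrite mulr_sumr.
 transitivity (\sum_(e < 2 ^ i.+1 | dyad i e) \sum_(A | dset i A && (pr A == e)) x A * jacR R g (pr A));last first.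
  eqbig e;rewrite /y mulr_suml mulr_sumr;apply: eq_bigr => A /andP[_ /eqP ->].
  by rewrite mulrA mulKf// expf_neq0// pnatr_eq0.
 rewrite (exchange_big_dep (dset i))/=;last by move=> e A _ /andP[].
 apply: eq_bigr => A hA;have [hA1 /andP[h1 h2]] := andP hA.
 case: (eqVneq (wtS kappa A) 0) => [e|nA].
  have := hx A;rewrite e normr_le0 => /eqP ->.
  by rewrite mul0r big1// => j _;rewrite mul0r.
 rewrite (big_pred1 (Ordinal h2))//= => e;rewrite hA/= -[RHS](inj_eq val_inj)/= eq_sym.
 by case: eqP => [->|];rewrite ?andbF// /dyad h1 (wtS_neq0 hA1 nA).
pose S j : R := \sum_(G : pset z | dset j G) wtS kappa G * `|\sum_(A | dset i A) x A * jacR R (pr G) (pr A)|.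
have hS j : (i <= j)%N -> S j <= C * theta R ^+ i * r ^+ j.
 move=> ij;rewrite /S.
 pose f (n : nat) : R := if dyad j n then (2 ^+ j)^-1 * r ^+ j * ((2 ^+ i)^-1 * `|\sum_(e < 2 ^ i.+1 | dyad i e) y e * jacR R n e|) else 0.
 have f0 n : 0 <= f n by rewrite /f;case: ifP => // _;rewrite !mulr_ge0 ?invr_ge0 ?exprn_ge0// ltW.
 via (\sum_(G : pset z | dset j G) f (pr G)).
  apply: ler_sum => G /andP[hG /andP[h1 h2]].
  case: (eqVneq (wtS kappa G) 0) => [->|nG];first by rewrite mul0r.
  rewrite /f /dyad (wtS_neq0 hG nG) h1/= eA normrM [ `|_^-1|]ger0_norm ?invr_ge0 ?exprn_ge0//.
  rewrite ler_wpM2r ?mulr_ge0 ?invr_ge0 ?exprn_ge0//.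
  letr (wtS_le k0 k1 hG).
  apply: ler_pM;rewrite ?invr_ge0 ?expR_ge0//.
   by rewrite lef_pV2 ?posrE ?ltr0n ?pr_gt0 ?exprn_gt0// -natrX ler_nat.
  rewrite /r -expRM_natl ler_expR mulrN lerN2 mulrA ler_wpM2r ?invr_ge0 ?(ltW L0)//.
  by rewrite mulr_natl -lnXn// -natrX ln_nat_le// expn_gt0.
 letr (sum_dset_le z j f0).
 rewrite big_nat_cond (eq_bigl (fun n => (2 ^ j <= n < 2 ^ j.+1)%N)) => [|n];last by rewrite andbT.
 have -> : \sum_(2 ^ j <= n < 2 ^ j.+1 | (2 ^ j <= n < 2 ^ j.+1)%N) f n = \sum_(n < 2 ^ j.+1 | dyad j n) f n.
  rewrite -(big_mkord (dyad j)) [RHS](big_cat_nat (n := 2 ^ j)) ?leq_exp2l//=.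
  rewrite [X in _ = X + _]big_nat_cond [X in _ = X + _]big1 ?add0r;last first.
   by move=> n /andP[/andP[_ h1] /andP[_ h2]];move: h1;rewrite ltnNge h2.
  rewrite [LHS]big_mkcond [RHS]big_mkcond;apply: eq_big_nat => n hn.
  by rewrite hn /f;case: ifP.
 rewrite (eq_bigr (fun n : 'I__ => (2 ^+ j)^-1 * r ^+ j * (2 ^+ i)^-1 * `|\sum_(e < 2 ^ i.+1 | dyad i e) y e * jacR R n e|));last first.
  by move=> n hn;rewrite /f hn mulrA.
 rewrite -mulr_sumr;letr (ler_wpM2l _ (hC i j y ij y1)).
  pos.
 apply: eqler;field.
 by rewrite !expf_neq0 ?pnatr_eq0.
via (\sum_(i <= j < i + Jm) S j).
 pose FF (G : pset z) := wtS kappa G * `|\sum_(A | dset i A) x A * jacR R (pr G) (pr A)|.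
 have FF0 G : 0 <= FF G by rewrite mulr_ge0// wtS_ge0.
 have -> : \sum_(i <= j < i + Jm) S j = \sum_(G : pset z) \sum_(i <= j < i + Jm) if dset j G then FF G else 0 by rewrite exchange_big;eqbig j;rewrite -big_mkcond.
 rewrite big_mkcond;lesum G.
 have g0 (a b : nat) : 0 <= \sum_(a <= j < b) if dset j G then FF G else 0 by apply: sumr_ge0 => j _;case: ifP.
 case: ifP => // /andP[hG h1];have G0 := pr_gt0 hG.
 have /andP[t1 t2] := trunc_log_bounds (isT : 1 < 2)%N G0.
 set t := trunc_log 2 (pr G) in t1 t2.
 have it : (i <= t)%N by rewrite -ltnS -(ltn_exp2l _ _ (isT : 1 < 2)%N) (leq_ltn_trans h1).
 have tJ : (t < i + Jm)%N.
  apply: leq_trans (leq_addl _ _);rewrite -(ltn_exp2l _ _ (isT : 1 < 2)%N);exact: leq_ltn_trans (hJ G).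
 rewrite (big_cat_nat (n := t)) ?(ltnW tJ)//= [X in _ + X]big_ltn//=.
 have -> : dset t G = true by rewrite /dset hG t1 t2.
 have := g0 i t;have := g0 t.+1 (i + Jm)%N;rewrite -/(FF G);lra.
via (\sum_(i <= j < i + Jm) C * theta R ^+ i * r ^+ j).
 by rewrite big_nat_cond [leRHS]big_nat_cond;apply: ler_sum => j /andP[/andP[ij _] _];apply: hS.
rewrite -mulr_sumr.
have hg : \sum_(i <= j < i + Jm) r ^+ j <= 4 * L.
 via (\sum_(0 <= j < i + Jm) r ^+ j).
  rewrite [leRHS](big_cat_nat (n := i))//= ?leq_addr// lerDr.
  pos.
 letr (geom_le _ _);first lra.
 rewrite -[leRHS]invrK lef_pV2 ?posrE ?invr_gt0 ?mulr_gt0 ?subr_gt0//.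
 have h1 := expR_ge1Dx (ln 2 / L).
 have h2 : r * expR (ln 2 / L) = 1 by rewrite /r -expRD addNr expR0.
 have h3 : 1 / 2 / L <= ln 2 / L by rewrite ler_wpM2r ?invr_ge0 ?(ltW L0)// ln2_ge.
 have h4 : L * L^-1 = 1 by rewrite mulfV ?gt_eqF.
 have i0 : 0 < L^-1 by pos.
 rewrite invfM;move: h1 h2 h3 r0 r1 lu;set u := ln 2 / L;set v := expR u;set l := L^-1 in h4 i0 *.
 move=> h1 h2 h3 r0 r1 lu.
 have hl : l <= 2 by nra.
 have : r * (1 + 1 / 2 * l) <= 1 by nra.
 nra.
have -> : C * 4 * L * theta R ^+ i = C * theta R ^+ i * (4 * L) by ring.
by rewrite ler_wpM2l// mulr_ge0 ?(ltW C0)// exprn_ge0// ltW// theta_gt0.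
Qed.

End Regimes.

(** * Sums over many variables, with oscillation between linked ones *)

Section Multi.
Variable R : realType.
Variables (T E : finType) (e0 : E) (w : E -> R) (idx : E -> nat) (linked : rel T) (d : nat) (F : R).
Hypothesis w0 : forall e, 0 <= w e.
Hypothesis lsym : symmetric linked.
Hypothesis lirr : irreflexive linked.
Definition unlinked (U : {set T}) : bool := [forall s in U, forall s' in U, ~~ linked s s'].
Hypothesis hd : forall U, unlinked U -> (#|U| <= d)%N.
Hypothesis F1 : 1 <= F.
Hypothesis hF : \sum_e w e <= F.
Hypothesis hH : forall i, \sum_(e | (idx e <= i)%N) w e <= i.+1%:R.

(** Among the linked pairs ordered so that the first index is at most the second, q is maximal for
    the lexicographic order of the two indices. *)
Definition canon (v : T -> nat) (q : T * T) : bool :=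
 [&& linked q.1 q.2, (v q.1 <= v q.2)%N &
  [forall q' : T * T, (linked q'.1 q'.2 && (v q'.1 <= v q'.2)%N) ==>
   ((v q'.1 < v q.1) || ((v q'.1 == v q.1) && (v q'.2 <= v q.2)))%N]].

Lemma canon_ex (v : T -> nat) (s s' : T) : linked s s' -> exists q, canon v q.
move=> l.
pose M := (\max_t v t).+1.
have hM t : (v t < M)%N by rewrite ltnS leq_bigmax.
pose P := fun q : T * T => linked q.1 q.2 && (v q.1 <= v q.2)%N.
have [q0 hq0] : exists q0, P q0.
 case/orP: (leq_total (v s) (v s')) => h;[exists (s, s') | exists (s', s)];rewrite /P/= h ?l//.
 by rewrite lsym l.
(* As M exceeds all values of v, this key realises the lexicographic order. *)
case: (@arg_maxnP _ q0 P (fun q => v q.1 * M + v q.2)%N hq0) => q /andP[h1 h2] hmax.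
exists q;rewrite /canon h1 h2/=;apply/forallP => q';apply/implyP => hq'.
have := hmax q' hq';have := hM q'.2;have := hM q.2;move: (v q'.1) (v q'.2) (v q.1) (v q.2) => a b a' b'.
case: (ltngtP a a') => //= [h|->];last lia.
move=> hb' hb hk;have : (a'.+1 * M <= a * M)%N by rewrite leq_mul2r h orbT.
lia.
Qed.

(** A linked pair among variables of index larger than that of q.1, or between such a variable and
    q.2, would beat q in the order. *)
Lemma canon_unlinked (v : T -> nat) (q : T * T) (U : {set T}) : canon v q ->
 (forall s, s \in U -> (v q.1 < v s)%N) -> unlinked (q.2 |: U).
case: q => t t' /and3P[/= l tt' /forallP hmax] hU.
have h1 s s' : s \in U -> s' \in U -> ~~ linked s s'.
 move=> sU s'U;apply/negP => l'.
 wlog ss : s s' sU s'U l' / (v s <= v s')%N.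
  by move=> H;case/orP: (leq_total (v s) (v s')) => h;[apply: (H s s')|apply: (H s' s)];rewrite // lsym.
 have := hmax (s, s');rewrite /=;have := hU s sU;lia.
have h2 s : s \in U -> ~~ linked s t'.
 move=> sU;apply/negP => l';have := hU s sU;have := hmax (s, t');have := hmax (t', s).
 by rewrite lsym;case: (leqP (v s) (v t')) => /= ?;case: (leqP (v t') (v s)) => /= ?;lia.
apply/forall_inP => s;rewrite !inE => /orP[/eqP ->|sU];apply/forall_inP => s';rewrite !inE => /orP[/eqP ->|s'U].
- by rewrite lirr.
- by rewrite lsym h2.
- exact: h2.
- exact: h1.
Qed.

Definition upd2 (o : {ffun T -> E}) (t t' : T) (e g : E) : {ffun T -> E} :=
 [ffun s => if s == t then e else if s == t' then g else o s].

(** The two coordinates t and t' are separated from the others, which are recorded by functions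
    frozen at the dummy value [e0] in t and t'. *)
Lemma sum_upd2 (t t' : T) (f : {ffun T -> E} -> R) : t != t' ->
 \sum_S f S = \sum_(o : {ffun T -> E} | (o t == e0) && (o t' == e0)) \sum_g \sum_e f (upd2 o t t' e g).
move=> tt';have t't : (t' == t) = false by rewrite eq_sym (negbTE tt').
rewrite (partition_big (fun S => upd2 S t t' e0 e0) (fun o => (o t == e0) && (o t' == e0)))/=;last first.
 by move=> S _;rewrite !ffunE t't !eqxx.
apply: eq_bigr => o /andP[/eqP ot /eqP ot'].
rewrite pair_big/= (reindex_onto (fun p : E * E => upd2 o t t' p.2 p.1) (fun S : {ffun T -> E} => (S t', S t)))/=.
 apply: eq_bigl => -[g e]/=;rewrite !ffunE t't !eqxx andbT.
 apply/eqP/ffunP => s;rewrite !ffunE;case: eqP => [->|_];first by [].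
 by case: eqP => [->|_];rewrite ?ot'.
move=> S /eqP <-;apply/ffunP => s;rewrite !ffunE;case: eqP => [->|_]//.
by case: eqP => [->|_]//.
Qed.

Variable val : {ffun T -> E} -> R.
Variable j : T -> T -> E -> E -> R.
Variable Phi : nat -> R.
Hypothesis Phi0 : forall i, 0 <= Phi i.
Hypothesis val_le : forall S, `|val S| <= \prod_t w (S t).
Hypothesis val_split : forall (t t' : T) (o : {ffun T -> E}), linked t t' ->
 exists (W : R) (x y : E -> R), [/\ `|W| <= \prod_(s | (s != t) && (s != t')) w (o s),
  (forall e, `|x e| <= w e), (forall g, `|y g| <= w g) &
  forall e g, val (upd2 o t t' e g) = W * y g * (x e * j t t' e g)].
Hypothesis inner : forall (t t' : T) i (x : E -> R), linked t t' -> (forall e, `|x e| <= w e) ->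
 \sum_(g | (i <= idx g)%N) w g * `|\sum_(e | idx e == i) x e * j t t' e g| <= Phi i.

Let Im := (\max_e idx e).+1.

Lemma idx_lt e : (idx e < Im)%N.
by rewrite ltnS leq_bigmax. Qed.

(** Let U be the set of variables of index larger than i. With t' it is unlinked, so it has at most
    d - 1 elements, each of mass at most F. The other variables have index at most i, hence mass at
    most i + 1. The choice of U costs 2^|T|. *)
Lemma sum_others (t t' : T) i : t != t' ->
 \sum_(o : {ffun T -> E} | [&& o t == e0, o t' == e0 &
    unlinked (t' |: [set s | (s != t) && (s != t') && (i < idx (o s))%N])])
   \prod_(s | (s != t) && (s != t')) w (o s) <=
 2 ^+ #|T| * (F ^+ d.-1 * i.+1%:R ^+ #|T|).
move=> tt'.
pose G (U : {set T}) (s : T) (e : E) : R := if (s != t) && (s != t') then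
  (if s \in U then w e else if (idx e <= i)%N then w e else 0) else (if e == e0 then 1 else 0).
have G0 U s e : 0 <= G U s e by rewrite /G;do ![case: ifP => _//].
have F0 : 0 <= F by apply: le_trans F1.
via (\sum_(o : {ffun T -> E}) \sum_(U : {set T} | (t' \notin U) && unlinked (t' |: U)) \prod_s G U s (o s)).
 rewrite big_mkcond;lesum o;case: ifP => [/and3P[/eqP ot /eqP ot' hU]|_];last first.
  pos.
 set U := [set s | _] in hU;rewrite (bigD1 U)/=;last by rewrite hU andbT !inE eqxx andbF.
 rewrite ler_wpDr//;first pos.
 rewrite big_mkcond;apply: eqler;eqbig s.
 rewrite /G inE;case: ifP => h;last first.
  move/negbT: h;rewrite negb_and !negbK => /orP[/eqP ->|/eqP ->];by rewrite ?ot ?ot' eqxx.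
 by rewrite /=;case: ltnP => //.
rewrite exchange_big/=.
via (\sum_(U : {set T} | (t' \notin U) && unlinked (t' |: U)) (F ^+ d.-1 * i.+1%:R ^+ #|T|));last first.
 rewrite sumr_const -[_ *+ _]mulr_natl;apply: ler_wpM2r;first pos.
 rewrite -natrX ler_nat;letr (max_card _).
 by rewrite -cardsT -powersetT card_powerset cardsT.
apply: ler_sum => U /andP[tU hU].
rewrite -(bigA_distr_bigA (fun s e => G U s e)).
via (\prod_s (if s \in U then F else i.+1%:R)).
 apply: ler_prod => s _;rewrite sumr_ge0//= /G;case h : ((s != t) && (s != t')).
  case sU : (s \in U);first exact: hF.
  by rewrite -big_mkcond.
 rewrite -big_mkcond (big_pred1 e0)//;case: ifP => // _;by rewrite ler1n.
have e1 : \prod_s (if s \in U then F else i.+1%:R) = F ^+ #|U| * \prod_(s | s \notin U) i.+1%:R.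
 rewrite (bigID (fun s => s \in U))/=;congr (_ * _).
  by rewrite (eq_bigr (fun=> F)) => [|s ->]//;rewrite prodr_const.
 by apply: eq_bigr => s /negbTE ->.
rewrite e1;apply: ler_pM;rewrite ?exprn_ge0//.
- by apply: prodr_ge0.
- apply: ler_weXn2l => //;have := hd hU;rewrite cardsU1 tU;lia.
- rewrite prodr_const;apply: ler_weXn2l;rewrite ?ler1n//;exact: max_card.
Qed.

(* The sum is split according to the linked pair (t, t') with the largest smaller index i; all
   variables of index > i are then unlinked with each other and with t', and the bilinear bound
   Phi i is applied to the pair. *)
Lemma multi_bound : (0 < d)%N ->
 `|\sum_S val S| <= F ^+ d + \sum_(q : T * T) \sum_(i < Im) Phi i * (2 ^+ #|T| * (F ^+ d.-1 * i.+1%:R ^+ #|T|)).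
move=> d0.
have F0 : 0 <= F by apply: le_trans F1.
have pos : 0 <= \sum_(q : T * T) \sum_(i < Im) Phi i * (2 ^+ #|T| * (F ^+ d.-1 * i.+1%:R ^+ #|T|)) by pos.
case: (pickP (fun q : T * T => linked q.1 q.2)) => [[s s']/= l|nl];last first.
 via (F ^+ d);last lra.
 letr (ler_norm_sum _ _ _).
 via (\sum_(S : {ffun T -> E}) \prod_t w (S t));first by lesum S;apply: val_le.
 rewrite -(bigA_distr_bigA (fun _ e => w e)) prodr_const.
 via (F ^+ #|T|);first by apply: lerXn2r;rewrite ?nnegrE ?sumr_ge0.
 apply: ler_weXn2l => //;rewrite -cardsT;apply: hd.
 by apply/forall_inP => t _;apply/forall_inP => t' _;have/= -> := nl (t, t').
via (0 + \sum_(q : T * T) \sum_(i < Im) Phi i * (2 ^+ #|T| * (F ^+ d.-1 * i.+1%:R ^+ #|T|)));last first.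
 by rewrite lerD2r exprn_ge0.
rewrite add0r.
pose c (v : T -> nat) : option (T * T) := [pick q | canon v q].
have cP v : exists2 q, c v = Some q & canon v q.
 rewrite /c;case: pickP => [q hq|h0];first by exists q.
 by have [q] := canon_ex v l;rewrite h0.
pose iS (S : {ffun T -> E}) (t : T) := idx (S t).
have e1 : \sum_S val S = \sum_(q : T * T) \sum_(S | c (iS S) == Some q) val S.
 rewrite (exchange_big_dep predT)//=;eqbig S.
 have [q eq hq] := cP (iS S);rewrite (big_pred1 q)// => q'.
 by rewrite eq;apply/eqP/eqP => [[]|->].
rewrite e1;letr (ler_norm_sum _ _ _);apply: ler_sum => -[t t'] _.
case: (boolP (linked t t')) => lt;last first.
 rewrite big_pred0 ?normr0 => [|S].
  pos.
 have [q -> /and3P[hq _ _]] := cP (iS S);apply/eqP => -[e];move: hq;rewrite e/= => h.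
 lia.
have tt' : t != t' by apply/eqP => e;rewrite e lirr in lt.
rewrite big_mkcond/= (sum_upd2 _ tt').
pose vv (o : {ffun T -> E}) (i : nat) (g : E) : T -> nat := fun s => if s == t then i else if s == t' then idx g else idx (o s).
have hvv o e g : c (iS (upd2 o t t' e g)) = c (vv o (idx e) g).
 rewrite /c;apply: eq_pick => q;congr canon;apply/funext => s1.
 by rewrite /iS /vv ffunE;case: ifP => // _;case: ifP.
pose ok (o : {ffun T -> E}) (i : nat) := unlinked (t' |: [set s | (s != t) && (s != t') && (i < idx (o s))%N]).
have cond o i g : c (vv o i g) = Some (t, t') -> ok o i && (i <= idx g)%N.
 move=> e;have [q] := cP (vv o i g);rewrite e => -[<-] hc.
 have h1 : vv o i g t = i by rewrite /vv eqxx.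
 have h2 : vv o i g t' = idx g by rewrite /vv eq_sym (negbTE tt') eqxx.
 apply/andP;split;last by case/and3P: hc => _;rewrite h1 h2.
 apply: (canon_unlinked hc) => s1;rewrite inE => /andP[/andP[/negbTE st /negbTE st']].
 by rewrite h1 /vv st st'.
letr (ler_norm_sum _ _ _).
via (\sum_(o : {ffun T -> E} | (o t == e0) && (o t' == e0)) \sum_(i < Im)
  (if ok o i then \prod_(s | (s != t) && (s != t')) w (o s) * Phi i else 0)).
 lesum o.
 have [W [x [y [hW hx hy hv]]]] := val_split o lt.
 have e2 : \sum_g \sum_e (if c (iS (upd2 o t t' e g)) == Some (t, t') then val (upd2 o t t' e g) else 0) =
   \sum_(i < Im) \sum_g (if c (vv o i g) == Some (t, t') then W * y g * \sum_(e | idx e == i) x e * j t t' e g else 0).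
  rewrite [RHS]exchange_big/=;eqbig g.
  transitivity (\sum_(i < Im) \sum_(e | idx e == i) if c (vv o i g) == Some (t, t') then W * y g * (x e * j t t' e g) else 0).
   rewrite (exchange_big_dep predT)//=;eqbig e.
   rewrite (big_pred1 (Ordinal (idx_lt e)))/=;last first.
    by [].
   by rewrite hvv hv.
  eqbig i;case: ifP => _;last by rewrite big1.
  by rewrite mulr_sumr.
 rewrite e2;letr (ler_norm_sum _ _ _);lesum i.
 letr (ler_norm_sum _ _ _).
 have pr0 : 0 <= \prod_(s | (s != t) && (s != t')) w (o s) by pos.
 case: ifP => hok;last first.
  rewrite big1// => g _;case: eqP => [/cond|];last by rewrite normr0.
  by rewrite hok.
 apply: le_trans (ler_wpM2l pr0 (inner i lt hx)).
 rewrite mulr_sumr [leRHS]big_mkcond;lesum g.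
 case: eqP => [/cond/andP[_ ->]|_];last first.
  by rewrite normr0;case: ifP => // _;rewrite !mulr_ge0.
 by rewrite !normrM -mulrA;apply: ler_pM;rewrite ?mulr_ge0// ler_wpM2r.
rewrite exchange_big/=;lesum i.
rewrite -big_mkcondr/= -mulr_suml mulrC;apply: ler_wpM2l => //.
apply: le_trans (sum_others i tt');apply: eqler.
by apply: eq_bigl => o;rewrite andbA.
Qed.

End Multi.

(** * The indices: pairs of orthogonal vectors over the field with two elements *)

Section Types.
Variable m : nat.
Definition bvec := {ffun 'I_m -> bool}.
Definition dotb (u w : bvec) : bool := \big[addb/false]_i (u i && w i).
(** The label (u, w) that a prime receives when an m-th moment is expanded. The quadratic condition
    u . w = 0 comes from averaging over the signs, see [okp_sum]. *)
Definition ttype := {x : bvec * bvec | ~~ dotb x.1 x.2}.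
Definition tu (t : ttype) : bvec := (val t).1.
Definition tw (t : ttype) : bvec := (val t).2.
(** The symplectic pairing of the labels. It is nonzero exactly when one, and only one, of the two
    mutually reciprocal Jacobi symbols between the variables occurs. *)
Definition tlinked (t t' : ttype) : bool := dotb (tu t) (tw t') (+) dotb (tu t') (tw t).

Lemma tlinked_sym : symmetric tlinked.
by move=> t t';rewrite /tlinked addbC. Qed.

Lemma tlinked_irr : irreflexive tlinked.
by move=> t;rewrite /tlinked addbb. Qed.

Lemma dotb_tt t : dotb (tu t) (tw t) = false.
exact/negbTE/(valP t). Qed.

Variable R : realType.

Lemma sgn_addb (I : Type) (r : seq I) (P : pred I) (f : I -> bool) :
 (-1 : R) ^+ (\big[addb/false]_(i <- r | P i) f i) = \prod_(i <- r | P i) (-1) ^+ f i.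
by apply: (big_ind2 (fun a b => (-1 : R) ^+ nat_of_bool a = b)) => // a b c d <- <-;rewrite signr_addb.
Qed.

Lemma prod1D_bvec (y : 'I_m -> R) : \prod_j (1 + y j) = \sum_(w : bvec) \prod_j (if w j then y j else 1).
rewrite -(bigA_distr_bigA (fun j (b : bool) => if b then y j else 1));eqbig j.
by rewrite big_bool addrC.
Qed.

Lemma sum_sgn_dotb (u : bvec) : \sum_(w : bvec) (-1 : R) ^+ dotb u w = if u == [ffun=> false] then 2 ^+ m else 0.
transitivity (\prod_j (1 + (-1 : R) ^+ u j)).
 rewrite prod1D_bvec;eqbig w;rewrite sgn_addb;eqbig j.
 by case: (w j);rewrite ?andbT ?andbF.
case: eqP => [->|/eqP h].
 by under eq_bigr => j _ do rewrite ffunE expr0 (_ : 1 + 1 = 2)//;rewrite prodr_const card_ord.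
have [j hj] : exists j, u j.
 apply/existsP;apply: contraNT h;rewrite negb_exists => /forallP h;apply/eqP/ffunP => j.
 by rewrite ffunE;apply/negbTE.
by rewrite (bigD1 j)//= hj expr1 subrr mul0r.
Qed.

Lemma dotbC (u w : bvec) : dotb u w = dotb w u.
by eqbig i;rewrite andbC. Qed.

Lemma dotbDl (u u' w : bvec) : dotb [ffun i => u i (+) u' i] w = dotb u w (+) dotb u' w.
rewrite /dotb -big_split/=;eqbig i;rewrite ffunE.
lia.
Qed.

(* The vectors (sum of the signs of the pairing with the elements of U) have square norm 4^m |U|,
   and the value at each of the |U| elements of U is |U|. *)
Lemma unlinked_card (U : {set ttype}) : unlinked tlinked U -> (#|U| <= 2 ^ m)%N.
move=> hU.
pose B (t : ttype) (z : bvec * bvec) := dotb (tu t) z.2 (+) dotb z.1 (tw t).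
pose g (z : bvec * bvec) : R := \sum_(t in U) (-1) ^+ B t z.
have orth t t' : \sum_(z : bvec * bvec) (-1 : R) ^+ B t z * (-1) ^+ B t' z = if t == t' then 4 ^+ m else 0.
 transitivity ((\sum_(w : bvec) (-1 : R) ^+ dotb [ffun i => tu t i (+) tu t' i] w) *
   (\sum_(u : bvec) (-1 : R) ^+ dotb [ffun i => tw t i (+) tw t' i] u)).
  rewrite big_distrlr/= pair_big/= (reindex_onto (fun z : bvec * bvec => (z.2, z.1)) (fun z => (z.2, z.1)))/=;last by case.
  apply: eq_big => [[a b]|[a b] _]/=;first by rewrite eqxx.
  rewrite /B/= !dotbDl !signr_addb ![dotb b _]dotbC;ring.
 have h0 (a b : bvec) : ([ffun i => a i (+) b i] == [ffun=> false] :> bvec) = (a == b).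
  apply/eqP/eqP => [/ffunP h|->];apply/ffunP => i;last by rewrite !ffunE addbb.
  by have := h i;rewrite !ffunE;case: (a i);case: (b i).
 rewrite !sum_sgn_dotb !h0 (_ : (t == t') = (tu t == tu t') && (tw t == tw t'));last first.
  by [].
 case: eqP => _;rewrite ?mul0r//;case: eqP => _;rewrite ?mulr0//.
 by rewrite -exprMn;congr (_ ^+ _);ring.
have e1 : \sum_z g z ^+ 2 = 4 ^+ m * #|U|%:R.
 transitivity (\sum_(t in U) \sum_(t' in U) \sum_(z : bvec * bvec) (-1 : R) ^+ B t z * (-1) ^+ B t' z).
  transitivity (\sum_z \sum_(t in U) \sum_(t' in U) (-1 : R) ^+ B t z * (-1) ^+ B t' z).
   by eqbig z;rewrite expr2 mulr_suml;eqbig t;rewrite mulr_sumr.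
  by rewrite exchange_big;eqbig t;rewrite exchange_big.
 transitivity (\sum_(t in U) (4 : R) ^+ m);last by rewrite sumr_const mulr_natr.
 apply: eq_bigr => t tU;rewrite (bigD1 t)//= orth eqxx big1 ?addr0// => t' /andP[_ /negbTE h].
 by rewrite orth eq_sym h.
have e2 t : t \in U -> g (val t) = #|U|%:R.
 move=> tU;rewrite /g (eq_bigr (fun=> 1)) ?sumr_const// => t' t'U.
 have := forall_inP (forall_inP hU t' t'U) t tU.
 by rewrite /tlinked /B -/(tu t) -/(tw t) => /negbTE ->.
have h3 : #|U|%:R * #|U|%:R ^+ 2 <= 4 ^+ m * #|U|%:R :> R.
 rewrite -e1;via (\sum_(t in U) g (val t) ^+ 2).
  by rewrite (eq_bigr (fun=> #|U|%:R ^+ 2)) => [|t /e2 -> //];rewrite sumr_const mulr_natl.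
 by apply: (ler_sum_inj (h := fun t : ttype => val t)) => // [t t' _ _|z _];[exact: val_inj|exact: sqr_ge0].
case: (posnP #|U|) => [->//|U0];rewrite -(ler_nat R) natrX.
have U0' : 0 < #|U|%:R :> R by pos.
rewrite -(ler_pXn2r (n := 2)) ?nnegrE ?exprn_ge0//.
have -> : (2 ^+ m) ^+ 2 = 4 ^+ m :> R by rewrite -exprM mulnC exprM;congr (_ ^+ _);ring.
by rewrite -(ler_pM2l U0') [leRHS]mulrC.
Qed.

End Types.

(** * Moments of the kernel of a matrix of Legendre symbols *)

Section Kernel.
Variable z : nat.
Let I := 'I_z.+1.

Definition odd_primes (A : {set I}) : bool := [forall (p | p \in A), prime p && odd p].

(** Redei's conditions for the factorisation of pr A into pr e and its cofactor. The sign at p,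
    given by s, stands for the symbol at p of minus the part of the discriminant outside A, see
    [sset]. *)
Definition condK (A s e : {set I}) : bool :=
 [forall (p | p \in A), if p \in e then (-1) ^+ (p \in s) * \prod_(q in A :\: e) leg p q%:Z == 1
   else \prod_(q in e) leg p q%:Z == 1].

Definition Kc (A s : {set I}) : nat := #|[set e : {set I} | (e \subset A) && condK A s e]|.

Variables (R : realType) (m : nat).
Notation T := (ttype m).
Let kap : R := 2 / 2 ^+ m.

Definition lR (p q : I) : R := (leg p (q : nat))%:~R.

Lemma lR_sqr (A : {set I}) p q : odd_primes A -> p \in A -> q \in A -> q != p -> lR p q ^+ 2 = 1.
move=> hA pA qA qp;have /andP[pp po] := forall_inP hA p pA;have /andP[qpr _] := forall_inP hA q qA.
rewrite /lR expr2 -intrM leg_sq1// dvdzE/= dvdn_prime2// eq_sym.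
by [].
Qed.

Lemma sgn_eq1 (x : int) : x ^+ 2 = 1 -> ((x == 1)%:R : R) = (1 + x%:~R) / 2.
move/eqP;rewrite sqrf_eq1 => /orP[] /eqP ->;first by rewrite eqxx/=;field.
by rewrite subrr mul0r.
Qed.

Lemma natr_forall (K : finType) (P : pred K) (b : K -> bool) :
 \prod_(p | P p) ((b p)%:R : R) = ([forall (p | P p), b p])%:R.
case: (boolP [forall (p | P p), b p]) => [/forall_inP h|].
 by rewrite big1// => p /h ->.
rewrite negb_forall_in => /exists_inP[p Pp /negbTE h].
by rewrite (bigD1 p)//= h mul0r.
Qed.

Lemma sg_addb (K : Type) (r : seq K) (f : K -> bool) (x : R) : x ^+ 2 = 1 ->
 x ^+ (\big[addb/false]_(i <- r) f i) = \prod_(i <- r) x ^+ f i.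
move=> x2;apply: (big_ind2 (fun a b => x ^+ nat_of_bool a = b)) => // a b c d <- <-.
by case: a c => -[]/=;rewrite ?mulr1 ?mul1r//.
Qed.

Lemma prod_sqr1 (K : comNzRingType) (L : finType) (P : pred L) (f : L -> K) :
 (forall i, P i -> f i ^+ 2 = 1) -> (\prod_(i | P i) f i) ^+ 2 = 1.
by move=> h;rewrite -prodrXl big1. Qed.

Section Local.
Variables (A : {set I}) (u : {ffun I -> bvec m}) (p : I).
Hypotheses (hA : odd_primes A) (pA : p \in A).

(** The conditions at p for m subsets at once, as a function of the bit b telling whether p belongs
    to s. *)
Definition okp (b : bool) : bool := [forall j,
 if u p j then (-1) ^+ b * \prod_(q in A | ~~ u q j) leg p q%:Z == 1 else \prod_(q in A | u q j) leg p q%:Z == 1].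

Lemma leg2 q : q \in A -> q != p -> leg p (q : nat)%:Z ^+ 2 = 1.
by move=> qA qp;apply: (@intr_inj R);rewrite rmorphXn;exact: lR_sqr hA pA qA qp. Qed.

Lemma okpE b : ((okp b)%:R : R) = \prod_(j < m) ((1 + (\prod_(q in A | (q != p) && u q j) lR p q) *
  ((-1) ^+ b * \prod_(q in A | q != p) lR p q) ^+ u p j) / 2).
rewrite /okp -(natr_forall predT);eqbig j.
have x2 : (\prod_(q in A | (q != p) && u q j) leg p (q : nat)%:Z) ^+ 2 = 1 by apply: prod_sqr1 => q /and3P[qA qp _];apply: leg2.
case: ifP => upj.
 have e : (-1) ^+ b * \prod_(q in A | ~~ u q j) leg p (q : nat)%:Z =
  (\prod_(q in A | (q != p) && u q j) leg p (q : nat)%:Z) * ((-1) ^+ b * \prod_(q in A | q != p) leg p (q : nat)%:Z).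
  rewrite mulrCA;congr (_ * _).
  have -> : \prod_(q in A | q != p) leg p (q : nat)%:Z =
   (\prod_(q in A | (q != p) && u q j) leg p (q : nat)%:Z) * \prod_(q in A | ~~ u q j) leg p (q : nat)%:Z.
   rewrite (bigID (fun q => u q j))/=;congr (_ * _);apply: eq_bigl => q;rewrite -!andbA//.
   by case: eqP => [->|];rewrite ?upj//.
  by rewrite mulrA -expr2 x2 mul1r.
 rewrite e sgn_eq1;last first.
  rewrite !exprMn x2 mul1r -exprM mulnC exprM sqrrN !expr1n mul1r.
  by apply: prod_sqr1 => q /andP[qA qp];apply: leg2.
 by rewrite !rmorphM !rmorph_prod rmorphXn.
have e : \prod_(q in A | u q j) leg p (q : nat)%:Z = \prod_(q in A | (q != p) && u q j) leg p (q : nat)%:Z by apply: eq_bigl => q;case: eqP => [->|];rewrite ?upj.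
by rewrite e sgn_eq1// mulr1 rmorph_prod.
Qed.

(** The indicator of x = 1 for a sign x is (1 + x)/2. The product of the m factors expands into a
    sum over w, where the bit occurs as (-1)^(b u_p . w); adding both values of b kills the w with
    u_p . w = 1 and doubles the others. *)
Lemma okp_sum : ((okp true)%:R + (okp false)%:R : R) =
 kap * \sum_(w : bvec m | ~~ dotb (u p) w) \prod_(q in A | q != p) lR p q ^+ dotb (u q) w.
pose Y : R := \prod_(q in A | q != p) lR p q.
have Y2 : Y ^+ 2 = 1 by apply: prod_sqr1 => q /andP[qA qp];apply: lR_sqr hA pA qA qp.
have h b : ((okp b)%:R : R) = (2 ^+ m)^-1 * \sum_(w : bvec m) ((-1) ^+ b * Y) ^+ dotb (u p) w *
  \prod_(q in A | q != p) lR p q ^+ dotb (u q) w.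
 rewrite okpE big_split/= prodr_const card_ord -exprVn mulrC;congr (_ * _).
 rewrite prod1D_bvec;eqbig w.
 have s2 : ((-1) ^+ b * Y) ^+ 2 = 1 by rewrite exprMn Y2 mulr1 -exprM mulnC exprM sqrrN !expr1n.
 transitivity (\prod_(j < m) ((\prod_(q in A | q != p) lR p q ^+ (u q j && w j)) * ((-1) ^+ b * Y) ^+ (u p j && w j))).
  eqbig j;case: (w j);last by rewrite andbF expr0 mulr1 big1// => q _;rewrite andbF.
  rewrite andbT.
  congr (_ * _);rewrite [RHS](bigID (fun q => u q j))/= [X in _ = _ * X]big1 ?mulr1;last first.
   by move=> q /andP[_ /negbTE ->].
  by apply: eq_big => [q|q /and3P[_ _ ->]];rewrite ?andbA.
 rewrite big_split/= mulrC sg_addb//;congr (_ * _).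
 rewrite exchange_big;apply: eq_bigr => q /andP[qA qp];rewrite sg_addb//;exact: lR_sqr hA pA qA qp.
rewrite !h -mulrDr -big_split/= [in RHS]big_mkcond /kap mulrC mulr_suml [RHS]mulr_sumr;eqbig w.
set Q := \prod_(q in A | _) _;set v := (2 ^+ m)^-1.
by case: (dotb (u p) w);rewrite /=;ring.
Qed.

End Local.

(* The m-tuple (e_j) of subsets of A is encoded by u : p |-> (p \in e_j)_j. *)
Lemma moment_expand (A : {set I}) : odd_primes A ->
 \sum_(s : {set I} | s \subset A) ((Kc A s)%:R : R) ^+ m =
 \sum_(u : {ffun I -> bvec m} | [forall p, (p \notin A) ==> (u p == [ffun=> false])])
  \prod_(p in A) (kap * \sum_(w : bvec m | ~~ dotb (u p) w) \prod_(q in A | q != p) lR p q ^+ dotb (u q) w).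
move=> hA.
have e1 (s : {set I}) : ((Kc A s)%:R : R) ^+ m =
  \sum_(u : {ffun I -> bvec m} | [forall p, (p \notin A) ==> (u p == [ffun=> false])])
   \prod_(p in A) (okp A u p (p \in s))%:R.
 have -> : ((Kc A s)%:R : R) ^+ m = \sum_(f : {ffun 'I_m -> {set I}} | [forall j, (f j \subset A) && condK A s (f j)]) 1.
  rewrite sumr_const -natrX /Kc -(card_ord m) -card_ffun_on card_ord;congr (_%:R).
  apply: eq_card => f;rewrite !inE;apply/ffun_onP/forallP => h j;have := h j;by rewrite inE.
 pose F (u : {ffun I -> bvec m}) : {ffun 'I_m -> {set I}} := [ffun j => [set p | u p j]].
 pose G (f : {ffun 'I_m -> {set I}}) : {ffun I -> bvec m} := [ffun p => [ffun j => p \in f j]].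
 have FG f : F (G f) = f by apply/ffunP => j;rewrite ffunE;apply/setP => p;rewrite inE !ffunE.
 have GF u : G (F u) = u by apply/ffunP => p;apply/ffunP => j;rewrite !ffunE inE.
 rewrite (reindex_onto F G)/= => [|f _];last exact: FG.
 rewrite big_mkcond [RHS]big_mkcond;eqbig u;rewrite GF eqxx andbT.
 have Fin j p : (p \in F u j) = u p j by rewrite ffunE inE.
 have esub : [forall j, F u j \subset A] = [forall p, (p \notin A) ==> (u p == [ffun=> false])].
  apply/forallP/forallP => [h p|h j].
   apply/implyP => pA;apply/eqP/ffunP => j;rewrite ffunE;apply/negbTE.
   by apply: contra pA => uj;apply: (fintype.subsetP (h j));rewrite ffunE inE.
  apply/fintype.subsetP => p;rewrite ffunE inE => uj;apply/negPn/negP => pA.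
  by have := implyP (h p) pA => /eqP e;move: uj;rewrite e ffunE.
 have -> : [forall j, (F u j \subset A) && condK A s (F u j)] = [forall j, F u j \subset A] && [forall j, condK A s (F u j)].
  apply/forallP/andP => [h|[/forallP h1 /forallP h2] j];last by rewrite h1 h2.
  by split;apply/forallP => j;have /andP[] := h j.
 rewrite -esub;case: (boolP [forall j, F u j \subset A]) => //= /forallP hs.
 rewrite natr_forall.
 suff -> : [forall j, condK A s (F u j)] = [forall (p | p \in A), okp A u p (p \in s)] by case: ifP.
 have e2 j p : (if p \in F u j then (-1) ^+ (p \in s) * \prod_(q in A :\: F u j) leg p (q : nat)%:Z == 1
   else \prod_(q in F u j) leg p (q : nat)%:Z == 1) =
   (if u p j then (-1) ^+ (p \in s) * \prod_(q in A | ~~ u q j) leg p (q : nat)%:Z == 1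
    else \prod_(q in A | u q j) leg p (q : nat)%:Z == 1).
  rewrite Fin;case: ifP => _;congr (_ == _).
   by congr (_ * _);apply: eq_bigl => q;rewrite finset.in_setD Fin andbC.
  apply: eq_bigl => q;rewrite Fin;case uq : (u q j);rewrite ?andbF// andbT.
  by symmetry;apply: (fintype.subsetP (hs j));rewrite Fin.
 apply/forallP/forall_inP => [h p pA|h j].
  by apply/forallP => j;have /forall_inP/(_ p pA) := h j;rewrite e2.
 by apply/forall_inP => p pA;have /forallP/(_ j) := h p pA;rewrite e2.
under eq_bigr => s _ do rewrite e1.
rewrite exchange_big/=;eqbig u.
transitivity (\prod_(p in A) ((okp A u p true)%:R + (okp A u p false)%:R : R));last first.
 by apply: eq_bigr => p pA;exact: okp_sum.
rewrite [RHS]big_mkcond.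
transitivity (\prod_p ((if p \in A then (okp A u p true)%:R else 0) + (if p \in A then (okp A u p false)%:R else 1) : R));last first.
 by eqbig p;case: ifP => _;rewrite ?add0r.
rewrite bigA_distr/= big_mkcond;eqbig s.
case: (boolP (s \subset A)) => [sA|/subsetPn[p ps pA]];last by rewrite (bigD1 p)//= ps (negbTE pA) mul0r.
rewrite big_mkcond;eqbig p;case: ifP => [pA|/negbT pA];first by case: (p \in s).
by rewrite (negbTE (contra (fintype.subsetP sA p) pA)).
Qed.
End Kernel.

Lemma prod_pair_split (K : comNzRingType) (T : finType) (t t' : T) (H : T -> T -> K) : t != t' ->
 (forall s, H s s = 1) ->
 \prod_s \prod_s' H s s' = (\prod_(s | (s != t) && (s != t')) \prod_(s' | (s' != t) && (s' != t')) H s s') *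
  (\prod_(s | (s != t) && (s != t')) (H t s * H s t)) * (\prod_(s | (s != t) && (s != t')) (H t' s * H s t')) *
  (H t t' * H t' t).
move=> tt' h1;have t't : t' != t by rewrite eq_sym.
have d2 (F : T -> K) : \prod_s F s = F t * (F t' * \prod_(s | (s != t) && (s != t')) F s) by rewrite (bigD1 t)//= (bigD1 t').
rewrite (eq_bigr _ (fun s _ => d2 (H s))) d2 !h1 !big_split/=;ring.
Qed.

Lemma prod_some (K : comNzRingType) (X T : finType) (o : X -> option T) (F : X -> K) :
 \prod_(p | o p) F p = \prod_t \prod_(p | o p == Some t) F p.
rewrite (exchange_big_dep (fun p => isSome (o p)))/=;last by move=> t p _ /eqP ->.
by apply: eq_bigr => p;case: (o p) => // t _;rewrite (big_pred1 t)// => t';rewrite eq_sym;apply/eqP/eqP => [[]|->].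
Qed.

(** * The moment as a sum over disjoint squarefree variables *)

Section Moment.
Variables (z : nat) (R : realType) (m : nat).
Let I := 'I_z.+1.
Notation T := (ttype m).
Notation kap := (2 / 2 ^+ m : R).

Lemma odd_primes_all (A : {set I}) : odd_primes A -> all_prime A.
by move/forall_inP => h;apply/all_primeP => p /h /andP[]. Qed.

Lemma J_pr (A B : {set I}) : odd_primes A -> jacR R (pr B) (pr A) = \prod_(p in A) \prod_(q in B) lR R p q.
move=> hA;rewrite /jacR.
have -> : jac (pr B) (pr A) = \prod_(p in A) leg p (pr B).
 suff [] : (0 < pr A)%N /\ jac (pr B) (pr A) = \prod_(p in A) leg p (pr B) by [].
 apply: (big_ind2 (fun a b => (0 < a)%N /\ jac (pr B) a = b)) => [|a b c d [a0 <-] [c0 <-]|p pA].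
 - by rewrite jac1.
 - by rewrite muln_gt0 a0 c0 jacMr.
 - by have /andP[pp _] := forall_inP hA p pA;rewrite jac_prime ?prime_gt0.
rewrite rmorph_prod;apply: eq_bigr => p /(forall_inP hA)/andP[pp po].
rewrite /lR -rmorph_prod/=;congr (_%:~R).
apply: (big_ind2 (fun a b => leg p (a : nat)%:Z = b)) => [|a b c d <- <-|//];first by rewrite leg1.
by rewrite PoszM legM.
Qed.

Definition pairx (o o' : option T) : bool := if (o, o') is (Some t, Some t') then dotb (tu t) (tw t') else false.

(** The product over p of the sums over w_p is expanded: every prime of A receives a label (u_p,
    w_p), and the primes outside A receive [None]. *)
Lemma moment_sigma (A : {set I}) : odd_primes A ->
 \sum_(s : {set I} | s \subset A) ((Kc A s)%:R : R) ^+ m =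
 \sum_(o : {ffun I -> option T} | [set p | isSome (o p)] == A)
  \prod_(p in A) (kap * \prod_(q in A | q != p) lR R p q ^+ pairx (o q) (o p)).
move=> hA;rewrite moment_expand//.
pose z0 : bvec m := [ffun=> false].
pose Q (u : {ffun I -> bvec m}) (p : I) (w : bvec m) := if p \in A then ~~ dotb (u p) w else w == z0.
pose G (u : {ffun I -> bvec m}) (p : I) (w : bvec m) : R :=
 if p \in A then kap * \prod_(q in A | q != p) lR R p q ^+ dotb (u q) w else 1.
transitivity (\sum_(u : {ffun I -> bvec m} | [forall p, (p \notin A) ==> (u p == z0)])
  \sum_(w : {ffun I -> bvec m} | w \in family (Q u)) \prod_p G u p (w p)).
 eqbig u;rewrite -(bigA_distr_big_dep _ (G u)) big_mkcond;eqbig p.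
 rewrite /G /Q;case: ifP => pA;last by rewrite (big_pred1 z0).
 by rewrite mulr_sumr.
rewrite pair_big_dep/=.
pose ou (o : option T) : bvec m := if o is Some t then tu t else z0.
pose ow (o : option T) : bvec m := if o is Some t then tw t else z0.
pose h (o : {ffun I -> option T}) : {ffun I -> bvec m} * {ffun I -> bvec m} := ([ffun p => ou (o p)], [ffun p => ow (o p)]).
pose h' (x : {ffun I -> bvec m} * {ffun I -> bvec m}) : {ffun I -> option T} :=
 [ffun p => if p \in A then (insub (x.1 p, x.2 p) : option T) else None].
have dz w : dotb z0 w = false by rewrite /dotb big1// => i _;rewrite ffunE.
rewrite (reindex_onto h h')/=;last first.
 move=> [u w]/= /andP[/forallP h1 /familyP h2];rewrite /h /h';congr pair;apply/ffunP => p;rewrite !ffunE/=.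
  have : Q u p (w p) := h2 p;rewrite /Q;case: ifP => pA hq;first by rewrite insubT.
  by have := h1 p;rewrite pA => /eqP ->.
 have : Q u p (w p) := h2 p;rewrite /Q;case: ifP => pA hq;first by rewrite insubT.
 by rewrite (eqP hq).
have key o : [&& [forall p, (p \notin A) ==> ((h o).1 p == z0)], (h o).2 \in family (Q (h o).1) & h' (h o) == o] =
  ([set p | isSome (o p)] == A).
 apply/and3P/eqP => [[_ _ /eqP/ffunP e]|e].
  apply/setP => p;rewrite inE;have := e p;rewrite ffunE/=;case: ifP => pA <- //.
  rewrite !ffunE;case: (o p) => [t|]/=;first by case: insubP => // ;rewrite -/(tu t) (valP t).
  by rewrite insubT// dz.
 have e' p : isSome (o p) = (p \in A) by rewrite -e inE.
 split.
 - apply/forallP => p;apply/implyP;rewrite -e' ffunE;by case: (o p).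
 - apply/familyP => p;change (is_true (Q (h o).1 p ((h o).2 p)));rewrite /Q -e' !ffunE;case: (o p) => [t|]//=;exact: (valP t).
 - apply/eqP/ffunP => p;rewrite /h' !ffunE -e';case: (o p) => [t|]//=.
  by rewrite (_ : (tu t, tw t) = val t) ?valK;rewrite /tu /tw;case: (val t).
apply: eq_big => [o|o];first by rewrite -andbA key.
rewrite -andbA key => /eqP e.
have e' p : isSome (o p) = (p \in A) by rewrite -e inE.
rewrite [RHS]big_mkcond;eqbig p;rewrite /G;case: ifP => pA//.
congr (_ * _);apply: eq_bigr => q /andP[qA _];rewrite !ffunE /pairx.
by have := e' p;have := e' q;rewrite pA qA;case: (o p) => // t;case: (o q).
Qed.

Definition wE (A : {set I}) : R := if all_prime A then wtS kap A else 0.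

(** The interaction of two variables. The indicator of disjointness is inserted so that the
    variables can be treated as independent. *)
Definition ff (s s' : T) (a b : {set I}) : R :=
 if s == s' then 1 else [disjoint a & b]%:R * jacR R (pr b) (pr a) ^+ dotb (tu s') (tw s).

Definition valS (S : {ffun T -> {set I}}) : R :=
 (\prod_t wE (S t)) * \prod_t \prod_t' ff t t' (S t) (S t').

Definition disjS (S : {ffun T -> {set I}}) : bool := [forall t, forall t', (t != t') ==> [disjoint S t & S t']].

(** The primes are grouped by label: S t is the set of primes labelled t, and the Legendre symbols
    between two groups combine into one Jacobi symbol. Families of sets that are not disjoint
    contribute 0. *)
Lemma moment_valS :
 \sum_(A : {set I} | odd_primes A) (\prod_(p in A) (p%:R^-1 * expR (- (ln p%:R / ln z%:R)))) *
  \sum_(s : {set I} | s \subset A) ((Kc A s)%:R : R) ^+ m = \sum_S valS S.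
transitivity (\sum_(o : {ffun I -> option T} | odd_primes [set p | isSome (o p)])
  \prod_(p | o p) (wt z kap p * \prod_(q | o q && (q != p)) lR R p q ^+ pairx (o q) (o p))).
 rewrite (partition_big (fun o : {ffun I -> option T} => [set p | isSome (o p)]) (@odd_primes z))//=.
 apply: eq_bigr => A hA;rewrite moment_sigma// mulr_sumr;apply: eq_big => [o|o /eqP e].
  by case: eqP => [->|];rewrite ?hA ?andbF.
 rewrite -big_split/= [RHS](eq_bigl (fun p => p \in A)) => [|p];last by rewrite -e inE.
 apply: eq_bigr => p pA;rewrite /wt;have /andP[_ ->] := forall_inP hA p pA.
 rewrite mulrCA !mulrA;congr (_ * _);apply: eq_bigl => q;by rewrite -e inE.
pose h (S : {ffun T -> {set I}}) : {ffun I -> option T} := [ffun p => [pick t | p \in S t]].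
pose h' (o : {ffun I -> option T}) : {ffun T -> {set I}} := [ffun t => [set p | o p == Some t]].
have hh' o : h (h' o) = o.
 apply/ffunP => p;rewrite ffunE;case: pickP => [t|n];first by rewrite ffunE inE => /eqP ->.
 by case e: (o p) => [t|]//;have := n t;rewrite ffunE inE e eqxx.
rewrite (reindex_onto h h')/= => [|o _];last exact: hh'.
rewrite big_mkcond;eqbig S.
have [d|nd] := boolP (disjS S);last first.
 have [t [t' [tt' h1]]] : exists t t', t != t' /\ ~~ [disjoint S t & S t'].
  move: nd;rewrite negb_forall => /existsP[t];rewrite negb_forall => /existsP[t'].
  by rewrite negb_imply => /andP[];exists t, t'.
 have -> : valS S = 0.
  rewrite /valS;have -> : \prod_t0 \prod_t' ff t0 t' (S t0) (S t') = 0;last lra.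
  apply/eqP/prodf_eq0;exists t => //;apply/prodf_eq0;exists t' => //.
  by rewrite /ff (negbTE tt') (negbTE h1) mul0r.
 case: ifP => // /andP[_ /eqP/ffunP e];exfalso;move/negP: h1;apply.
 rewrite -!e !ffunE -setI_eq0;apply/eqP/setP => p;rewrite !inE.
 by case: eqP => // ->;apply/negbTE;apply: contra tt' => /eqP[->].
have e1 p t : p \in S t -> h S p = Some t.
 move=> pt;rewrite ffunE;case: pickP => [t' pt'|/(_ t)];last by rewrite pt.
 congr Some;apply/eqP;apply: contraT => tt';have /forallP/(_ t')/forallP/(_ t) := d.
 by rewrite tt' => /pred0P/(_ p)/=;rewrite pt pt'.
have e2 t : [set p | h S p == Some t] = S t.
 apply/setP => p;rewrite inE;apply/eqP/idP => [|/e1//].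
 by rewrite ffunE;case: pickP => // t' pt' [<-].
have e3 p t : (h S p == Some t) = (p \in S t) by move/setP/(_ p): (e2 t);rewrite inE.
have -> : h' (h S) == S by apply/eqP/ffunP => t;rewrite ffunE e2.
rewrite andbT.
have odE : odd_primes [set p | isSome (h S p)] = [forall t, odd_primes (S t)].
 apply/forall_inP/forallP => [H t|H p].
  by apply/forall_inP => p pt;apply: H;rewrite inE (e1 _ _ pt).
 by rewrite inE ffunE;case: pickP => // t pt _;exact: (forall_inP (H t)).
rewrite odE;case: ifP => [/forallP H|/negbT];last first.
 rewrite negb_forall => /existsP[t ht];rewrite /valS (bigD1 t)//= {1}/wE;case: ifP;rewrite ?mul0r// => ap.
 move: ht;rewrite negb_forall => /existsP[p];rewrite negb_imply => /andP[pt].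
 rewrite (all_primeP _ ap)//= => po;rewrite /wtS (bigD1 p)//= /wt (negbTE po) !mul0r//.
rewrite prod_some /valS.
transitivity (\prod_t ((\prod_(p in S t) wt z kap p) * \prod_(p in S t) \prod_t' (if t == t' then 1 else
  \prod_(q in S t') lR R p q ^+ dotb (tu t') (tw t)))).
 eqbig t;rewrite [LHS](eq_bigl (fun p => p \in S t)) => [|p];last by [].
 rewrite big_split/=;congr (_ * _);apply: eq_bigr => p pt;rewrite big_mkcondr/= prod_some;apply: eq_bigr => t' _.
 rewrite [LHS](eq_bigl (fun q => q \in S t')) => [|q];last by [].
 case: eqP => [<-|/eqP tt'].
  by apply: big1 => q qt;case: ifP => // _;rewrite /pairx (e1 _ _ pt) (e1 _ _ qt) dotb_tt.
 apply: eq_bigr => q qt;rewrite /pairx (e1 _ _ pt) (e1 _ _ qt);case: eqP => // qp;exfalso.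
 by have := e1 _ _ pt;rewrite -qp (e1 _ _ qt) => -[e];rewrite e eqxx in tt'.
rewrite big_split/=;congr (_ * _).
 by eqbig t;rewrite /wE odd_primes_all.
apply: eq_bigr => t _;rewrite exchange_big/=;apply: eq_bigr => t' _;rewrite /ff.
case: eqP => [_|/eqP tt'];first by rewrite big1.
have /forallP/(_ t)/forallP/(_ t') := d;rewrite tt'/= => ->;rewrite mul1r J_pr// -prodrXl.
by eqbig p;rewrite prodrXl.
Qed.

End Moment.

(** * Separation of a linked pair of variables *)

Section Bound.
Variables (z : nat) (R : realType) (m : nat).
Hypotheses (m0 : (0 < m)%N) (z2 : (1 < z)%N).
Let I := 'I_z.+1.
Notation T := (ttype m).
Notation kap := (2 / 2 ^+ m : R).
Notation wk := (@wE z R m).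
Notation fk := (@ff z R m).
Notation vk := (@valS z R m).

Lemma kap_gt0 : 0 < kap.
pos. Qed.

Lemma kap_le1 : kap <= 1.
rewrite ler_pdivrMr ?exprn_gt0// mul1r -(prednK m0) exprS ler_peMr//.
by apply: exprn_ege1;lra.
Qed.

Lemma wE_ge0 A : 0 <= wk A.
by rewrite /wE;case: ifP => // _;apply: wtS_ge0;exact: kap_gt0. Qed.

Lemma wE_le A : wk A <= wtS kap A.
by rewrite /wE;case: ifP => // _;apply: wtS_ge0;exact: kap_gt0. Qed.

Lemma J_le1' a n : `|jacR R a n| <= 1.
case: (posnP n) => [->|/J_le1//];by rewrite /jacR /jac big_nil normr1.
Qed.

Lemma ff_le1 s s' a b : `|fk s s' a b| <= 1.
rewrite /ff;case: ifP => _;first by rewrite normr1.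
rewrite normrM normrX;case: ([disjoint _ & _]);rewrite ?normr0 ?mul0r// normr1 mul1r.
by apply: exprn_ile1 => //;exact: J_le1'.
Qed.

Lemma prod_le1 (X : Type) (r : seq X) (P : pred X) (f : X -> R) : (forall i, `|f i| <= 1) -> `|\prod_(i <- r | P i) f i| <= 1.
move=> h;rewrite normr_prod;apply: prodr_ile1 => i _;rewrite normr_ge0/=;exact: h.
Qed.

Lemma valS_le S : `|vk S| <= \prod_t wk (S t).
rewrite /valS normrM -[leRHS]mulr1;apply: ler_pM;rewrite //.
 by rewrite normr_prod;apply: eqler;eqbig t;rewrite ger0_norm ?wE_ge0.
by apply: prod_le1 => t;apply: prod_le1 => t';exact: ff_le1.
Qed.

(** The only symbol that couples the linked variables t and t'; its direction depends on which of
    the two pairings is 1. *)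
Definition jj (t t' : T) (e g : {set I}) : R := if dotb (tu t) (tw t') then jacR R (pr e) (pr g) else jacR R (pr g) (pr e).

Lemma J_ndisj (A B : {set I}) : all_prime A -> all_prime B -> ~~ [disjoint A & B] -> jacR R (pr A) (pr B) = 0.
move=> hA hB;rewrite -setI_eq0 => /set0Pn[p];rewrite inE => /andP[pA pB].
have pp := all_primeP _ hA p pA.
apply/eqP;rewrite /jacR intr_eq0 jac_coprime ?pr_gt0//;apply/negP => c.
have : (p %| gcdn (pr A) (pr B))%N by rewrite dvdn_gcd !prime_dvd_pr// pA pB.
by rewrite (eqP c) dvdn1 => /eqP e;rewrite e in pp.
Qed.

Lemma val_split (t t' : T) (o : {ffun T -> {set I}}) : tlinked t t' ->
 exists (W : R) (x y : {set I} -> R), [/\ `|W| <= \prod_(s | (s != t) && (s != t')) wk (o s),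
  (forall e, `|x e| <= wk e), (forall g, `|y g| <= wk g) &
  forall e g, vk (upd2 o t t' e g) = W * y g * (x e * jj t t' e g)].
move=> l;have tt' : t != t' by apply/eqP => e;rewrite e tlinked_irr in l.
have t't : (t' == t) = false by rewrite eq_sym (negbTE tt').
exists ((\prod_(s | (s != t) && (s != t')) wk (o s)) *
 \prod_(s | (s != t) && (s != t')) \prod_(s' | (s' != t) && (s' != t')) fk s s' (o s) (o s')).
exists (fun e => wk e * \prod_(s | (s != t) && (s != t')) (fk t s e (o s) * fk s t (o s) e)).
exists (fun g => wk g * \prod_(s | (s != t) && (s != t')) (fk t' s g (o s) * fk s t' (o s) g)).
have nn (w P : R) : 0 <= w -> `|P| <= 1 -> `|w * P| <= w by move=> w0 P1;rewrite normrM (ger0_norm w0) ler_piMr.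
have ff2 s s' a b : `|fk s s' a b * fk s' s b a| <= 1 by rewrite normrM mulr_ile1 ?ff_le1.
split.
- apply: nn;first by apply: prodr_ge0 => s _;exact: wE_ge0.
 by apply: prod_le1 => s;apply: prod_le1 => s';exact: ff_le1.
- by move=> e;apply: nn;[exact: wE_ge0 | apply: prod_le1 => s;exact: ff2].
- by move=> e;apply: nn;[exact: wE_ge0 | apply: prod_le1 => s;exact: ff2].
move=> e g;rewrite /valS.
have ut : upd2 o t t' e g t = e by rewrite ffunE eqxx.
have ut' : upd2 o t t' e g t' = g by rewrite ffunE t't eqxx.
have us s : (s != t) && (s != t') -> upd2 o t t' e g s = o s by rewrite ffunE => /andP[/negbTE -> /negbTE ->].
rewrite (prod_pair_split tt') => [|s];last by rewrite /ff eqxx.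
rewrite (bigD1 t)//= (bigD1 t')//=;last by rewrite t't.
rewrite ut ut' (eq_bigr _ (fun s hs => congr1 wk (us s hs))).
rewrite [X in _ * (X * _ * _ * _)](eq_bigr (fun s => \prod_(s' | (s' != t) && (s' != t')) fk s s' (o s) (o s')));last first.
 by move=> s hs;apply: eq_bigr => s' hs';rewrite !us.
rewrite [X in _ * (_ * X * _ * _)](eq_bigr (fun s => fk t s e (o s) * fk s t (o s) e));last first.
 by move=> s hs;rewrite !us.
rewrite [X in _ * (_ * _ * X * _)](eq_bigr (fun s => fk t' s g (o s) * fk s t' (o s) g));last first.
 by move=> s hs;rewrite !us.
have key : wk e * wk g * (fk t t' e g * fk t' t g e) = wk e * wk g * jj t t' e g.
 rewrite /wE;case: ifP => he;last by rewrite !mul0r.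
 case: ifP => hg;last by rewrite !(mulr0, mul0r).
 have ds : [disjoint g & e] = [disjoint e & g] by rewrite disjoint_sym.
 congr (_ * _);rewrite /ff (negbTE tt') t't /jj ds.
 have := l;rewrite /tlinked;case d1 : (dotb (tu t) (tw t'));case d2 : (dotb (tu t') (tw t)) => // _.
  by case: (boolP [disjoint e & g]) => d;rewrite !(expr0, expr1, mul1r, mul0r)// J_ndisj.
 case: (boolP [disjoint e & g]) => d;rewrite !(expr0, expr1, mul1r, mul0r, mulr1)// J_ndisj//.
 by rewrite disjoint_sym.
suff rg (a b P Q X Y f1 j1 : R) : a * b * f1 = a * b * j1 ->
  a * (b * P) * (Q * X * Y * f1) = P * Q * (b * Y) * (a * X * j1) by exact: rg key.
by move=> k;transitivity (a * b * f1 * (P * Q * X * Y));[ring|rewrite k;ring].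
Qed.

Definition idx (A : {set I}) : nat := trunc_log 2 (pr A).

Lemma idx_dset i A : all_prime A -> (idx A == i) = dset i A.
move=> hA;rewrite /dset hA/=;apply/eqP/andP => [<-|[h1 h2]].
 have := trunc_log_bounds (isT : (1 < 2)%N) (pr_gt0 hA);by move/andP.
by apply: trunc_log_eq => //;rewrite h1.
Qed.

Lemma idx_ge i A : all_prime A -> (i <= idx A)%N = (2 ^ i <= pr A)%N.
move=> hA;have /andP[h1 h2] := trunc_log_bounds (isT : (1 < 2)%N) (pr_gt0 hA).
apply/idP/idP => h;first by apply: leq_trans h1;rewrite leq_exp2l.
by rewrite -ltnS -(ltn_exp2l _ _ (isT : (1 < 2)%N));apply: leq_ltn_trans h h2.
Qed.

(** If the symbol points the other way, reciprocity reverses it. For g = 1 mod 4 nothing changes and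
    for g = 3 mod 4 the sign depends only on e, so it is absorbed into the coefficients; adding both
    cases costs the factor 2. *)
Lemma inner_bound (B : R) i :
 (forall x : {set I} -> R, (forall A, `|x A| <= wtS kap A) ->
   \sum_(G : {set I} | all_prime G && (2 ^ i <= pr G)%N)
    wtS kap G * `|\sum_(A : {set I} | dset i A) x A * jacR R (pr G) (pr A)| <= B) ->
 forall (t t' : T) (x : {set I} -> R), tlinked t t' -> (forall e, `|x e| <= wk e) ->
 \sum_(g | (i <= idx g)%N) wk g * `|\sum_(e | idx e == i) x e * jj t t' e g| <= 2 * B.
move=> hB t t' x l hx.
have x0 e : ~~ all_prime e -> x e = 0 by move=> h;apply/eqP;rewrite -normr_le0;letr (hx e);rewrite /wE (negbTE h).
have xw e : `|x e| <= wtS kap e by apply: le_trans (hx e) (wE_le e).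
have es (y : {set I} -> R) (f : {set I} -> R) : (forall e, ~~ all_prime e -> y e = 0) ->
 \sum_(e | idx e == i) y e * f e = \sum_(e | dset i e) y e * f e.
 move=> hy;rewrite big_mkcond [RHS]big_mkcond;eqbig e.
 case: (boolP (all_prime e)) => ae;first by rewrite idx_dset.
 by rewrite hy// mul0r;case: ifP;case: ifP.
have gs (f : {set I} -> R) : \sum_(g | (i <= idx g)%N) wk g * f g =
 \sum_(G : {set I} | all_prime G && (2 ^ i <= pr G)%N) wtS kap G * f G.
 rewrite big_mkcond [RHS]big_mkcond;eqbig g;rewrite /wE.
 case: (boolP (all_prime g)) => ag;first by rewrite idx_ge.
 by rewrite mul0r;case: ifP.
have B0 : 0 <= B.
 apply: le_trans (hB _ xw);apply: sumr_ge0 => G _;apply: mulr_ge0 => //;apply: wtS_ge0;exact: kap_gt0.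
rewrite gs /jj;case: (dotb _ _);last first.
 under eq_bigr => g _ do rewrite es//.
 by letr (hB _ xw);lra.
pose x' e : R := x e * (-1) ^+ (pr e %% 4 == 3)%N.
have x'w e : `|x' e| <= wtS kap e by rewrite normrM normrX normrN1 expr1n mulr1.
via (\sum_(G : {set I} | all_prime G && (2 ^ i <= pr G)%N) wtS kap G *
  (`|\sum_(A : {set I} | dset i A) x A * jacR R (pr G) (pr A)| + `|\sum_(A : {set I} | dset i A) x' A * jacR R (pr G) (pr A)|));last first.
 under eq_bigr => G _ do rewrite mulrDr.
 rewrite big_split;letr (lerD (hB _ xw) (hB _ x'w));lra.
apply: ler_sum => G /andP[aG _];rewrite es//.
case: (eqVneq (wtS kap G) 0) => [->|wG];first by rewrite !mul0r.
apply: ler_wpM2l;first by apply: wtS_ge0;exact: kap_gt0.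
have /andP[Go Gs] : oddsf (pr G) := wtS_neq0 aG wG.
suff -> : \sum_(e | dset i e) x e * jacR R (pr e) (pr G) = \sum_(e | dset i e) (if (pr G %% 4 == 3)%N then x' e else x e) * jacR R (pr G) (pr e) by case: ((pr G %% 4)%N == 3%N);rewrite ?lerDl ?lerDr.
apply: eq_bigr => e /and3P[ae _ _].
case: (eqVneq (x e) 0) => [xe|xe];first by rewrite /x' xe !mul0r;case: ifP;rewrite mul0r.
have we : wtS kap e != 0 by apply: contraNneq xe => w0;rewrite -normr_le0 -w0.
have /andP[eo _] : oddsf (pr e) := wtS_neq0 ae we.
rewrite /jacR jac_rec ?pr_gt0// rmorphM/= /rsgn andbC /x'.
case: (pr G %% 4 == 3)%N => /=;last lra.
by case: (pr e %% 4 == 3)%N;rewrite ?mulr1//=;ring.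
Qed.

End Bound.

(** * The moment bound *)

Section MomentBound.
Variables (R : realType) (m : nat).
Hypothesis (m0 : (0 < m)%N).
Notation T := (ttype m).
Notation kap := (2 / 2 ^+ m : R).
Let d := (2 ^ m)%N.

Let d0 : (0 < d)%N. Proof. by rewrite expn_gt0. Qed.

Lemma kap_d : kap * d%:R = 2.
by rewrite natrX divfK// expf_neq0// pnatr_eq0. Qed.

Lemma sum_wt_approx z : (1 < z)%N ->
 `|\sum_pr(p <= z) wt z kap p - kap * \sum_pr(p <= z) p%:R^-1| <= 3.
move=> z2;have h : forall n : nat, -1 <= (fun=> 1 : R) n <= 1 by move=> n;lra.
have := wt_sum_approx z2 (kap_gt0 R m) (kap_le1 R m0) h;congr (`|_ - _ * _| <= _).
 by eqbig p;rewrite mulr1.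
by eqbig p;rewrite mul1r.
Qed.

(** Since kappa 2^m = 2, the power F^(2^m) is comparable with exp(2 sum 1/p), hence with (log z)^2,
    for every m. *)
Lemma wF_lower : exists2 C : R, 0 < C & forall z, (1 < z)%N -> ln z%:R ^+ 2 <= C * wF z kap ^+ d.
exists (4 * expR 7 ^+ d) => [|z z2];first pos.
have w2 p : (0 < p)%N -> 0 <= wt z kap p <= 2 / p%:R.
 move=> p0;rewrite wt_ge0 ?kap_gt0//=;letr (wt_le _ (kap_gt0 R m) _).
 by rewrite ler_wpM2r ?invr_ge0//;letr (kap_le1 R m0);lra.
set S1 := \sum_pr(p <= z) (p%:R^-1 : R).
have h1 : expR (kap * S1) <= expR 7 * wF z kap.
 have := expR_sum_le_prod z w2;rewrite -/(wF z kap) => h.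
 via (expR 3 * expR (\sum_pr(p <= z) wt z kap p)).
  by rewrite -expRD ler_expR;have := sum_wt_approx z2;rewrite ler_norml -/S1;lra.
 letr (ler_wpM2l (expR_ge0 _) h).
 by rewrite mulrA -expRD (_ : 3 + 4 = 7 :> R)//;ring.
have h2 : expR S1 ^+ 2 <= (expR 7 * wF z kap) ^+ d.
 apply: le_trans (lerXn2r d _ _ h1);rewrite ?nnegrE ?expR_ge0 ?mulr_ge0 ?expR_ge0//;last first.
  by apply: le_trans (wF_ge1 z (kap_gt0 R m)).
 by rewrite -!expRM_natl mulrA [_ * kap]mulrC kap_d.
have h3 := @mertens_lower R z (ltnW z2).
via ((2 * expR S1) ^+ 2).
 by apply: lerXn2r;rewrite ?nnegrE ?mulr_ge0 ?expR_ge0// ln_nat_ge0.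
have -> : (2 * expR S1) ^+ 2 = 4 * expR S1 ^+ 2 by ring.
rewrite -mulrA -exprMn.
lra.
Qed.

Lemma wF_upper : exists2 C : R, 0 < C & forall z, (1 < z)%N -> wF z kap ^+ d <= C * ln z%:R ^+ 2.
have [C [C0 hC]] := mertens_upper R.
exists (expR 3 ^+ d * C ^+ 2) => [|z z2];first pos.
set S1 := \sum_pr(p <= z) (p%:R^-1 : R).
have F0 : 0 <= wF z kap by apply: le_trans (wF_ge1 z (kap_gt0 R m)).
have h1 : wF z kap <= expR 3 * expR (kap * S1).
 letr (prod_le_expR _ _) => [p _|];first by apply: wt_ge0;exact: kap_gt0.
 by rewrite -expRD ler_expR;have := sum_wt_approx z2;rewrite ler_norml -/S1;lra.
letr (lerXn2r d _ _ h1);rewrite ?nnegrE ?mulr_ge0 ?expR_ge0//.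
rewrite exprMn -mulrA;apply: ler_wpM2l;first pos.
rewrite -exprMn.
have -> : expR (kap * S1) ^+ d = expR S1 ^+ 2 by rewrite -!expRM_natl;congr expR;rewrite mulrA -[_ * kap]mulrC kap_d.
by apply: lerXn2r;rewrite ?nnegrE ?expR_ge0 ?mulr_ge0 ?(ltW C0) ?ln_nat_ge0 ?hC.
Qed.

(** The d-th root of [theta]. *)
Definition vth : R := expR (- (ln 2 / 32 / d%:R)).

Lemma vth_d : vth ^+ d = theta R.
by rewrite -expRM_natl;congr expR;field;rewrite pnatr_eq0 -lt0n. Qed.

Lemma vth_gt0 : 0 < vth. Proof. pos. Qed.

Lemma half_vth : 1 / 2 <= vth ^+ 2.
have -> : 1 / 2 = expR (- ln 2) :> R by rewrite expRN lnK ?posrE// mul1r.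
rewrite /vth -expRM_natl ler_expR mulrN lerN2 -!mulrA mulrCA ler_piMr ?ln_ge0 ?ler1n//.
have : (d%:R : R)^-1 <= 1 by rewrite invf_le1 ?ltr0n// ler1n.
lra.
Qed.

(** Let X be the sum. If F/2^i dominates in [regime_small], that bound suffices, because vth^2 is at
    least 1/2. Otherwise X^2 = O(F (i+1)), while [regime_large] and [wF_lower] give X^2 = O(F^d
    theta^(2i)). The first bound to the power d - 1 times the second gives X^(2d) = O(F^(2d-1)
    (i+1)^(d-1) vth^(2di)), which is more than enough as F is at least 1. *)
Lemma phi_bound : exists2 C : R, 0 < C & forall z i (x : pset z -> R), (1 < z)%N ->
  (forall A, `|x A| <= wtS kap A) ->
   \sum_(G : pset z | all_prime G && (2 ^ i <= pr G)%N)
    wtS kap G * `|\sum_(A : pset z | dset i A) x A * jacR R (pr G) (pr A)| <=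
   C * wF z kap * i.+1%:R * vth ^+ i.
have [C1 [C10 h1]] := regime_small R.
have [C2 [C20 h2]] := regime_large R.
have [C3 C30 h3] := wF_lower.
pose C := 2 + 2 * C1 + C2 ^+ 2 * C3.
have p1 : 0 < C2 ^+ 2 * C3 by pos.
have C0 : 0 < C by pos.
exists C => // z i x z2 hx.
have k0 := kap_gt0 R m;have k1 := kap_le1 R m0.
have := h2 z _ i x z2 k0 k1 hx;have := h1 z _ i x z2 k0 k1 hx.
set X1 := \sum_(G | all_prime G) _;set X := \sum_(G | _ && _) _ => hX1 hX2.
have F1 := wF_ge1 z k0;set F := wF z kap in hX1 F1 *.
have X0 : 0 <= X by apply: sumr_ge0 => G _;rewrite mulr_ge0 ?wtS_ge0.
have XX1 : X <= X1.
 rewrite /X big_mkcondr;lesum G;case: ifP => // _;by rewrite mulr_ge0 ?wtS_ge0.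
have hX : X ^+ 2 <= F * (F / 2 ^+ i + C1 * (i%:R + 1)) by apply: le_trans hX1;apply: lerXn2r;rewrite ?nnegrE ?(le_trans X0).
have i1 : (1 : R) <= i.+1%:R by rewrite ler1n.
have vi0 : 0 < vth ^+ i by pos.
have F0 : 0 < F by lra.
case: (leP (C1 * (i%:R + 1)) (F / 2 ^+ i)) => hc.
 have : X ^+ 2 <= (2 * F * vth ^+ i) ^+ 2.
  letr hX;via (2 * F ^+ 2 * 2^-1 ^+ i).
   rewrite exprVn -!mulrA mulrCA;apply: ler_wpM2l;[exact: ltW|lra].
  rewrite !exprMn -exprM mulnC exprM;have -> : 2 ^+ 2 = 4 :> R by ring.
  apply: ler_pM;rewrite ?mulr_ge0 ?exprn_ge0 ?invr_ge0 ?(ltW F0)//.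
   by apply: ler_wpM2r;rewrite ?exprn_ge0 ?(ltW F0)//;lra.
  by apply: lerXn2r;rewrite ?nnegrE ?invr_ge0 ?exprn_ge0 ?(ltW vth_gt0)//;have := half_vth;lra.
 rewrite ler_pXn2r ?nnegrE ?mulr_ge0 ?(ltW F0) ?(ltW vi0)// => h.
 letr h;apply: ler_wpM2r;first exact: ltW.
 rewrite mulrAC;apply: ler_wpM2r;first exact: ltW.
 by via (C * 1);[rewrite /C;nra | rewrite ler_wpM2l// ltW].
have hX' : X ^+ 2 <= C * F * i.+1%:R.
 letr hX;via (F * (2 * C1 * i.+1%:R)).
  apply: ler_wpM2l;first exact: ltW.
  have -> : 2 * C1 * i.+1%:R = 2 * (C1 * (i%:R + 1)) by ring.
  by move: hc;set u := C1 * _;set v := F / _;lra.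
 have -> : F * (2 * C1 * i.+1%:R) = 2 * C1 * F * i.+1%:R by ring.
 apply: ler_wpM2r;first lra.
 by apply: ler_wpM2r;[exact: ltW|rewrite /C;lra].
have hXl : X ^+ 2 <= C * F ^+ d * theta R ^+ i ^+ 2.
 letr (lerXn2r 2 _ _ hX2);rewrite ?nnegrE ?mulr_ge0 ?(ltW C20) ?exprn_ge0 ?(ltW (theta_gt0 R)) ?ln_nat_ge0//.
 rewrite !exprMn;apply: ler_wpM2r;first pos.
 letr (ler_wpM2l _ (h3 z z2));first pos.
 rewrite mulrA;apply: ler_wpM2r;first pos.
 by rewrite /C;lra.
have : X ^+ 2 ^+ d <= (C * F * i.+1%:R * vth ^+ i) ^+ 2 ^+ d.
 rewrite -{1}(prednK d0) exprS.
 letr (ler_pM _ _ hXl (lerXn2r d.-1 _ _ hX'));rewrite ?nnegrE ?exprn_ge0 ?mulr_ge0 ?(ltW C0) ?(ltW F0)//.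
 have -> : theta R ^+ i ^+ 2 = vth ^+ i ^+ 2 ^+ d by rewrite -vth_d (exprAC _ d i) (exprAC _ d 2).
 rewrite [X in _ <= X ^+ d]exprMn [leRHS]exprMn mulrAC;apply: ler_wpM2r;first pos.
 have CF1 : 1 <= C * F * i.+1%:R.
  rewrite -[leLHS]mulr1 -[X in X * _ <= _]mulr1;apply: ler_pM;rewrite ?mulr_ge0//.
  by apply: ler_pM => //;rewrite /C;nra.
 have C1' : 1 <= C by rewrite /C;nra.
 via ((C * F * i.+1%:R) ^+ d * (C * F * i.+1%:R) ^+ d.-1).
  apply: ler_wpM2r;first pos.
  rewrite !exprMn -mulrA;apply: ler_pM;rewrite ?exprn_ge0 ?(ltW C0) ?(ltW F0)//;first by apply: ler_eXnr.
  by rewrite ler_peMr ?exprn_ge0 ?(ltW F0)// exprn_ege1.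
 rewrite -exprD -exprM;apply: ler_weXn2l => //;by rewrite mul2n -addnn leq_add2l leq_pred.
rewrite -!exprM ler_pXn2r ?nnegrE ?mulr_ge0 ?(ltW C0) ?(ltW F0) ?(ltW vi0)//.
pos.
Qed.

Lemma poly_geom_sum k : exists2 C : R, 0 < C & forall n, \sum_(i < n) i.+1%:R ^+ k * vth ^+ i <= C.
pose e : R := ln 2 / 32 / d%:R.
have e0 : 0 < e by rewrite !divr_gt0 ?ltr0n// ln_gt0// ltr1n.
pose r := expR (- (e / 2)).
have r1 : r < 1 by rewrite /r -[X in _ < X]expR0 ltr_expR;lra.
have r0 : 0 < r := expR_gt0 _.
pose a := e / 2 / k.+1%:R.
have a0 : 0 < a by rewrite /a;apply: divr_gt0;[lra|rewrite ltr0n].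
exists (a^-1 ^+ k * expR (e / 2) * (1 - r)^-1) => [|n].
 by rewrite !mulr_gt0 ?exprn_gt0 ?invr_gt0 ?expR_gt0// subr_gt0.
via (\sum_(0 <= i < n) a^-1 ^+ k * expR (e / 2) * r ^+ i);last first.
 rewrite -mulr_sumr;apply: ler_wpM2l;first pos.
 by apply: geom_le;rewrite ltW.
rewrite big_mkord;lesum i.
have h : i.+1%:R ^+ k <= a^-1 ^+ k * expR (e / 2 * i.+1%:R).
 have h1 : i.+1%:R <= a^-1 * expR (a * i.+1%:R).
  rewrite mulrC ler_pdivlMr//;have := expR_ge1Dx (a * i.+1%:R);lra.
 letr (lerXn2r k _ _ h1);rewrite ?nnegrE ?mulr_ge0 ?invr_ge0 ?expR_ge0 ?(ltW a0)//.
 rewrite exprMn;apply: ler_wpM2l;first pos.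
 rewrite -expRM_natl ler_expR mulrA;apply: ler_wpM2r => //.
 rewrite /a mulrCA ler_piMr//;first lra.
 by rewrite ler_pdivrMr// mul1r ler_nat.
letr (ler_wpM2r _ h);first pos.
rewrite -[leLHS]mulrA -[leRHS]mulrA;apply: ler_wpM2l;first pos.
rewrite -!expRM_natl -!expRD ler_expR -/e;apply: eqler;by field.
Qed.

(** The smooth weight dominates the truncation pr A at most z up to a factor e, and [moment_valS]
    gives the sum to which [multi_bound] applies. Its error terms form a convergent series in i by
    [phi_bound], so all is O(F^d), that is O((log z)^2). *)
Lemma moment_bound : exists2 C : R, 0 < C & forall z, (1 < z)%N ->
 \sum_(A : pset z | odd_primes A && (pr A <= z)%N) (pr A)%:R^-1 *
  \sum_(s : pset z | s \subset A) ((Kc A s)%:R : R) ^+ m <= C * ln z%:R ^+ 2.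
have [C1 C10 h1] := phi_bound.
pose t := #|{: T}|.
have [C2 C20 h2] := poly_geom_sum t.+1.
have [C3 C30 h3] := wF_upper.
pose K : R := 1 + (t ^ 2)%:R * (2 * C1 * 2 ^+ t * C2).
have K0 : 0 < K by pos.
exists (expR 1 * (K * C3)) => [|z z2];first pos.
have k0 := kap_gt0 R m;have k1 := kap_le1 R m0.
have lz : 0 < ln (z%:R : R) by rewrite ln_gt0// ltr1n.
have F1 := wF_ge1 z k0.
via (expR 1 * \sum_S @valS z R m S).
 rewrite -moment_valS mulr_sumr big_mkcondr;apply: ler_sum => A hA.
 have S0 : 0 <= \sum_(s : pset z | s \subset A) ((Kc A s)%:R : R) ^+ m by pos.
 have e1 : \prod_(p in A) (p%:R^-1 * expR (- (ln p%:R / ln z%:R))) = (pr A)%:R^-1 * expR (- (ln (pr A)%:R / ln z%:R)) :> R.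
  have ap := all_primeP _ (odd_primes_all hA).
  rewrite big_split/=;congr (_ * _);first by rewrite /pr natr_prod prodfV.
  rewrite -expR_sum;congr expR;rewrite sumrN -mulr_suml;congr (- (_ * _)).
  by rewrite ln_prodn// => p pA;apply: prime_gt0;exact: ap.
 rewrite e1;case: ifP => hz;last pos.
 rewrite mulrA;apply: ler_wpM2r => //;rewrite mulrCA ler_peMr ?invr_ge0// -expRD -[leLHS]expR0 ler_expR.
 rewrite subr_ge0 ler_pdivrMr// mul1r;apply: ln_nat_le;rewrite pr_gt0//;exact: odd_primes_all.
rewrite -!mulrA;apply: ler_wpM2l;first exact: expR_ge0.
via (K * wF z kap ^+ d);last by apply: ler_wpM2l;[exact: ltW|exact: h3].
have w0 e : 0 <= @wE z R m e := wE_ge0 R m e.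
have hF : \sum_e @wE z R m e <= wF z kap by rewrite wF_sum -big_mkcond.
have hH i : \sum_(e | (@idx z e <= i)%N) @wE z R m e <= i.+1%:R.
 via (\sum_(j < i.+1) \sum_(e : pset z | dset j e) wtS kap e);last first.
  via (\sum_(j < i.+1) 1);last by rewrite sumr_const card_ord.
  by lesum j;exact: sum_dset_inv.
 rewrite (exchange_big_dep predT)//= big_mkcond;lesum e.
 case: ifP => hi;last by apply: sumr_ge0 => j _;exact: wtS_ge0.
 rewrite /wE;case: ifP => ae;last by apply: sumr_ge0 => j _;exact: wtS_ge0.
 rewrite (bigD1 (Ordinal (hi : (idx e < i.+1)%N)))/=;last by rewrite -idx_dset.
 by rewrite lerDl;apply: sumr_ge0 => j _;exact: wtS_ge0.
pose Phi i : R := 2 * (C1 * wF z kap * i.+1%:R * vth ^+ i).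
have Phi0 i : 0 <= Phi i by rewrite !mulr_ge0 ?exprn_ge0 ?(ltW C10) ?(ltW vth_gt0)// (le_trans _ F1).
have inner (t1 t2 : T) i (x : pset z -> R) : tlinked t1 t2 -> (forall e, `|x e| <= @wE z R m e) ->
 \sum_(g | (i <= @idx z g)%N) @wE z R m g * `|\sum_(e | idx e == i) x e * @jj z R m t1 t2 e g| <= Phi i.
 by apply: inner_bound => y hy;apply: h1.
have hU (U : {set T}) : unlinked (@tlinked m) U -> (#|U| <= d)%N by exact: (unlinked_card R).
have := multi_bound (finset.set0 : pset z) w0 (@tlinked_sym m) (@tlinked_irr m) hU F1 hF hH Phi0 (@valS_le z R m) (@val_split z R m) inner d0.
move/(le_trans (ler_norm _))/le_trans;apply.
have -> (x : R) : K * x = x + (t ^ 2)%:R * (2 * C1 * 2 ^+ t * C2 * x) by rewrite /K;set q := _ * C2;rewrite mulrDl mul1r mulrA.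
rewrite lerD2l sumr_const -[_ *+ _]mulr_natl.
have -> : #|{: T * T}| = (t ^ 2)%N by rewrite card_prod.
apply: ler_wpM2l => //;rewrite -/t.
set Im := (\max_e _).+1.
via (\sum_(i < Im) (2 * C1 * 2 ^+ t * wF z kap ^+ d) * (i.+1%:R ^+ t.+1 * vth ^+ i));last first.
 rewrite -mulr_sumr [leRHS]mulrAC;apply: ler_wpM2l;last exact: h2.
 by rewrite !mulr_ge0 ?exprn_ge0 ?(ltW C10)// (le_trans _ F1).
apply: ler_sum => i _;rewrite /Phi -{2}(prednK d0) !exprS.
suff -> (a b c f g h k : R) : 2 * (a * b * c * f) * (g * (h * k)) = 2 * a * g * (b * h) * (c * k * f) by [].
ring.
Qed.
End MomentBound.

(** * Residue classes of pairs and points in boxes *)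

Definition cnt (M : nat) (G : nat -> nat -> bool) : nat := \sum_(i < M) \sum_(j < M) G i j.
Definition per2 (M : nat) (G : nat -> nat -> bool) : Prop := forall i i' j j',
 (i = i' %[mod M])%N -> (j = j' %[mod M])%N -> G i j = G i' j'.

Lemma crt_sum (m1 m2 : nat) (F : nat -> nat -> nat) : coprime m1 m2 -> (0 < m1)%N -> (0 < m2)%N ->
 (\sum_(i < m1 * m2) F (i %% m1) (i %% m2) = \sum_(a < m1) \sum_(b < m2) F a b)%N.
move=> co m10 m20.
pose h (i : 'I_(m1 * m2)) : 'I_m1 * 'I_m2 := (Ordinal (ltn_pmod i m10), Ordinal (ltn_pmod i m20)).
have hinj : injective h.
 move=> i j [e1 e2];apply: val_inj => /=.
 have : (i = j %[mod m1 * m2])%N by apply/eqP;rewrite chinese_remainder// e1 e2 !eqxx.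
 by rewrite !modn_small.
have hbij : bijective h by apply: inj_card_bij => //;rewrite card_prod !card_ord.
by rewrite pair_big/= (reindex h)//;exact: onW_bij.
Qed.

Lemma cnt_crt (m1 m2 : nat) G1 G2 : coprime m1 m2 -> (0 < m1)%N -> (0 < m2)%N -> per2 m1 G1 -> per2 m2 G2 ->
 cnt (m1 * m2) (fun i j => G1 i j && G2 i j) = (cnt m1 G1 * cnt m2 G2)%N.
move=> co m10 m20 p1 p2;rewrite /cnt.
have e1 (i : nat) : (\sum_(j < m1 * m2) (G1 i j && G2 i j) = \sum_(c < m1) \sum_(d < m2) (G1 (i %% m1) c && G2 (i %% m2) d))%N.
 rewrite -(crt_sum (fun c d => nat_of_bool (G1 (i %% m1)%N c && G2 (i %% m2)%N d)))//.
 by eqbig j;congr (nat_of_bool (_ && _));[apply: p1|apply: p2];rewrite ?modn_mod.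
under eq_bigr => i _ do rewrite e1.
rewrite (crt_sum (fun a b => (\sum_(c < m1) \sum_(d < m2) (G1 a c && G2 b d))%N))//.
rewrite big_distrlr/=;eqbig a;eqbig b.
by rewrite big_distrlr/=;eqbig c;eqbig d;rewrite mulnb.
Qed.

Lemma per2_dvd (m M : nat) G : (m %| M)%N -> per2 m G -> per2 M G.
have h i i' : (m %| M)%N -> (i = i' %[mod M])%N -> (i = i' %[mod m])%N by move=> /dvdnP[k ->] e;rewrite -[LHS](@modn_dvdm (k * m)) ?dvdn_mull// e modn_dvdm// dvdn_mull.
by move=> d p i i' j j' ei ej;apply: p;apply: h.
Qed.

Lemma cnt_prod (X : eqType) (r : seq X) (m : X -> nat) (G : X -> nat -> nat -> bool) : uniq r ->
 (forall x y, x \in r -> y \in r -> x != y -> coprime (m x) (m y)) -> (forall x, x \in r -> (0 < m x)%N) ->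
 (forall x, x \in r -> per2 (m x) (G x)) ->
 cnt (\prod_(x <- r) m x)%N (fun i j => all (fun x => G x i j) r) = (\prod_(x <- r) cnt (m x) (G x))%N /\
 per2 (\prod_(x <- r) m x)%N (fun i j => all (fun x => G x i j) r).
elim: r => [_ _ _ _|x r IH/= /andP[xr ur] co m0 hp].
 by rewrite !big_nil;split => //;rewrite /cnt !big_ord_recl !big_ord0.
rewrite !big_cons;have [|||e1 e2] := IH ur.
- by move=> y y' yr yr';apply: co;rewrite inE ?yr ?yr' orbT.
- by move=> y yr;apply: m0;rewrite inE yr orbT.
- by move=> y yr;apply: hp;rewrite inE yr orbT.
have c1 : coprime (m x) (\prod_(y <- r) m y)%N.
 rewrite big_seq;apply: (big_ind (fun k => coprime (m x) k)) => [|a b ca cb|y yr];first exact: coprimen1.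
  by rewrite coprimeMr ca.
 by apply: co;rewrite ?inE ?eqxx ?yr ?orbT//;apply: contraNneq xr => ->.
have m1 : (0 < \prod_(y <- r) m y)%N by rewrite big_seq;apply: prodn_cond_gt0 => y yr;apply: m0;rewrite inE yr orbT.
have px := hp x (mem_head x r);have mx := m0 x (mem_head x r).
split;first by rewrite -e1 -cnt_crt.
move=> i i' j j' ei ej;congr (_ && _).
 by apply: (per2_dvd _ px) ei ej;exact: dvdn_mulr.
by apply: (per2_dvd _ e2) ei ej;exact: dvdn_mull.
Qed.

Section BoxCount.
Variable R : realType.

Lemma periodic_sum (f : nat -> R) (M L : nat) : (0 < M)%N -> (forall i, 0 <= f i) ->
 (forall i, f (i %% M)%N = f i) ->
 `|\sum_(i < L) f i - L%:R / M%:R * \sum_(i < M) f i| <= \sum_(i < M) f i.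
move=> M0 f0 per;set S := \sum_(i < M) f i.
have blk q : \sum_(0 <= i < q * M) f i = q%:R * S.
 elim: q => [|q IH];first by rewrite mul0n big_geq// mul0r.
 rewrite mulSn addnC (@big_cat_nat _ _ _ (q * M)) ?leq_addr//= IH -natr1 mulrDl mul1r;congr (_ + _).
 rewrite -{1}[(q * M)%N]add0n [(q * M + M)%N]addnC big_addn addnK big_mkord;eqbig i.
 by rewrite -per -[in RHS]per addnC modnMDl.
have hr : 0 <= \sum_(L %/ M * M <= i < L) f i <= S.
 rewrite sumr_ge0//=.
 have e : \sum_(L %/ M * M <= i < L) f i = \sum_(0 <= i < L %% M) f i.
  rewrite -{1}[(L %/ M * M)%N]add0n big_addn (_ : L - L %/ M * M = L %% M)%N;last lia.
  by eqbig i;rewrite -per addnC modnMDl.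
 rewrite e /S -(big_mkord predT) [leRHS](@big_cat_nat _ _ _ (L %% M))//=;last lia.
 by rewrite lerDl sumr_ge0.
rewrite -(big_mkord predT) (@big_cat_nat _ _ _ (L %/ M * M)) ?leq_divM//= blk.
have eL : (L%:R : R) = (L %/ M)%:R * M%:R + (L %% M)%:R by rewrite -natrM -natrD -divn_eq.
have M0' : (0 : R) < M%:R by pos.
have -> : L%:R / M%:R = (L %/ M)%:R + (L %% M)%:R / M%:R :> R by rewrite eL mulrDl mulfK// gt_eqF.
set t := (L %% M)%:R / M%:R.
have t0 : 0 <= t by pos.
have t1 : t <= 1 by rewrite ler_pdivrMr// mul1r ler_nat ltnW// ltn_mod.
have S0 : 0 <= S by lra.
move: hr;set u := \sum_(_ <= i < _) _;move=> /andP[u0 u1].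
have -> : (L %/ M)%:R * S + u - ((L %/ M)%:R + t) * S = u - t * S by ring.
rewrite ler_norml;apply/andP;split;nra.
Qed.

(** [periodic_sum] is applied in the first variable, then in the second one. *)
Lemma box_count (M : nat) (G : nat -> nat -> bool) (L1 L2 : nat) : (0 < M)%N -> per2 M G ->
 `|(\sum_(i < L1) \sum_(j < L2) G i j)%N%:R - (cnt M G)%:R * (L1%:R / M%:R) * (L2%:R / M%:R)| <=
  (cnt M G)%:R * (L1%:R / M%:R + L2%:R / M%:R + 1) :> R.
move=> M0 per.
pose H (i : nat) : R := (\sum_(j < L2) G i j)%N%:R.
have H0 i : 0 <= H i by [].
have hH := periodic_sum L1 M0 H0 (fun i => _ : H (i %% M)%N = H i).
have {}hH := hH (fun i => congr1 (fun n : nat => n%:R : R) (eq_bigr _ (fun j _ => congr1 nat_of_bool (per _ _ _ _ (modn_mod i M) erefl)))).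
pose K (j : nat) : R := (\sum_(i < M) G i j)%N%:R.
have K0 j : 0 <= K j by [].
have hK := periodic_sum L2 M0 K0 (fun j => congr1 (fun n : nat => n%:R : R) (eq_bigr _ (fun i _ => congr1 nat_of_bool (per _ _ _ _ erefl (modn_mod j M))))).
have eK : \sum_(j < L2) K j = \sum_(i < M) H i by rewrite -!natr_sum exchange_big.
have eC : \sum_(j < M) K j = (cnt M G)%:R by rewrite /K -natr_sum exchange_big.
have eB : \sum_(i < L1) H i = (\sum_(i < L1) \sum_(j < L2) G i j)%N%:R by rewrite /H -natr_sum.
move: hH hK;rewrite eK eC eB.
set x := (_%:R in X in X -> _);set Hs := \sum_(i < M) H i;set c := (cnt M G)%:R.
set a := L1%:R / M%:R;set b := L2%:R / M%:R.
have a0 : 0 <= a by pos.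
have b0 : 0 <= b by pos.
rewrite !ler_norml => /andP[h1 h2] /andP[h3 h4].
apply/andP;split;nra.
Qed.
End BoxCount.

(** * Selberg's sieve *)

Lemma sum_sign_between (R : comNzRingType) (I : finType) (l k : {set I}) :
 \sum_(d : {set I} | (l \subset d) && (d \subset k)) (-1 : R) ^+ #|d| = if l == k then (-1) ^+ #|l| else 0.
pose F (p : I) : R := if p \in k then -1 else 0.
pose G (p : I) : R := if p \in l then 0 else 1.
transitivity (\prod_p (F p + G p)).
 rewrite bigA_distr/= big_mkcond;eqbig d.
 case: ifP => [/andP[ld dk]|/negbT];last first.
  rewrite negb_and => /orP[] /subsetPn[p p1 p2].
   by rewrite (bigD1 p)//= (negbTE p2) /G p1 mul0r.
  by rewrite (bigD1 p)//= p1 /F (negbTE p2) mul0r.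
 rewrite -prodr_const big_mkcond;eqbig p;case: ifP => pd.
  by rewrite /F (fintype.subsetP dk).
 by rewrite /G;case: ifP => // /(fintype.subsetP ld);rewrite pd.
case: eqP => [e|/eqP ne].
 rewrite -prodr_const [RHS]big_mkcond;eqbig p;rewrite /F /G e;by case: (p \in k);rewrite ?addr0 ?add0r.
have [p hp] : exists p, (p \in l) != (p \in k) by apply/existsP;apply: contraNT ne;rewrite negb_exists => /forallP h;apply/eqP/setP => p;have := h p;rewrite negbK => /eqP.
by rewrite (bigD1 p)//= /F /G;move: hp;case: (p \in l);case: (p \in k) => // _;rewrite ?addr0 ?addNr ?mul0r.
Qed.

Section Selberg.
Variables (R : realType) (w : nat) (Ps : {set 'I_w.+1}).
Hypotheses (w1 : (0 < w)%N) (hP : all_prime Ps).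
Notation I := 'I_w.+1.

(** Euler's function at pr k. *)
Definition phs (k : {set I}) : R := \prod_(p in k) (p%:R - 1).
Definition supp (k : {set I}) : bool := (k \subset Ps) && (pr k <= w)%N.
Definition selS : R := \sum_(k : {set I} | supp k) (phs k)^-1.
(** Selberg's optimal weights. They are supported on pr d at most w and normalised by [lam0]. *)
Definition lam (d : {set I}) : R :=
 (-1) ^+ #|d| * (pr d)%:R / selS * \sum_(k : {set I} | supp k && (d \subset k)) (phs k)^-1.

Lemma all_prime_sub (k : {set I}) : k \subset Ps -> all_prime k.
by move=> h;apply/all_primeP => p pk;apply: (elimT (all_primeP Ps) hP);apply: (fintype.subsetP h). Qed.

Lemma phs_gt0 (k : {set I}) : k \subset Ps -> 0 < phs k.
move=> h;apply: prodr_gt0 => p pk;rewrite subr_gt0 ltr1n prime_gt1//.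
exact: (elimT (all_primeP _) (all_prime_sub h)).
Qed.

Lemma prR_gt0 (k : {set I}) : k \subset Ps -> 0 < (pr k)%:R :> R.
by move=> h;rewrite ltr0n;apply: pr_gt0;exact: all_prime_sub. Qed.

Lemma pr0 : pr (finset.set0 : {set I}) = 1%N.
by rewrite /pr big_set0. Qed.

Lemma supp_down (k d : {set I}) : supp k -> d \subset k -> supp d.
move=> /andP[kP kw] dk;have dP := fintype.subset_trans dk kP;rewrite /supp dP/=.
apply: leq_trans kw;rewrite /pr [leqRHS](bigID (fun p => p \in d))/= [X in (_ <= X * _)%N](eq_bigl (fun p => p \in d)) => [|p];last first.
 by rewrite andb_idl// => /(fintype.subsetP dk).
rewrite leq_pmulr// prodn_cond_gt0// => p /andP[pk _];apply: prime_gt0.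
exact: (elimT (all_primeP _) (all_prime_sub kP)).
Qed.

Lemma selS_ge1 : 1 <= selS.
have s0 : supp finset.set0 by rewrite /supp finset.sub0set pr0.
rewrite /selS (bigD1 finset.set0)//= /phs big_set0 invr1 lerDl sumr_ge0// => k /andP[/andP[kP _] _].
by rewrite invr_ge0 ltW// phs_gt0.
Qed.

Lemma lam0 : lam finset.set0 = 1.
rewrite /lam cards0 expr0 mul1r pr0 mul1r (eq_bigl supp) => [|k];last by rewrite finset.sub0set andbT.
by rewrite mulVf// gt_eqF// (lt_le_trans _ selS_ge1).
Qed.

Lemma lam_supp (d : {set I}) : lam d != 0 -> supp d.
apply: contraR => h;rewrite /lam big_pred0 ?mulr0// => k;apply/negP => /andP[h1 h2].
by rewrite (supp_down h1 h2) in h.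
Qed.

Lemma lam_le (d : {set I}) : `|lam d| <= (pr d)%:R.
have S0 : 0 < selS by apply: lt_le_trans selS_ge1.
rewrite /lam !normrM normrX normrN1 expr1n mul1r normr_nat normfV (gtr0_norm S0) -mulrA ler_piMr//.
have h0 : 0 <= \sum_(k : {set I} | supp k && (d \subset k)) (phs k)^-1 by apply: sumr_ge0 => k /andP[/andP[kP _] _];rewrite invr_ge0 ltW// phs_gt0.
rewrite (ger0_norm h0) mulrC ler_pdivrMr// mul1r big_mkcondr;apply: ler_sum => k /andP[kP _].
by case: ifP => // _;rewrite invr_ge0 ltW// phs_gt0.
Qed.

Lemma prR_phs (k : {set I}) : (pr k)%:R = \sum_(l : {set I} | l \subset k) phs l.
by rewrite -(prod1D_sub k (fun p : I => p%:R - 1)) /pr natr_prod;eqbig p;rewrite addrC subrK.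
Qed.

Lemma pr_setUI (A B : {set I}) : (pr (A :|: B) * pr (A :&: B) = pr A * pr B)%N.
have -> : pr (A :|: B) = (pr A * \prod_(p in B | p \notin A) p)%N.
 rewrite /pr (bigID (fun p => p \in A))/=;congr (_ * _)%N;apply: eq_bigl => p;rewrite !inE.
  by rewrite andbC;case: (p \in A).
 by case: (p \in A);rewrite ?andbF ?andbT.
rewrite -mulnA;congr (_ * _)%N;rewrite mulnC [RHS](bigID (fun p => p \in A))/=;congr (_ * _)%N.
by apply: eq_bigl => p;rewrite inE andbC.
Qed.

(** Writing gcd(d1, d2) as the sum of phi(l) over common divisors l diagonalises the quadratic form
    in the variables [y]. Moebius inversion ([sum_sign_between]) evaluates y l as plus or minus 1/(S
    phi(l)) on the support. *)
Lemma lam_diag : \sum_d1 \sum_d2 lam d1 * lam d2 / (pr (d1 :|: d2))%:R = selS^-1.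
have S0 : selS != 0 by rewrite gt_eqF// (lt_le_trans _ selS_ge1).
pose y (l : {set I}) : R := \sum_(d : {set I} | l \subset d) lam d / (pr d)%:R.
have yE l : y l = if supp l then (-1) ^+ #|l| / (selS * phs l) else 0.
 transitivity (\sum_(k : {set I} | supp k) (selS * phs k)^-1 * \sum_(d : {set I} | (l \subset d) && (d \subset k)) (-1) ^+ #|d|).
  under [RHS]eq_bigr => k _ do rewrite mulr_sumr.
  rewrite (exchange_big_dep (fun d : {set I} => l \subset d))/=;last by move=> k d _ /andP[].
  apply: eq_bigr => d ld;rewrite /lam.
  case: (boolP (d \subset Ps)) => dP;last first.
   have nk k : supp k -> d \subset k -> False by move=> /andP[kP _] dk;rewrite (fintype.subset_trans dk kP) in dP.
   rewrite big_pred0 => [|k];last by apply/negP => /andP[/nk h];first [by move/h | by case/andP => _ /h].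
   rewrite big_pred0 ?mulr0 ?mul0r// => k;apply/negP => /andP[/nk h];first [by move/h | by case/andP => _ /h].
  set Q := \sum_(k : {set I} | _ && (d \subset k)) _.
  have -> : (-1) ^+ #|d| * (pr d)%:R / selS * Q / (pr d)%:R = (-1) ^+ #|d| / selS * Q by field;rewrite S0 gt_eqF ?prR_gt0.
  rewrite /Q mulr_sumr;apply: eq_big => [k|k _];first by rewrite ld.
  lra.
 under eq_bigr => k _ do rewrite sum_sign_between.
 case: ifP => hl;last first.
  by rewrite big1// => k hk;case: eqP => [e|_];rewrite ?mulr0//;rewrite e hk in hl.
 rewrite (bigD1 l)//= eqxx big1 ?addr0 => [|k /andP[_ /negbTE kl]];last by rewrite eq_sym kl mulr0.
 lra.
transitivity (\sum_l phs l * y l ^+ 2).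
 have e d1 d2 : lam d1 * lam d2 / (pr (d1 :|: d2))%:R = \sum_(l : {set I} | (l \subset d1) && (l \subset d2)) phs l * (lam d1 / (pr d1)%:R * (lam d2 / (pr d2)%:R)).
  case: (eqVneq (lam d1) 0) => [->|/lam_supp/andP[h1 _]].
   by rewrite !mul0r big1// => l _;rewrite ?(mul0r, mulr0).
  case: (eqVneq (lam d2) 0) => [->|/lam_supp/andP[h2 _]].
   by rewrite mulr0 !mul0r big1// => l _;rewrite ?(mul0r, mulr0).
  rewrite -mulr_suml (eq_bigl (fun l : {set I} => l \subset d1 :&: d2)) => [|l];last by rewrite finset.subsetI.
  rewrite -prR_phs.
  have hu : d1 :|: d2 \subset Ps by rewrite finset.subUset h1.
  have := congr1 (fun n : nat => n%:R : R) (pr_setUI d1 d2);rewrite !natrM => hn.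
  have n1 := prR_gt0 h1;have n2 := prR_gt0 h2;have nu := prR_gt0 hu.
  apply: (mulIf (_ : (pr (d1 :|: d2))%:R != 0));first lra.
  rewrite divfK ?gt_eqF//.
  transitivity ((pr (d1 :|: d2))%:R * (pr (d1 :&: d2))%:R * (lam d1 / (pr d1)%:R * (lam d2 / (pr d2)%:R)));last ring.
  by rewrite hn;field;rewrite !gt_eqF.
 under eq_bigr => d1 _ do under eq_bigr => d2 _ do rewrite e.
 transitivity (\sum_(l : {set I}) \sum_(d1 : {set I} | l \subset d1) \sum_(d2 : {set I} | l \subset d2) phs l * (lam d1 / (pr d1)%:R * (lam d2 / (pr d2)%:R))).
  rewrite [RHS](exchange_big_dep predT)//=;eqbig d1.
  rewrite [RHS](exchange_big_dep predT)//=.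
 eqbig l;rewrite expr2 /y mulr_suml mulr_sumr;eqbig d1.
 by rewrite mulr_sumr mulr_sumr.
rewrite (eq_bigr (fun l => if supp l then (phs l)^-1 * (selS ^+ 2)^-1 else 0)) => [|l _];last first.
 rewrite yE;case: ifP => [/andP[lP _]|_];last lra.
 rewrite !exprMn exprVn -exprM mulnC exprM sqrrN !expr1n mul1r exprMn.
 by field;rewrite S0 gt_eqF ?phs_gt0.
rewrite -big_mkcond -mulr_suml -/selS;by field.
Qed.

Lemma sum_lam_le : \sum_d `|lam d| <= (w ^ 2)%:R.
via (\sum_(d : {set I} | all_prime d && (pr d <= w)%N) (w%:R : R)).
 rewrite [leRHS]big_mkcond;lesum d.
 case: (eqVneq (lam d) 0) => [->|/lam_supp/andP[h1 h2]];first by rewrite normr0;case: ifP.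
 by rewrite all_prime_sub// h2;letr (lam_le d);rewrite ler_nat.
letr (sum_pr_le _ _ (fun _ => ler0n _ _)).
by rewrite big_const_nat subn1 iter_addr_0 -mulrnA expnS.
Qed.

(** Every squarefree integer up to w is a part supported on M times a part supported on [Ps]; so the
    sum of 1/pr A, which is at least half of log(w+1), is at most the product over M times S. *)
Lemma selS_lower (M : {set I}) : all_prime M -> (forall p : I, prime p -> (p \in Ps) || (p \in M)) ->
 ln w.+1%:R <= 2 * (\prod_(p in M) (1 + p%:R^-1)) * selS.
move=> hM cov;letr (harmonic_le_sqfree R w);rewrite -mulrA;apply: ler_wpM2l => //.
rewrite prod1D_sub /selS big_distrlr/= pair_big/=.
apply: (ler_sum_inj (h := fun A : {set I} => (A :&: M, A :\: M))).
- by move=> A B _ _ [e1 e2];rewrite -(finset.setID A M) e1 e2 finset.setID.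
- move=> A /andP[hA hw]/=;rewrite finset.subsetIr/=;apply/andP;split.
  apply/fintype.subsetP => p;rewrite !inE => /andP[pM pA].
  by have := cov p (elimT (all_primeP _) hA p pA);rewrite (negbTE pM) orbF.
 apply: leq_trans hw;rewrite -{2}(finset.setID A M) /pr.
 rewrite [leqRHS](bigID (fun p => p \in M))/= mulnC [X in (_ <= X * _)%N](eq_bigl (fun p => p \in A :\: M)) => [|p];last first.
  by rewrite !inE;case: (p \in M);case: (p \in A).
 rewrite leq_pmulr// prodn_cond_gt0// => p /andP[];rewrite !inE => /orP[/andP[pA _]|/andP[_ pA]] _;
  exact/prime_gt0/(elimT (all_primeP _) hA).
- move=> A /andP[hA hw]/=.
 have e : (pr A)%:R = (pr (A :&: M))%:R * (pr (A :\: M))%:R :> R.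
  rewrite -natrM;congr (_%:R);rewrite {1}/pr (bigID (fun p => p \in M))/=;congr (_ * _)%N.
   by apply: eq_bigl => p;rewrite inE.
  by apply: eq_bigl => p;rewrite inE andbC.
 rewrite e invfM /pr !natr_prod -!prodfV;apply: ler_wpM2l.
  pos.
 apply: ler_prod => p;rewrite inE => /andP[_ pA].
 have p1 := prime_gt1 (elimT (all_primeP _) hA p pA).
 by rewrite invr_ge0 ler0n/= lef_pV2 ?posrE ?subr_gt0 ?ltr1n ?ltr0n ?(ltnW p1)// gerBl.
- move=> [l k] /andP[_ /andP[kP _]];apply: mulr_ge0;last by rewrite invr_ge0 ltW// phs_gt0.
 pos.
Qed.

(* Selberg's upper bound: the indicator function of "no p in Ps divides D x" is at most
   (sum of lam d over d such that every p in d divides D x)^2. *)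
Lemma selberg (X : finType) (C : pred X) (D : X -> nat -> bool) (B E : R) : 0 <= E ->
 (forall d : {set I}, d \subset Ps -> (pr d <= w ^ 2)%N ->
   `|#|[pred x | C x && [forall (p | p \in d), D x p]]|%:R - B / (pr d)%:R| <= E) ->
 #|[pred x | C x && [forall (p | p \in Ps), ~~ D x p]]|%:R <= B / selS + (w ^ 4)%:R * E.
move=> E0 hN.
pose q x (d : {set I}) : R := ([forall (p | p \in d), D x p])%:R.
have qM x d1 d2 : q x d1 * q x d2 = q x (d1 :|: d2).
 rewrite /q -natrM mulnb;congr ((nat_of_bool _)%:R);apply/andP/forall_inP => [[/forall_inP h1 /forall_inP h2] p|h].
  by rewrite inE => /orP[];[apply: h1|apply: h2].
 by split;apply/forall_inP => p pd;apply: h;rewrite inE pd ?orbT.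
via (\sum_(x | C x) (\sum_d lam d * q x d) ^+ 2).
 rewrite -sum1_card natr_sum big_mkcondr;apply: ler_sum => x Cx;case: ifP => [/forall_inP h|_];last exact: sqr_ge0.
 rewrite (bigD1 finset.set0)//= lam0 mul1r big1 ?addr0 => [|d d0].
  rewrite /q (_ : [forall (p : I | p \in finset.set0), D x p] = true) ?expr1n//.
  by apply/forall_inP => p;rewrite inE.
 case: (eqVneq (lam d) 0) => [->|/lam_supp/andP[h1 _]];first lra.
 have /set0Pn[p pd] := d0;rewrite /q;case: (boolP [forall (_ | _), _]) => [/forall_inP/(_ p pd) h2|_];last by rewrite mulr0.
 by have := h p (fintype.subsetP h1 p pd);rewrite h2.
have -> : \sum_(x | C x) (\sum_d lam d * q x d) ^+ 2 = \sum_d1 \sum_d2 lam d1 * lam d2 * #|[pred x | C x && [forall (p | p \in d1 :|: d2), D x p]]|%:R.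
 transitivity (\sum_(x | C x) \sum_d1 \sum_d2 lam d1 * lam d2 * q x (d1 :|: d2)).
  eqbig x;rewrite expr2 mulr_suml;eqbig d1;rewrite mulr_sumr.
  by eqbig d2;rewrite -qM;ring.
 rewrite exchange_big/=;eqbig d1;rewrite exchange_big/=;eqbig d2.
 rewrite -mulr_sumr;congr (_ * _);rewrite -sum1_card natr_sum big_mkcondr/=;eqbig x.
 by rewrite /q;case: ifP.
rewrite -lam_diag mulr_sumr -lerBlDl -sumrB.
via (\sum_d1 \sum_d2 `|lam d1| * `|lam d2| * E);last first.
 via ((\sum_d `|lam d|) ^+ 2 * E).
  rewrite expr2 mulr_suml mulr_suml;lesum d1;rewrite mulr_sumr mulr_suml;exact: ler_sum.
 apply: ler_wpM2r => //;have -> : (w ^ 4)%:R = ((w ^ 2)%:R : R) ^+ 2 by lra.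
 by apply: lerXn2r;rewrite ?nnegrE ?sumr_ge0 ?sum_lam_le.
apply: ler_sum => d1 _;rewrite mulr_sumr -sumrB;lesum d2.
case: (eqVneq (lam d1) 0) => [->|/lam_supp/andP[h1 k1]];first by rewrite normr0 !mul0r mulr0 subrr.
case: (eqVneq (lam d2) 0) => [->|/lam_supp/andP[h2 k2]];first by rewrite normr0 !(mulr0, mul0r) subrr.
have hu : d1 :|: d2 \subset Ps by rewrite finset.subUset h1.
have hw : (pr (d1 :|: d2) <= w ^ 2)%N.
 via (pr d1 * pr d2)%N;last by rewrite expnS expn1 leq_mul.
 rewrite -pr_setUI leq_pmulr// pr_gt0//;apply: all_prime_sub;apply: fintype.subset_trans h1;exact: finset.subsetIl.
have := hN _ hu hw;set n := #|_|%:R => hn.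
have -> : lam d1 * lam d2 * n - B * (lam d1 * lam d2 / (pr (d1 :|: d2))%:R) = lam d1 * lam d2 * (n - B / (pr (d1 :|: d2))%:R) by ring.
by letr (ler_norm _);rewrite normrM normrM;apply: ler_wpM2l hn;rewrite mulr_ge0.
Qed.

End Selberg.

Lemma leg_Fp_val p (x : int) : prime p -> odd p -> leg p (val (x%:~R : 'F_p))%:Z = leg p x.
move=> pp po;apply: (sgn_inj pp po);rewrite ?leg_val// !leg_Fp//;congr (_ ^+ _).
by rewrite -pmulrn natr_Zp.
Qed.

Lemma expn_prod (X : Type) (r : seq X) (P : pred X) (f : X -> nat) k :
 ((\prod_(x <- r | P x) f x) ^ k = \prod_(x <- r | P x) f x ^ k)%N.
exact: (big_morph (expn^~ k) (fun x y => expnMn x y k) (exp1n k)). Qed.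

(** Here n is [nA], a is pr A, t is 2^|A|, P2 the product of the 1 + 1/p over A, om is 2^omega(N), S
    Selberg's sum and lw is log(w+1). *)
Lemma sieve_arith (R : realType) (n P2 t a l1 l2 om S lw : R) : 0 <= n -> 0 <= l1 -> 0 <= l2 ->
 0 < om -> 0 < S -> 0 < lw -> 0 < a -> 0 < t ->
 n * P2 * (t * a) <= a ^+ 4 -> lw <= 2 * (om * P2) * S ->
 n * l1 * l2 / a ^+ 4 / S <= l1 * l2 * (2 * om) / lw / (t * a).
move=> n0 l10 l20 om0 S0 lw0 a0 t0 h3 h5;have a4 : 0 < a ^+ 4 by pos.
have -> : l1 * l2 * (2 * om) / lw / (t * a) = l1 * l2 * (2 * om) / ((t * a) * lw) by lra.
have -> : n * l1 * l2 / a ^+ 4 / S = n * l1 * l2 / (a ^+ 4 * S) by lra.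
rewrite ler_pdivrMr ?mulr_gt0// [leRHS]mulrAC ler_pdivlMr ?mulr_gt0//.
via (n * l1 * l2 * (t * a * (2 * (om * P2) * S))).
 apply: ler_wpM2l;first pos.
 by apply: ler_wpM2l => //;rewrite mulr_ge0// ltW.
have -> : n * l1 * l2 * (t * a * (2 * (om * P2) * S)) = n * P2 * (t * a) * (l1 * l2 * (2 * om) * S) by ring.
have -> : l1 * l2 * (2 * om) * (a ^+ 4 * S) = a ^+ 4 * (l1 * l2 * (2 * om) * S) by ring.
by apply: ler_wpM2r h3;rewrite !mulr_ge0// ltW.
Qed.

(** * Sieving the values of a function of two variables *)

Section LocalCount.
(** D stands for an integral polynomial in two variables. At primes not dividing N only two facts
    are used: p zeros modulo p, and at most p^2 points above each residue modulo p^2 exactly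
    divisible by p. *)
Variables (N : nat) (D : nat -> nat -> int).
Hypothesis N0 : (0 < N)%N.
Hypothesis N2 : (2 %| N)%N.
Hypothesis Dper : forall (n i i' j j' : nat), (i = i' %[mod n])%N -> (j = j' %[mod n])%N -> (D i j = D i' j' %[mod n])%Z.
Hypothesis Dcnt1 : forall p, prime p -> ~~ (p %| N)%N -> cnt p (fun i j => (p %| D i j)%Z) = p.
Hypothesis Dcnt2 : forall p, prime p -> ~~ (p %| N)%N -> forall t : int, (p %| t)%Z -> ~~ ((p ^ 2)%N %| t)%Z ->
 (cnt (p ^ 2) (fun i j => (D i j == t %[mod (p ^ 2)%N])%Z) <= p ^ 2)%N.

Lemma Ddvd n i i' j j' : (i = i' %[mod n])%N -> (j = j' %[mod n])%N -> (n %| D i j)%Z = (n %| D i' j')%Z.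
by move=> ei ej;rewrite -!(sameP eqP dvdz_mod0P) (Dper ei ej). Qed.

(* Exact divisibility by p, together with the sign of the Legendre symbol of - D / pr A at p, where a = pr A / p. *)
Definition Gp (a p : nat) (b : bool) (i j : nat) : bool :=
 [&& (p %| D i j)%Z, ~~ ((p ^ 2)%N %| D i j)%Z & leg p (- (D i j %/ p)%Z * a%:Z) == (-1) ^+ b].

Lemma dvd_mod_lt (n p j : nat) : (n = j %[mod p ^ 2])%N -> (n = j %[mod p])%N.
by move=> e;rewrite -[LHS](@modn_dvdm (p ^ 2)) ?dvdn_exp// e modn_dvdm// dvdn_exp. Qed.

Lemma Gp_per a p b : prime p -> per2 (p ^ 2) (Gp a p b).
move=> pp i i' j j' ei ej;have p0 := prime_gt0 pp.
have e1 := Ddvd (dvd_mod_lt ei) (dvd_mod_lt ej);have e2 := Ddvd ei ej.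
rewrite /Gp e1 e2;case: (boolP (p %| D i' j')%Z) => //= h';case: (boolP (_ %| _)%Z) => //= _.
congr (_ == _);apply: leg_mod => //.
have h : (p %| D i j)%Z by rewrite e1.
have /eqP := Dper ei ej;rewrite eqz_mod_dvd => /dvdzP[q hq].
apply/eqP;rewrite eqz_mod_dvd;apply/dvdzP;exists (- q * a%:Z).
have p0' : (p%:Z != 0) by rewrite eqz_nat -lt0n.
apply: (mulfI p0');rewrite [LHS](_ : _ = - ((D i j %/ p)%Z * p - (D i' j' %/ p)%Z * p) * a%:Z);last ring.
by rewrite !divzK// hq -mulnn PoszM;ring.
Qed.

(** The quotient D/p modulo p must be one of the at most (p-1)/2 residues with the prescribed
    symbol, and each of them has at most p^2 points modulo p^2. This is where the factor 1/2 per
    prime of A is gained. *)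
Lemma Gp_cnt a p b : prime p -> ~~ (p %| N)%N -> ~~ (p %| a)%N -> (cnt (p ^ 2) (Gp a p b) <= (p.-1)./2 * p ^ 2)%N.
move=> pp pN pa;have p0 := prime_gt0 pp.
have po : odd p by case: (even_prime pp) => // e;rewrite e N2 in pN.
pose Q (t : 'I_p) := (leg p (- (t : nat)%:Z * a%:Z) == (-1) ^+ b).
have hQ : (#|Q| <= (p.-1)./2)%N.
 have c0 : (-1 : int) ^+ b != 0 by rewrite signr_eq0.
 apply: leq_trans (card_leg_le pp po c0).
 pose f (t : 'I_p) : 'F_p := (- (t : nat)%:Z * a%:Z)%:~R.
 have finj : injective f.
  move=> t t';rewrite /f !rmorphM/= !rmorphN/= => /(mulIf _) h.
  have a0 : (a%:Z%:~R : 'F_p) != 0.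
   rewrite -pmulrn;apply: contra pa => /eqP h0;rewrite (dvdn_pcharf (pchar_Fp pp));exact/eqP.
  have /oppr_inj := h a0;rewrite -!pmulrn => e.
  apply: val_inj => /=;have := congr1 val e;rewrite /= !val_Fp_nat// !modn_small//.
 rewrite -(card_imset _ finj);apply: subset_leq_card;apply/fintype.subsetP => x /imsetP[t ht ->].
 move: ht;rewrite inE /in_mem/= /Q => /eqP <-;apply/eqP;exact: leg_Fp_val.
rewrite /cnt.
pose W := (\sum_(t | Q t) cnt (p ^ 2) (fun i j => [&& (p %| (t%:Z * p%:Z)%R)%Z, ~~ ((p ^ 2)%N %| (t%:Z * p%:Z)%R)%Z & (D i j == (t%:Z * p%:Z)%R %[mod (p ^ 2)%N])%Z]))%N.
apply: (@leq_trans W);rewrite {}/W;last first.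
 apply: (@leq_trans (\sum_(t | Q t) p ^ 2)%N);last by rewrite sum_nat_const leq_mul.
 apply: leq_sum => t _;case: (boolP ((p %| (t%:Z * p%:Z)%R)%Z && ~~ ((p ^ 2)%N %| (t%:Z * p%:Z)%R)%Z)) => [/andP[h1 h2]|/negbTE h].
  by rewrite h1 h2/=;apply: Dcnt2.
 by rewrite /cnt big1// => i _;rewrite big1// => j _;rewrite andbA h.
rewrite /cnt [leqRHS]exchange_big/=;apply: leq_sum => i _;rewrite [leqRHS]exchange_big/=;apply: leq_sum => j _.
case: (boolP (Gp a p b i j)) => // /and3P[h1 h2 h3].
pose t0 := `|((D i j %/ p)%Z %% p)%Z|%N.
have p0' : (p%:Z != 0) by rewrite eqz_nat -lt0n.
have t0E : t0%:Z = ((D i j %/ p)%Z %% p)%Z by rewrite /t0 gez0_abs// modz_ge0.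
have t0p : (t0 < p)%N by rewrite -ltz_nat t0E ltz_pmod// ltz_nat.
have key : (D i j == t0%:Z * p%:Z %[mod (p ^ 2)%N])%Z.
 rewrite eqz_mod_dvd;apply/dvdzP;exists ((D i j %/ p)%Z %/ p)%Z.
 rewrite -{1}(divzK h1) {1}(divz_eq (D i j %/ p)%Z p) t0E [X in _ = _ * X](_ : _ = p%:Z * p%:Z);first ring.
 by rewrite -mulnn PoszM.
have d1 : ((p ^ 2)%N %| t0%:Z * p%:Z)%Z = ((p ^ 2)%N %| D i j)%Z by rewrite -!(sameP eqP dvdz_mod0P) (eqP key).
rewrite (bigD1 (Ordinal t0p))/=;last first.
 rewrite /Q/= -(eqP h3);apply/eqP;apply: leg_mod => //.
 apply/eqP;rewrite eqz_mod_dvd t0E;apply/dvdzP;exists (((D i j %/ p)%Z %/ p)%Z * a%:Z).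
 by rewrite {2}(divz_eq (D i j %/ p)%Z p);ring.
by rewrite d1 h2 key dvdz_mull.
Qed.

Variables (z w : nat) (A : pset z) (s : pset z).
Hypotheses (hA : odd_primes A) (AN : forall p, p \in A -> ~~ (p %| N)%N) (Az : (pr A <= z)%N) (wz : (w <= z)%N) (w1 : (0 < w)%N).

Definition GA (i j : nat) : bool := [forall (p | p \in A), Gp (pr A %/ p) p (p \in s) i j].

Definition Ps : {set 'I_w.+1} := [set p : 'I_w.+1 | [&& prime p, ~~ (p %| N)%N & ~~ (p %| pr A)%N]].

Lemma Ps_all : all_prime Ps.
by apply/all_primeP => p;rewrite inE => /andP[]. Qed.

Definition nA : nat := (\prod_(p in A) cnt (p ^ 2) (Gp (pr A %/ p) p (p \in s)))%N.

Lemma A_prime p : p \in A -> prime p.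
by move=> pA;case/andP: (forall_inP hA p pA). Qed.

Lemma pr_div (p : 'I_z.+1) : p \in A -> (pr A %/ p = \prod_(q in A | q != p) q)%N.
by move=> pA;rewrite /pr (bigD1 p)//= mulKn// prime_gt0// A_prime. Qed.

Lemma ndvd_div (p : 'I_z.+1) : p \in A -> ~~ (p %| pr A %/ p)%N.
move=> pA;rewrite pr_div//;have pp := A_prime pA.
rewrite Euclid_dvd_prod//;apply/negP;rewrite big_has_cond => /hasP[q _ /andP[/andP[qA qp]]].
by rewrite dvdn_prime2 ?A_prime// => /eqP e;move: qp;rewrite -val_eqE/= e eqxx.
Qed.

Lemma Gp_cntA (p : 'I_z.+1) : p \in A -> (cnt (p ^ 2) (Gp (pr A %/ p) p (p \in s)) <= (p.-1)./2 * p ^ 2)%N.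
by move=> pA;apply: Gp_cnt;[exact: A_prime|exact: AN|exact: ndvd_div]. Qed.

Lemma nA_le : (nA <= pr A ^ 3)%N.
rewrite /nA /pr expn_prod;apply: leq_prod => p pA;letr (Gp_cntA pA).
by rewrite leq_mul2r;apply/orP;right;apply: leq_trans (leq_pred p);by rewrite leq_half_double;lia.
Qed.

Lemma allE (n : nat) (B : {set 'I_n}) (P : 'I_n -> bool) : all P (enum B) = [forall (p | p \in B), P p].
apply/allP/forall_inP => h p pB;apply: h;by rewrite ?mem_enum// -mem_enum.
Qed.

(** The conditions at different primes are independent by the Chinese remainder theorem. *)
Lemma count_GA (d : {set 'I_w.+1}) : d \subset Ps ->
 let M := (pr A ^ 2 * pr d)%N in
 let G i j := GA i j && [forall (p | p \in d), (p %| D i j)%Z] in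
 cnt M G = (nA * pr d)%N /\ per2 M G.
move=> dP M G.
have dp p : p \in d -> [&& prime p, ~~ (p %| N)%N & ~~ (p %| pr A)%N] by move=> /(fintype.subsetP dP);rewrite inE.
have cop (p q : nat) : prime p -> prime q -> p != q -> coprime p q by move=> pp qq pq;rewrite prime_coprime// dvdn_prime2.
have [] := @cnt_prod _ (enum A) (fun p : 'I_z.+1 => p ^ 2)%N (fun p => Gp (pr A %/ p) p (p \in s)) (enum_uniq _).
- move=> p q;rewrite !mem_enum => pA qA pq;rewrite coprimeXl// coprimeXr// cop ?A_prime//.
- by move=> p;rewrite mem_enum => pA;rewrite expn_gt0 prime_gt0// A_prime.
- by move=> p;rewrite mem_enum => pA;apply: Gp_per;exact: A_prime.
move=> c1 p1.
have [] := @cnt_prod _ (enum d) (fun p : 'I_w.+1 => p : nat) (fun p i j => (p %| D i j)%Z) (enum_uniq _).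
- by move=> p q;rewrite !mem_enum => /dp/and3P[pp _ _] /dp/and3P[qp _ _] pq;rewrite cop.
- by move=> p;rewrite mem_enum => /dp/and3P[pp _ _];rewrite prime_gt0.
- by move=> p _ i i' j j' ei ej;apply: Ddvd.
move=> c2 p2.
have e1 : (\prod_(p <- enum A) p ^ 2 = pr A ^ 2)%N by rewrite big_enum/= /pr expn_prod.
have e2 : (\prod_(p <- enum d) p = pr d)%N by rewrite big_enum.
have e3 : (\prod_(p <- enum A) cnt (p ^ 2) (Gp (pr A %/ p) p (p \in s)) = nA)%N by rewrite big_enum.
have e4 : (\prod_(p <- enum d) cnt p (fun i j => (p %| D i j)%Z) = pr d)%N.
 by rewrite big_enum;apply: eq_bigr => p /dp/and3P[pp pN _];exact: Dcnt1.
rewrite e1 e3 in c1;rewrite e1 in p1;rewrite e2 e4 in c2;rewrite e2 in p2.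
have co : coprime (pr A ^ 2) (pr d).
 rewrite coprimeXl//;apply: (big_ind (fun k => coprime (pr A) k)) => [|a b ca cb|p /dp/and3P[pp _ pA]];first exact: coprimen1.
  by rewrite coprimeMr ca.
 by rewrite coprime_sym prime_coprime.
have A0 : (0 < pr A ^ 2)%N by rewrite expn_gt0 pr_gt0 ?odd_primes_all.
have d0 : (0 < pr d)%N by apply: prodn_cond_gt0 => p /dp/and3P[pp _ _];rewrite prime_gt0.
have eG i j : G i j = all (fun p : 'I_z.+1 => Gp (pr A %/ p) p (p \in s) i j) (enum A) && all (fun p : 'I_w.+1 => (p %| D i j)%Z) (enum d).
 by rewrite !allE.
split.
 rewrite -c1 -c2 -cnt_crt//;eqbig i;eqbig j;by rewrite eG.
move=> i i' j j' ei ej;rewrite !eG;congr (_ && _).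
 by apply: (per2_dvd (m := pr A ^ 2) _ p1) ei ej;exact: dvdn_mulr.
by apply: (per2_dvd (m := pr d) _ p2) ei ej;exact: dvdn_mull.
Qed.

Variable R : realType.
Variables (L1 L2 : nat).

Lemma GA_box (d : {set 'I_w.+1}) : d \subset Ps -> (pr d <= w ^ 2)%N ->
 `|#|[pred x : 'I_L1 * 'I_L2 | GA x.1 x.2 && [forall (p | p \in d), (p %| D x.1 x.2)%Z]]|%:R -
   (nA%:R * L1%:R * L2%:R / (pr A)%:R ^+ 4) / (pr d)%:R| <= (z ^ 5)%:R * (L1%:R + L2%:R + 1) :> R.
move=> dP dw;have [hc hp] := count_GA dP.
have A0 : (0 < pr A)%N by rewrite pr_gt0 ?odd_primes_all.
have d0 : (0 < pr d)%N by apply: prodn_cond_gt0 => p /(fintype.subsetP dP);rewrite inE => /and3P[pp _ _];rewrite prime_gt0.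
have M0 : (0 < pr A ^ 2 * pr d)%N by lia.
have := box_count R L1 L2 M0 hp;rewrite hc.
set c1 := (\sum_(i < L1) _)%N;set c2 := #|_|.
have -> : c1 = c2.
 rewrite /c1 /c2 pair_big -sum1_card [RHS]big_mkcond;eqbig x;rewrite inE;by [].
have Ar : (pr A)%:R != 0 :> R by pos.
have dr : (pr d)%:R != 0 :> R by pos.
set a := (pr A)%:R in Ar *;set b := (pr d)%:R in dr *.
have -> : (nA * pr d)%:R * (L1%:R / (pr A ^ 2 * pr d)%:R) * (L2%:R / (pr A ^ 2 * pr d)%:R) = nA%:R * L1%:R * L2%:R / a ^+ 4 / b :> R.
 rewrite -/b;field;by rewrite dr Ar.
move/le_trans;apply.
apply: ler_pM => //;last 1 first.
- rewrite lerD2r;apply: lerD;rewrite ler_pdivrMr ?ltr0n// ler_peMr// ler1n//.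
- by rewrite !addr_ge0// divr_ge0.
rewrite ler_nat;via (z ^ 3 * z ^ 2)%N;last lia.
apply: leq_mul;first by letr nA_le;rewrite leq_exp2r.
by letr dw;rewrite leq_exp2r.
Qed.

(** At each prime, (p-1)/2 p^2 (1 + 1/p) 2p = p^4 - p^2. The product of the 1 + 1/p is included
    because the primes of A are not sieved. *)
Lemma density_le : (nA%:R * \prod_(p in A) (1 + p%:R^-1)) * (2 ^+ #|A| * (pr A)%:R) <= (pr A)%:R ^+ 4 :> R.
rewrite /nA /pr !natr_prod -!prodr_const -!big_split -prodrXl/=;apply: ler_prod => p pA.
have pp := A_prime pA;have p0 : 0 < p%:R :> R by pos.
have p1 : 1 <= p%:R :> R by rewrite ler1n prime_gt0.
apply/andP;split;first pos.
set c := cnt _ _.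
have hc : c%:R <= (p%:R - 1) / 2 * p%:R ^+ 2 :> R.
 via (((p.-1)./2 * p ^ 2)%:R);first by rewrite ler_nat;exact: Gp_cntA.
 rewrite natrM natrX;apply: ler_wpM2r;first pos.
 have -> : p%:R - 1 = (p.-1)%:R :> R by rewrite -subn1 natrB ?prime_gt0.
 rewrite ler_pdivlMr// -natrM ler_nat muln2 -[leqRHS]odd_double_half;exact: leq_addl.
via ((p%:R - 1) / 2 * p%:R ^+ 2 * (1 + p%:R^-1) * (2 * p%:R)).
 by apply: ler_wpM2r;[rewrite mulr_ge0// ltW | apply: ler_wpM2r => //;rewrite addr_ge0// invr_ge0 ltW].
have -> : (p%:R - 1) / 2 * p%:R ^+ 2 * (1 + p%:R^-1) * (2 * p%:R) = p%:R ^+ 4 - p%:R ^+ 2 :> R by field;rewrite gt_eqF.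
by rewrite lerBlDr lerDl exprn_ge0//.
Qed.

(** The primes excluded from the sieve divide N, where 1 + 1/p is at most 2, or belong to A. *)
Lemma prod_bad_le : \prod_(p : 'I_w.+1 | prime p && ((p %| N) || (p %| pr A))%N) (1 + p%:R^-1) <=
  2 ^+ size (primes N) * \prod_(p in A) (1 + p%:R^-1) :> R.
have f1 (p : nat) : 1 <= 1 + p%:R^-1 :> R by rewrite lerDl invr_ge0.
have f2 (p : nat) : 1 + p%:R^-1 <= 2 :> R.
 have : p%:R^-1 <= 1 :> R;last lra.
 by case: p => [|p];[rewrite invr0|rewrite invf_le1 ?ltr0n// ler1n].
have f0 (p : nat) : 0 <= 1 + p%:R^-1 :> R by apply: le_trans (f1 p).
rewrite (bigID (fun p : 'I_w.+1 => (p %| N)%N))/=;apply: ler_pM;rewrite ?prodr_ge0//.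
 via (\prod_(p : 'I_w.+1 | prime p && (p %| N)%N) (2 : R)).
  rewrite (eq_bigl (fun p : 'I_w.+1 => prime p && (p %| N)%N)) => [|p].
   by apply: ler_prod => p _;rewrite f0 f2.
  by case: (p %| N)%N;rewrite ?andbT ?andbF.
 rewrite prodr_const;apply: ler_weXn2l;first lra.
 rewrite cardE -(size_map val);apply: uniq_leq_size.
  by rewrite map_inj_uniq ?enum_uniq//;exact: val_inj.
 move=> q /mapP[p];rewrite mem_enum unfold_in => /andP[pp pN] ->.
 by rewrite mem_primes pp N0.
rewrite (eq_bigl (fun p : 'I_w.+1 => [&& prime p, ~~ (p %| N)%N & (p %| pr A)%N])) => [|p];last first.
 by case: (p %| N)%N;rewrite ?andbT ?andbF ?andbT.
rewrite (big_ord_widen_cond z.+1 (fun p => [&& prime p, ~~ (p %| N)%N & (p %| pr A)%N]) (fun p => 1 + p%:R^-1))//.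
have hs (p : 'I_z.+1) : [&& prime p, ~~ (p %| N)%N & (p %| pr A)%N] && (p < w.+1)%N -> p \in A by move=> /andP[/and3P[pp _ pA] _];rewrite -prime_dvd_pr// odd_primes_all.
rewrite big_mkcond [leRHS]big_mkcond;apply: ler_prod => p _;case: ifP => h.
 by rewrite hs// f0 lexx.
by rewrite ler01/=;case: ifP => // _;exact: f1.
Qed.

(** [selberg] applied to the points satisfying [GA]; the primes dividing N or pr A enter only
    through the lower bound for Selberg's sum. *)
Lemma sieve_count :
 #|[pred x : 'I_L1 * 'I_L2 | GA x.1 x.2 &&
   [forall p : 'I_w.+1, [&& prime p, ~~ (p %| N)%N & ~~ (p %| pr A)%N] ==> ~~ (p %| D x.1 x.2)%Z]]|%:R <=
  (L1 * L2)%:R * 2 ^+ (size (primes N)).+1 / ln w.+1%:R / (2 ^+ #|A| * (pr A)%:R) +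
   (z ^ 9)%:R * (L1%:R + L2%:R + 1) :> R.
have A0 : (0 < pr A)%N by rewrite pr_gt0 ?odd_primes_all.
have z0 : (0 < z)%N := leq_trans w1 wz.
have E0 : 0 <= (z ^ 5)%:R * (L1%:R + L2%:R + 1) :> R by pos.
have := @selberg R w Ps w1 Ps_all _ (fun x : 'I_L1 * 'I_L2 => GA x.1 x.2) (fun (x : 'I_L1 * 'I_L2) p => (p %| D x.1 x.2)%Z) _ _ E0 GA_box.
set B := _ / (pr A)%:R ^+ 4 => hs.
via (B / selS R Ps + (w ^ 4)%:R * ((z ^ 5)%:R * (L1%:R + L2%:R + 1))).
 apply: le_trans hs;rewrite ler_nat;apply: subset_leq_card;apply/fintype.subsetP => x.
 rewrite !inE => /andP[-> /forallP h];apply/forall_inP => p;rewrite inE => hp.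
 by have := h p;rewrite hp.
apply: lerD;last first.
 rewrite mulrA -natrM;apply: ler_wpM2r;first pos.
 by rewrite ler_nat (_ : 9 = 4 + 5)%N// expnD leq_mul2r leq_exp2r// wz orbT.
pose M : {set 'I_w.+1} := [set p : 'I_w.+1 | prime p && ((p %| N) || (p %| pr A))%N].
have hM : all_prime M by apply/all_primeP => p;rewrite inE => /andP[].
have cov (p : 'I_w.+1) : prime p -> (p \in Ps) || (p \in M) by move=> pp;rewrite !inE pp;case: (p %| N)%N;case: (p %| pr A)%N.
have := selS_lower R Ps_all hM cov.
have S1 : 1 <= selS R Ps by apply: selS_ge1;rewrite ?Ps_all.
have -> : \prod_(p in M) (1 + p%:R^-1) = \prod_(p : 'I_w.+1 | prime p && ((p %| N) || (p %| pr A))%N) (1 + p%:R^-1) :> R by apply: eq_bigl => p;rewrite inE.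
have h2 := prod_bad_le;have h3 := density_le.
set P1 := \prod_(p | _) _ in h2 *;set P2 := \prod_(p in A) _ in h2 h3 *.
set S := selS R Ps in S1 *;set om := 2 ^+ size (primes N) in h2 *.
have lw : 0 < ln w.+1%:R :> R by rewrite ln_gt0// ltr1n ltnS.
have a0 : 0 < (pr A)%:R :> R by pos.
have t0 : 0 < 2 ^+ #|A| :> R by pos.
have S0 : 0 < S by lra.
move=> h4;rewrite -/S.
have h5 : ln w.+1%:R <= 2 * (om * P2) * S by letr h4;apply: ler_wpM2r;[exact: ltW|apply: ler_wpM2l].
rewrite /B natrM (exprS 2 (size (primes N))) -/om;apply: sieve_arith h3 h5 => //;pos.
Qed.

End LocalCount.

(** * Classes of initial factors and their moments *)

Lemma root_ex z v : (0 < z)%N -> exists w, [&& (0 < w)%N, (w <= z)%N, (w ^ v.+1 <= z)%N & (z < w.+1 ^ v.+1)%N].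
move=> z0;pose P w := (w ^ v.+1 <= z)%N.
have ex : exists w, P w by exists 0%N;rewrite /P exp0n.
have le w : P w -> (w <= z)%N.
 case: w => // w h;apply: leq_trans h;rewrite -{1}(expn1 w.+1);exact: leq_pexp2l.
case: (ex_maxnP ex le) => w hw hmax;exists w;rewrite (le w hw) (hw : w ^ v.+1 <= z)%N/=.
apply/andP;split;first by apply: hmax;rewrite /P exp1n.
by rewrite ltnNge;apply/negP => /hmax;rewrite ltnn.
Qed.

Section ClassMoment.
Variables (R : realType).

Lemma prod_1D2 : exists2 C : R, 0 < C & forall z, (1 < z)%N ->
 \prod_(0 <= p < z.+1 | prime p) (1 + 2 / p%:R) <= C * ln z%:R ^+ 2.
have [C [C0 hC]] := mertens_upper R;exists (C ^+ 2) => [|z z2];first pos.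
letr (prod_le_expR _ _) => [p _|];first pos.
rewrite -mulr_sumr mulr2n mulrDl !mul1r expRD -expr2 -exprMn.
by apply: lerXn2r;rewrite ?nnegrE ?expR_ge0 ?hC ?mulr_ge0 ?(ltW C0) ?ln_nat_ge0.
Qed.

(** The sets A that can be the initial factor of a value whose next prime q satisfies q^v <= z <
    q^(v+1). If v is at least 2, then A is z^(1/v)-smooth with product larger than the square root
    of z. *)
Definition clA (v z : nat) (A : pset z) : bool :=
 [&& odd_primes A, (pr A <= z)%N &
  (1 < v)%N ==> [forall (p | p \in A), (p ^ v <= z)%N] && (z < pr A ^ 2)%N].

(** For v at least 2 Rankin's trick is applied with smoothness w = z^(1/v), rounded down, and x =
    sqrt z: the exponent K log x / log w is at least Kv/2. For v at most 1 the full Euler product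
    suffices. *)
Lemma smooth_bound (K : R) : 0 <= K -> exists2 C : R, 0 < C & forall z v, (1 < z)%N -> (2 ^ v <= z)%N ->
 \sum_(A : pset z | clA v A) 2 ^+ #|A| / (pr A)%:R <= C * expR (- (K / 2 * v%:R)) * ln z%:R ^+ 2.
move=> K0;have [C C0 hC] := prod_1D2.
pose E : R := 4 * K * expR K.
have E0 : 0 <= E by pos.
have eW n (A : {set 'I_n}) : 2 ^+ #|A| / (pr A)%:R = \prod_(p in A) (2 / p%:R) :> R by rewrite -prodr_const natr_prod -prodf_div.
exists (C * expR (E + K)) => [|z v z2 zv];first pos.
have lz := ln_nat_gt0 R z2.
case: (leqP v 1) => hv.
 via (\prod_(0 <= p < z.+1 | prime p) (1 + 2 / p%:R)).
  rewrite prod1D_set big_mkcond [leRHS]big_mkcond;lesum A;rewrite eW.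
  have p0 : 0 <= \prod_(p in A) (2 / p%:R) :> R by pos.
  case: ifP => [/andP[/odd_primes_all -> _]//|_];by case: ifP.
 letr (hC z z2);rewrite -!mulrA;apply: ler_wpM2l;first exact: ltW.
 rewrite mulrA ler_peMl ?sqr_ge0// -expRD -[leLHS]expR0 ler_expR.
 have : v%:R <= 1 :> R by rewrite lern1.
 by nra.
have [w /and4P[w0 wz h1 h2]] := root_ex v.-1 (ltnW z2).
rewrite (prednK (ltnW hv)) in h1 h2.
have w2 : (1 < w)%N.
 rewrite ltnNge;apply/negP => w1;move: (leq_ltn_trans zv h2);rewrite ltn_exp2r ?(ltnW hv);lia.
have lw := ln_nat_gt0 R w2.
have wz1 : (w.+1 <= z.+1)%N by [].
pose h (A : pset z) : {set 'I_w.+1} := [set q | widen_ord wz1 q \in A].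
pose x : R := expR (ln z%:R / 2).
have x2 : x ^+ 2 = z%:R by rewrite expr2 -expRD -splitr lnK// posrE ltr0n ltnW.
have hA A : clA v A -> [set widen_ord wz1 q | q in h A] = A.
 move=> /and3P[_ _ /implyP/(_ hv)/andP[/forall_inP sm _]];apply/setP => p;apply/imsetP/idP => [[q]|pA].
  by rewrite inE => qA ->.
 have pw : (p < w.+1)%N by have := leq_ltn_trans (sm p pA) h2;rewrite ltn_exp2r// ltnW.
 by exists (Ordinal pw);[rewrite inE;congr (_ \in A) : pA;apply: val_inj|apply: val_inj].
have winj : injective (widen_ord wz1) by move=> a b /(congr1 val)/= /val_inj.
have hpr A : clA v A -> pr (h A) = pr A by move=> c;rewrite -{2}(hA A c) /pr big_imset//= => a b _ _;exact: winj.
via (\sum_(A : {set 'I_w.+1} | all_prime A && (x < (pr A)%:R)) \prod_(p in A) (2 / p%:R)).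
 apply: (ler_sum_inj (h := h)).
 - by move=> A B cA cB e;rewrite -(hA A cA) -(hA B cB) e.
 - move=> A cA;have /and3P[oA _ /implyP/(_ hv)/andP[_ zA]] := cA;apply/andP;split.
   by apply/all_primeP => q;rewrite inE => qA;exact: (all_primeP _ (odd_primes_all oA) _ qA).
  rewrite hpr// -(ltr_pXn2r (n := 2)) ?nnegrE ?expR_ge0// x2 -natrX ltr_nat//.
 - move=> A cA;rewrite eW -{1}(hA A cA) big_imset//= => a b _ _;exact: winj.
 - by move=> A _;apply: prodr_ge0 => p _;rewrite divr_ge0.
have x0 : 0 < x := expR_gt0 _.
have hw2 (p : nat) : (0 < p)%N -> 0 <= 2 / (p%:R : R) <= 2 / (p%:R : R) by move=> _;rewrite divr_ge0//=.
letr (rankin w2 K0 x0 hw2).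
rewrite [leRHS](_ : _ = (expR (E + K) * expR (- (K / 2 * v%:R))) * (C * ln z%:R ^+ 2));last ring.
apply: ler_pM;rewrite ?expR_ge0 ?prodr_ge0//.
- by move=> p _;rewrite addr_ge0// divr_ge0.
- rewrite -expRD ler_expR -/E /x expRK.
 have h3 : v%:R * ln w%:R <= ln z%:R :> R by rewrite mulr_natl -lnXn ?ltr0n// -natrX;apply: ln_nat_le;rewrite expn_gt0 w0.
 have h4 : K / 2 * v%:R <= K * (ln z%:R / 2) / ln w%:R.
  rewrite ler_pdivlMr//;have := ler_wpM2l K0 h3;lra.
 lra.
- letr (hC w w2);apply: ler_wpM2l;first exact: ltW.
 by apply: lerXn2r;rewrite ?nnegrE ?ln_nat_ge0// ln_nat_le// w0.
Qed.

Variable m : nat.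
Hypothesis m0 : (0 < m)%N.

(** With t = exp(-Kv/4), the inequality 2x <= t x^2 + 1/t for x = Kc^m splits the sum into the
    moment of order 2m, of size (log z)^2, and the sum of 2^|A|/pr A, small by [smooth_bound]. *)
Lemma class_moment (K : R) : 0 <= K -> exists2 C : R, 0 < C & forall z v, (1 < z)%N -> (2 ^ v <= z)%N ->
 \sum_(A : pset z | clA v A) (pr A)%:R^-1 * \sum_(s : pset z | s \subset A) ((Kc A s)%:R : R) ^+ m <=
  C * expR (- (K / 4 * v%:R)) * ln z%:R ^+ 2.
move=> K0;have [C1 C10 h1] := smooth_bound K0.
have m20 : (0 < m * 2)%N by lia.
have [C2 C20 h2] := moment_bound R m20.
exists (C2 + C1) => [|z v z2 zv];first lra.
pose t : R := expR (- (K / 4 * v%:R));have t0 : 0 < t := expR_gt0 _.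
have i0 n (A : {set 'I_n}) : 0 <= (pr A)%:R^-1 :> R by pos.
via (\sum_(A : pset z | clA v A) (t * ((pr A)%:R^-1 * \sum_(s : pset z | s \subset A) ((Kc A s)%:R : R) ^+ (m * 2))
  + t^-1 * (2 ^+ #|A| / (pr A)%:R))).
 lesum A.
 rewrite [leRHS](_ : _ = (pr A)%:R^-1 * (t * \sum_(s : pset z | s \subset A) ((Kc A s)%:R : R) ^+ (m * 2) + t^-1 * 2 ^+ #|A|));last ring.
 apply: ler_wpM2l => //.
 have -> : 2 ^+ #|A| = \sum_(s : pset z | s \subset A) (1 : R).
  rewrite sumr_const -natrX -card_powerset;congr (_%:R);apply: eq_card => s;by rewrite inE.
 rewrite mulr_sumr mulr_sumr -big_split/=;lesum s.
 rewrite mulr1 exprM;set x := (Kc A s)%:R ^+ m;have x0 : 0 <= x by pos.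
 have : 0 <= t * (x - t^-1) ^+ 2 by pos.
 have -> : t * (x - t^-1) ^+ 2 = t * x ^+ 2 + t^-1 - 2 * x by field;rewrite gt_eqF.
 lra.
rewrite big_split/= -!mulr_sumr !mulrDl;apply: lerD.
 rewrite -mulrA mulrCA;apply: ler_wpM2l;first exact: ltW.
 apply: le_trans (h2 z z2);rewrite big_mkcond [leRHS]big_mkcond;lesum A.
 have p0 : 0 <= (pr A)%:R^-1 * \sum_(s : pset z | s \subset A) ((Kc A s)%:R : R) ^+ (m * 2) by pos.
 by case: ifP => [/and3P[-> -> _]//|_];case: ifP.
letr (ler_wpM2l _ (h1 z v z2 zv));first pos.
apply: eqler.
have -> : expR (- (K / 2 * v%:R)) = t * t by rewrite -expRD;congr expR;field.
by rewrite -/t;field;rewrite gt_eqF.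
Qed.
End ClassMoment.

Lemma prod_primes_dvd (r : seq nat) (n : nat) : uniq r -> all prime r -> all (fun p => p %| n)%N r ->
 (\prod_(p <- r) p %| n)%N.
elim: r => [|p r IH]/=;first by rewrite big_nil dvd1n.
move=> /andP[pr ur] /andP[pp ap] /andP[pn an];rewrite big_cons Gauss_dvd ?pn ?IH//.
rewrite big_seq;apply: (big_ind (fun k => coprime p k)) => [|a b ca cb|q qr];first exact: coprimen1.
 by rewrite coprimeMr ca.
rewrite prime_coprime// dvdn_prime2//;last exact: (allP ap).
by apply: contraNneq pr => ->.
Qed.

(** The symbol equals that of -D/pr A at p, because (D/p)(pr A/p) is D/pr A times a square. *)
Definition sset (z : nat) (A : pset z) (D : int) : pset z :=
 [set p in A | leg p (- (D %/ (p : nat)%:Z)%Z * (pr A %/ p)%N%:Z) == -1].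

Definition omout (z : nat) (A : pset z) (D : int) : nat :=
 size [seq p <- primes `|D|%N | ~~ (p %| pr A)%N].

Section ClassExists.
Variables (N z kappa : nat) (D : int).
Hypotheses (N0 : (0 < N)%N) (z2 : (1 < z)%N) (D0 : D != 0) (Dle : (`|D|%N <= z ^ kappa)%N).
Hypothesis N2 : (2 %| N)%N.

Lemma omout_le (A : pset z) v : (forall p, prime p -> (p %| `|D|)%N -> ~~ (p %| N)%N -> ~~ (p %| pr A)%N -> (z < p ^ v.+1)%N) ->
 (omout A D <= size (primes N) + kappa * v.+1)%N.
move=> h;rewrite /omout -(count_predC (fun p => p %| N)%N) -!size_filter.
apply: leq_add.
 apply: uniq_leq_size;first by rewrite !filter_uniq ?primes_uniq.
 move=> p;rewrite !mem_filter mem_primes => /andP[pN /andP[_ /andP[pp _]]].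
 by rewrite mem_primes pp N0.
set r := [seq p <- _ | _].
have rP p : p \in r -> [/\ prime p, (p %| `|D|)%N, ~~ (p %| N)%N & ~~ (p %| pr A)%N] by rewrite !mem_filter mem_primes => /and3P[/= h1 h2 /and3P[h3 h4 h5]].
have ur : uniq r by rewrite !filter_uniq ?primes_uniq.
have d1 : (\prod_(p <- r) p %| `|D|)%N by apply: prod_primes_dvd => //;apply/allP => p /rP[].
have h2 : (z ^ size r <= (\prod_(p <- r) p) ^ v.+1)%N.
 have -> : (z ^ size r = \prod_(p <- r) z)%N by rewrite big_const_seq count_predT;elim: (size r) => //= n <-;rewrite expnS.
 rewrite expn_prod big_seq [leqRHS]big_seq;apply: leq_prod => p /rP[a b c e].
 by apply: ltnW;exact: h.
rewrite -(leq_exp2l _ _ z2);letr h2;rewrite expnM leq_exp2r//.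
by apply: leq_trans Dle;apply: dvdn_leq => //;rewrite absz_gt0.
Qed.

(** A consists of the primes up to t of D not dividing N, with t maximal such that their product is
    at most z. Either t = z, and then v = 0, or t + 1 is the next prime of D and v is the integral
    part of log z / log(t+1); in that case z < (t+1) pr A, so pr A exceeds sqrt z when v is at least
    2. *)
Lemma class_exists : exists v (A : pset z), [/\ (v <= z)%N, clA v A, (forall p, p \in A -> ~~ (p %| N)%N && (p %| `|D|)%N),
 (forall w p, (w ^ v.+1 <= z)%N -> (p <= w)%N -> prime p -> ~~ (p %| N)%N -> ~~ (p %| pr A)%N -> ~~ (p %| `|D|)%N) &
 (omout A D <= size (primes N) + kappa * v.+1)%N].
pose At t : pset z := [set p : 'I_z.+1 | [&& prime p, ~~ (p %| N)%N, (p %| `|D|)%N & (p <= t)%N]].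
have AtP t p : p \in At t -> [/\ prime p, ~~ (p %| N)%N, (p %| `|D|)%N & (p <= t)%N] by rewrite inE => /and4P[].
have Ato t : odd_primes (At t).
 apply/forall_inP => p /AtP[pp pN _ _];rewrite pp/=.
 by case: (even_prime pp) => // e;rewrite e N2 in pN.
have Atp t := odd_primes_all (Ato t).
pose P t := (t <= z)%N && (pr (At t) <= z)%N.
have ex : exists t, P t.
 exists 0%N;rewrite /P/= /pr big_pred0 ?(ltnW z2)// => p;apply/negP => /AtP[pp _ _].
 by rewrite leqn0 => /eqP e;rewrite e in pp.
have le t : P t -> (t <= z)%N by case/andP.
case: (ex_maxnP ex le) => t /andP[tz prz] tmax.
have mem p : prime p -> ~~ (p %| N)%N -> (p %| `|D|)%N -> (p <= t)%N -> (p %| pr (At t))%N.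
 move=> pp pN pD pt;have pz : (p < z.+1)%N by lia.
 by rewrite -[p]/(val (Ordinal pz)) prime_dvd_pr// inE/= pp pN pD pt.
have small w v q : (w ^ v.+1 <= z)%N -> (z < q ^ v.+1)%N -> (w < q)%N by move=> h1 h2;have := leq_ltn_trans h1 h2;rewrite ltn_exp2r.
move: tz;rewrite leq_eqVlt => /orP[/eqP tz|tz].
 have nt p : prime p -> (p %| `|D|)%N -> ~~ (p %| N)%N -> ~~ (p %| pr (At t))%N -> (z < p)%N by move=> pp pD pN;apply: contraR;rewrite -leqNgt => pz;apply: mem;rewrite // tz.
 exists 0%N, (At t);split => //.
 - by rewrite /clA Ato prz.
 - by move=> p /AtP[_ -> ->].
 - move=> w p wz pw pp pN;apply: contra => pD;apply: mem => //;rewrite tz.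
  lia.
 - by apply: omout_le => p pp pD pN pA;rewrite expn1;exact: nt.
have big : (z < pr (At t.+1))%N by rewrite ltnNge;apply/negP => h;have := tmax t.+1;rewrite /P tz h => /(_ isT);rewrite ltnn.
have [qP|qn] := boolP [&& prime t.+1, ~~ (t.+1 %| N)%N & (t.+1 %| `|D|)%N];last first.
 suff e : At t.+1 = At t by rewrite e ltnNge prz in big.
 apply/setP => p;rewrite !inE leq_eqVlt ltnS;case: eqP => [e|//].
 by rewrite -e in qn;case: (prime p) qn => //=;case: (p %| N)%N => //=;case: (p %| `|D|)%N => //.
have q0 : (0 < t.+1)%N by [].
case/and3P: qP => qp qN qD.
have q1 := prime_gt1 qp.
have prE : pr (At t.+1) = (t.+1 * pr (At t))%N.
 have tz' : (t.+1 < z.+1)%N by [].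
 rewrite /pr (bigD1 (Ordinal tz'))/=;last by rewrite inE qp qN qD leqnn.
 congr (_ * _)%N;apply: eq_bigl => p;rewrite !inE -val_eqE/= leq_eqVlt ltnS.
 by case: eqP => [->|_];rewrite ?ltnn ?andbF ?andbT.
pose v := trunc_log t.+1 z.
have /andP[v1 v2] : (t.+1 ^ v <= z < t.+1 ^ v.+1)%N by apply: trunc_log_bounds;rewrite // ltnW.
have vz : (v <= z)%N by apply: leq_trans v1;apply: ltnW;exact: ltn_expl.
exists v, (At t);split => //.
- rewrite /clA Ato prz/=;apply/implyP => vv;apply/andP;split.
  apply/forall_inP => p /AtP[_ _ _ pt];apply: leq_trans v1;rewrite leq_exp2r;[exact: leqW|exact: ltnW].
 have h2 : (t.+1 ^ 2 <= z)%N by apply: leq_trans v1;rewrite leq_exp2l.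
 have h3 : (z ^ 2 < (t.+1 * pr (At t)) ^ 2)%N by rewrite ltn_exp2r// -prE.
 rewrite expnMn in h3;rewrite ltnNge;apply/negP => h4.
 have := leq_mul h2 h4;rewrite leqNgt h3//.
- by move=> p /AtP[_ -> ->].
- move=> w p wz pw pp pN;apply: contra => pD;apply: mem => //.
 by rewrite -ltnS;apply: leq_ltn_trans pw _;exact: small wz v2.
- apply: omout_le => p pp pD pN pA;letr v2;rewrite leq_exp2r// ltnNge.
 by apply: contra pA => pt;exact: mem.
Qed.

(* For z large, a set of primes A with p^v <= z on A and pr A > sqrt z cannot consist of bounded primes. *)
Lemma class_small_v B v (A : pset z) : (0 < B)%N -> ((B ^ B) ^ 2 <= z)%N -> clA v A -> (B ^ v <= z)%N.
move=> B0 zB /and3P[oA Az /implyP hv].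
have BB : (B <= B ^ B)%N by rewrite -{1}(expn1 B) leq_pexp2l.
have Bz : (B <= z)%N by apply: leq_trans zB;letr BB;rewrite -{1}(expn1 (B ^ B)) leq_pexp2l// expn_gt0 B0.
case: (leqP v 1) => v1.
 by case: v v1 {hv} => [|[|//]] _;rewrite ?expn0 ?expn1// ltnW.
have /andP[/forall_inP sm big] := hv v1.
rewrite leqNgt;apply/negP => zv.
have pB p : p \in A -> (p < B)%N by move=> pA;have := leq_ltn_trans (sm p pA) zv;rewrite ltn_exp2r// ltnW.
have cA : (#|A| <= B)%N.
 rewrite cardE -(size_map val) -(size_iota 0 B);apply: uniq_leq_size.
  by rewrite map_inj_uniq ?enum_uniq//;exact: val_inj.
 by move=> q /mapP[p];rewrite mem_enum => pA ->;rewrite mem_iota/= add0n pB.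
have : (pr A <= B ^ B)%N.
 via (B ^ #|A|)%N;last by rewrite leq_pexp2l.
 by rewrite /pr -prod_nat_const;apply: leq_prod => p pA;apply: ltnW;exact: pB.
rewrite -(leq_exp2r _ _ (isT : (0 < 2)%N)) => h.
by have := leq_trans big (leq_trans h zB);rewrite ltnn.
Qed.
End ClassExists.

Lemma leq_exp2r_wk a b v : (a <= b -> a ^ v <= b ^ v)%N.
by case: v => // v;rewrite leq_exp2r. Qed.

Section Core.
Variables (R : realType) (m kappa C1 : nat).
Hypotheses (m0 : (0 < m)%N) (C10 : (0 < C1)%N).

Let B := (2 * C1 ^ kappa)%N.
Let B0 : (0 < B)%N. Proof. by rewrite muln_gt0 expn_gt0 C10. Qed.

Lemma Kc_le z (A s : pset z) : (Kc A s <= 2 ^ #|A|)%N.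
rewrite -card_powerset;apply: subset_leq_card;apply/fintype.subsetP => e;rewrite !inE;by case/andP.
Qed.

Lemma two_pow_pr z (A : pset z) : odd_primes A -> (2 ^ #|A| <= pr A)%N.
move=> oA;rewrite /pr -prod_nat_const;apply: leq_prod => p pA;apply: prime_gt1.
by case/andP: (forall_inP oA p pA).
Qed.

Lemma sum_geom_lin (n : nat) : \sum_(v < n) v.+1%:R * (4^-1) ^+ v <= 2 :> R.
via (\sum_(0 <= v < n) (2^-1 : R) ^+ v);last first.
 rewrite [leRHS](_ : _ = (1 - 2^-1)^-1);last by field.
 by apply: geom_le;lra.
rewrite big_mkord;lesum v.
have -> : 4^-1 = 2^-1 * 2^-1 :> R by field.
rewrite exprMn mulrA ler_piMl ?exprn_ge0 ?invr_ge0// exprVn ler_pdivrMr ?exprn_gt0// mul1r -natrX ler_nat.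
exact: ltn_expl.
Qed.

(* The Nair-Tenenbaum splitting: x in the box is attached to the initial product A of its primes not dividing
   N, to the class v of the next prime, and to the signs s; for fixed (v, A, s) Selberg's sieve applies. *)
Theorem core : exists2 C : R, 0 < C & exists z0 : nat, forall (N L1 L2 z : nat) (D : nat -> nat -> int)
  (good : nat -> nat -> bool) (g : nat -> nat -> R),
 (0 < N)%N -> (2 %| N)%N ->
 (forall (n i i' j j' : nat), (i = i' %[mod n])%N -> (j = j' %[mod n])%N -> (D i j = D i' j' %[mod n])%Z) ->
 (forall p, prime p -> ~~ (p %| N)%N -> cnt p (fun i j => (p %| D i j)%Z) = p) ->
 (forall p, prime p -> ~~ (p %| N)%N -> forall t : int, (p %| t)%Z -> ~~ ((p ^ 2)%N %| t)%Z ->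
  (cnt (p ^ 2) (fun i j => (D i j == t %[mod (p ^ 2)%N])%Z) <= p ^ 2)%N) ->
 (z0 <= z)%N -> (z ^ (m + 24) <= L1)%N -> (z ^ (m + 24) <= L2)%N ->
 (forall i j, good i j -> [/\ D i j != 0, (`|D i j|%N <= z ^ kappa)%N &
   forall p, prime p -> ~~ (p %| N)%N -> ~~ (p ^ 2 %| `|D i j|)%N]) ->
 (forall i j, good i j -> forall A : pset z, odd_primes A ->
   (forall p, p \in A -> (p %| `|D i j|)%N && ~~ (p ^ 2 %| `|D i j|)%N) ->
   g i j <= (C1 ^ (omout A (D i j)).+1 * 2 ^ #|A| * Kc A (sset A (D i j)) ^ m)%:R) ->
 \sum_(i < L1) \sum_(j < L2) (if good i j then g i j else 0) <=
   C * ((2 * C1) ^ size (primes N))%:R * (L1 * L2)%:R * ln z%:R.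
(* With this K, [class_moment] decays like (4 C1^kappa)^-v, which absorbs the growth C1^(kappa v) of
   the factor for the primes outside A and leaves 4^-v. *)
pose K : R := 4 * ln (4 * C1%:R ^+ kappa).
have cK : 1 <= C1%:R ^+ kappa :> R by rewrite exprn_ege1// ler1n.
have K0 : 0 <= K by rewrite /K mulr_ge0// ln_ge0;lra.
have [CM CM0 hM] := class_moment m0 K0.
pose c1 : R := C1%:R ^+ kappa.+1.
have c10 : 0 < c1 by pos.
exists (c1 * (4 * CM + 12));first pos.
exists ((B ^ B) ^ 2 + 2)%N => N L1 L2 z D good g N0 N2 Dper Dc1 Dc2 zz L1z L2z hgood hg.
have z2 : (1 < z)%N by lia.
have zB : ((B ^ B) ^ 2 <= z)%N by lia.
have z0 := ltnW z2.
have lz : 0 < ln z%:R :> R by apply: ln_nat_gt0.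
pose om := size (primes N).
have [wv hwv] : exists wv : nat -> nat, forall v, [&& (0 < wv v)%N, (wv v <= z)%N, (wv v ^ v.+1 <= z)%N & (z < (wv v).+1 ^ v.+1)%N] by exists (fun v => projT1 (cid (root_ex v z0))) => v;exact: (projT2 (cid (root_ex v z0))).
pose X := ('I_L1 * 'I_L2)%type.
pose cl v (A : pset z) := [&& clA v A, [forall (p | p \in A), ~~ (p %| N)%N] & (B ^ v <= z)%N].
pose coef v (A s : pset z) : R := (C1 ^ (om + kappa * v.+1).+1 * 2 ^ #|A| * Kc A s ^ m)%:R.
pose ok v (A s : pset z) (x : X) : bool := @GA D z A s x.1 x.2 &&
   [forall p : 'I_(wv v).+1, [&& prime p, ~~ (p %| N)%N & ~~ (p %| pr A)%N] ==> ~~ (p %| D x.1 x.2)%Z].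
have coef0 v A s : 0 <= coef v A s by [].
(* Each good point is charged to its class v, its initial factor A and its signs s; the bound on [g]
   depends on these alone once [omout] has been estimated. *)
have step1 : \sum_(i < L1) \sum_(j < L2) (if good i j then g i j else 0) <=
  \sum_(v < z.+1) \sum_(A | cl v A) \sum_(s : pset z | s \subset A) coef v A s * #|[pred x | ok v A s x]|%:R.
 via (\sum_(x : X) \sum_(v < z.+1) \sum_(A | cl v A) \sum_(s : pset z | s \subset A) coef v A s * (ok v A s x)%:R);last first.
  rewrite exchange_big/=;lesum v;rewrite exchange_big/=;lesum A.
  rewrite exchange_big/=;lesum s;rewrite -mulr_sumr;apply: ler_wpM2l => //.
  by rewrite -natr_sum ler_nat -sum1_card [leqRHS]big_mkcond;apply: leq_sum => x _;rewrite inE;case: (ok v A s x).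
 rewrite pair_big/=;apply: ler_sum => -[i j] _/=;case: ifP => gij;last first.
  pos.
 have [D0 Dle Dsf] := hgood _ _ gij.
 have [v [A [vz cA hA hs ho]]] := class_exists N0 z2 D0 Dle N2.
 have oA : odd_primes A by case/and3P: cA.
 have ap p : p \in A -> prime p := all_primeP _ (odd_primes_all oA) p.
 have pD p : p \in A -> (p %| `|D i j|)%N && ~~ (p ^ 2 %| `|D i j|)%N by move=> pA;have /andP[pN ->] := hA p pA;rewrite Dsf ?ap.
 letr (hg _ _ gij A oA pD).
 have clv : cl v A.
  rewrite /cl cA (class_small_v z2 B0 zB cA) andbT;apply/forall_inP => p /hA /andP[]//.
 have ss : sset A (D i j) \subset A by apply/fintype.subsetP => p;rewrite inE => /andP[].
 have okv : ok v A (sset A (D i j)) (i, j).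
  apply/andP;split;last first.
   apply/forallP => p;apply/implyP => /and3P[h1 h2 h3];have /and4P[_ _ hw _] := hwv v.
   by rewrite dvdzE/=;apply: (hs (wv v)) => //;rewrite -ltnS.
  apply/forall_inP => p pA;rewrite /Gp/= !dvdzE/=;have /andP[-> -> /=] := pD p pA.
  have pp := ap p pA;have po : odd p by case/andP: (forall_inP oA p pA).
  rewrite inE pA/=;have := leg_val p (- (D i j %/ p)%Z * (pr A %/ p)%N);rewrite !inE.
  case: eqP => [/eqP|_/=];last first.
   by move=> /orP[/eqP ->|/eqP ->]//=;rewrite expr1.
  rewrite leg_eq0// dvdzE abszM abszN Euclid_dvdM//= => /orP[h|h];last first.
   by have := ndvd_div oA pA;rewrite h.
  have /andP[d1 /negP[]] := pD p pA.
  have e : `|D i j|%N = (`|(D i j %/ p)%Z| * p)%N by rewrite -{1}(divzK (_ : (p %| D i j)%Z)) ?abszM//.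
  by rewrite e dvdn_pmul2r ?prime_gt0.
 rewrite (bigD1 (Ordinal (vz : (v < z.+1)%N)))//= ler_wpDr//.
  pos.
 rewrite (bigD1 A)//= ler_wpDr//.
  pos.
 rewrite (bigD1 (sset A (D i j)))//= ler_wpDr//.
  pos.
 rewrite okv mulr1 /coef ler_nat leq_mul2r;apply/orP;right;rewrite leq_mul2r;apply/orP;right.
 by apply: leq_pexp2l.
letr step1.
pose LL : R := (L1 * L2)%:R.
have LL0 : 0 <= LL by [].
pose Y : R := (z ^ (m + 24))%:R.
have Y0 : 0 < Y by pos.
have Lsum : L1%:R + L2%:R + 1 <= 3 * LL / Y :> R.
 have y1 : 1 <= Y by rewrite ler1n expn_gt0 z0.
 have a1 : Y <= L1%:R by rewrite ler_nat.
 have a2 : Y <= L2%:R by rewrite ler_nat.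
 rewrite ler_pdivlMr// /LL;nra.
(* The sieve goes up to w = z^(1/(v+1)), rounded down, hence log(w+1) is at least log z / (v+1). *)
have hcnt v A s : cl v A -> #|[pred x | ok v A s x]|%:R <=
  LL * 2 ^+ om.+1 * v.+1%:R / ln z%:R / (2 ^+ #|A| * (pr A)%:R) + (z ^ 9)%:R * (3 * LL / Y).
 move=> /and3P[cA AN _];have /and3P[oA Az _] := cA.
 have /and4P[w1 wz hw hw2] := hwv v.
 have AN' p : p \in A -> ~~ (p %| N)%N by move=> pA;exact: (forall_inP AN).
 have := @sieve_count N D N0 N2 Dper Dc1 Dc2 z (wv v) A s oA AN' Az wz w1 R L1 L2.
 move/le_trans;apply;apply: lerD;last by apply: ler_wpM2l.
 have a0 : 0 < (2 ^+ #|A| * (pr A)%:R : R) by rewrite mulr_gt0 ?exprn_gt0// ltr0n pr_gt0// odd_primes_all.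
 rewrite ler_pM2r ?invr_gt0// -!mulrA;apply: ler_wpM2l => //;apply: ler_wpM2l;first pos.
 have lw : 0 < ln (wv v).+1%:R :> R by rewrite ln_gt0// ltr1n ltnS.
 rewrite -[v.+1%:R / _]invf_div lef_pV2 ?posrE ?divr_gt0 ?ltr0n// ler_pdivrMr ?ltr0n// mulr_natr -lnXn ?ltr0n// -natrX.
 by apply: ln_nat_le;rewrite z0 ltnW.
pose M v : R := \sum_(A | cl v A) (pr A)%:R^-1 * \sum_(s : pset z | s \subset A) ((Kc A s)%:R : R) ^+ m.
have M0 v : 0 <= M v by pos.
pose ce v : R := (C1 ^ (om + kappa * v.+1).+1)%:R.
have ce0 v : 0 <= ce v by [].
(* The first term is the sieve main term, where 2^|A| has cancelled. The second one collects the
   sieve errors over at most z sets A with at most z choices of s each; it is harmless because the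
   sides of the box are at least z^(m+24). *)
have stepv (v : nat) : \sum_(A | cl v A) \sum_(s : pset z | s \subset A) coef v A s * #|[pred x | ok v A s x]|%:R <=
  ce v * (LL * 2 ^+ om.+1 * v.+1%:R / ln z%:R * M v) +
  (if (B ^ v <= z)%N then ce v * ((z ^ (m + 3))%:R * ((z ^ 9)%:R * (3 * LL / Y))) else 0).
 pose e : R := (z ^ 9)%:R * (3 * LL / Y).
 have e0 : 0 <= e by pos.
 via (\sum_(A | cl v A) \sum_(s : pset z | s \subset A)
   (ce v * (LL * 2 ^+ om.+1 * v.+1%:R / ln z%:R * ((pr A)%:R^-1 * (Kc A s)%:R ^+ m)) + ce v * ((z ^ (m + 1))%:R * e))).
  apply: ler_sum => A cA;lesum s.
  have /and3P[/and3P[oA Az _] _ _] := cA.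
  letr (ler_wpM2l (coef0 v A s) (hcnt v A s cA)).
  rewrite mulrDr;apply: lerD.
   rewrite /coef !natrM !natrX -/(ce v);apply: eqler.
   rewrite /ce natrX;have t0 : (2 : R) ^+ #|A| != 0 by pos.
   have p0 : (pr A)%:R != 0 :> R by rewrite pnatr_eq0 -lt0n pr_gt0 ?odd_primes_all.
   have l0 : ln z%:R != 0 :> R by pos.
   set q := C1%:R ^+ _;set k := (Kc A s)%:R ^+ m;set t := 2 ^+ #|A| in t0 *.
   set l := ln _ in l0 *;set p := (pr A)%:R in p0 *;set u := 2 ^+ om.+1;field;by rewrite p0 l0.
  have -> : coef v A s = ce v * (2 ^ #|A| * Kc A s ^ m)%:R by ring.
  rewrite -[leLHS]mulrA;apply: ler_wpM2l => //;apply: ler_wpM2r => //.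
  rewrite ler_nat expnD mulnC;have h2 := leq_trans (two_pow_pr oA) Az.
  by apply: leq_mul;rewrite // leq_exp2r//;apply: leq_trans (Kc_le A s) h2.
 set Q : R := LL * 2 ^+ om.+1 * v.+1%:R / ln z%:R;set f : R := ce v * ((z ^ (m + 1))%:R * e).
 have f0 : 0 <= f by apply: mulr_ge0;[exact: ce0|apply: mulr_ge0].
 have n0 : 0 <= z%:R * f by pos.
 have -> : \sum_(A | cl v A) \sum_(s : pset z | s \subset A) (ce v * (Q * ((pr A)%:R^-1 * (Kc A s)%:R ^+ m)) + f) =
   ce v * (Q * M v) + \sum_(A | cl v A) \sum_(s : pset z | s \subset A) f.
  by rewrite mulr_sumr mulr_sumr -big_split;eqbig A;rewrite mulr_sumr mulr_sumr mulr_sumr big_split.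
 apply: lerD => //.
 case: ifP => vz;last first.
  by rewrite big_pred0// => A;rewrite /cl vz !andbF.
 via (\sum_(A : pset z | all_prime A && (pr A <= z)%N) (z%:R * f)).
  rewrite big_mkcond [leRHS]big_mkcond;lesum A.
  case: ifP => [/and3P[/and3P[oA Az _] _ _]|_];last by case: ifP.
  rewrite odd_primes_all// Az sumr_const -[_ *+ _]mulr_natl;apply: ler_wpM2r => //.
  rewrite ler_nat;apply: leq_trans Az;apply: leq_trans (two_pow_pr oA);rewrite -card_powerset.
  by apply: subset_leq_card;apply/fintype.subsetP => s;rewrite !inE.
 letr (sum_pr_le _ _ (fun _ => n0)).
 rewrite big_const_nat subn1/= iter_addr_0 -[_ *+ _]mulr_natl.
 apply: eqler;rewrite /f /e !natrX !exprD;ring.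
letr (ler_sum _ (fun (v : 'I_z.+1) _ => stepv v)).
have -> : ((2 * C1) ^ size (primes N))%:R = 2 ^+ om * C1%:R ^+ om :> R by rewrite expnMn natrM !natrX.
rewrite big_split/= -/LL.
have -> : c1 * (4 * CM + 12) * (2 ^+ om * C1%:R ^+ om) * LL * ln z%:R = c1 * 4 * CM * (2 ^+ om * C1%:R ^+ om) * LL * ln z%:R + c1 * 12 * (2 ^+ om * C1%:R ^+ om) * LL * ln z%:R by ring.
have ceE v : ce v = c1 * C1%:R ^+ om * (C1%:R ^+ kappa) ^+ v by rewrite /ce natrX -exprM -!exprD;congr (_ ^+ _);clear;lia.
have o1 : 0 <= C1%:R ^+ om :> R by pos.
apply: lerD.
 via (\sum_(v < z.+1) (c1 * C1%:R ^+ om * (LL * 2 ^+ om.+1) * CM * ln z%:R) * (v.+1%:R * (4^-1) ^+ v));last first.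
  rewrite -mulr_sumr;letr (ler_wpM2l _ (sum_geom_lin _)).
   pos.
  by rewrite exprS;apply: eqler;ring.
 lesum v;rewrite ceE.
 case: (leqP (B ^ v) z) => vz;last first.
  rewrite (_ : M v = 0) ?mulr0;last by rewrite /M big_pred0// => A;rewrite /cl leqNgt vz !andbF.
  by rewrite !mulr_ge0 ?exprn_ge0 ?invr_ge0// ltW.
 have hMv : M v <= CM * (4 * C1%:R ^+ kappa) ^- v * ln z%:R ^+ 2.
  have v2z : (2 ^ v <= z)%N by apply: leq_trans vz;apply: leq_exp2r_wk;rewrite leq_pmulr// expn_gt0 C10.
  have := hM z v z2 v2z;rewrite /K.
  have -> : expR (- (4 * ln (4 * C1%:R ^+ kappa) / 4 * v%:R)) = (4 * C1%:R ^+ kappa) ^- v :> R.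
   have u0 : 0 < 4 * C1%:R ^+ kappa :> R by lra.
   rewrite (_ : 4 * ln (4 * C1%:R ^+ kappa) / 4 = ln (4 * C1%:R ^+ kappa) :> R);last by field.
   by rewrite expRN [_ * v%:R]mulrC expRM_natl lnK.
  move=> h;apply: le_trans h;rewrite /M big_mkcond [leRHS]big_mkcond;lesum A.
  have p0 : 0 <= (pr A)%:R^-1 * \sum_(s : pset z | s \subset A) ((Kc A s)%:R : R) ^+ m by pos.
  by rewrite /cl;case: ifP => [/and3P[-> _ _]//|_];case: ifP.
 via (c1 * C1%:R ^+ om * C1%:R ^+ kappa ^+ v * (LL * 2 ^+ om.+1 * v.+1%:R / ln z%:R * (CM * (4 * C1%:R ^+ kappa) ^- v * ln z%:R ^+ 2))).
  apply: ler_wpM2l;first pos.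
  by apply: ler_wpM2l hMv;rewrite !mulr_ge0 ?exprn_ge0 ?invr_ge0// ltW.
 apply: eqler.
 have ck0 : (C1%:R ^+ kappa) ^+ v != 0 :> R by pos.
 rewrite exprMn exprVn;set q := (C1%:R ^+ kappa) ^+ v in ck0 *;set f := 4 ^+ v.
 have f0 : f != 0 by pos.
 by set l := ln _ in lz *;field;rewrite f0 ck0 gt_eqF.
via (\sum_(v < z.+1) (c1 * C1%:R ^+ om * ((z ^ (m + 13))%:R * (3 * LL / Y)))).
 lesum v;case: ifP => vz;last pos.
 rewrite ceE -!mulrA;apply: ler_wpM2l;first exact: ltW.
 apply: ler_wpM2l => //.
 rewrite [leLHS](_ : _ = (C1%:R ^+ kappa) ^+ v * (z ^ (m + 12))%:R * (3 * (LL * Y^-1)));last first.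
  by rewrite !natrX !exprD;ring.
 apply: ler_wpM2r;first pos.
 rewrite (_ : m + 13 = (m + 12).+1)%N;last ring.
 rewrite expnS natrM;apply: ler_wpM2r => //;rewrite -!natrX ler_nat;apply: leq_trans vz.
 by apply: leq_exp2r_wk;rewrite leq_pmull.
rewrite sumr_const card_ord -[_ *+ _]mulr_natl.
have h1 : z.+1%:R * ((z ^ (m + 13))%:R * (3 * LL / Y)) <= 6 * LL.
 have hZ : z.+1%:R * (z ^ (m + 13))%:R <= 2 * Y :> R.
  rewrite -!natrM ler_nat;apply: (@leq_trans (2 * z * z ^ (m + 13))%N).
   by rewrite leq_mul2r;apply/orP;right;move: z2;clear;lia.
  rewrite -mulnA -expnS leq_pmul2l// leq_pexp2l//;clear;lia.
 have -> : z.+1%:R * ((z ^ (m + 13))%:R * (3 * LL / Y)) = z.+1%:R * (z ^ (m + 13))%:R * (3 * LL) / Y by ring.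
 rewrite ler_pdivrMr//;have -> : 6 * LL * Y = 2 * Y * (3 * LL) by ring.
 by apply: ler_wpM2r hZ;rewrite mulr_ge0.
have lz2 : 1 / 2 <= ln z%:R :> R.
 via (ln 2);last by apply: ln_nat_le.
 by have := ln2_ge R;lra.
have t1 : 1 <= 2 ^+ om :> R by rewrite exprn_ege1// ler1n.
via (c1 * C1%:R ^+ om * (6 * LL)).
 by rewrite mulrCA;apply: ler_wpM2l => //;rewrite mulr_ge0// ltW.
rewrite [leRHS](_ : _ = c1 * C1%:R ^+ om * (6 * LL * (2 * ln z%:R * 2 ^+ om)));last ring.
apply: ler_wpM2l;first pos.
rewrite ler_peMr ?mulr_ge0//;nra.
Qed.
End Core.

(** * Cardinality bounds and torsion of abelian groups *)

(** An upper bound for a cardinality that does not presuppose finiteness. *)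
Definition bnd (X : eqType) (A : X -> Prop) (n : nat) : Prop :=
 forall s : seq X, uniq s -> (forall x, x \in s -> A x) -> (size s <= n)%N.

Lemma bnd_sub (X : eqType) (A B : X -> Prop) n : (forall x, A x -> B x) -> bnd B n -> bnd A n.
by move=> AB h s us hs;apply: h => // x /hs/AB. Qed.

Lemma bnd_leq (X : eqType) (A : X -> Prop) m n : (m <= n)%N -> bnd A m -> bnd A n.
by move=> mn h s us hs;apply: leq_trans mn;exact: h. Qed.

Lemma bnd_inj (X Y : eqType) (A : X -> Prop) (B : Y -> Prop) (f : X -> Y) n :
 (forall x, A x -> B (f x)) -> (forall x y, A x -> A y -> f x = f y -> x = y) -> bnd B n -> bnd A n.
move=> fB fi h s us hs;rewrite -(size_map f);apply: h.
 by rewrite map_inj_in_uniq// => x y /hs Ax /hs Ay;exact: fi.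
by move=> y /mapP[x /hs Ax ->];exact: fB.
Qed.

Lemma bnd_fiber (X Y : eqType) (A : X -> Prop) (B : Y -> Prop) (f : X -> Y) a b :
 (forall x, A x -> B (f x)) -> bnd B b -> (forall y, bnd (fun x => A x /\ f x = y) a) -> bnd A (b * a).
move=> fB hB hA s us hs.
have ht : (size (undup (map f s)) <= b)%N by apply: hB;[exact: undup_uniq|move=> y;rewrite mem_undup => /mapP[x /hs Ax ->];exact: fB].
apply: leq_trans (leq_mul ht (leqnn a)).
have : {subset map f s <= undup (map f s)} by move=> y;rewrite mem_undup.
move: (undup (map f s)) => t;clear ht;elim: t s us hs => [|y t IH] s us hs hst.
 by case: s hst {us hs} => // x s /(_ (f x));rewrite mem_head => /(_ isT).
rewrite -(count_predC (fun x => f x == y)) -!size_filter mulSn;apply: leq_add.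
 apply: (hA y);first exact: filter_uniq.
 by move=> x;rewrite mem_filter => /andP[/eqP e /hs].
apply: IH;first exact: filter_uniq.
 by move=> x;rewrite mem_filter => /andP[_ /hs].
move=> z /mapP[x];rewrite mem_filter/= => /andP[/negbTE fx xs] ->.
have : f x \in y :: t by apply: hst;apply: map_f.
by rewrite inE fx.
Qed.

Lemma bnd_fin (T : finType) (X : eqType) (A : X -> Prop) (f : T -> X) : (forall x, A x -> exists t, f t = x) -> bnd A #|T|.
move=> h s us hs;rewrite cardE -(size_map f);apply: uniq_leq_size => // x /hs/h[t <-].
by apply: map_f;rewrite mem_enum.
Qed.

Section AbGroup.
Variables (X : eqType) (G : X -> Prop) (mul : X -> X -> X) (one : X).
Hypotheses (G1 : G one) (GM : forall x y, G x -> G y -> G (mul x y)).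
Hypothesis mulA : forall x y z, G x -> G y -> G z -> mul x (mul y z) = mul (mul x y) z.
Hypothesis mulC : forall x y, G x -> G y -> mul x y = mul y x.
Hypothesis mul1 : forall x, G x -> mul one x = x.
Hypothesis mulV : forall x, G x -> exists2 y, G y & mul x y = one.

Definition gexp (x : X) n := iter n (mul x) one.
Definition gtor n x := G x /\ gexp x n = one.

Lemma gexp_G x n : G x -> G (gexp x n).
by move=> Gx;elim: n => //= n;exact: GM. Qed.

Lemma gexpD x m n : G x -> gexp x (m + n) = mul (gexp x m) (gexp x n).
move=> Gx;elim: m => [|m IH];first by rewrite add0n mul1//;exact: gexp_G.
by rewrite addSn/= -/(gexp x (m + n)) IH mulA//;exact: gexp_G.
Qed.

Lemma gexp_one n : gexp one n = one.
by elim: n => //= n ->;exact: mul1. Qed.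

Lemma gexpM x m n : G x -> gexp x (m * n) = gexp (gexp x m) n.
move=> Gx;elim: n => [|n IH];first by rewrite muln0.
by rewrite mulnS gexpD// IH.
Qed.

Lemma gexp_mul x y n : G x -> G y -> gexp (mul x y) n = mul (gexp x n) (gexp y n).
move=> Gx Gy;elim: n => [|n IH]/=;first by rewrite mul1.
rewrite -/(gexp (mul x y) n) IH -/(gexp x n) -/(gexp y n).
have Gxn := gexp_G n Gx;have Gyn := gexp_G n Gy;have Gxyn := GM Gxn Gyn;have Gyyn := GM Gy Gyn.
by rewrite -(mulA Gx Gy Gxyn) -(mulA Gx Gxn Gyyn) (mulA Gy Gxn Gyn) (mulC Gy Gxn) -(mulA Gxn Gy Gyn).
Qed.

Lemma mul_cancel x y z : G x -> G y -> G z -> mul x z = mul y z -> x = y.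
move=> Gx Gy Gz e;have [w Gw zw] := mulV Gz.
by rewrite -(mul1 Gx) -(mul1 Gy) (mulC G1 Gx) (mulC G1 Gy) -zw !mulA// e.
Qed.

(* If x^m = x0^m, then x x0^-1 lies in G[m]. *)
Lemma bnd_pow (A B : X -> Prop) m a b : (forall x, A x -> G x) -> (forall x, A x -> B (gexp x m)) ->
 bnd B b -> bnd (gtor m) a -> bnd A (b * a).
move=> AG AB hB ha;apply: (bnd_fiber (f := fun x => gexp x m) AB hB) => y s us hs.
case: s us hs => // x0 s us hs;have [A0 e0] := hs x0 (mem_head _ _).
have G0 := AG _ A0;have [w Gw xw] := mulV G0.
rewrite -(size_map (fun x => mul x w));apply: ha.
 rewrite map_inj_in_uniq// => x x' /hs[/AG Gx _] /hs[/AG Gx' _];exact: mul_cancel.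
move=> z /mapP[x /hs[/AG Gx ex] ->];split;first exact: GM.
by rewrite gexp_mul// ex -e0 -gexp_mul// xw gexp_one.
Qed.

Definition gsq x := exists2 y, G y & gexp y 2 = x.

(** Raising to the power 2^(k+1) maps the 2^(k+2)-torsion into the squares of order dividing 2, with
    kernel the 2^(k+1)-torsion. *)
Lemma bnd_2pow b2 S k : bnd (gtor 2) b2 -> bnd (fun x => gtor 2 x /\ gsq x) S ->
 bnd (gtor (2 ^ k.+1)) (S ^ k * b2).
move=> h2 hS;elim: k => [|k IH];first by rewrite expn0 mul1n expn1.
rewrite (expnS S k) -mulnA;apply: (bnd_pow (B := fun x => gtor 2 x /\ gsq x) (m := 2 ^ k.+1)) => //.
 by move=> x [].
move=> x [Gx e];split;first by split;[exact: gexp_G|rewrite -gexpM// -expnSr].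
by exists (gexp x (2 ^ k));[exact: gexp_G|rewrite -gexpM// -expnSr].
Qed.

Lemma bnd_3_2pow b3 b2 k : bnd (gtor 3) b3 -> bnd (gtor (2 ^ k)) b2 -> bnd (gtor (3 * 2 ^ k)) (b3 * b2).
move=> h3 h2;apply: (bnd_pow (B := gtor 3) (m := 2 ^ k)) => // [x []//|x [Gx e]].
by split;[exact: gexp_G|rewrite -gexpM// mulnC].
Qed.

(** P plays the role of a subgroup of index at most 2 in A: dividing by a fixed element outside P
    maps the complement of P injectively into P. *)
Lemma bnd_index2 (A P : X -> Prop) n : (forall x, A x -> G x) ->
 (forall x x0 w, A x -> A x0 -> ~ P x -> ~ P x0 -> G w -> mul x0 w = one -> A (mul x w) /\ P (mul x w)) ->
 bnd (fun x => A x /\ P x) n -> bnd A (2 * n).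
move=> AG h hn s us hs;rewrite -(count_predC (fun x => `[< P x >])) -!size_filter mul2n -addnn;apply: leq_add.
 apply: hn;first exact: filter_uniq.
 by move=> x;rewrite mem_filter => /andP[/asboolP Px /hs].
set s' := filter _ s;have us' : uniq s' by exact: filter_uniq.
have hs' x : x \in s' -> A x /\ ~ P x by rewrite mem_filter => /andP[/asboolP Px /hs].
case: s' us' hs' => // x0 s0 us' hs';have [A0 P0] := hs' x0 (mem_head _ _).
have [w Gw xw] := mulV (AG _ A0).
rewrite -(size_map (fun x => mul x w));apply: hn.
 by rewrite map_inj_in_uniq// => x x' /hs'[/AG Gx _] /hs'[/AG Gx' _];exact: mul_cancel.
by move=> z /mapP[x /hs'[Ax Px] ->];exact: h Px P0 Gw xw.
Qed.
End AbGroup.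

(** * Arithmetic of a quadratic field inside the algebraic numbers *)

Lemma quad_monic (F : nzRingType) (a c : F) :
 size ('X^2 - a *: 'X + c%:P) = 3%N /\ 'X^2 - a *: 'X + c%:P \is monic.
have h2 : (size (- (a *: 'X) : {poly F}) < 3)%N by rewrite size_polyN;apply: leq_ltn_trans (size_scale_leq _ _) _;rewrite size_polyX.
have h1 : (size (c%:P : {poly F}) < 3)%N by apply: leq_ltn_trans (size_polyC_leq1 _) _.
have e : size ('X^2 - a *: 'X : {poly F}) = 3%N by rewrite size_polyDl size_polyXn.
by split;[rewrite size_polyDl e|rewrite monicE !lead_coefDl ?lead_coefXn ?size_polyXn ?e].
Qed.

Lemma half_emb (u v s : algC) : u + v * s = (2 * u + 2 * v * s) / 2.
by field. Qed.

Lemma quad_root (u v : algC) : ((u + v) / 2) ^+ 2 - u * (u + v) / 2 + (u ^+ 2 - v ^+ 2) / 4 = 0.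
by field. Qed.

Lemma ratC_inj : injective (ratr : rat -> algC).
exact: fmorph_inj. Qed.

Lemma ratC_eq0 (q : rat) : (ratr q == 0 :> algC) = (q == 0).
exact: fmorph_eq0. Qed.

Lemma ratCX (q : rat) n : ratr (q ^+ n) = ratr q ^+ n :> algC. Proof. exact: rmorphXn. Qed.
Lemma ratCM (p q : rat) : ratr (p * q) = ratr p * ratr q :> algC. Proof. ring. Qed.
Lemma ratCB (p q : rat) : ratr (p - q) = ratr p - ratr q :> algC. Proof. ring. Qed.

Lemma intrX (R : pzRingType) (n : int) k : (n ^+ k)%:~R = n%:~R ^+ k :> R.
exact: rmorphXn. Qed.

Lemma dvdz_prime_sqr (p : nat) (A : int) : prime p -> (p%:Z %| A ^+ 2)%Z = (p%:Z %| A)%Z.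
by move=> pp;rewrite !dvdzE abszX Euclid_dvdX// andbT. Qed.

Lemma sqr_absz (k : int) : (`|k|%N%:Z) ^+ 2 = k ^+ 2.
lia. Qed.

Lemma rat_Aint (q : rat) : (ratr q : algC) \in Aint -> exists n : int, q = n%:~R.
move/(Cint_rat_Aint (Crat_rat q)) => /intrP[n hn];exists n.
by apply: ratC_inj;rewrite ratr_int.
Qed.

Lemma rat_sqr_int (q : rat) (k : int) : q ^+ 2 = k%:~R -> exists n : int, q = n%:~R.
move=> e;apply/rat_Aint/(@root_monic_Aint ('X^2 - (k%:~R)%:P)).
- by rewrite /root !hornerE -rmorphXn/= e ratr_int subrr.
- by rewrite monicXnsubC.
- by rewrite polyOverXnsubC rpred_int.
Qed.

Lemma squarefree_sqr (k : int) : squarefree (k ^+ 2) -> `|k|%N = 1%N.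
move=> h;case: (posnP `|k|%N) => [k0|k0].
 by have := h 2%N isT;rewrite abszX k0.
case: (leqP `|k|%N 1) => [k1|k1];first lia.
have := h _ (pdiv_prime k1);rewrite abszX dvdn_exp2r ?pdiv_dvd//.
Qed.

Section Quad.
Variable d : int.
Hypothesis fd : fundamental_discriminant d.
Notation K := (quadratic_field d).
Notation O := (ring_of_integers K).
Definition sq : algC := sqrtC d%:~R.

Lemma sq2 : sq * sq = d%:~R.
by rewrite -expr2 sqrtCK. Qed.

Lemma fd_odd p : prime p -> odd p -> ~~ (p ^ 2 %| `|d|)%N.
move=> pp po;case: fd => [[_ sf _]|[m [-> sf _]]];first exact: sf.
by rewrite abszM Gauss_dvdr ?sf// coprimeXl// (@coprimeXr 2 _ 2)// prime_coprime// dvdn_prime2//;case: eqP po => // ->.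
Qed.

(* [d / 4] is not a discriminant *)
Lemma fd_4 (x : int) : d = 4 * x -> (x %% 4)%Z = 2 \/ (x %% 4)%Z = 3.
case: fd => [[h _ _] e|[m [-> _ h]] /(mulfI (_ : 4 != 0)) <-//].
lia.
Qed.

Lemma fd_nsqr (q : rat) : q ^+ 2 != d%:~R.
apply/eqP => /[dup] e /rat_sqr_int[n en].
have {e en} dn : d = n ^+ 2 by apply/eqP;rewrite -(@eqr_int rat) -e en rmorphXn.
case: fd => [[_ sf d1]|[m [e4 sf h]]].
 rewrite dn in sf;have := squarefree_sqr sf => n1;apply: d1.
 lia.
have n2 : (2 %| n)%Z.
 have : (2 %| n ^+ 2)%Z by lia.
 by rewrite (@dvdz_prime_sqr 2).
have [k ek] := dvdzP n2.
have em : m = k ^+ 2 by lia.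
rewrite em in sf h;have := squarefree_sqr sf => k1.
lia.
Qed.

Lemma d_neq0 : d != 0.
by apply/eqP => e;have := fd_nsqr 0;rewrite e. Qed.

Lemma sq_neq0 : sq != 0.
by rewrite sqrtC_eq0 intr_eq0 d_neq0. Qed.

Definition emb (a b : rat) : algC := ratr a + ratr b * sq.

Lemma emb_inj a b a' b' : emb a b = emb a' b' -> a = a' /\ b = b'.
move=> e;have h : ratr (a - a') = ratr (b' - b) * sq :> algC.
 have e2 : emb a b - ratr a' - ratr b * sq = emb a' b' - ratr a' - ratr b * sq by rewrite e.
 rewrite !rmorphB/= mulrBl;transitivity (emb a b - ratr a' - ratr b * sq);first by rewrite /emb;ring.
 by rewrite e2 /emb;ring.
have [b0|b0] := eqVneq (b' - b) 0.
 rewrite b0 rmorph0 mul0r in h;split.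
  by apply/eqP;rewrite -subr_eq0 -ratC_eq0 h.
 lra.
exfalso;have := fd_nsqr ((a - a') / (b' - b));rewrite -(inj_eq ratC_inj) => /negP;apply.
rewrite (rmorphXn (@ratr algC)) fmorph_div/= h mulrC mulKf ?ratC_eq0//.
by rewrite expr2 sq2 ratr_int.
Qed.

Lemma embD a b a' b' : emb a b + emb a' b' = emb (a + a') (b + b').
by rewrite /emb;ring. Qed.
Lemma embN a b : - emb a b = emb (- a) (- b).
by rewrite /emb;ring. Qed.
Lemma embM a b a' b' : emb a b * emb a' b' = emb (a * a' + b * b' * d%:~R) (a * b' + b * a').
rewrite /emb !rmorphD !rmorphM/= ratr_int -sq2;ring.
Qed.
Lemma emb_rat a : emb a 0 = ratr a. Proof. by rewrite /emb rmorph0 mul0r addr0. Qed.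

Lemma Nf_neq0 (a b : rat) : (a != 0) || (b != 0) -> a ^+ 2 - b ^+ 2 * d%:~R != 0.
move=> h;rewrite subr_eq0;case: (eqVneq b 0) h => [->|b0 _]/=.
 by rewrite orbF mul0r sqrf_eq0.
apply/eqP => e;have := fd_nsqr (a / b);rewrite exprMn exprVn e mulrC mulKf ?expf_neq0 ?eqxx//.
Qed.

Lemma emb_eq0 a b : (emb a b == 0) = (a == 0) && (b == 0).
apply/eqP/andP => [e|[/eqP-> /eqP->]];last by rewrite emb_rat rmorph0.
by have [-> ->] := emb_inj (etrans e (esym (etrans (emb_rat 0) (rmorph0 _)))).
Qed.

Lemma embV (a b : rat) : (a != 0) || (b != 0) ->
 (emb a b)^-1 = emb (a / (a ^+ 2 - b ^+ 2 * d%:~R)) (- b / (a ^+ 2 - b ^+ 2 * d%:~R)).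
move=> h;have n0 := Nf_neq0 h;set n := _ - _ in n0 *.
have e0 : emb a b != 0 by rewrite emb_eq0 negb_and.
apply: (mulfI e0);rewrite mulfV// embM.
have -> : a * (a / n) + b * (- b / n) * d%:~R = 1 by rewrite /n;field.
have -> : a * (- b / n) + b * (a / n) = 0 by field.
by rewrite emb_rat rmorph1.
Qed.

Lemma KD x y : K x -> K y -> K (x + y).
by move=> [a [b ->]] [a' [b' ->]];rewrite -!/(emb _ _) embD;exists (a + a'), (b + b'). Qed.
Lemma KN x : K x -> K (- x).
by move=> [a [b ->]];rewrite -!/(emb _ _) embN;exists (- a), (- b). Qed.
Lemma KM x y : K x -> K y -> K (x * y).
by move=> [a [b ->]] [a' [b' ->]];rewrite -!/(emb _ _) embM;do 2![eexists]. Qed.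
Lemma K_rat q : K (ratr q).
by exists q, 0;rewrite -/(emb _ _) emb_rat. Qed.
Lemma K_int (n : int) : K n%:~R.
by rewrite -ratr_int;exact: K_rat. Qed.
Lemma K0 : K 0. Proof. exact: (K_int 0). Qed.
Lemma K1 : K 1. Proof. exact: (K_int 1). Qed.
Lemma K_sq : K sq. Proof. by exists 0, 1;rewrite rmorph0 rmorph1 mul1r add0r. Qed.
Lemma KV x : K x -> K x^-1.
move=> [a [b ->]];rewrite -/(emb _ _);have [h|h] := boolP ((a != 0) || (b != 0)).
 by rewrite embV//;do 2![eexists].
by move: h;rewrite negb_or !negbK -emb_eq0 => /eqP ->;rewrite invr0;exact: K0.
Qed.
Lemma KX x n : K x -> K (x ^+ n).
by move=> Kx;elim: n => [|n IH];[rewrite expr0;exact: K1|rewrite exprS;exact: KM]. Qed.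

(** The rational coordinates of x in the basis 1, sqrt d, with default (0, 0) outside the field;
    they serve to define the conjugation [sg]. *)
Definition cof (x : algC) : rat * rat :=
 if pselect (exists p : rat * rat, x = emb p.1 p.2) is left h then projT1 (cid h) else (0, 0).

Definition sg (x : algC) : algC := emb (cof x).1 (- (cof x).2).

Lemma sgE a b : sg (emb a b) = emb a (- b).
rewrite /sg /cof;case: pselect => [h|[]];last by exists (a, b).
by case: (cid h) => -[a' b']/= /emb_inj[-> ->].
Qed.

Lemma sgD x y : K x -> K y -> sg (x + y) = sg x + sg y.
by move=> [a [b ->]] [a' [b' ->]];rewrite -!/(emb _ _) embD !sgE embD;congr emb;ring. Qed.
Lemma sgM x y : K x -> K y -> sg (x * y) = sg x * sg y.
by move=> [a [b ->]] [a' [b' ->]];rewrite -!/(emb _ _) embM !sgE embM;congr emb;ring. Qed.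
Lemma sg_rat q : sg (ratr q) = ratr q.
by rewrite -emb_rat sgE. Qed.
Lemma sg_int (n : int) : sg n%:~R = n%:~R.
by rewrite -ratr_int sg_rat. Qed.
Lemma sg1 : sg 1 = 1. Proof. exact: (sg_int 1). Qed.
Lemma sg0 : sg 0 = 0. Proof. exact: (sg_int 0). Qed.
Lemma sg_sq : sg sq = - sq.
have e : sq = emb 0 1 by rewrite /emb rmorph0 rmorph1 mul1r add0r.
by rewrite {1}e sgE e embN.
Qed.
Lemma K_sg x : K x -> K (sg x).
by move=> [a [b ->]];rewrite -/(emb _ _) sgE;do 2![eexists]. Qed.
Lemma sgK x : K x -> sg (sg x) = x.
by move=> [a [b ->]];rewrite -!/(emb _ _) !sgE opprK. Qed.
Lemma sg_eq0 x : K x -> (sg x == 0) = (x == 0).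
by move=> [a [b ->]];rewrite -!/(emb _ _) sgE !emb_eq0 oppr_eq0. Qed.
Lemma sgV x : K x -> sg x^-1 = (sg x)^-1.
move=> Kx;have [->|x0] := eqVneq x 0;first by rewrite invr0 sg0 invr0.
have s0 : sg x != 0 by rewrite sg_eq0.
by apply: (mulfI s0);rewrite -sgM ?mulfV ?sg1//;exact: KV.
Qed.
Lemma sgX x n : K x -> sg (x ^+ n) = sg x ^+ n.
by move=> Kx;elim: n => [|n IH];[rewrite !expr0 sg1|rewrite !exprS sgM ?IH//;exact: KX]. Qed.

Lemma Nm_rat x : K x -> exists2 q : rat, x * sg x = ratr q & (q == 0) = (x == 0).
move=> [a [b ->]];rewrite -!/(emb _ _) sgE embM;exists (a ^+ 2 - b ^+ 2 * d%:~R).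
 by rewrite -emb_rat;congr emb;ring.
rewrite emb_eq0;apply/idP/idP => [|/andP[/eqP-> /eqP->]];last by rewrite !expr0n mul0r subrr.
by apply: contraTT;rewrite negb_and;exact: Nf_neq0.
Qed.

(* the integers of K *)
Definition oint (A B : int) : algC := (A%:~R + B%:~R * sq) / 2.

Lemma sqr_mod4 (A : int) : exists k : int, A ^+ 2 = 4 * k \/ A ^+ 2 = 4 * k + 1.
have [/dvdzP[q ->]|] := boolP (2 %| A)%Z;first by exists (q ^+ 2);left;ring.
rewrite (divz_eq A 2);have r0 : 0 <= (A %% 2)%Z by lia.
have r2 : (A %% 2)%Z < 2 by lia.
move: (A %/ 2)%Z (A %% 2)%Z r0 r2 => q r r0 r2;have [->|->] : r = 0 \/ r = 1 by lia.
 lia.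
by move=> _;exists (q ^+ 2 + q);right;ring.
Qed.

(** The square of a prime dividing the denominator of B would divide m. *)
Lemma sf_half (B : rat) (m n : int) : squarefree m -> B ^+ 2 * m%:~R = n%:~R -> exists k : int, B = k%:~R.
move=> sf e;have den : denq B = 1.
 apply/eqP;rewrite eq_le;apply/andP;split;last by have := denq_gt0 B;lia.
 rewrite leNgt;apply/negP => d1.
 have hd : (1 < `|denq B|%N)%N by lia.
 have e2 : numq B ^+ 2 * m = n * denq B ^+ 2.
  apply/eqP;rewrite -(@eqr_int rat) !(intrX, intrM) -e -[X in _ == X ^+ 2 * _ * _](divq_num_den B) exprMn exprVn.
  by apply/eqP;field;rewrite intr_eq0 denq_neq0.
 have := sf _ (pdiv_prime hd);apply/negP;rewrite negbK.
 set p := pdiv _;have pp : prime p := pdiv_prime hd.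
 have h1 : (p ^ 2 %| `|numq B| ^ 2 * `|m|)%N.
  have -> : (`|numq B| ^ 2 * `|m| = `|n| * `|denq B| ^ 2)%N by lia.
  by rewrite dvdn_mull// dvdn_exp2r// pdiv_dvd.
 rewrite Gauss_dvdr// in h1;rewrite coprimeXl// coprimeXr//.
 apply: coprime_dvdl (pdiv_dvd _) _;rewrite coprime_sym;exact: coprime_num_den.
by exists (numq B);rewrite -{1}(divq_num_den B) den divr1.
Qed.

(** Conjugation fixes the integral coefficients of the minimal polynomial of x. *)
Lemma sg_Aint x : K x -> x \in Aint -> sg x \in Aint.
move=> Kx xA;have cf i : exists n : int, (minCpoly x)`_i = n%:~R by have /polyOverP/(_ i)/intrP : minCpoly x \is a polyOver Num.int by [].
apply: (@root_monic_Aint (minCpoly x)) => //;last exact: minCpoly_monic.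
have h n : K (\sum_(i < n) (minCpoly x)`_i * x ^+ i) /\
 sg (\sum_(i < n) (minCpoly x)`_i * x ^+ i) = \sum_(i < n) (minCpoly x)`_i * sg x ^+ i.
 elim: n => [|n [IH1 IH2]];first by rewrite !big_ord0 sg0;split=> //;exact: K0.
 rewrite !big_ord_recr/=;have [c ->] := cf n.
 have Kc : K (c%:~R * x ^+ n) by apply: KM;[exact: K_int|exact: KX].
 by split;[exact: KD|rewrite sgD// IH2 sgM ?sg_int ?sgX//;[exact: K_int|exact: KX]].
have [_] := h (size (minCpoly x));rewrite -!horner_coef (eqP (root_minCpoly x)) sg0 => h0.
by rewrite /root -h0.
Qed.

(** The usual description in one formula for both kinds of discriminants: (A + B sqrt d)/2 is
    integral when A and dB have the same parity. Conversely, the trace and the norm are integers,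
    and [sf_half] shows that B is one. *)
Lemma O_oint x : O x <-> exists A B : int, (2 %| A - d * B)%Z /\ x = oint A B.
split;last first.
 move=> [A [B [/dvdzP[k hk] ->]]];split.
  by rewrite /oint;apply: KM;[apply: KD;[exact: K_int|apply: KM;[exact: K_int|exact: K_sq]]|apply: KV;exact: (K_int 2)].
 have [c hc] : exists c : int, A ^+ 2 - d * B ^+ 2 = 4 * c.
  have [d1|[m [dm _ _]]] := fd.
   have eA : A = d * B + k * 2 by lia.
   have [q eq] : exists q : int, d = 4 * q + 1 by exists (d %/ 4)%Z;case: d1 => d1 _ _;rewrite {1}(divz_eq d 4) d1;ring.
   have [t [et|et]] := sqr_mod4 B.
    by exists (d * q * B ^+ 2 + d * k * B + k ^+ 2);rewrite eA eq;ring.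
   by exists (d * q * B ^+ 2 + d * k * B + k ^+ 2);rewrite eA eq;ring.
  exists ((2 * m * B + k) ^+ 2 - m * B ^+ 2).
  lia.
 apply: (@root_monic_Aint ('X^2 - A%:~R *: 'X + (c%:~R)%:P)).
 - rewrite /root !hornerE /oint;apply/eqP.
  have hc' : (4 * c)%:~R = A%:~R ^+ 2 - d%:~R * B%:~R ^+ 2 :> algC by rewrite -hc intrB intrM !intrX.
  have -> : c%:~R = (A%:~R ^+ 2 - (sq * sq) * B%:~R ^+ 2) / 4 :> algC by rewrite sq2 -hc' intrM;field.
  rewrite /=;set u := A%:~R;set v := B%:~R * sq.
  have -> : sq * sq * B%:~R ^+ 2 = v ^+ 2 by rewrite /v;ring.
  exact: quad_root.
 - by have [] := quad_monic (A%:~R : algC) c%:~R.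
 - apply/polyOverP => i;rewrite coefD coefB coefXn coefZ coefX coefC.
  by apply: rpredD;[apply: rpredB;[exact: rpred_nat|apply: rpredM;[exact: rpred_int|exact: rpred_nat]]|case: ifP => _;[exact: rpred_int|exact: rpred0]].
move=> [[a [b ex]] xA];have sA : sg x \in Aint by apply: sg_Aint => //;exists a, b.
rewrite -/(emb a b) in ex.
have [A eA] : exists A : int, 2 * a = A%:~R.
 have e : x + sg x = ratr (2 * a) by rewrite ex sgE embD addrN emb_rat;congr ratr;ring.
 by apply: rat_Aint;rewrite -e rpredD.
have [B eB] : exists B : int, a ^+ 2 - b ^+ 2 * d%:~R = B%:~R.
 have e : x * sg x = ratr (a ^+ 2 - b ^+ 2 * d%:~R) by rewrite ex sgE embM -emb_rat;congr emb;ring.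
 by apply: rat_Aint;rewrite -e rpredM.
have e4 : (2 * b) ^+ 2 * d%:~R = (A ^+ 2 - 4 * B)%:~R :> rat by rewrite intrB intrM intrX -eA -eB;ring.
have xE (C : int) : 2 * b = C%:~R -> x = oint A C.
 move=> eC;rewrite ex /oint -(ratr_int _ A) -(ratr_int _ C) -eA -eC !ratCM ratr_nat -/sq.
 exact: half_emb.
have [d1|[m [dm sfm hm4]]] := fd.
 have [C eC] := sf_half (let: And3 _ h _ := d1 in h) e4.
 exists A, C;split;last exact: xE.
 have eAC : C ^+ 2 * d = A ^+ 2 - 4 * B by apply/eqP;rewrite -(@eqr_int rat) -e4 eC intrM intrX.
 have [q eq] : exists q : int, d = 4 * q + 1 by exists (d %/ 4)%Z;case: d1 => d1 _ _;rewrite {1}(divz_eq d 4) d1;ring.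
 have : (2 %| (A - d * C) ^+ 2)%Z by lia.
 by rewrite (@dvdz_prime_sqr 2).
have e5 : (2 * (2 * b)) ^+ 2 * m%:~R = (A ^+ 2 - 4 * B)%:~R :> rat by rewrite -e4 dm rmorphM/=;ring.
have [C eC] := sf_half sfm e5.
have eAC : C ^+ 2 * m = A ^+ 2 - 4 * B by apply/eqP;rewrite -(@eqr_int rat) -e5 eC intrM intrX.
have [q [r [eq hr]]] : exists q r : int, m = 4 * q + r /\ (r = 2 \/ r = 3) by exists (m %/ 4)%Z, (m %% 4)%Z;split => //;rewrite {1}(divz_eq m 4);ring.
have [tA hA] := sqr_mod4 A;have [tC hC] := sqr_mod4 C.
have [eA2 eC2] : A ^+ 2 = 4 * tA /\ C ^+ 2 = 4 * tC by lia.
have C2 : (2 %| C)%Z.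
 have : (2 %| C ^+ 2)%Z by lia.
 by rewrite (@dvdz_prime_sqr 2).
have [C' eC'] := dvdzP C2.
exists A, C';split;last first.
 by apply: xE;move: eC;rewrite eC';lra.
have : (2 %| A ^+ 2)%Z by lia.
rewrite dm (@dvdz_prime_sqr 2)// => A2.
lia.
Qed.

End Quad.

(** * Fractional ideals as lattices *)

Definition scal (x : algC) (I : set algC) : set algC := [set x * y | y in I]%classic.
Definition lat (u v : algC) : set algC := [set x | exists m n : int, x = m%:~R * u + n%:~R * v]%classic.

Section Quad.
Variable d : int.
Hypothesis fd : fundamental_discriminant d.
Notation K := (quadratic_field d).
Notation O := (ring_of_integers K).
Notation s := (sq d).
Notation oint := (oint d).

Lemma O_K x : O x -> K x. Proof. by case. Qed.
Lemma O_D x y : O x -> O y -> O (x + y).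
by move=> [? ?] [? ?];split;[exact: KD|exact: rpredD]. Qed.
Lemma O_N x : O x -> O (- x).
by move=> [? ?];split;[exact: KN|rewrite rpredN]. Qed.
Lemma O_M x y : O x -> O y -> O (x * y).
by move=> [? ?] [? ?];split;[exact: KM|exact: rpredM]. Qed.
Lemma O_int (n : int) : O n%:~R.
by split;[exact: K_int|exact: rpred_int]. Qed.
Lemma O_1 : O 1. Proof. exact: (O_int 1). Qed.
Lemma O_rat q : O (ratr q) -> exists n : int, q = n%:~R.
move=> [_ /(Cint_rat_Aint (Crat_rat q)) /intrP[n hn]];exists n.
by apply: ratC_inj;rewrite ratr_int.
Qed.

Lemma oint_emb A B : oint A B = emb d (A%:~R / 2) (B%:~R / 2).
by rewrite /oint /emb !fmorph_div/= !ratr_int !ratr_nat;field. Qed.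
Lemma oint_inj A B A' B' : oint A B = oint A' B' -> A = A' /\ B = B'.
rewrite !oint_emb => /(emb_inj fd)[e1 e2];split;apply/eqP;rewrite -(@eqr_int rat);apply/eqP;lra.
Qed.
Lemma sg_oint A B : sg d (oint A B) = oint A (- B).
by rewrite !oint_emb sgE//;congr emb;rewrite intrN mulNr. Qed.
Lemma O_sg x : O x -> O (sg d x).
move=> /(O_oint fd)[A [B [h ->]]];rewrite sg_oint;apply/(O_oint fd);exists A, (- B);split => //.
lia.
Qed.
Lemma ointB A B A' B' : oint A B - oint A' B' = oint (A - A') (B - B').
by rewrite /oint;field. Qed.
Lemma ointZ (k : int) A B : k%:~R * oint A B = oint (k * A) (k * B).
by rewrite /oint;field. Qed.
Lemma oint_int n : oint (2 * n) 0 = n%:~R.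
by rewrite /oint;field. Qed.

Definition om (b : int) : algC := oint b 1.
(** The module Ze + Z(b + sqrt d)/2. When b^2 - d = 4ef it is an ideal, and it corresponds to the
    binary quadratic form with coefficients e, b, f. *)
Definition J (e b : int) : set algC := lat e%:~R (om b).

Lemma fd01 : exists q : int, d = 4 * q \/ d = 4 * q + 1.
case: fd => [[d1 _ _]|[m [-> _ _]]];last by exists m;left.
by exists (d %/ 4)%Z;right;rewrite {1}(divz_eq d 4) d1;ring.
Qed.

Lemma O_om (b c : int) : b ^+ 2 - d = 4 * c -> O (om b).
move=> h;apply/(O_oint fd);exists b, 1;split => //;rewrite mulr1.
have [q hq] := fd01;have [t ht] := sqr_mod4 b.
have : (2 %| (b - d) ^+ 2)%Z.
 case: hq => hq;case: ht => ht;try (by exfalso;move: h;rewrite hq ht;lia).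
  lia.
 have -> : (b - d) ^+ 2 = 2 * (2 * t + 1 - b * (4 * q + 1) + (8 * q ^+ 2 + 4 * q)) by lia.
 lia.
by rewrite (@dvdz_prime_sqr 2).
Qed.

Lemma om_sqr b c : b ^+ 2 - d = 4 * c -> om b * om b = b%:~R * om b - c%:~R.
move=> h;have hc : (4 : algC) * c%:~R = b%:~R ^+ 2 - s * s by rewrite (sq2 d) -intrX -intrB h intrM.
have -> : c%:~R = (b%:~R ^+ 2 - s * s) / 4 :> algC by rewrite -hc;field.
by rewrite /om /oint;field.
Qed.

Lemma om_sgM b c : b ^+ 2 - d = 4 * c -> om b * om (- b) = - c%:~R.
move=> h;have -> : om (- b) = om b - b%:~R by rewrite /om /oint intrN;field.
by rewrite mulrBr (om_sqr h);ring.
Qed.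

Lemma om_shift b k : om (b + 2 * k) = om b + k%:~R.
by rewrite /om /oint intrD;field. Qed.

Lemma latD u v x y : lat u v x -> lat u v y -> lat u v (x + y).
by move=> [m [n ->]] [m' [n' ->]];exists (m + m'), (n + n');rewrite !intrD;ring. Qed.
Lemma latZ u v (k : int) x : lat u v x -> lat u v (k%:~R * x).
by move=> [m [n ->]];exists (k * m), (k * n);rewrite !intrM;ring. Qed.
Lemma lat1 u v : lat u v u. Proof. by exists 1, 0;ring. Qed.
Lemma lat2 u v : lat u v v. Proof. by exists 0, 1;ring. Qed.

Lemma b_d b c : b ^+ 2 - d = 4 * c -> exists k : int, b = d + 2 * k.
move=> /O_om/(O_oint fd)[A [B [/dvdzP[k hk] /oint_inj[eA eB]]]].
by exists k;move: hk;rewrite -eB;lia.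
Qed.

Lemma om_d : exists c : int, d ^+ 2 - d = 4 * c.
by have [q [->|->]] := fd01;[exists (4 * q ^+ 2 - q)|exists (4 * q ^+ 2 + q)];ring. Qed.

Lemma O_lat : O = lat 1 (om d).
apply/seteqP;split => x;last first.
 have [c hc] := om_d;move=> [m [n ->]];apply: O_D;rewrite ?mulr1;first exact: O_int.
 by apply: O_M;[exact: O_int|exact: O_om hc].
move=> /(O_oint fd)[A [B [/dvdzP[k hk] ->]]];exists k, B;rewrite /om /oint.
have -> : A = d * B + k * 2 by lia.
by rewrite intrD;field.
Qed.

Lemma J_shift e b k : J e (b + 2 * (e * k)) = J e b.
rewrite /J om_shift;apply/seteqP;split => x [m [n ->]].
 by exists (m + n * k), n;rewrite !intrM;ring.
by exists (m - n * k), n;rewrite !intrM;ring.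
Qed.

Record isI (I : set algC) : Prop := IsI { isI_D : forall x y, I x -> I y -> I (x + y);
 isI_Z : forall a x, O a -> I x -> I (a * x) }.

Lemma isI_N I x : isI I -> I x -> I (- x).
by move=> h Ix;rewrite -mulN1r;apply: isI_Z => //;apply: O_N;exact: O_1. Qed.
Lemma isI_B I x y : isI I -> I x -> I y -> I (x - y).
by move=> h Ix Iy;apply: isI_D => //;apply: isI_N. Qed.
Lemma isI_int I (k : int) x : isI I -> I x -> I (k%:~R * x).
by move=> h Ix;apply: isI_Z => //;apply: O_int. Qed.
Lemma frac_isI I : fractional_ideal K I -> isI I.
by case=> *;split. Qed.

Lemma J_isI e b f : b ^+ 2 - d = 4 * (e * f) -> isI (J e b).
move=> h;split=> [x y|a x];first exact: latD.
rewrite O_lat => -[m [n ->]] Jx;rewrite mulrDl;apply: latD;first by rewrite mulr1;exact: latZ.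
rewrite -mulrA;apply: latZ;have [k hk] := b_d h.
have -> : om d = om b - k%:~R by rewrite hk om_shift;ring.
have [p [q ->]] := Jx.
exists (- k * p - q * f), (p * e + q * b - k * q).
have := om_sqr h;rewrite intrM;move: (om b) => w hw.
rewrite mulrBl !mulrDr.
have -> : w * (q%:~R * w) = q%:~R * (w * w) by ring.
by rewrite hw !intrD;ring.
Qed.

Lemma K_om b : K (om b).
by rewrite /om oint_emb;exists (b%:~R / 2), (1%:~R / 2). Qed.

Lemma J_frac e b f : 0 < e -> b ^+ 2 - d = 4 * (e * f) -> fractional_ideal K (J e b).
move=> e0 h;have hI := J_isI h;have Ob := O_om h;split.
- move=> x [m [n ->]];apply: KD;apply: KM;try exact: K_int;exact: K_om.
- by exists e%:~R;[exact: lat1|rewrite intr_eq0 gt_eqF].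
- by case: hI.
- by case: hI.
- exists 1;split;[exact: O_1|exact: oner_neq0|].
 move=> x [m [n ->]];rewrite mul1r;apply: O_D;apply: O_M;try exact: O_int;exact: Ob.
Qed.

(** Euclidean division by the least positive value: g associates an integer with elements of I and
    is compatible with subtraction of multiples. *)
Lemma ex_min_dvd (I : set algC) (g : algC -> int -> Prop) : isI I ->
 (forall x y (m n k : int), I x -> I y -> g x m -> g y n -> g (x - k%:~R * y) (m - k * n)) ->
 (exists x n, [/\ I x, g x n & n != 0]) ->
 exists y t, [/\ I y, g y t, 0 < t & forall x m, I x -> g x m -> exists k : int, m = k * t].
move=> hI gB [x0 [n0 [Ix0 g0 n00]]].
pose P (t : nat) := `[< (0 < t)%N /\ exists2 x, I x & g x t%:Z >].
have exP : exists t, P t.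
 exists `|n0|%N;apply/asboolP;split;first lia.
 case: (ltgtP n0 0) n00 => // s0 _;last by exists x0 => //;rewrite gtz0_abs.
 have := gB x0 x0 n0 n0 2 Ix0 Ix0 g0 g0;rewrite (_ : n0 - 2 * n0 = `|n0|%N);last lia.
 by exists (x0 - 2%:~R * x0) => //;apply: isI_B => //;exact: isI_int.
have [t /asboolP[t0 [y Iy gy]] tmin] := ex_minnP exP.
exists y, t%:Z;split => // x m Ix gx;exists (m %/ t%:Z)%Z;rewrite {1}(divz_eq m t).
suff -> : (m %% t%:Z)%Z = 0 by lia.
apply/eqP/negPn/negP => r0;have rge : 0 <= (m %% t%:Z)%Z by lia.
have rlt : (m %% t%:Z)%Z < t%:Z by lia.
have : P `|(m %% t%:Z)%Z|%N.
 apply/asboolP;split;first lia.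
 exists (x - (m %/ t%:Z)%Z%:~R * y);first by apply: isI_B => //;exact: isI_int.
 rewrite gez0_abs// (_ : (m %% t%:Z)%Z = m - (m %/ t%:Z)%Z * t%:Z);first exact: gB.
 by [].
by move/tmin;rewrite leqNgt => /negP;apply;rewrite -ltz_nat gez0_abs.
Qed.

(** Hermite normal form: y is an element of I with least positive sqrt d-component t, and z a least
    positive rational element, both after multiplication by a common denominator M. Stability under
    the ring of integers gives the divisibilities. *)
Lemma nform I : fractional_ideal K I -> exists (q : rat) (e b f : int),
 [/\ 0 < q, 0 < e, b ^+ 2 - d = 4 * (e * f) & I = scal (ratr q) (J e b)].
move=> fI;have hI := frac_isI fI;case: fI => sub [x0 Ix0 x0n] _ _ [r0 [Or0 r0n hr0]].
(* The square of the norm of a denominator is a positive rational integer that is again a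
   denominator. *)
have [M M0 hM] : exists2 M : int, 0 < M & forall x, I x -> O (M%:~R * x).
 have [q eq q0] := Nm_rat fd (O_K Or0).
 have [n en] : exists n : int, q = n%:~R by apply: O_rat;rewrite -eq;apply: O_M => //;exact: O_sg.
 exists (n ^+ 2).
  have n0 : n != 0 by rewrite -(intr_eq0 rat) -en q0.
  lia.
 have en' : r0 * sg d r0 = n%:~R by rewrite eq en ratr_int.
 move=> x Ix;have -> : (n ^+ 2)%:~R * x = n%:~R * sg d r0 * (r0 * x) by rewrite intrX expr2 -{2}en';ring.
 by apply: O_M;[apply: O_M;[exact: O_int|exact: O_sg]|exact: hr0].
have Mn : M%:~R != 0 :> algC by pos.
have Os : O s by apply/(O_oint fd);exists 0, 2;split;[rewrite sub0r rpredN dvdz_mull|rewrite /oint;field].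
have MI x : I x -> exists A B, M%:~R * x = oint A B by move=> /hM/(O_oint fd)[A [B [_ ->]]];exists A, B.
have [A0 [B0 e0]] := MI _ Ix0.
have AB0 : (A0 != 0) || (B0 != 0).
 rewrite -negb_and;apply/negP => /andP[/eqP a0 /eqP b0];move: e0;rewrite a0 b0 /oint mul0r addr0 mul0r => /eqP.
 by rewrite mulf_eq0 (negbTE Mn) (negbTE x0n).
have [y [t [Iy [At gy] t0 ht]]] : exists y t, [/\ I y, (exists A, M%:~R * y = oint A t), 0 < t &
  forall x m, I x -> (exists A, M%:~R * x = oint A m) -> exists k : int, m = k * t].
 apply: (ex_min_dvd hI (g := fun x m => exists A, M%:~R * x = oint A m)).
  move=> x y m n k _ _ [A hA] [B hB];exists (A - k * B);rewrite mulrBr hA mulrCA hB ointZ ointB//.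
 have [b0|b0] := eqVneq B0 0;last by exists x0, B0;split => //;exists A0.
 exists (s * x0), A0;split;[exact: isI_Z|exists (d * B0)|by move: AB0;rewrite b0 eqxx orbF].
 by rewrite mulrCA e0 /oint intrM -(sq2 d);field.
have [z [s0 [Iz gz s00 hs]]] : exists y t, [/\ I y, M%:~R * y = t%:~R, 0 < t &
  forall x m, I x -> M%:~R * x = m%:~R -> exists k : int, m = k * t].
 apply: (ex_min_dvd hI (g := fun x m => M%:~R * x = m%:~R)).
  by move=> x y' m n k _ _ hA hB;rewrite mulrBr hA mulrCA hB intrB intrM.
 have [q eq q0] := Nm_rat fd (O_K (hM _ Ix0)).
 have [n en] : exists n : int, q = n%:~R by apply: O_rat;rewrite -eq;apply: O_M;[exact: hM|apply: O_sg;exact: hM].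
 exists (sg d (M%:~R * x0) * x0), n;split;first by apply: isI_Z => //;apply: O_sg;exact: hM.
  by rewrite mulrCA mulrC eq en ratr_int.
 by rewrite -(intr_eq0 rat) -en q0 mulf_neq0.
have [k1 hk1] := om_d;have Oomd := O_om hk1.
have [e he] : exists e : int, s0 = e * t.
 apply: ht (isI_Z hI Oomd Iz) _;exists (s0 * d).
 by rewrite mulrCA gz mulrC ointZ mulr1.
have [k' hb] : exists k' : int, At = t * (2 * k' - d).
 have /(O_oint fd)[A' [B' [/dvdzP[k hk] /oint_inj[eA eB]]]] : O (oint At t) by rewrite -gy;apply: hM.
 have eAt : At = d * t + k * 2 by lia.
 have [k' hk'] : exists k' : int, t * d + k = k' * t.
  apply: ht (isI_Z hI Oomd Iy) _;exists ((2 * k1 + d) * t + d * k).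
  rewrite mulrCA gy /om /oint eAt.
  have -> : ((2 * k1 + d) * t + d * k)%:~R = (4 * k1 + 2 * d)%:~R / 2 * t%:~R + d%:~R * k%:~R :> algC by rewrite !intrD;field.
  by rewrite -hk1 !(intrD, intrM, intrN, intrX) -(sq2 d);field.
 by exists k';rewrite mulrBr;lia.
pose b := 2 * k' - d;rewrite hb -/b in gy.
have gy' : M%:~R * y = t%:~R * om b by rewrite gy /om ointZ mulr1.
have hc : b ^+ 2 - d = 4 * (k1 + k' ^+ 2 - k' * d) by lia.
set c := k1 + _ - _ in hc.
(* The product of y with the conjugate of [om b] is rational, hence a multiple of z; this makes e a
   divisor of (b^2 - d)/4. *)
have [f' hf] : exists f : int, - c * t = f * s0.
 have hc' : (- b) ^+ 2 - d = 4 * c by lra.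
 apply: hs (isI_Z hI (O_om hc') Iy) _.
 by rewrite mulrCA gy' mulrCA [om _ * _]mulrC (om_sgM hc) mulrC intrM intrN.
have tn : t != 0 by lia.
have hf' : c = e * - f' by apply: (mulIf tn);move: hf;rewrite he => hf;rewrite mulrN mulNr;lia.
exists (t%:~R / M%:~R), e, b, (- f');rewrite -hf';split => //.
- by rewrite divr_gt0 ?ltr0z.
- by rewrite -(pmulr_lgt0 _ t0) -he.
apply/seteqP;split => x.
 move=> Ix;have [A [B eAB]] := MI _ Ix.
 have [k hk] := ht _ _ Ix (ex_intro _ A eAB).
 have Ix' : I (x - k%:~R * y) by apply: isI_B => //;exact: isI_int.
 have e1 : M%:~R * (x - k%:~R * y) = oint (A - k * (t * b)) 0 by rewrite mulrBr eAB mulrCA gy ointZ ointB hk subrr.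
 have [n en] : exists n : int, oint (A - k * (t * b)) 0 = n%:~R.
  move: (hM _ Ix');rewrite e1 => /(O_oint fd)[A' [B' [/dvdzP[k2 hk2] /oint_inj[eA eB]]]].
  by exists k2;rewrite -oint_int;congr oint;move: hk2;rewrite -eB eA;lia.
 have [m hm] : exists m, n = m * s0 by apply: hs Ix' _;rewrite e1.
 exists (m%:~R * e%:~R + k%:~R * om b);first by exists m, k.
 rewrite fmorph_div/= !ratr_int;apply: (mulfI Mn).
 have -> : M%:~R * x = n%:~R + k%:~R * (M%:~R * y) by rewrite -en -e1;ring.
 by rewrite gy' hm he;field.
move=> [_ [m [k ->]] <-].
have -> : ratr (t%:~R / M%:~R) * (m%:~R * e%:~R + k%:~R * om b) = m%:~R * z + k%:~R * y.
 rewrite fmorph_div/= !ratr_int;apply: (mulfI Mn);rewrite [RHS]mulrDr [M%:~R * (m%:~R * z)]mulrCA gz.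
 by rewrite [M%:~R * (k%:~R * y)]mulrCA gy' he intrM;field.
by apply: isI_D => //;apply: isI_int.
Qed.

(** The square of a common prime factor p of e, b and f would divide d, with a discriminant as
    quotient; for odd p, and for p = 2 by [fd_4], this is excluded since d is fundamental. *)
Lemma primitive (e b f : int) : b ^+ 2 - d = 4 * (e * f) -> exists u v w : int, u * e + v * b + w * f = 1.
move=> h;pose g := gcdz (gcdz e b) f.
suff g1 : g = 1.
 have [[u v] huv] : exists uv : int * int, uv.1 * e + uv.2 * b = gcdz e b by have [u [v ?]] := Bezoutz e b;exists (u, v).
 have [u' [w]] := Bezoutz (gcdz e b) f;rewrite -/g g1 -huv/= => <-.
 by exists (u' * u), (u' * v), w;ring.
apply/eqP/negPn/negP => gn1.
have ge : (g %| e)%Z by apply: dvdz_trans (dvdz_gcdl _ _) (dvdz_gcdl _ _).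
have gb : (g %| b)%Z by apply: dvdz_trans (dvdz_gcdl _ _) (dvdz_gcdr _ _).
have gf : (g %| f)%Z := dvdz_gcdr _ _.
have g0 : g != 0.
 apply/eqP => g0;move: ge gb;rewrite g0 !dvd0z => /eqP e0 /eqP b0.
 by have := d_neq0 fd;move: h;rewrite e0 b0 mul0r sub0r => /eqP;rewrite oppr_eq0 => ->.
have [p pp pg] : exists2 p, prime p & (p%:Z %| g)%Z.
 exists (pdiv `|g|%N);last by rewrite dvdzE pdiv_dvd.
 by apply: pdiv_prime;have gg : 0 <= g by [];move: g0 gn1 gg;lia.
have [e' he] := dvdzP (dvdz_trans pg ge);have [b' hb] := dvdzP (dvdz_trans pg gb);have [f' hf] := dvdzP (dvdz_trans pg gf).
have ed : d = p%:Z ^+ 2 * (b' ^+ 2 - 4 * (e' * f')).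
 have -> : d = b ^+ 2 - 4 * (e * f) by lra.
 by rewrite he hb hf;ring.
have [po|/(prime_oddPn pp) p2] := boolP (odd p).
 by have := fd_odd fd pp po;rewrite ed abszM dvdn_mulr.
have [t ht] := sqr_mod4 b';rewrite p2 in ed.
have /(fd_4 fd) : d = 4 * (b' ^+ 2 - 4 * (e' * f')) by [].
case: ht => -> ht.
 by rewrite (_ : 4 * t - 4 * (e' * f') = (t - e' * f') * 4) ?modzMl in ht;[case: ht|ring].
by rewrite (_ : 4 * t + 1 - 4 * (e' * f') = (t - e' * f') * 4 + 1) ?modzMDl in ht;[case: ht|ring].
Qed.

End Quad.

(** * Products of ideals and the class group *)

Lemma imul_in (I J : set algC) x y : I x -> J y -> ideal_mul I J (x * y).
by move=> Ix Jy;exists 1%N, (fun=> x), (fun=> y);split => //;rewrite big_ord1. Qed.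

Lemma imul_D (I J : set algC) x y : ideal_mul I J x -> ideal_mul I J y -> ideal_mul I J (x + y).
move=> [m [x1 [y1 [hx hy ->]]]] [n [x2 [y2 [hx' hy' ->]]]].
exists (m + n)%N, (fun i : 'I_(m + n) => match fintype.split i with inl j => x1 j | inr j => x2 j end),
 (fun i : 'I_(m + n) => match fintype.split i with inl j => y1 j | inr j => y2 j end);split.
- by move=> i;case: (fintype.split i).
- by move=> i;case: (fintype.split i).
rewrite big_split_ord/=;congr (_ + _);eqbig i.
 by rewrite (_ : fintype.split (lshift n i) = inl i)//;exact: (unsplitK (inl _ i)).
by rewrite (_ : fintype.split (rshift m i) = inr i)//;exact: (unsplitK (inr _ i)).
Qed.

Lemma imul_sub (I J M : set algC) : M 0 -> (forall x y, M x -> M y -> M (x + y)) ->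
 (forall x y, I x -> J y -> M (x * y)) -> (ideal_mul I J `<=` M)%classic.
by move=> M0 MD h z [m [x [y [hx hy ->]]]];apply: (big_ind M) => // i _;apply: h. Qed.

Lemma imul_0 (I J : set algC) : ideal_mul I J 0.
by exists 0%N, (fun=> 0), (fun=> 0);split;[case|case|rewrite big_ord0]. Qed.

Lemma imulC (I J : set algC) : ideal_mul I J = ideal_mul J I.
by apply/seteqP;split;apply: imul_sub => [|x y|x y Ix Jy];rewrite ?[x * y]mulrC;try exact: imul_0;try exact: imul_D;exact: imul_in.
Qed.

Lemma imulA (I J L : set algC) : ideal_mul I (ideal_mul J L) = ideal_mul (ideal_mul I J) L.
apply/seteqP;split;apply: imul_sub => [|x y|x y Ix];try exact: imul_0;try exact: imul_D.
 apply: (imul_sub (M := fun y => ideal_mul (ideal_mul I J) L (x * y))) => [|a b|a b Ja Lb].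
 - by rewrite mulr0;exact: imul_0.
 - by rewrite mulrDr;exact: imul_D.
 - by rewrite mulrA;apply: imul_in => //;apply: imul_in.
move: x Ix => z Iz Ly;move: z Iz.
apply: (imul_sub (M := fun z => ideal_mul I (ideal_mul J L) (z * y))) => [|a b|a b Ja Lb].
- by rewrite mul0r;exact: imul_0.
- by rewrite mulrDl;exact: imul_D.
- by rewrite -mulrA;apply: imul_in => //;apply: imul_in.
Qed.

Lemma scal1 I : scal 1 I = I.
by apply/seteqP;split => [x [y Iy <-]|x Ix];[rewrite mul1r|exists x;rewrite ?mul1r]. Qed.
Lemma scalA x y I : scal x (scal y I) = scal (x * y) I.
apply/seteqP;split => [z [_ [t It <-] <-]|z [t It <-]];first by exists t;rewrite ?mulrA.
by exists (y * t);[exists t|rewrite mulrA].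
Qed.
Lemma scal_inj x I I' : x != 0 -> scal x I = scal x I' -> I = I'.
by move=> x0 h;rewrite -(scal1 I) -(mulVf x0) -scalA h scalA mulVf// scal1. Qed.

Lemma scal_mul x y I J : ideal_mul (scal x I) (scal y J) = scal (x * y) (ideal_mul I J).
apply/seteqP;split.
 apply: imul_sub => [|_ _ [a Ia <-] [b Jb <-]|_ _ [a Ia <-] [b Jb <-]].
 - by exists 0;[exact: imul_0|rewrite mulr0].
 - by exists (a + b);[exact: imul_D|rewrite mulrDr].
 - by exists (a * b);[exact: imul_in|ring].
move=> _ [z Iz <-];move: z Iz.
apply: (imul_sub (M := fun z => ideal_mul (scal x I) (scal y J) (x * y * z))) => [|a b|a b Ia Jb].
- by rewrite mulr0;exact: imul_0.
- by rewrite mulrDr;exact: imul_D.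
- by rewrite (_ : x * y * (a * b) = (x * a) * (y * b));[apply: imul_in;[exists a|exists b]|ring].
Qed.

Section Quad.
Variable d : int.
Hypothesis fd : fundamental_discriminant d.
Notation K := (quadratic_field d).
Notation O := (ring_of_integers K).
Notation s := (sq d).

Lemma isI_0 I x : isI d I -> I x -> I 0.
by move=> hI Ix;rewrite -(subrr x);exact: (isI_B hI Ix Ix). Qed.

Lemma O_frac : fractional_ideal K O.
split;[by move=> x []|by exists 1;[exact: O_1|exact: oner_neq0]|exact: O_D|exact: O_M|].
by exists 1;split => // [||x Ox];rewrite ?mul1r ?oner_neq0//;exact: O_1.
Qed.

Lemma mul1I I : fractional_ideal K I -> ideal_mul O I = I.
move=> fI;have hI := frac_isI fI;case: fI => _ [x0 Ix0 _] _ _ _;apply/seteqP;split.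
 by apply: imul_sub => [||x y];[exact: isI_0 Ix0|by case: hI|by case: hI => _ h;exact: h].
by move=> x Ix;rewrite -[x]mul1r;apply: imul_in => //;exact: O_1.
Qed.

Lemma frac_mul I I' : fractional_ideal K I -> fractional_ideal K I' -> fractional_ideal K (ideal_mul I I').
move=> fI fI';case: (fI) (fI') => [sI [x0 Ix0 x00] _ ZI [r [Or r0 hr]]] [sJ [y0 Jy0 y00] _ _ [r' [Or' r0' hr']]];split.
- by apply: imul_sub => [|x y|x y /sI Kx /sJ Ky];[exact: K0|exact: KD|exact: KM].
- by exists (x0 * y0);[exact: imul_in|rewrite mulf_neq0].
- exact: imul_D.
- move=> a + Oa;apply: (imul_sub (M := fun x => ideal_mul I I' (a * x))) => [|x y|x y Ix Jy].
 + by rewrite mulr0;exact: imul_0.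
 + by rewrite mulrDr;exact: imul_D.
 + by rewrite mulrA;apply: imul_in => //;apply: ZI.
- exists (r * r');split;[exact: O_M|exact: mulf_neq0|].
 apply: (imul_sub (M := fun x => O (r * r' * x))) => [|x y|x y Ix Jy].
 + by rewrite mulr0;exact: (O_int d 0).
 + by rewrite mulrDr;exact: O_D.
 + by rewrite (_ : r * r' * (x * y) = (r * x) * (r' * y));[apply: O_M;[exact: hr|exact: hr']|ring].
Qed.

Lemma K_OO x : K x -> exists2 r, O r /\ r != 0 & O (r * x).
move=> [a [b ->]];have e : ratr a + ratr b * sqrtC d%:~R = emb d a b by [].
have da := denq_neq0 a;have db := denq_neq0 b.
exists (denq a * denq b)%:~R;first by split;[exact: O_int|rewrite intr_eq0 mulf_neq0].
have -> : (denq a * denq b)%:~R * (ratr a + ratr b * sqrtC d%:~R) = (numq a * denq b)%:~R + (denq a * numq b)%:~R * s :> algC.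
 have ha : ratr a * (denq a)%:~R = (numq a)%:~R :> algC by rewrite -!(ratr_int algC) -ratCM numqE.
 have hb : ratr b * (denq b)%:~R = (numq b)%:~R :> algC by rewrite -!(ratr_int algC) -ratCM numqE.
 by rewrite !intrM -ha -hb /sq;ring.
apply: O_D;[exact: O_int|apply: O_M;[exact: O_int|]].
by apply/(O_oint fd);exists 0, 2;split;[rewrite sub0r rpredN dvdz_mull|rewrite /oint;field].
Qed.

Lemma frac_scal x I : K x -> x != 0 -> fractional_ideal K I -> fractional_ideal K (scal x I).
move=> Kx x0 [sI [x1 Ix1 x10] DI ZI [r [Or r0 hr]]];split.
- by move=> _ [y /sI Ky <-];exact: KM.
- by exists (x * x1);[exists x1|rewrite mulf_neq0].
- by move=> _ _ [a Ia <-] [b Ib <-];exists (a + b);[exact: DI|rewrite mulrDr].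
- by move=> a _ Oa [b Ib <-];exists (a * b);[exact: ZI|ring].
- have [t [Ot t0] Otx] := K_OO Kx;exists (r * t);split;[exact: O_M|exact: mulf_neq0|].
 move=> _ [y Iy <-];rewrite (_ : r * t * (x * y) = (r * y) * (t * x));last ring.
 by apply: O_M => //;exact: hr.
Qed.

Notation cl := (ideal_class K).

Lemma cl_scal x I : K x -> x != 0 -> cl (scal x I) = cl I.
move=> Kx x0;apply/seteqP;split => A [y [Ky y0 ->]].
 by exists (y * x);split;[exact: KM|exact: mulf_neq0|exact: scalA].
exists (y / x);split;[by apply: KM => //;exact: KV|by rewrite mulf_neq0// invr_eq0|].
by rewrite -[RHS]/(scal _ _) scalA divfK.
Qed.

Lemma cl_mem I : cl I I.
by exists 1;split;[exact: K1|exact: oner_neq0|rewrite -[RHS]/(scal _ _) scal1]. Qed.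

Lemma cl_eq I I' : cl I = cl I' <-> exists x, [/\ K x, x != 0 & I = scal x I'].
split=> [e|[x [Kx x0 ->]]];last exact: cl_scal.
by have := cl_mem I;rewrite e.
Qed.

Lemma cl_mul I I' : class_mul (cl I) (cl I') = cl (ideal_mul I I').
apply/seteqP;split => A.
 move=> [_ [x [Kx x0 ->]]] [_ [y [Ky y0 ->]]] <-;exists (x * y);split;[exact: KM|exact: mulf_neq0|].
 exact: scal_mul.
move=> [x [Kx x0 ->]];exists (scal x I);first by exists x.
exists I';first exact: cl_mem.
by rewrite -{1}(scal1 I') scal_mul mulr1.
Qed.

Definition conjI (I : set algC) : set algC := [set sg d x | x in I]%classic.

Lemma conj_J (e b : int) : conjI (J d e b) = J d e (- b).
have sgom c : sg d (om d c) = - om d (- c) by rewrite /om sg_oint// /oint;field.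
have h c x : J d e c x -> J d e (- c) (sg d x).
 move=> [m [n ->]];rewrite -intrM sgD//;[|exact: K_int|by apply: KM;[exact: K_int|exact: K_om]].
 rewrite sgM//;[|exact: K_int|exact: K_om].
 by rewrite !sg_int// sgom;exists m, (- n);rewrite intrN intrM;ring.
apply/seteqP;split => [_ [x Jx <-]|x Jx];first exact: h.
exists (sg d x);first by have := h _ _ Jx;rewrite opprK.
apply: sgK => //;case: Jx => m [n ->];apply: KD;apply: KM;try exact: K_int;exact: K_om.
Qed.

(** The product contains e^2, eb and ef up to sign, and gcd(e, b, f) = 1 by [primitive], so it
    contains e. *)
Lemma J_norm (e b f : int) : 0 < e -> b ^+ 2 - d = 4 * (e * f) -> ideal_mul (J d e b) (J d e (- b)) = scal e%:~R O.
move=> e0 h;have h' : (- b) ^+ 2 - d = 4 * (e * f) by lia.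
have Ob := O_om fd h;have Ob' := O_om fd h'.
have hom := om_sgM h;have hs : om d b + om d (- b) = s by rewrite /om /oint intrN;field.
have hd : om d b - om d (- b) = b%:~R by rewrite /om /oint intrN;field.
apply/seteqP;split.
 apply: imul_sub => [|_ _ [x Ox <-] [y Oy <-]|_ _ [m [n ->]] [m' [n' ->]]].
 - by exists 0;[exact: (O_int d 0)|rewrite mulr0].
 - by exists (x + y);[exact: O_D|rewrite mulrDr].
 exists ((m * m' * e)%:~R + (m * n')%:~R * om d (- b) + (n * m')%:~R * om d b - (n * n' * f)%:~R).
  by apply: O_D;[apply: O_D;[apply: O_D|]|apply: O_N];try exact: O_int;apply: O_M;try exact: O_int.
 transitivity (m%:~R * e%:~R * (m'%:~R * e%:~R) + m%:~R * e%:~R * (n'%:~R * om d (- b)) +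
  n%:~R * om d b * (m'%:~R * e%:~R) + n%:~R * n'%:~R * (om d b * om d (- b)) : algC);last ring.
 by rewrite hom;ring.
have [u [v [w huvw]]] := primitive fd h.
move=> _ [x Ox <-];have hI : isI d (ideal_mul (J d e b) (J d e (- b))) by apply: frac_isI;apply: frac_mul;[exact: J_frac e0 h|exact: J_frac e0 h'].
rewrite mulrC;apply: (isI_Z hI) => //.
have -> : e%:~R = (u * e)%:~R * e%:~R + v%:~R * (om d b * e%:~R) + (- v)%:~R * (e%:~R * om d (- b)) + (- w)%:~R * (om d b * om d (- b)) :> algC.
 transitivity ((u * e + v * b + w * f)%:~R * e%:~R : algC);first by rewrite huvw mul1r.
 by rewrite hom !intrN !(intrD, intrM) -hd;ring.
have e1 : J d e b e%:~R := lat1 _ _;have e2 : J d e (- b) e%:~R := lat1 _ _.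
have o1 : J d e b (om d b) := lat2 _ _;have o2 : J d e (- b) (om d (- b)) := lat2 _ _.
do 3?[apply: (isI_D hI)];try (apply: (isI_int _ hI);exact: imul_in).
by rewrite intrM -mulrA;apply: (isI_int _ hI);exact: imul_in.
Qed.

Notation G := (class_group K).
Notation one := (class_one K).
Notation cmul := (@class_mul).

Lemma G_rep c : G c -> exists (e b f : int), [/\ 0 < e, b ^+ 2 - d = 4 * (e * f) & c = cl (J d e b)].
move=> [I fI <-];have [q [e [b [f [q0 e0 h eI]]]]] := nform fd fI.
exists e, b, f;split => //;rewrite {1}eI cl_scal//;first exact: K_rat.
by rewrite ratC_eq0 gt_eqF.
Qed.

Lemma G_J (e b f : int) : 0 < e -> b ^+ 2 - d = 4 * (e * f) -> G (cl (J d e b)).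
by move=> e0 h;exists (J d e b) => //;exact: J_frac h. Qed.

Lemma G_1 : G one. Proof. by exists O => //;exact: O_frac. Qed.
Lemma G_M x y : G x -> G y -> G (class_mul x y).
by move=> [I fI <-] [I' fI' <-];rewrite cl_mul;exists (ideal_mul I I') => //;exact: frac_mul. Qed.
Lemma G_A x y z : G x -> G y -> G z -> class_mul x (class_mul y z) = class_mul (class_mul x y) z.
by move=> [I fI <-] [I' fI' <-] [I'' _ <-];rewrite !cl_mul imulA. Qed.
Lemma G_C x y : G x -> G y -> class_mul x y = class_mul y x.
by move=> [I fI <-] [I' fI' <-];rewrite !cl_mul imulC. Qed.
Lemma G_1l x : G x -> class_mul one x = x.
by move=> [I fI <-];rewrite cl_mul mul1I. Qed.
Lemma J_inv (e b f : int) : 0 < e -> b ^+ 2 - d = 4 * (e * f) -> class_mul (cl (J d e b)) (cl (J d e (- b))) = one.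
move=> e0 h;rewrite cl_mul (J_norm e0 h) cl_scal//;first exact: K_int.
pos.
Qed.
Lemma G_V x : G x -> exists2 y, G y & class_mul x y = one.
move=> /G_rep[e [b [f [e0 h ->]]]];exists (cl (J d e (- b)));last exact: J_inv h.
by apply: (@G_J e (- b) f);rewrite ?sqrrN.
Qed.

(** Multiplication by the conjugate of [om b] exchanges e and f: this is the reduction step for
    quadratic forms. *)
Lemma J_flip (e b f : int) : b ^+ 2 - d = 4 * (e * f) -> scal (om d (- b)) (J d e b) = scal e%:~R (J d f (- b)).
move=> h;have hom := om_sgM h;apply/seteqP;split => _ [_ [m [n ->]] <-].
 exists ((- n)%:~R * f%:~R + m%:~R * om d (- b));first by exists (- n), m.
 transitivity (m%:~R * e%:~R * om d (- b) + n%:~R * (om d b * om d (- b)) : algC);last ring.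
 by rewrite hom;ring.
exists (n%:~R * e%:~R + (- m)%:~R * om d b);first by exists n, (- m).
transitivity (n%:~R * e%:~R * om d (- b) + (- m)%:~R * (om d b * om d (- b)) : algC);first ring.
by rewrite hom;ring.
Qed.

Lemma om_neq0 b : om d b != 0.
rewrite /om oint_emb emb_eq0// negb_and;apply/orP;right.
by [].
Qed.

Lemma cl_flip (e b f : int) : 0 < e -> b ^+ 2 - d = 4 * (e * f) -> cl (J d e b) = cl (J d f (- b)).
move=> e0 h;rewrite -(cl_scal (J d e b) (K_om d (- b)) (om_neq0 _)) (J_flip h) cl_scal//;first exact: K_int.
pos.
Qed.

(** Gauss reduction: with e minimal in the class and |b| at most e, [cl_flip] shows that f is at
    least e, whence e and |b| are at most |d|. *)
Lemma G_finite : d < 0 -> finite_set G.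
move=> d0;pose N := `|d|%N.
pose F (x : 'I_N.+1 * 'I_N.+1 * bool) := cl (J d (val x.1.1)%:Z ((-1) ^+ x.2 * (val x.1.2)%:Z)).
suff : (G `<=` range F)%classic by move=> h;apply: sub_finite_set h _;apply: finite_image;exact: finite_finset.
move=> c Gc.
pose P (n : nat) := `[< (0 < n)%N /\ exists b f : int, b ^+ 2 - d = 4 * (n%:Z * f) /\ c = cl (J d n b) >].
have exP : exists n, P n.
 have [e [b [f [e0 h ec]]]] := G_rep Gc;exists `|e|%N;apply/asboolP;split;first lia.
 by exists b, f;rewrite gtz0_abs.
have [n /asboolP[n0 [b0 [f0 [h0 ec0]]]] nmin] := ex_minnP exP.
have n0' : 0 < n%:Z by [].
have [b [f [h ec hb]]] : exists b f : int, [/\ b ^+ 2 - d = 4 * (n%:Z * f), c = cl (J d n b) & `|b| <= n%:Z].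
 pose k := ((b0 + n%:Z) %/ (2 * n%:Z))%Z;pose r := ((b0 + n%:Z) %% (2 * n%:Z))%Z.
 have er : b0 + n%:Z = k * (2 * n%:Z) + r by lia.
 have r0 : 0 <= r by lia.
 have r1 : r < 2 * n%:Z by lia.
 have eb : b0 = (r - n%:Z) + 2 * (n%:Z * k) by lia.
 exists (r - n%:Z), (f0 - (r - n%:Z) * k - n%:Z * k ^+ 2);split.
 - have -> : (r - n%:Z) ^+ 2 - d = b0 ^+ 2 - d - 4 * (n%:Z * ((r - n%:Z) * k + n%:Z * k ^+ 2)) by rewrite eb;ring.
  lia.
 - by rewrite ec0 {1}eb J_shift.
 - by rewrite ler_norml;lia.
have f0' : 0 < f by lia.
have nf : (n <= `|f|)%N.
 apply: nmin;apply/asboolP;split;first lia.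
 by exists (- b), n%:Z;rewrite gtz0_abs// sqrrN h mulrC [f * _]mulrC;split;[ring|rewrite ec (cl_flip n0' h)].
have nd : (n <= N)%N.
 have bb : b ^+ 2 <= n%:Z * n%:Z by rewrite expr2;move: hb;rewrite ler_norml => /andP[];clear;nia.
 have ff : n%:Z * n%:Z <= n%:Z * f by rewrite ler_pM2l;lia.
 have : n%:Z <= n%:Z * n%:Z by rewrite ler_peMr;lia.
 lia.
have bN : (`|b| < N.+1)%N by lia.
exists (Ordinal (nd : (n < N.+1)%N), Ordinal bN, b < 0) => //.
rewrite ec /F/=;congr (cl (J d _ _)).
by rewrite [RHS]intEsign.
Qed.

(** If the torsion were infinite, [fset_set] would be empty and the inequality would hold
    trivially. *)
Lemma h_le k n : bnd (fun c => G c /\ gexp class_mul one c k = one) n -> (h k d <= n)%N.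
move=> hb;rewrite /h;have [fin|nfin] := pselect (finite_set (class_group_torsion K k)).
 by apply: hb => [|c];[exact: finmap.fset_uniq|rewrite in_fset_set// inE => -[]].
by rewrite /fset_set;case: pselect => // _;rewrite finmap.cardfs0.
Qed.

Lemma h_ge k (t : seq (set (set algC))) : d < 0 -> uniq t -> (forall c, c \in t -> G c /\ gexp class_mul one c k = one) ->
 (size t <= h k d)%N.
move=> d0 ut ht.
have fin : finite_set (class_group_torsion K k) by apply: sub_finite_set (G_finite d0) => c [].
rewrite /h;apply: uniq_leq_size => // c /ht[Gc ec];rewrite in_fset_set// inE;split;[exact: Gc|exact: ec].
Qed.

End Quad.

(** * Classes of order two and ambiguous ideals *)

Lemma imul4 (A B C D : set algC) :
 ideal_mul (ideal_mul A B) (ideal_mul C D) = ideal_mul (ideal_mul A C) (ideal_mul B D).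
by rewrite -imulA (imulA B C D) (imulC B C) -(imulA C B D) imulA. Qed.

Section Quad.
Variable d : int.
Hypothesis fd : fundamental_discriminant d.
Notation K := (quadratic_field d).
Notation O := (ring_of_integers K).
Notation s := (sq d).
Notation cl := (ideal_class K).
Notation G := (class_group K).
Notation one := (class_one K).
Notation conjI := (conjI d).
Notation J := (J d).

Lemma conj_scal x I : K x -> (I `<=` K)%classic -> conjI (scal x I) = scal (sg d x) (conjI I).
move=> Kx IK;apply/seteqP;split.
 by move=> _ [_ [y Iy <-] <-];exists (sg d y);[exists y|rewrite sgM//;exact: IK].
by move=> _ [_ [y Iy <-] <-];exists (x * y);[exists y|rewrite sgM//;exact: IK].
Qed.

Lemma conj_mul I I' : (I `<=` K)%classic -> (I' `<=` K)%classic -> conjI (ideal_mul I I') = ideal_mul (conjI I) (conjI I').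
move=> IK IK';apply/seteqP;split.
 move=> _ [z Iz <-];suff : K z /\ ideal_mul (conjI I) (conjI I') (sg d z) by case.
 move: z Iz;apply: (imul_sub (M := fun z => K z /\ ideal_mul (conjI I) (conjI I') (sg d z))).
 - by split;[exact: K0|rewrite sg0//;exact: imul_0].
 - by move=> x y [Kx hx] [Ky hy];split;[exact: KD|rewrite sgD//;exact: imul_D].
 - move=> x y Ix Iy;split;first by apply: KM;[exact: IK|exact: IK'].
  by rewrite sgM//;[apply: imul_in;[exists x|exists y]|exact: IK|exact: IK'].
move=> w hw;suff : exists2 z, K z /\ ideal_mul I I' z & sg d z = w by move=> [z [_ hz] <-];exists z.
move: w hw;apply: (imul_sub (M := fun w => exists2 z, K z /\ ideal_mul I I' z & sg d z = w)).
- by exists 0;[split;[exact: K0|exact: imul_0]|rewrite sg0].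
- by move=> _ _ [x [Kx hx] <-] [y [Ky hy] <-];exists (x + y);[split;[exact: KD|exact: imul_D]|rewrite sgD].
- move=> _ _ [x Ix <-] [y Iy <-];exists (x * y);last by rewrite sgM//;[exact: IK|exact: IK'].
 by split;[apply: KM;[exact: IK|exact: IK']|exact: imul_in].
Qed.

(** The quotients x/y and y/x are rational and integral, so both are units of Z. *)
Lemma scalO_rat (x y : rat) : x != 0 -> scal (ratr x) O = scal (ratr y) O -> x = y \/ x = - y.
move=> x0 h.
have [a [Oa ea]] : exists a, O a /\ ratr y * a = ratr x.
 have : scal (ratr y) O (ratr x) by rewrite -h;exists 1;[exact: O_1|rewrite mulr1].
 by case=> a Oa ea;exists a.
have [b [Ob eb]] : exists b, O b /\ ratr x * b = ratr y.
 have : scal (ratr x) O (ratr y) by rewrite h;exists 1;[exact: O_1|rewrite mulr1].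
 by case=> b Ob eb;exists b.
have x0' : ratr x != 0 :> algC by rewrite ratC_eq0.
have y0 : y != 0 by rewrite -ratC_eq0;apply: contra x0' => /eqP y0;rewrite -ea y0 mul0r.
have y0' : ratr y != 0 :> algC by rewrite ratC_eq0.
have [m em] : exists m : int, x / y = m%:~R by apply: O_rat;rewrite fmorph_div/= -ea mulrC mulKf//;exact: Oa.
have [n en] : exists n : int, y / x = n%:~R by apply: O_rat;rewrite fmorph_div/= -eb mulrC mulKf//;exact: Ob.
have mn : m * n = 1 by apply/eqP;rewrite -(@eqr_int rat) intrM -em -en;apply/eqP;field;rewrite x0 y0.
have : m = 1 \/ m = -1.
 have /eqP : (`|m| * `|n| = 1)%N by lia.
 by rewrite muln_eq1 => /andP[/eqP m1 _];clear -m1;lia.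
case=> hm;move: em;rewrite hm => em;[left|right];rewrite -[x](divfK y0) em;ring.
Qed.

Lemma frac_K I : fractional_ideal K I -> (I `<=` K)%classic. Proof. by case. Qed.

(** The class has a representative I equal to b times its conjugate, with b of norm eps. *)
Definition twist (c : set (set algC)) (eps : algC) := exists I b,
 [/\ fractional_ideal K I, c = cl I, K b, I = scal b (conjI I) & b * sg d b = eps].

Lemma G_1r x : G x -> class_mul x one = x.
by move=> Gx;rewrite (@G_C d x one Gx (G_1 d)) G_1l. Qed.

(** A class of order dividing 2 is equal to its conjugate, say J = x conj(J). Applying this twice
    gives J = N(x) J, hence N(x) is 1 or -1. *)
Lemma twist_ex c : G c -> gexp (@class_mul) one c 2 = one -> twist c 1 \/ twist c (-1).
move=> Gc;rewrite /gexp/= G_1r//.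
have [e [b [f [e0 h ec]]]] := G_rep fd Gc;rewrite ec => c2.
have h' : (- b) ^+ 2 - d = 4 * (e * f) by lia.
have fJ := J_frac fd e0 h;have GJ := G_J fd e0 h;have GJ' := G_J fd e0 h'.
have : cl (J e b) = cl (J e (- b)).
 apply: (mul_cancel (G_1 d) (@G_A d) (@G_C d) (@G_1l d) (G_V fd) GJ GJ' GJ).
 by rewrite c2 (G_C GJ' GJ) (J_inv fd e0 h).
move/(cl_eq fd) => [x [Kx x0 hx]].
have e0' : e%:~R != 0 :> rat by pos.
have [q eq q0] := Nm_rat fd Kx.
have hJ : J e b = scal (ratr q) (J e b).
 have hx' : J e (- b) = scal (sg d x) (J e b).
  rewrite -(conj_J fd e b) {1}hx conj_scal//;first by rewrite conj_J// opprK.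
  exact: frac_K (J_frac fd e0 h').
 by rewrite {1}hx {1}hx' scalA eq.
have h2 : scal (ratr (q * e%:~R)) O = scal (ratr e%:~R) O.
 rewrite ratCM -scalA !ratr_int -(J_norm fd e0 h).
 by have := scal_mul (ratr q) 1 (J e b) (J e (- b));rewrite -hJ scal1 mulr1.
have [|hq|hq] := scalO_rat _ h2.
- by rewrite mulf_neq0// q0.
- left;exists (J e b), x;split => //;first by rewrite conj_J.
 by rewrite eq -(rmorph1 (@ratr algC));congr ratr;apply: (mulIf e0');rewrite mul1r.
right;exists (J e b), x;split => //;first by rewrite conj_J.
by rewrite eq -(rmorph1 (@ratr algC)) -rmorphN/=;congr ratr;apply: (mulIf e0');rewrite mulN1r.
Qed.

Lemma twist_mul c c' a b : twist c a -> twist c' b -> twist (class_mul c c') (a * b).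
move=> [I [x [fI -> Kx hI <-]]] [I' [y [fI' -> Ky hI' <-]]].
exists (ideal_mul I I'), (x * y);split;rewrite ?cl_mul ?sgM//.
- exact: frac_mul.
- exact: KM.
- by rewrite conj_mul;[rewrite -scal_mul -hI -hI'|exact: frac_K|exact: frac_K].
- by ring.
Qed.

(** By Hilbert 90, b is a quotient g / conj(g), so I/g is stable under conjugation. In the normal
    form q J(e, b') this means that e divides b', and b' matters only modulo 2e. *)
Lemma twist_stable c : twist c 1 -> exists (e r f : int),
 [/\ 0 < e, r = 0 \/ r = 1, (e * r) ^+ 2 - d = 4 * (e * f) & c = cl (J e (e * r))].
move=> [I [b [fI -> Kb hI nb]]].
(* Hilbert 90 made explicit: g = 1 + b, or sqrt d when b = -1. *)
have [g [Kg g0 hg]] : exists g, [/\ K g, g != 0 & b * sg d g = g].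
 have [b1|b1] := eqVneq (1 + b) 0.
  exists s;split;[exact: K_sq|exact: sq_neq0|rewrite sg_sq//].
  have -> : b = -1 by rewrite -[b](addrK 1) [b + 1]addrC b1;ring.
  ring.
 exists (1 + b);split => //;first by apply: KD;[exact: K1|].
 by rewrite sgD ?sg1//;[rewrite mulrDr nb;ring|exact: K1].
have sg0' : sg d g != 0 by rewrite sg_eq0.
have b0 : b != 0 by apply: contra g0 => /eqP b0;rewrite -hg b0 mul0r.
have Kg' := KV fd Kg;have g0' : g^-1 != 0 by rewrite invr_eq0.
rewrite -(cl_scal fd I Kg' g0').
have fI' := frac_scal fd Kg' g0' fI.
have hI' : conjI (scal g^-1 I) = scal g^-1 I.
 rewrite conj_scal//;last exact: frac_K.
 rewrite [in RHS]hI scalA sgV//;congr scal.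
 by apply: (mulfI g0);rewrite mulrA mulfV// -{1}hg;field.
have [q [e [b' [f [q0 e0 h hJ]]]]] := nform fd fI'.
have q0' : ratr q != 0 :> algC by rewrite ratC_eq0 gt_eqF.
have fJ := J_frac fd e0 h.
have hJ' : J e (- b') = J e b'.
 apply: (scal_inj q0');rewrite -hJ -[RHS]hI' hJ conj_scal ?sg_rat ?conj_J//;[exact: K_rat|exact: frac_K].
have : J e b' (om d b' - om d (- b')).
 apply: (isI_B (frac_isI fJ));first exact: lat2.
 by rewrite -hJ';exact: lat2.
have -> : om d b' - om d (- b') = oint d (2 * b') 0 by rewrite /om /oint intrN intrM;field.
move=> [m [n hmn]].
have : oint d (2 * b') 0 = oint d (2 * m * e + n * b') n by rewrite hmn /om /oint !intrD !intrM;field.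
move/(oint_inj fd) => [e1 e2];have eb : b' = e * m by lia.
have [t [ht|ht]] : exists t : int, m = 0 + 2 * t \/ m = 1 + 2 * t by exists (m %/ 2)%Z;lia.
 exists e, 0, (f - 2 * 0 * t * e - 2 ^+ 0 * e * t ^+ 2 );split => //;first by left.
  lia.
 by rewrite hJ cl_scal// ?eb ?ht;[rewrite -(@J_shift d e (e * 0) t);congr (cl (J e _));ring|exact: K_rat].
exists e, 1, (f - e * t - e * t ^+ 2);split => //;first by right.
 lia.
by rewrite hJ cl_scal// ?eb ?ht;[rewrite -(@J_shift d e (e * 1) t);congr (cl (J e _));ring|exact: K_rat].
Qed.

(* A relation J1^2 = g J gives a norm equation. *)
Lemma sqr_norm (e b f : int) : 0 < e -> b ^+ 2 - d = 4 * (e * f) -> gsq G (@class_mul) one (cl (J e b)) ->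
 exists (U V W eps : int), [/\ W != 0, eps = 1 \/ eps = -1 & (U ^+ 2 - d * V ^+ 2) * e = eps * W ^+ 2].
move=> e0 h [c1 Gc1];rewrite /gexp/= G_1r//.
have [e1 [b1 [f1 [e10 h1 ->]]]] := G_rep fd Gc1.
rewrite cl_mul// => /(cl_eq fd)[g [Kg g0 hg]].
have fJ := J_frac fd e0 h;have fJ1 := J_frac fd e10 h1.
have hc := congr1 conjI hg;rewrite conj_scal ?conj_mul ?conj_J// in hc;try exact: frac_K.
have [q eq q0] := Nm_rat fd Kg.
have h2 : scal (ratr (q * e%:~R)) O = scal (ratr (e1%:~R ^+ 2)) O.
 rewrite ratCM -eq -scalA !ratCX !ratr_int -(J_norm fd e0 h) -scal_mul -hg -hc.
 by rewrite imul4 (J_norm fd e10 h1) scal_mul mul1I//;exact: O_frac.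
have e0' : e%:~R != 0 :> rat by pos.
have [u [v euv]] := Kg;pose W : int := denq u * denq v.
have W0 : W != 0 by pos.
have eq2 : q = u ^+ 2 - v ^+ 2 * d%:~R.
 apply: ratC_inj;rewrite -eq euv -/(emb d u v) sgE// embM -(emb_rat d);congr emb;ring.
have hu : u * (denq u)%:~R = (numq u)%:~R by rewrite numqE.
have hv : v * (denq v)%:~R = (numq v)%:~R by rewrite numqE.
have key : ((numq u * denq v) ^+ 2 - d * (numq v * denq u) ^+ 2)%:~R = q * W%:~R ^+ 2 :> rat by rewrite intrB !intrM -hu -hv eq2;ring.
have [|hq|hq] := scalO_rat _ h2;first by rewrite mulf_neq0// q0.
 exists (numq u * denq v), (numq v * denq u), (e1 * W), 1;split;[by rewrite mulf_neq0// gt_eqF|by left|].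
 by apply: (@intr_inj rat);rewrite intrM key mul1r intrX (intrM _ e1 W) exprMn -hq;ring.
exists (numq u * denq v), (numq v * denq u), (e1 * W), (-1);split;[by rewrite mulf_neq0// gt_eqF|by right|].
by apply: (@intr_inj rat);rewrite intrM key mulN1r intrN intrX (intrM _ e1 W) exprMn -[e1%:~R ^+ 2]opprK -hq;ring.
Qed.
End Quad.

(** * Norm equations and their local conditions *)

Lemma bnd_or (X : eqType) (A B : X -> Prop) m n : bnd A m -> bnd B n -> bnd (fun x => A x \/ B x) (m + n).
move=> hA hB t ut ht;rewrite -(count_predC (fun x => `[< A x >])) -!size_filter;apply: leq_add.
 by apply: hA;[exact: filter_uniq|move=> x;rewrite mem_filter => /andP[/asboolP]].
apply: hB;first exact: filter_uniq.
by move=> x;rewrite mem_filter => /andP[/asboolP nA /ht[]].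
Qed.

Lemma bnd_pred (T : finType) (A : T -> Prop) (B : pred T) : (forall x, A x -> B x) -> bnd A #|B|.
by move=> h t ut ht;rewrite cardE;apply: uniq_leq_size => // x /ht/h Bx;rewrite mem_enum. Qed.

Definition nrm_eq (d eps e : int) := exists U V W : int, W != 0 /\ (U ^+ 2 - d * V ^+ 2) * e = eps * W ^+ 2.

(** If p divides U, V and W, all three can be divided by p; descent on |W|. *)
Lemma nrm_descent (d eps e : int) p : prime p -> nrm_eq d eps e ->
 exists U V W : int, [/\ W != 0, (U ^+ 2 - d * V ^+ 2) * e = eps * W ^+ 2 & ~~ [&& (p %| U)%Z, (p %| V)%Z & (p %| W)%Z]].
move=> pp [U [V [W []]]];have [n] := ubnP `|W|%N;elim: n U V W => // n IH U V W hn W0 h.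
have [/and3P[pU pV pW]|hp] := boolP [&& (p %| U)%Z, (p %| V)%Z & (p %| W)%Z];last by exists U, V, W.
have [U' eU] := dvdzP pU;have [V' eV] := dvdzP pV;have [W' eW] := dvdzP pW.
have p0 : p%:Z != 0 by have := prime_gt0 pp;lia.
have W'0 : W' != 0 by apply: contra W0 => /eqP W0;rewrite eW W0 mul0r.
apply: (IH U' V' W') => //.
 have := prime_gt1 pp;rewrite eW in hn;rewrite -absz_gt0 in W'0;move: hn;clear -W'0;nia.
have p20 : p%:Z ^+ 2 != 0 by lia.
apply: (mulfI p20);move: h;rewrite eU eV eW => h.
lra.
Qed.

Section Cond.
Variables (d eps e : int) (p : nat).
Hypotheses (pp : prime p) (po : odd p) (he : eps = 1 \/ eps = -1) (hn : nrm_eq d eps e).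
Hypotheses (pd : (p %| d)%Z) (p2d : ~~ (p%:Z ^+ 2 %| d)%Z).

Let P0 : p%:Z != 0.
lia. Qed.
Let dvM a b : (p %| a * b)%Z = (p %| a)%Z || (p %| b)%Z.
by rewrite !dvdzE abszM Euclid_dvdM. Qed.
Let dv2 a : (p %| a ^+ 2)%Z = (p %| a)%Z.
exact: dvdz_prime_sqr. Qed.
Let legsq a : leg p (a ^+ 2) = if (p %| a)%Z then 0 else 1.
rewrite expr2;case: ifP => h;last by rewrite leg_sqr// h.
by apply/eqP;rewrite leg_eq0// dvM h.
Qed.
Let peps : ~~ (p %| eps)%Z.
by rewrite dvdzE;case: he => -> /=;rewrite dvdn1 gtn_eqF// prime_gt1. Qed.

(** In a solution not divisible by p as a whole, p does not divide U nor W, and modulo p the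
    equation reads e U^2 = eps W^2. *)
Lemma leg_cond_out : ~~ (p %| e)%Z -> leg p (eps * e) = 1.
move=> pe;have [U [V [W [W0 h hp]]]] := nrm_descent pp hn.
have [d' ed] := dvdzP pd;have pd' : ~~ (p %| d')%Z by apply: contra p2d => /dvdzP[q eq];rewrite ed eq -mulrA dvdz_mull.
have hU : eps * W ^+ 2 = U ^+ 2 * e - p%:Z * (d' * V ^+ 2 * e) by rewrite -h ed;ring.
have pW : ~~ (p %| W)%Z.
 apply/negP => pW;have pU : (p %| U)%Z.
  have : (p %| U ^+ 2 * e)%Z.
   have -> : U ^+ 2 * e = eps * W ^+ 2 + p%:Z * (d' * V ^+ 2 * e) by lra.
   by apply: rpredD;[rewrite dvdz_mull// dv2|exact: dvdz_mulr].
  by rewrite dvM (negbTE pe) orbF dv2.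
 have pV : (p %| V)%Z.
  have [U' eU] := dvdzP pU;have [W' eW] := dvdzP pW.
  have : (p %| d' * V ^+ 2 * e)%Z.
   apply/dvdzP;exists (U' ^+ 2 * e - eps * W' ^+ 2);apply: (mulfI P0).
   have -> : p%:Z * (d' * V ^+ 2 * e) = U ^+ 2 * e - eps * W ^+ 2 by lra.
   by rewrite eU eW;ring.
  by rewrite dvM [(_ %| d' * _)%Z]dvM dv2 (negbTE pe) (negbTE pd') orbF.
 by move: hp;rewrite pU pV pW.
have pU : ~~ (p %| U)%Z.
 apply: contra pW => pU;have : (p %| eps * W ^+ 2)%Z by rewrite hU;apply: rpredB;[rewrite dvdz_mulr// dv2|exact: dvdz_mulr].
 by rewrite dvM (negbTE peps) dv2.
have : leg p (eps * e * U ^+ 2) = leg p ((eps * W) ^+ 2).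
 apply: leg_mod => //;apply/eqP;rewrite eqz_mod_dvd.
 have -> : eps * e * U ^+ 2 - (eps * W) ^+ 2 = p%:Z * (eps * (d' * V ^+ 2 * e)).
  have -> : (eps * W) ^+ 2 = eps * (eps * W ^+ 2) by ring.
  by rewrite hU;ring.
 by rewrite dvdz_mulr.
by rewrite legM// !legsq dvM (negbTE peps) (negbTE pW) (negbTE pU) mulr1.
Qed.

(** Here p divides W and U. After division by p the equation modulo p reads -d' e' V^2 = eps W'^2,
    with V and W' prime to p. *)
Lemma leg_cond_in d' e' : d = d' * p%:Z -> e = e' * p%:Z -> ~~ (p %| e')%Z -> leg p (- eps * d' * e') = 1.
move=> ed ee pe;have [U [V [W [W0 h hp]]]] := nrm_descent pp hn.
have pd' : ~~ (p %| d')%Z by apply: contra p2d => /dvdzP[q eq];rewrite ed eq -mulrA dvdz_mull.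
have pW : (p %| W)%Z.
 have : (p %| eps * W ^+ 2)%Z by rewrite -h ee mulrA dvdz_mull.
 by rewrite dvM (negbTE peps) dv2.
have [W' eW] := dvdzP pW.
have h2 : (U ^+ 2 - d * V ^+ 2) * e' = eps * (p%:Z * W' ^+ 2) by apply: (mulIf P0);rewrite -mulrA -ee h eW;ring.
have pU : (p %| U)%Z.
 have : (p %| U ^+ 2 * e')%Z.
  have -> : U ^+ 2 * e' = p%:Z * (eps * W' ^+ 2 + d' * V ^+ 2 * e').
   transitivity ((U ^+ 2 - d * V ^+ 2) * e' + d * V ^+ 2 * e');first ring.
   by rewrite h2 ed;ring.
  by rewrite dvdz_mulr.
 by rewrite dvM (negbTE pe) orbF dv2.
have [U' eU] := dvdzP pU.
have h3 : p%:Z * U' ^+ 2 * e' - d' * V ^+ 2 * e' = eps * W' ^+ 2.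
 apply: (mulfI P0);transitivity ((U ^+ 2 - d * V ^+ 2) * e');first by rewrite eU ed;ring.
 lra.
have pV : ~~ (p %| V)%Z by apply: contra hp => ->;rewrite pU pW.
have pW' : ~~ (p %| W')%Z.
 apply/negP => pW';have : (p %| d' * V ^+ 2 * e')%Z.
  have -> : d' * V ^+ 2 * e' = p%:Z * (U' ^+ 2 * e') - eps * W' ^+ 2 by lra.
  by apply: rpredB;[exact: dvdz_mulr|rewrite dvdz_mull// dv2].
 by rewrite dvM [(_ %| d' * _)%Z]dvM dv2 (negbTE pd') (negbTE pV) (negbTE pe).
have : leg p (- eps * d' * e' * V ^+ 2) = leg p ((eps * W') ^+ 2).
 apply: leg_mod => //;apply/eqP;rewrite eqz_mod_dvd.
 have -> : - eps * d' * e' * V ^+ 2 - (eps * W') ^+ 2 = p%:Z * (- eps * (U' ^+ 2 * e')).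
  have -> : (eps * W') ^+ 2 = eps * (eps * W' ^+ 2) by ring.
  by rewrite -h3;ring.
 by rewrite dvdz_mulr.
by rewrite legM// !legsq dvM (negbTE peps) (negbTE pW') (negbTE pV) mulr1.
Qed.
End Cond.

(** * Counting divisors of d subject to the local conditions *)

Section Count.
Variable d : int.
Hypothesis fd : fundamental_discriminant d.
Variables (z : nat) (A : pset z).
Hypothesis oA : odd_primes A.
Hypothesis hA : forall p, p \in A -> (p %| `|d|%N)%N && ~~ (p ^ 2 %| `|d|)%N.

Let dn0 : (0 < `|d|)%N.
by rewrite absz_gt0;exact: d_neq0 fd. Qed.
Let Ap (p : 'I_z.+1) : p \in A -> prime p /\ odd p.
by move=> pA;have /forall_inP/(_ _ pA)/andP := oA. Qed.

Definition Es (e : nat) : pset z := [set p in A | (p %| e)%N].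
Definition eout (e : nat) : nat := (e %/ pr (Es e))%N.

Let EsA e : Es e \subset A. Proof. by apply/fintype.subsetP => p;rewrite inE => /andP[]. Qed.
Let allE (E : pset z) : E \subset A -> all_prime E.
by move=> /fintype.subsetP h;apply/all_primeP => p /h/Ap[]. Qed.

Lemma pr_dvd (E : pset z) n : E \subset A -> (forall p, p \in E -> (p %| n)%N) -> (pr E %| n)%N.
move=> EA h;rewrite /pr -big_enum/= -(big_map (@nat_of_ord z.+1) xpredT id).
apply: prod_primes_dvd.
- by rewrite map_inj_uniq ?enum_uniq//;exact: val_inj.
- by apply/allP => y /mapP[p];rewrite mem_enum => pE ->;apply: (Ap _).1;exact: (fintype.subsetP EA).
- by apply/allP => y /mapP[p];rewrite mem_enum => pE ->;exact: h.
Qed.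

Lemma eoutK e : (eout e * pr (Es e))%N = e.
by rewrite divnK// pr_dvd// => p;rewrite inE => /andP[]. Qed.

Lemma logn_pr (E : pset z) (q : nat) : E \subset A -> prime q ->
 logn q (pr E) = (q %| pr E)%N :> nat.
move=> EA pq;have [qE|qE] := boolP (q %| pr E)%N;last by rewrite lognE (negbTE qE) !andbF.
have pE0 : (0 < pr E)%N by apply: pr_gt0;exact: allE.
have : (q ^ 1 %| pr E)%N by [].
rewrite pfactor_dvdn// => l1;apply/eqP;rewrite eqn_leq l1 andbT -ltnS ltnNge -pfactor_dvdn//.
have q2 : (pr E %| `|d|)%N by apply: pr_dvd => // p /(fintype.subsetP EA)/hA/andP[].
apply/negP => q2E.
have : exists2 p, p \in E & q = p :> nat.
 move: qE;rewrite /pr => /(@big_ind _ (fun m => (q %| m)%N -> exists2 p, p \in E & q = p :> nat));apply.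
 - by rewrite dvdn1 => /eqP q1;rewrite q1 in pq.
 - by move=> x y hx hy;rewrite Euclid_dvdM// => /orP[].
 - by move=> p pE;rewrite dvdn_prime2 ?(Ap (fintype.subsetP EA _ pE)).1// => /eqP ->;exists p.
case=> p pE eq;have /andP[_ /negP] := hA (fintype.subsetP EA _ pE);apply.
by rewrite -eq;exact: dvdn_trans q2E q2.
Qed.

Definition outp : seq nat := [seq p <- primes `|d|%N | ~~ (p %| pr A)%N].
(** The part of a divisor e of d outside A is determined by the primes outside A dividing e and by
    the exponent of 2, which is less than 4. *)
Definition code (e : nat) : (size outp).-tuple bool * 'I_4 := ([tuple of map (fun p => p %| e)%N (in_tuple outp)], inord (logn 2 e)).

Lemma logn2_d : (logn 2 `|d|%N < 4)%N.
rewrite ltnNge -pfactor_dvdn//;apply/negP;case: fd => [[_ sf _]|[m [-> sf _]]] h.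
 by have := sf 2%N isT;rewrite (dvdn_trans _ h)// dvdn_exp2l.
have := sf 2%N isT;move: h;rewrite abszM/= (_ : 2 ^ 4 = 4 * 2 ^ 2)%N// dvdn_pmul2l//.
by move=> ->.
Qed.

Lemma eout_code e1 e2 : (0 < e1)%N -> (0 < e2)%N -> (e1 %| `|d|)%N -> (e2 %| `|d|)%N -> code e1 = code e2 -> eout e1 = eout e2.
move=> e10 e20 d1 d2 [] hm /(congr1 (@nat_of_ord 4)).
have l2 e : (0 < e)%N -> (e %| `|d|)%N -> (logn 2 e < 4)%N by move=> e0 ed;apply: leq_ltn_trans logn2_d;exact: dvdn_leq_log.
rewrite !inordK ?l2// => h2.
have pE0 e : (0 < pr (Es e))%N by apply: pr_gt0;exact: allE.
have eo0 e : (0 < e)%N -> (0 < eout e)%N by move=> e0;move: e0;rewrite -{1}(eoutK e) muln_gt0 => /andP[].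
apply: eqn_from_log;[exact: eo0|exact: eo0|] => q.
have [pq|npq] := boolP (prime q);last by rewrite lognE (negbTE npq)/= lognE (negbTE npq).
have lg e : (0 < e)%N -> (e %| `|d|)%N -> logn q (eout e) = (if (q %| pr A)%N then 0 else logn q e)%N.
 move=> e0 ed;have := congr1 (logn q) (eoutK e);rewrite lognM ?eo0// logn_pr//.
 have [qA|qA] := boolP (q %| pr A)%N.
  have [p pA eq] : exists2 p, p \in A & q = p :> nat.
   move: qA;rewrite /pr => /(@big_ind _ (fun m => (q %| m)%N -> exists2 p, p \in A & q = p :> nat));apply.
   - by rewrite dvdn1 => /eqP q1;rewrite q1 in pq.
   - by move=> x y hx hy;rewrite Euclid_dvdM// => /orP[].
   - by move=> p pE;rewrite dvdn_prime2 ?(Ap pE).1// => /eqP ->;exists p.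
  have le1 : (logn q e <= 1)%N.
   rewrite -ltnS ltnNge -pfactor_dvdn//;have /andP[_ /negP nq] := hA pA.
   by apply/negP => qe;apply: nq;rewrite -eq;exact: dvdn_trans qe ed.
  have -> : (q %| pr (Es e))%N = (q %| e)%N.
   apply/idP/idP => [h|h];first by apply: dvdn_trans h _;rewrite -{2}(eoutK e) dvdn_mull.
   by rewrite eq /pr (bigD1 p) ?dvdn_mulr// inE pA -eq.
  have : (0 < logn q e)%N = (q %| e)%N by rewrite logn_gt0 mem_primes pq e0.
  by case: (q %| e)%N le1;lia.
 suff -> : (q %| pr (Es e))%N = false by rewrite addn0.
 apply/negbTE;apply: contra qA => qE;apply: dvdn_trans qE _.
 by apply: pr_dvd => // p;rewrite inE => /andP[pA _];rewrite /pr (bigD1 p)//= dvdn_mulr.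
rewrite !lg//;case: ifP => // qA.
have [->//|q2] := eqVneq q 2%N.
have qo : odd q by case: (boolP (odd q)) => // /(prime_oddPn pq) e;rewrite e eqxx in q2.
have le1 e : (0 < e)%N -> (e %| `|d|)%N -> logn q e = (q %| e)%N :> nat.
 move=> e0 ed;have l1 : (logn q e <= 1)%N.
  rewrite -ltnS ltnNge -pfactor_dvdn//;apply: contra (fd_odd fd pq qo) => qe;exact: dvdn_trans qe ed.
 have : (0 < logn q e)%N = (q %| e)%N by rewrite logn_gt0 mem_primes pq e0.
 by case: (q %| e)%N l1;lia.
rewrite !le1//;congr nat_of_bool.
have [qd|qd] := boolP (q %| `|d|)%N;last first.
 have nd e : (e %| `|d|)%N -> (q %| e)%N = false by move=> ed;apply/negbTE;apply: contra qd => qe;exact: dvdn_trans qe ed.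
 by rewrite !nd.
have qL : q \in outp by rewrite mem_filter qA mem_primes pq dn0.
have : map (fun p => p %| e1)%N outp = map (fun p => p %| e2)%N outp by [].
move: qL;elim: outp => //= a l IH;rewrite inE => /orP[/eqP <-|ql] [h1 h2'];first exact: h1.
exact: IH.
Qed.

(** There are 2^omout times 4 codes. A code fixes the part r of e outside A, and e is then
    determined by its set of primes in A. *)
Lemma bnd_code (P : nat -> Prop) M : (forall e, P e -> (0 < e)%N /\ (e %| `|d|)%N) ->
 (forall r, bnd (fun E : pset z => exists e, [/\ P e, Es e = E & eout e = r]) M) ->
 bnd P (2 ^ omout A d * 4 * M).
move=> hP hM;apply: (bnd_fiber (f := code) (B := xpredT)) => //.
 have := @bnd_fin _ _ (fun _ => True) (@id ((size outp).-tuple bool * 'I_4)).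
 by rewrite card_prod card_tuple card_bool card_ord => h;apply: (bnd_sub _ (h _)) => // x _;exists x.
move=> y t ut ht;case: t ut ht => // e0 t ut ht.
have [P0 c0] := ht e0 (mem_head _ _);have [e00 e0d] := hP _ P0.
apply: (bnd_inj (f := Es) _ _ (hM (eout e0)) ut ht) => [e [Pe ce]|e e' [Pe ce] [Pe' ce'] h].
 by exists e;split => //;have [? ?] := hP _ Pe;apply: eout_code => //;rewrite c0.
have [? ?] := hP _ Pe;have [? ?] := hP _ Pe'.
by rewrite -(eoutK e) -(eoutK e') h (@eout_code e e')// ce ce'.
Qed.

Lemma bnd_div : bnd (fun e => (0 < e)%N /\ (e %| `|d|)%N) (2 ^ omout A d * 4 * 2 ^ #|A|).
apply: bnd_code => // r;rewrite -card_powerset -cardsE;apply: (bnd_pred (B := mem [set E : pset z | E \in powerset A])).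
by move=> E [e [_ <- _]];rewrite !inE.
Qed.

Let f (p : 'I_z.+1) (E : pset z) : int := \prod_(q in E | q != p) leg p q%:Z.

Lemma leg_pm (p : 'I_z.+1) a : p \in A -> ~~ (p %| a)%Z -> leg p a * leg p a = 1.
by move=> /Ap[pp po] h;exact: leg_sq1. Qed.

Lemma ndvd (p q : 'I_z.+1) : p \in A -> q \in A -> q != p -> ~~ (p %| q%:Z)%Z.
move=> /Ap[pp _] /Ap[pq _] qp;rewrite dvdzE/= dvdn_prime2//.
by apply: contra qp => /eqP h;apply/eqP/val_inj.
Qed.

Lemma f_symd (p : 'I_z.+1) (E F : pset z) : p \in A -> E \subset A -> F \subset A ->
 f p ((E :\: F) :|: (F :\: E)) = f p E * f p F.
move=> pA EA FA;rewrite /f [LHS]big_mkcond [X in _ = X * _]big_mkcond [X in _ = _ * X]big_mkcond -big_split/=.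
apply: eq_bigr => q _;rewrite !inE.
case: (boolP (q \in E)) => qE;case: (boolP (q \in F)) => qF;case: (eqVneq q p) => qp//=;rewrite ?mulr1 ?mul1r//.
by rewrite leg_pm//;apply: ndvd => //;exact: (fintype.subsetP EA).
Qed.

Lemma leg_prod (p : 'I_z.+1) (E : pset z) : p \in A -> E \subset A -> p \notin E -> leg p (pr E)%:Z = f p E.
move=> pA EA pE;have [pp po] := Ap pA;rewrite /pr /f.
transitivity (\prod_(q in E) leg p q%:Z).
 apply: (big_ind2 (fun (m : nat) (x : int) => leg p m%:Z = x)) => [|x1 x2 y1 y2 <- <-|//];first exact: leg1.
 by rewrite PoszM legM.
by apply: eq_bigl => q;case: eqVneq => [->|];rewrite ?andbT// andbF (negbTE pE).
Qed.

Lemma f_pm (p : 'I_z.+1) (E : pset z) : p \in A -> E \subset A -> f p E * f p E = 1.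
move=> pA EA;rewrite /f -big_split/= big1// => q /andP[qE qp].
by rewrite leg_pm//;apply: ndvd => //;exact: (fintype.subsetP EA).
Qed.

Lemma f_D1 (p : 'I_z.+1) (E : pset z) : f p (E :\ p) = f p E.
by apply: eq_bigl => q;rewrite !inE;case: eqVneq => // _;rewrite ?andbF ?andbT. Qed.

Lemma pdZ p : p \in A -> (p %| d)%Z /\ ~~ ((p : nat)%:Z ^+ 2 %| d)%Z.
by move=> /hA/andP[h1 h2];rewrite !dvdzE. Qed.

Lemma prD1 (p : 'I_z.+1) (E : pset z) : p \in E -> pr E = (pr (E :\ p) * p)%N.
by move=> pE;rewrite /pr (big_setD1 p)//= mulnC. Qed.

(** For a fixed part outside A the conditions on the set E of primes of e in A are affine over F_2;
    the symmetric difference with a fixed solution E0 satisfies the homogeneous conditions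
    [condK]. *)
Lemma bnd_leg eps : eps = 1 \/ eps = -1 ->
 bnd (fun e : nat => [/\ (0 < e)%N, (e %| `|d|)%N & nrm_eq d eps e%:Z]) (2 ^ omout A d * 4 * Kc A (sset A d)).
move=> he;apply: bnd_code => [e []//|r t ut ht].
case: t ut ht => // E0 t ut ht.
(* Symmetric difference with the base solution, an involution. *)
pose D (E : pset z) := (E :\: E0) :|: (E0 :\: E).
have DK E : D (D E) = E.
 apply/setP => q;rewrite !inE;case: (q \in E);case: (q \in E0) => //.
have hE E : E \in E0 :: t -> [/\ E \subset A,
  forall p : 'I_z.+1, p \in A -> p \notin E -> leg p (eps * r%:Z) * f p E = 1 &
  forall p : 'I_z.+1, p \in A -> p \in E -> leg p (- eps * (d %/ (p : nat)%:Z)%Z * r%:Z) * f p E = 1].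
 move=> /ht[e [[e0 ed hn] <- er]];split => [|p pA pE|p pA pE];first exact: EsA.
  have [pp po] := Ap pA;have [pd p2d] := pdZ pA.
  have pe : ~~ (p %| e%:Z)%Z by move: pE;rewrite inE pA.
  have := leg_cond_out pp po he hn pd p2d pe;rewrite -{1}(eoutK e) er PoszM mulrA legM//.
  by rewrite leg_prod//.
 have [pp po] := Ap pA;have [pd p2d] := pdZ pA.
 have ee : e%:Z = (r * pr (Es e :\ p))%:Z * (p : nat)%:Z by rewrite -PoszM -mulnA -prD1// -er eoutK.
 have EA : Es e :\ p \subset A by apply: fintype.subset_trans (EsA e);exact: subD1set.
 have pe : ~~ (p %| (r * pr (Es e :\ p))%:Z)%Z.
  have /andP[_ n2] := hA pA;apply: contra n2 => /dvdzP[q eq].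
  have : (p%:Z ^+ 2 %| d)%Z.
   apply: dvdz_trans (_ : (e%:Z %| d)%Z);last by [].
   by rewrite ee eq -mulrA dvdz_mull.
  by [].
 have ed' : d = (d %/ (p : nat)%:Z)%Z * (p : nat)%:Z by rewrite divzK.
 have := leg_cond_in pp po he hn pd p2d ed' ee pe;rewrite PoszM mulrA legM// leg_prod//.
  by rewrite f_D1.
 by rewrite !inE eqxx.
have := hE E0 (mem_head _ _) => -[E0A h0o h0i].
rewrite -(size_map D);apply: leq_trans (_ : (#|[set E : pset z | (E \subset A) && condK A (sset A d) E]| <= _)%N) => //.
rewrite cardE;apply: uniq_leq_size;first by rewrite map_inj_uniq//;exact: (can_inj DK).
move=> _ /mapP[E Et ->];have [EA ho hi] := hE E Et;rewrite mem_enum inE.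
have DA : D E \subset A by rewrite finset.subUset !(fintype.subset_trans (finset.subsetDl _ _)).
rewrite DA/=;apply/forall_inP => p pA;have [pp po] := Ap pA;have [pd p2d] := pdZ pA.
have fD : f p (D E) = f p E * f p E0 by exact: f_symd.
have pm x y : x * y = 1 :> int -> y * y = 1 -> x = y by move=> h1 h2;rewrite -[x]mulr1 -h2 mulrA h1 mul1r.
have fE := f_pm pA EA;have fE0 := f_pm pA E0A;have fDD := f_pm pA DA.
have fprod (F : pset z) : p \notin F -> \prod_(q in F) leg p q%:Z = f p F by move=> pF;apply: eq_bigl => q;case: eqVneq => [->|];rewrite ?andbT// andbF (negbTE pF).
have pD : (p \in D E) = (p \in E) (+) (p \in E0) by rewrite !inE;case: (p \in E);case: (p \in E0).
have key : p \in D E -> leg p (- (d %/ (p : nat)%:Z)%Z) * f p (D E) = 1 ->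
  (-1) ^+ (p \in sset A d) * \prod_(q in A :\: D E) leg p q%:Z = 1.
 move=> pDE h;rewrite fprod;last by rewrite finset.in_setD pDE.
 have -> : A :\: D E = (A :\: D E) :|: (D E :\: A) by move: DA;rewrite -finset.setD_eq0 => /eqP ->;rewrite finset.setU0.
 rewrite f_symd// inE pA/= legM//.
 have -> : leg p (pr A %/ p)%N%:Z = f p A.
  rewrite (prD1 pA) mulnK ?prime_gt0// leg_prod ?f_D1//;first exact: subD1set.
  by rewrite !inE eqxx.
 have fA := f_pm pA (fintype.subxx A);move: (f p A) (f p (D E)) (leg p _) fA fDD h => a b c haa hbb hcb.
 have ec := pm _ _ hcb hbb;rewrite ec.
 have : a = 1 \/ a = -1 by clear -haa;nia.
 have : b = 1 \/ b = -1 by clear -hbb;nia.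
 by move=> [->|->] [->|->];rewrite ?opprK.
have legd : leg p (- eps * (d %/ (p : nat)%:Z)%Z * r%:Z) = leg p (- (d %/ (p : nat)%:Z)%Z) * leg p (eps * r%:Z) by rewrite -legM//;congr leg;ring.
rewrite pD;case: (boolP (p \in E)) => pE;case: (boolP (p \in E0)) => pE0/=.
- rewrite fprod ?pD ?pE ?pE0// fD -(pm _ _ (hi p pA pE) fE) -(pm _ _ (h0i p pA pE0) fE0).
 by rewrite (pm _ _ (hi p pA pE) fE) fE.
- apply/eqP;apply: key;first by rewrite pD pE (negbTE pE0).
 by have := hi p pA pE;rewrite legd fD (pm _ _ (h0o p pA pE0) fE0) => <-;ring.
- apply/eqP;apply: key;first by rewrite pD pE0 (negbTE pE).
 by have := h0i p pA pE0;rewrite legd fD (pm _ _ (ho p pA pE) fE) => <-;ring.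
- rewrite fprod ?pD ?(negbTE pE) ?(negbTE pE0)// fD -(pm _ _ (ho p pA pE) fE) -(pm _ _ (h0o p pA pE0) fE0).
 by rewrite (pm _ _ (ho p pA pE) fE) fE.
Qed.
End Count.

Section Tors.
Variable d : int.
Hypothesis fd : fundamental_discriminant d.
Notation K := (quadratic_field d).
Notation G := (class_group K).
Notation one := (class_one K).
Notation gt2 := (gtor G (@class_mul) one 2).

(** Classes of twist 1 have index at most 2, since the product of two classes of twist -1 has twist
    1. Those of twist 1 are given by e and by r in {0, 1}, whence the second factor 2. *)
Lemma bnd_twist (Q : set (set algC) -> Prop) (P : nat -> Prop) N :
 (forall x y, G x -> G y -> Q x -> Q y -> Q (class_mul x y)) ->
 (forall e f r : int, 0 < e -> (e * r) ^+ 2 - d = 4 * (e * f) -> Q (ideal_class K (J d e (e * r))) -> P `|e|%N) ->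
 bnd P N -> bnd (fun c => gt2 c /\ Q c) (2 * (N * 2)).
move=> QM QP hN.
apply: (bnd_index2 (G_1 d) (@G_A d) (@G_C d) (@G_1l d) (G_V fd) (P := fun c => twist d c 1)) => [c [[]]//|x x0 w [[Gx x2] Qx] [[Gx0 x02] Qx0] nx nx0 Gw xw|].
 have -> : w = x0.
  apply: (mul_cancel (G_1 d) (@G_A d) (@G_C d) (@G_1l d) (G_V fd) Gw Gx0 Gx0).
  rewrite (G_C Gw Gx0) xw;move: x02;rewrite /gexp/= G_1r//.
 have Gxx := G_M Gx Gx0;split;first (split;last exact: QM).
  split => //;rewrite (gexp_mul (G_1 d) (@G_M d) (@G_A d) (@G_C d) (@G_1l d))// x2 x02 G_1l//;exact: G_1.
 have [//|t1] := twist_ex fd Gx x2;have [//|t2] := twist_ex fd Gx0 x02.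
 by have := twist_mul fd t1 t2;rewrite mulrNN mulr1.
pose B c (er : nat * bool) := exists f : int, let e := er.1%:Z in let r := (nat_of_bool er.2)%:Z in
 [/\ 0 < e, (e * r) ^+ 2 - d = 4 * (e * f) & c = ideal_class K (J d e (e * r))].
have hB c : twist d c 1 -> exists er, B c er.
 move=> /(twist_stable fd)[e [r [f [e0 hr h ec]]]].
 exists (`|e|%N, r == 1);exists f => /=;rewrite gtz0_abs//.
 by have -> : (nat_of_bool (r == 1))%:Z = r by lia.
pose F c := if pselect (exists er, B c er) is left h then projT1 (cid h) else (0%N, false).
have hF c : twist d c 1 -> B c (F c) by move=> /hB h;rewrite /F;case: pselect => // h';exact: (projT2 (cid h')).
apply: (bnd_fiber (f := fun c => (F c).1) (B := P)) => [c [[_ Qc] /hF[f [e0 h ec]]]|//|e].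
 have := QP _ _ _ e0 h;rewrite -ec => /(_ Qc)//.
rewrite -card_bool;apply: (bnd_fin (f := fun b : bool => ideal_class K (J d e%:Z (e%:Z * (nat_of_bool b)%:Z)))).
by move=> c [[_ /hF[f [e0 h ec]]] <-];exists (F c).2.
Qed.

Variables (z : nat) (A : pset z).
Hypothesis oA : odd_primes A.
Hypothesis hA : forall p, p \in A -> (p %| `|d|%N)%N && ~~ (p ^ 2 %| `|d|)%N.

Lemma e_dvd (e f r : int) : 0 < e -> (e * r) ^+ 2 - d = 4 * (e * f) -> (0 < `|e|)%N /\ (`|e| %| `|d|)%N.
move=> e0 h;split;first by rewrite absz_gt0 gt_eqF.
have -> : d = e * (e * r ^+ 2 - 4 * f) by transitivity ((e * r) ^+ 2 - 4 * (e * f));[rewrite -h;ring|ring].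
by rewrite abszM dvdn_mulr.
Qed.

Lemma bnd_gt2 : bnd gt2 (16 * 2 ^ omout A d * 2 ^ #|A|).
apply: (@bnd_sub _ _ (fun c => gt2 c /\ True));first by [].
apply: bnd_leq (bnd_twist (Q := fun _ => True) (P := fun e => (0 < e)%N /\ (e %| `|d|)%N) _ _ (bnd_div fd oA hA)) => //;first lia.
by move=> e f r e0 h _;exact: e_dvd h.
Qed.

(** By [sqr_norm] the divisor e satisfies a norm equation with sign 1 or -1, and [bnd_leg] counts
    the divisors for each sign. *)
Lemma bnd_gt2_sq : bnd (fun c => gt2 c /\ gsq G (@class_mul) one c) (32 * 2 ^ omout A d * Kc A (sset A d)).
have h1 : (1 : int) = 1 \/ (1 : int) = -1 by left.
have h2 : (-1 : int) = 1 \/ (-1 : int) = -1 by right.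
apply: bnd_leq (bnd_twist _ _ (bnd_or (bnd_leg fd oA hA h1) (bnd_leg fd oA hA h2)));first lia.
 move=> x y Gx Gy [u Gu <-] [v Gv <-];exists (class_mul u v);first exact: G_M.
 exact: (gexp_mul (G_1 d) (@G_M d) (@G_A d) (@G_C d) (@G_1l d)).
move=> e f r e0 h /(sqr_norm fd e0 h)[U [V [W [eps [W0 he hn]]]]].
have [e0' ed] := e_dvd e0 h;case: he => he;[left|right];split => //;exists U, V, W;rewrite gtz0_abs// -he//.
Qed.
End Tors.

(** * Reduction of planar lattices *)

Lemma shift_bound (F : realFieldType) (b n q : F) : 0 < q -> 4 * b ^+ 2 <= q ^+ 2 ->
 4 * (b + n * q) ^+ 2 <= (2 * `|n| + 1) ^+ 2 * q ^+ 2.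
move=> q0 h;have [h1 h2] : -q <= 2 * b /\ 2 * b <= q by split;nra.
have [n1 n2] : - `|n| <= n /\ n <= `|n| by split;[rewrite lerNl -normrN ler_norm|exact: ler_norm].
move: `|n| n1 n2 => N n1 n2;set M := (2 * N + 1) * q;set t := 2 * (b + n * q).
have e1 : 0 <= M - t by rewrite /M /t;nra.
have e2 : 0 <= M + t by rewrite /M /t;nra.
have -> : 4 * (b + n * q) ^+ 2 = t ^+ 2 by rewrite /t;ring.
have -> : (2 * N + 1) ^+ 2 * q ^+ 2 = M ^+ 2 by rewrite /M;ring.
by rewrite -subr_ge0 subr_sqr mulr_ge0.
Qed.

Section Reduce.
Variables (F : archiRealFieldType) (V : Type) (Bs : V -> V -> Prop) (add : V -> V -> int -> V) (q : V -> F) (B : V -> V -> F) (D : F).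
Hypotheses (D0 : 0 < D) (q0 : forall a b, Bs a b -> 0 < q a) (qD : forall a b, Bs a b -> q a * q b - B a b ^+ 2 = D).
Hypotheses (Bsw : forall a b, Bs a b -> Bs b a) (Badd : forall a b n, Bs a b -> Bs a (add b a n)).
Hypothesis (B_add : forall a b n, Bs a b -> B a (add b a n) = B a b + n%:~R * q a).

Lemma size_reduce a b : Bs a b -> exists b', Bs a b' /\ 4 * B a b' ^+ 2 <= q a ^+ 2.
move=> h;have qa := q0 h;pose n := Num.floor (B a b / q a + 2^-1).
exists (add b a (- n));split;first exact: Badd.
rewrite B_add// intrN;have h1 := floor_le_tmp (B a b / q a + 2^-1);have h2 := floorD1_gt (B a b / q a + 2^-1).
move: h1 h2;rewrite -/n intrD;set x := n%:~R => h1 h2.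
have e : B a b = B a b / q a * q a by rewrite divfK ?gt_eqF.
move: e h1 h2;set t := _ / _ => e h1 h2;rewrite e.
have -> : t * q a + - x * q a = (t - x) * q a by ring.
rewrite exprMn mulrA;apply: ler_piMl;first exact: sqr_ge0.
nra.
Qed.

(** Gauss reduction: as long as q(a)^2 > 4D, reducing b and exchanging the vectors divides q(a)^2 by
    at least 4. *)
Lemma reduce_basis a b : Bs a b -> exists a' b', [/\ Bs a' b', q a' ^+ 2 <= 4 * D & 4 * B a' b' ^+ 2 <= q a' ^+ 2].
move=> h;have [k hk] : exists k : nat, q a ^+ 2 <= 4 * D * 4 ^+ k.
 have D4 : 0 < 4 * D by pos.
 pose x := q a ^+ 2 / (4 * D);have x0 : 0 <= x by apply: divr_ge0;[exact: sqr_ge0|exact: ltW].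
 exists (Num.bound x);have hb : x < (Num.bound x)%:R := archi_boundP x0.
 have h2 : ((Num.bound x)%:R : F) <= 4 ^+ Num.bound x by rewrite -natrX ler_nat;apply: ltnW;apply: ltn_expl.
 by rewrite -ler_pdivrMl// mulrC;apply: le_trans h2;exact: ltW.
elim: k a b h hk => [|k IH] a b h hk;have [b' [h' hB]] := size_reduce h.
 by exists a, b';split => //;move: hk;rewrite mulr1.
have [le4|gt4] := leP (q a ^+ 2) (4 * D);first by exists a, b'.
apply: (IH b' a (Bsw h')).
have qa := q0 h;have qb := q0 (Bsw h');have e := qD h'.
have hqb : q b' <= q a / 2.
 rewrite -(ler_pM2l qa);have -> : q a * q b' = D + B a b' ^+ 2 by lra.
 lra.
have : q b' ^+ 2 <= (q a / 2) ^+ 2 by rewrite ler_pXn2r ?nnegrE//;[exact: ltW|lra].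
by rewrite expr_div_n;move: hk;rewrite (exprS _ k);set t := 4 ^+ k;lra.
Qed.
End Reduce.

(* Real and imaginary quadratic fields are treated alike: R x y is the real inner product on the complex plane. *)
Lemma ipC_real (x y : algC) : (x * y^* + x^* * y) / 2 \is Num.real.
by rewrite CrealE fmorph_div rmorphD !rmorphM/= !conjCK rmorph_nat addrC [x^* * _]mulrC [x * _]mulrC ![_ * x]mulrC ![_ * x^*]mulrC.
Qed.
Definition ip (x y : algC) : algR := in_algR (ipC_real x y).
Definition nsq x := ip x x.

Lemma algR_eq (x y : algR) : algRval x = algRval y -> x = y. Proof. exact: val_inj. Qed.
Lemma ipE x y : algRval (ip x y) = (x * y^* + x^* * y) / 2. Proof. by []. Qed.
Lemma nsqE x : algRval (nsq x) = x * x^*.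
by rewrite ipE;field. Qed.
Lemma algRM (x y : algR) : algRval (x * y) = algRval x * algRval y. Proof. by []. Qed.
Lemma algRD (x y : algR) : algRval (x + y) = algRval x + algRval y. Proof. by []. Qed.
Lemma algRN (x : algR) : algRval (- x) = - algRval x. Proof. by []. Qed.
Lemma algRX (x : algR) n : algRval (x ^+ n) = algRval x ^+ n. Proof. exact: rmorphXn. Qed.
Lemma algRz (n : int) : algRval n%:~R = n%:~R. Proof. ring. Qed.
Lemma algRn (n : nat) : algRval n%:R = n%:R. Proof. ring. Qed.
Definition algRE := (algRX, algRM, algRD, algRN, algRz, algRn).

Lemma nsqM x y : nsq (x * y) = nsq x * nsq y.
by apply: algR_eq;rewrite !algRE !nsqE;ring. Qed.
Lemma nsq_ge0 x : 0 <= nsq x.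
by apply: (_ : (0 : algC) <= algRval (nsq x));rewrite nsqE mul_conjC_ge0. Qed.
Lemma nsq_gt0 x : x != 0 -> 0 < nsq x.
by move=> x0;apply: (_ : (0 : algC) < algRval (nsq x));rewrite nsqE mul_conjC_gt0. Qed.
Lemma nsqX x n : nsq (x ^+ n) = nsq x ^+ n.
elim: n => [|n IH];last by rewrite !exprS nsqM IH.
by apply: algR_eq;rewrite nsqE rmorph1 mulr1.
Qed.
Lemma nsqV x : nsq x^-1 = (nsq x)^-1.
have [->|x0] := eqVneq x 0.
 have -> : nsq 0^-1 = 0 by apply: algR_eq;rewrite nsqE invr0 mul0r.
 have -> : nsq 0 = 0 by apply: algR_eq;rewrite nsqE mul0r.
 lra.
have n0 := nsq_gt0 x0;apply: (mulfI (lt0r_neq0 n0));rewrite -nsqM mulfV// mulfV ?lt0r_neq0//.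
by have := nsqX 1 0;rewrite expr0.
Qed.
Lemma nsqB x y : nsq (x - y) <= 2 * (nsq x + nsq y).
have -> : 2 * (nsq x + nsq y) = nsq (x - y) + nsq (x + y) by apply: algR_eq;rewrite !algRE !nsqE !(rmorphB, rmorphD);ring.
by rewrite lerDl nsq_ge0.
Qed.
Lemma nsq_int n : nsq n%:~R = n%:~R ^+ 2.
by apply: algR_eq;rewrite nsqE !algRE rmorph_int. Qed.

Lemma ratC_conj (q : rat) : (ratr q)^* = ratr q :> algC.
by apply/CrealP;apply: Creal_Crat;exact: Crat_rat. Qed.

(** * Binary cubic forms attached to classes of order three *)

(** The discriminant, divided by -27, of the cubic form with coefficients a, 3b, 3c, e. *)
Definition disc (a b c e : int) : int :=
 a ^+ 2 * e ^+ 2 - 6 * a * b * c * e - 3 * b ^+ 2 * c ^+ 2 + 4 * a * c ^+ 3 + 4 * b ^+ 3 * e.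

(** The form is a difference of two cubes of linear forms, with coefficients p and p', so its
    discriminant is a power of their determinant. *)
Lemma disc_id (x y x' y' p p' : algC) (u := fun j => x ^+ (3 - j) * y ^+ j * p - x' ^+ (3 - j) * y' ^+ j * p') :
 u 0%N ^+ 2 * u 3%N ^+ 2 - 6 * u 0%N * u 1%N * u 2%N * u 3%N - 3 * u 1%N ^+ 2 * u 2%N ^+ 2 + 4 * u 0%N * u 2%N ^+ 3 + 4 * u 1%N ^+ 3 * u 3%N
 = (x * y' - y * x') ^+ 6 * (p * p') ^+ 2.
by rewrite /u;ring. Qed.

Section Cubic.
Variable d : int.
Hypothesis fd : fundamental_discriminant d.
Notation K := (quadratic_field d).
Notation O := (ring_of_integers K).
Notation s := (sq d).
Notation cl := (ideal_class K).
Notation G := (class_group K).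
Notation one := (class_one K).
Notation J := (J d).

Lemma conj_K x : K x -> x^* = if 0 <= d then x else sg d x.
have hs : s^* = if 0 <= d then s else - s.
 case: ifP => d0;first by apply: CrealP;apply: ger0_real;rewrite sqrtC_ge0 ler0z.
 have : (s^* - s) * (s^* + s) == 0.
  have -> : (s^* - s) * (s^* + s) = s^* * s^* - s * s by ring.
  by rewrite -rmorphM sq2 rmorph_int subrr.
 rewrite mulf_eq0 => /orP[|];last by rewrite addr_eq0 => /eqP.
 rewrite subr_eq0 => /eqP/CrealP sr;have : 0 <= s * s by rewrite -expr2 real_exprn_even_ge0.
 by rewrite sq2 ler0z d0.
move=> [a [b ->]];have -> : (ratr a + ratr b * sqrtC d%:~R)^* = ratr a + ratr b * s^*.
 have cD (u v : algC) : (u + v)^* = u^* + v^* by ring.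
 have cM (u v : algC) : (u * v)^* = u^* * v^* by ring.
 by rewrite cD (cM (ratr b)) !ratC_conj.
rewrite hs -/s -/(emb d a b);case: ifP => // _;rewrite sgE// /emb rmorphN/=;ring.
Qed.

(** An ideal J with J^3 = (dl), and the norm of dl equal to e^3 up to sign. *)
Definition cdata (e b f : int) (dl : algC) := [/\ 0 < e, b ^+ 2 - d = 4 * (e * f), K dl, dl != 0 &
 ideal_mul (J e b) (ideal_mul (J e b) (J e b)) = scal dl O /\ (dl * sg d dl) ^+ 2 = e%:~R ^+ 6].

Lemma cdata_ex c : G c -> gexp (@class_mul) one c 3 = one -> exists e b f dl, cdata e b f dl /\ c = cl (J e b).
move=> Gc;rewrite /gexp/= G_1r//;have [e [b [f [e0 h ->]]]] := G_rep fd Gc.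
rewrite !cl_mul// => /(cl_eq fd) => -[dl [Kdl dl0 hdl]].
exists e, b, f, dl;split => //;split => //;split => //.
have fJ := J_frac fd e0 h;have fJJ := frac_mul fJ fJ;have fO := O_frac d.
have hc := congr1 (conjI d) hdl;rewrite !conj_mul ?conj_J ?conj_scal// in hc;try exact: frac_K.
have cO : conjI d O = O.
 apply/seteqP;split => [_ [x Ox <-]|x Ox];first exact: O_sg.
 by exists (sg d x);[exact: O_sg|rewrite sgK;case: Ox].
rewrite cO in hc.
have [q eq q0] := Nm_rat fd Kdl.
have h2 : scal (ratr q) O = scal (ratr (e%:~R ^+ 3)) O.
 rewrite -eq -{1}(mul1I fO) -scal_mul -hdl -hc imul4 (J_norm fd e0 h) imul4 (J_norm fd e0 h) !scal_mul !(mul1I fO).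
 by rewrite ratCX;congr (scal _ _);ring.
have [|hq|hq] := scalO_rat _ h2;first lia.
 by rewrite eq -ratCX hq -exprM ratCX ratr_int.
by rewrite eq -ratCX hq sqrrN -exprM ratCX ratr_int.
Qed.

Section Data.
Variables (e b f : int) (dl : algC).
Hypothesis cd : cdata e b f dl.

Let e0 : 0 < e. Proof. by case: cd. Qed.
Let Kdl : K dl. Proof. by case: cd. Qed.
Let dl0 : dl != 0. Proof. by case: cd. Qed.
Let eC0 : e%:~R != 0 :> algC. Proof. pos. Qed.
Let sdl0 : sg d dl != 0. Proof. by rewrite sg_eq0. Qed.

(** A Z-basis of J, normalised by its discriminant, which depends only on J. *)
Definition basis (x y : algC) := [/\ K x, K y, J e b = lat x y & (x * sg d y - y * sg d x) ^+ 2 = e%:~R ^+ 2 * d%:~R].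

Lemma basis0 : basis e%:~R (om d b).
split => //;[exact: K_int|exact: K_om|].
by rewrite sg_int// /om sg_oint// /oint intrN -(sq2 d);field.
Qed.

Lemma basis_neq0 x y : basis x y -> x != 0.
move=> [_ _ _ h];apply/eqP => x0;move: h;rewrite x0 sg0// mul0r mulr0 subrr expr0n => /esym/eqP.
by rewrite mulf_eq0 sqrf_eq0 (negbTE eC0) intr_eq0 (negbTE (d_neq0 fd)).
Qed.

Lemma basis_sw x y : basis x y -> basis y x.
move=> [Kx Ky eJ h];split => //;last by rewrite -h;ring.
by rewrite eJ;apply/seteqP;split => z [m [n ->]];exists n, m;ring.
Qed.

Lemma basis_add x y (n : int) : basis x y -> basis x (y + n%:~R * x).
move=> [Kx Ky eJ h];have Kn : K (n%:~R * x) by apply: KM => //;exact: K_int.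
split => //;[exact: KD| |].
 rewrite eJ;apply/seteqP;split => z [m [k ->]].
  by exists (m - k * n), k;rewrite intrB;ring.
 by exists (m + k * n), k;rewrite intrD;ring.
by rewrite sgD// sgM ?sg_int//;[rewrite -h;ring|exact: K_int].
Qed.

(** The coefficients, without binomial factors, of (Xx + Yy)^3 / dl. They are integral because J^3 =
    (dl); the cubic form takes their sqrt d-components. *)
Definition coef (x y : algC) (j : nat) : algC := x ^+ (3 - j) * y ^+ j / dl.

Lemma coef_O x y j : basis x y -> (j < 4)%N -> O (coef x y j).
move=> [Kx Ky eJ _] j4;have Jx : J e b x by rewrite eJ;exact: lat1.
have Jy : J e b y by rewrite eJ;exact: lat2.
suff [z Oz ez] : scal dl O (x ^+ (3 - j) * y ^+ j) by rewrite /coef -ez mulrC mulKf.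
case: cd => _ _ _ _ [<- _].
case: j j4 => [|[|[|[|//]]]] _/=.
- by rewrite (_ : _ * _ = x * (x * x));[do 2?[apply: imul_in => //]|ring].
- by rewrite (_ : _ * _ = x * (x * y));[do 2?[apply: imul_in => //]|ring].
- by rewrite (_ : _ * _ = x * (y * y));[do 2?[apply: imul_in => //]|ring].
- by rewrite (_ : _ * _ = y * (y * y));[do 2?[apply: imul_in => //]|ring].
Qed.

Lemma sg_coef x y j : basis x y -> sg d (coef x y j) = sg d x ^+ (3 - j) * sg d y ^+ j / sg d dl.
move=> [Kx Ky _ _];rewrite /coef !(sgM, sgX, sgV)//;try exact: KX;try exact: KV.
by apply: KM;exact: KX.
Qed.

Lemma coef_int x y j : basis x y -> (j < 4)%N -> exists a : int, coef x y j - sg d (coef x y j) = a%:~R * s.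
move=> h /(coef_O h)/(O_oint fd)[A [B [_ ->]]];exists B.
by rewrite sg_oint// /oint;field.
Qed.

Definition form (x y : algC) (a : nat -> int) := forall j, (j < 4)%N -> coef x y j - sg d (coef x y j) = (a j)%:~R * s.

Lemma form_ex x y : basis x y -> exists a, form x y a.
move=> h;have [a0 h0] := coef_int h (isT : (0 < 4)%N);have [a1 h1] := coef_int h (isT : (1 < 4)%N).
have [a2 h2] := coef_int h (isT : (2 < 4)%N);have [a3 h3] := coef_int h (isT : (3 < 4)%N).
by exists (fun j => nth 0 [:: a0;a1;a2;a3] j) => -[|[|[|[|]]]].
Qed.

(** [disc_id] applied to x, y and their conjugates: the determinant squared is e^2 d, and the norm
    of dl squared is e^6, so the powers of e cancel. *)
Lemma form_disc x y a : basis x y -> form x y a -> disc (a 0%N) (a 1%N) (a 2%N) (a 3%N) = d.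
move=> h ha;have [Kx Ky _ hD] := h;apply: (@intr_inj algC);have s4 : s ^+ 4 = d%:~R ^+ 2 by rewrite -(sq2 d);ring.
have d20 : d%:~R ^+ 2 != 0 :> algC by rewrite expf_neq0// intr_eq0 d_neq0.
apply: (mulIf d20);rewrite -[in LHS]s4.
have ND : (dl^-1 * (sg d dl)^-1) ^+ 2 = (e%:~R ^+ 6)^-1 by case: cd => _ _ _ _ [_ <-];rewrite -exprVn;congr (_ ^+ 2);rewrite invfM.
transitivity ((x * sg d y - y * sg d x) ^+ 6 * (dl^-1 * (sg d dl)^-1) ^+ 2);last first.
 rewrite ND (exprM _ 2 3) hD;field;by [].
rewrite -disc_id -!/(coef _ _ _) -!sg_coef// !ha// /disc !(intrD, intrB, intrX, intrM);ring.
Qed.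

Lemma wt_ex (x : algC) : x != 0 -> exists l : algR, 0 < l /\ l ^+ 3 * nsq x = 1.
move=> x0;have n0 := nsq_gt0 x0.
have rr : 3.-root (algRval (nsq x)) \is Num.real by apply: ger0_real;rewrite rootC_ge0//;exact: nsq_ge0.
pose r : algR := in_algR rr;have r3 : r ^+ 3 = nsq x by apply: algR_eq;rewrite algRX/= rootCK.
have r0 : 0 < r by apply: (_ : (0 : algC) < 3.-root _);rewrite rootC_gt0.
by exists r^-1;rewrite invr_gt0 exprVn r3 mulVf// lt0r_neq0.
Qed.

(** If a_0 = 0, then a_1^2 divides d with quotient 4 a_1 a_3 - 3 a_2^2, which forces a_1 = 1 or -1
    as d is fundamental. Moreover x^3/dl is rational, and comparing with a_1 gives N(x) = e up to
    sign; so x generates J. *)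
Lemma principal x y a : basis x y -> form x y a -> a 0%N = 0 -> cl (J e b) = one.
move=> h ha a0;have [Kx Ky eJ hD] := h;have x0 := basis_neq0 h.
have sx0 : sg d x != 0 by rewrite sg_eq0.
have hd := form_disc h ha;rewrite a0 in hd.
have b2 : d = (a 1%N) ^+ 2 * (4 * a 1%N * a 3%N - 3 * a 2%N ^+ 2) by rewrite -{1}hd /disc;ring.
have b1 : (a 1%N) ^+ 2 = 1.
 suff : `|a 1%N|%N = 1%N by lia.
 have nz : a 1%N != 0 by apply/eqP => z;have := d_neq0 fd;rewrite b2 z mul0r.
 apply/eqP/negPn/negP => n1;have g1 : (1 < `|a 1%N|)%N by lia.
 have pp := pdiv_prime g1;have [t ht] : exists t : int, a 1%N = t * (pdiv `|a 1%N|)%:Z by apply/dvdzP;rewrite dvdzE pdiv_dvd.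
 move: (pdiv _) pp ht => p pp ht.
 have [po|/(prime_oddPn pp) p2] := boolP (odd p).
  have := fd_odd fd pp po;rewrite b2 ht abszM exprMn abszM mulnAC dvdn_mull//.
 have e4 : d = 4 * (t ^+ 2 * (4 * a 1%N * a 3%N - 3 * a 2%N ^+ 2)) by lia.
 have [m1 hm1] := sqr_mod4 t;have [m2 hm2] := sqr_mod4 (a 2%N).
 have := fd_4 fd e4;case: hm1 => ->;case: hm2 => ->;set u := a 1%N * a 3%N.
 - by rewrite (_ : _ * _ = 4 * (m1 * (4 * u - 12 * m2)));[|rewrite /u;ring];move: (m1 * _) => v;lia.
 - by rewrite (_ : _ * _ = 4 * (m1 * (4 * u - 12 * m2 - 3)));[|rewrite /u;ring];move: (m1 * _) => v;lia.
 - by rewrite (_ : _ * _ = 4 * (4 * m1 * (u - 3 * m2) + u - 3 * m2));[|rewrite /u;ring];move: (_ + u - _) => v;lia.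
 - by rewrite (_ : _ * _ = 4 * (m1 * (4 * u - 12 * m2 - 3) + u - 3 * m2 - 1) + 1);[|rewrite /u;ring];move: (_ - 1) => v;lia.
have [q eq q0] := Nm_rat fd Kx.
pose r := coef x y 0.
have hr : r = sg d r by apply/eqP;rewrite -subr_eq0 ha// a0 mul0r.
have r2 : r ^+ 2 = (x * sg d x) ^+ 3 / (dl * sg d dl).
 rewrite expr2 {2}hr /r sg_coef// /coef;field;by rewrite dl0 sdl0.
have hb : ((a 1%N)%:~R * s) * (x * sg d x) = r * (y * sg d x - x * sg d y).
 have hr2 : sg d x ^+ 3 / sg d dl = r by rewrite hr sg_coef//= expr0;field.
 have hr1 : x ^+ 3 / dl = r by rewrite /r /coef/= expr0;field.
 rewrite -ha// sg_coef// /coef/=.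
 transitivity ((x ^+ 3 / dl) * (y * sg d x) - (sg d x ^+ 3 / sg d dl) * (x * sg d y));first ring.
 by rewrite hr1 hr2;ring.
have N1 : (x * sg d x) ^+ 2 = r ^+ 2 * e%:~R ^+ 2.
 have d0' : d%:~R != 0 :> algC by rewrite intr_eq0 d_neq0.
 apply: (mulfI d0');transitivity (((a 1%N)%:~R * s * (x * sg d x)) ^+ 2).
  have -> : ((a 1%N)%:~R * s * (x * sg d x)) ^+ 2 = ((a 1%N) ^+ 2)%:~R * (s * s) * (x * sg d x) ^+ 2 by ring.
  by rewrite b1 (sq2 d) mul1r.
 by rewrite hb exprMn -[(y * _ - _) ^+ 2]sqrrN opprB hD;ring.
have q00 : ratr q != 0 :> algC by rewrite ratC_eq0 q0.
have Nd : ratr q ^+ 2 = e%:~R ^+ 2 :> algC.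
 have hN : (dl * sg d dl) ^+ 2 = e%:~R ^+ 6 by case: cd => _ _ _ _ [].
 have nd0 : dl * sg d dl != 0 by pos.
 move: N1;rewrite r2 eq => N1.
 have q2 : ratr q ^+ 2 != 0 :> algC by pos.
 have h1 : dl * sg d dl = ratr q * e%:~R ^+ 2.
  apply: (mulfI q2);rewrite {1}N1;field;by rewrite ?sdl0.
 move: hN;rewrite h1 => hN;have e40 : (e%:~R : algC) ^+ 4 != 0 by pos.
 by apply: (mulIf e40);rewrite -[RHS]exprD/= -hN;ring.
have q2 : q ^+ 2 = e%:~R ^+ 2 by apply: ratC_inj;rewrite !ratCX ratr_int.
have qe : q = e%:~R \/ q = - e%:~R by move/eqP: q2;rewrite eqf_sqr => /orP[/eqP->|/eqP->];[left|right].
have [_ h4 _ _ _] := cd;have fJ := J_frac fd e0 h4;have hI := frac_isI fJ.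
have Jx : J e b x by rewrite eJ;exact: lat1.
have JN : scal (ratr q) O = ideal_mul (J e b) (J e (- b)).
 rewrite (J_norm fd e0 h4);case: qe => ->;rewrite ?ratr_int// rmorphN/= ratr_int.
 by apply/seteqP;split => _ [z Oz <-];exists (- z);rewrite ?mulNr ?mulrN ?opprK//;exact: O_N.
suff -> : J e b = scal x O by rewrite cl_scal.
apply/seteqP;split => [z Jz|_ [z Oz <-]];last by rewrite mulrC;exact: (isI_Z hI).
have : scal (ratr q) O (z * sg d x).
 rewrite JN;apply: imul_in => //;rewrite -conj_J//;by exists x.
case=> w Ow hw;exists w => //;apply: (mulIf sx0);rewrite -hw -eq;ring.
Qed.

(* a_(j+2) = (t + t') a_(j+1) - t t' a_j for the ratio t = y / x, so the form determines t up to conjugation. *)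
Definition ratio (x y : algC) : algC := y / x.

Lemma form_rec x y a : basis x y -> form x y a ->
 let t := ratio x y in let t' := sg d t in
 [/\ (a 2%N)%:~R = (t + t') * (a 1%N)%:~R - t * t' * (a 0%N)%:~R :> algC,
   (a 3%N)%:~R = (t + t') * (a 2%N)%:~R - t * t' * (a 1%N)%:~R :> algC &
   (a 1%N)%:~R ^+ 2 - (a 0%N)%:~R * (a 2%N)%:~R != 0 :> algC].
move=> h ha t t';have [Kx Ky eJ hD] := h;have x0 := basis_neq0 h.
have sx0 : sg d x != 0 by rewrite sg_eq0.
have s0 := sq_neq0 fd.
have et' : t' = sg d y / sg d x by rewrite /t' /t /ratio sgM ?sgV//;exact: KV.
pose u := x ^+ 3 / dl;pose u' := sg d x ^+ 3 / sg d dl.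
have ea j : (j < 4)%N -> (a j)%:~R = (u * t ^+ j - u' * t' ^+ j) / s.
 move=> j4;apply: (mulIf s0);rewrite -ha// divfK// sg_coef// et' /coef /u /u' /t /ratio.
 by case: j j4 => [|[|[|[|//]]]] _/=;field;rewrite x0 sx0 sdl0.
rewrite !ea//;split;[by field|by field|].
have -> : ((u * t ^+ 1 - u' * t' ^+ 1) / s) ^+ 2 - (u * t ^+ 0 - u' * t' ^+ 0) / s * ((u * t ^+ 2 - u' * t' ^+ 2) / s) = u * u' * (t - t') ^+ 2 / s ^+ 2 by field.
have tt : t - t' != 0.
 apply/eqP => tt0;have : x * sg d y - y * sg d x = 0.
  transitivity (- (t - t') * (x * sg d x));last by rewrite tt0 oppr0 mul0r.
  by rewrite et' /t /ratio;field;rewrite x0 sx0.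
 move=> z;move: hD;rewrite z expr0n => /esym/eqP;rewrite mulf_eq0 sqrf_eq0 (negbTE eC0) intr_eq0.
 by rewrite (negbTE (d_neq0 fd)).
by rewrite ?mulf_neq0 ?invr_eq0 ?expf_neq0.
Qed.

Lemma basis_cl x y : basis x y -> cl (J e b) = cl (lat 1 (ratio x y)).
move=> h;have [Kx Ky eJ hD] := h;have x0 := basis_neq0 h.
rewrite eJ -(cl_scal fd (lat 1 _) Kx x0);congr ideal_class.
apply/seteqP;split => [z [m [n ->]]|_ [_ [m [n ->]] <-]].
 by exists (m%:~R * 1 + n%:~R * ratio x y);[exists m, n|rewrite /ratio;field].
by exists m, n;rewrite /ratio;field.
Qed.

(** Weights for the two embeddings, cube roots of inverse squared absolute values of dl and its
    conjugate. The norm of dl fixes their product, and for imaginary fields they agree. *)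
Lemma wt_pair : exists l m : algR, [/\ 0 < l, 0 < m, l ^+ 3 * nsq dl = 1 /\ m ^+ 3 * nsq (sg d dl) = 1,
 l * m * e%:~R ^+ 2 = 1 & d < 0 -> l = m].
have [l [l0 hl]] := wt_ex dl0;have [m [m0 hm]] := wt_ex sdl0.
have cube1 (z : algR) : 0 < z -> z ^+ 3 = 1 -> z = 1 by move=> z0 h;apply/eqP;rewrite -(@pexpr_eq1 _ _ 3) ?h ?ltW.
exists l, m;split => //.
 apply: cube1;first by rewrite !mulr_gt0// ltr0z.
 have hN : (dl * sg d dl) ^+ 2 = e%:~R ^+ 6 by case: cd => _ _ _ _ [].
 have : nsq (dl * sg d dl) ^+ 2 = (e%:~R ^+ 6) ^+ 2 by rewrite -nsqX hN nsqX nsq_int -!exprM.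
 rewrite nsqM => hn;pose A := nsq dl;pose B := nsq (sg d dl);have hA : l ^+ 3 * A = 1 by [];have hB : m ^+ 3 * B = 1 by [].
 have AB : A * B = e%:~R ^+ 6.
  have eR0 : 0 < e%:~R ^+ 6 :> algR by rewrite exprn_gt0// ltr0z.
  have AB0 : 0 <= A * B by rewrite -nsqM nsq_ge0.
  by apply/eqP;rewrite -(@eqrXn2 _ 2) ?hn// ltW.
 transitivity ((l ^+ 3 * A) * (m ^+ 3 * B));last by rewrite hA hB mulr1.
 by transitivity (l ^+ 3 * m ^+ 3 * e%:~R ^+ 6);[ring|rewrite -AB;ring].
move=> d0;have e1 : nsq (sg d dl) = nsq dl.
 have := conj_K Kdl;rewrite leNgt d0/= => <-.
 by apply: algR_eq;rewrite !nsqE conjCK mulrC.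
have lm3 : l ^+ 3 = m ^+ 3.
 have n0 := lt0r_neq0 (nsq_gt0 dl0);by apply: (mulIf n0);rewrite hl -e1.
by apply/eqP;rewrite -(@eqrXn2 _ 3) ?ltW// lm3.
Qed.

(** The lattice J is reduced for q(x) = l |x|^2 + m |x'|^2, whose determinant on J is |d|. By the
    choice of l and m, division by dl turns q(x)^(3-j) q(y)^j into a bound for the coefficient
    number j and for its conjugate. *)
Lemma adapted_basis : exists (x y : algC) (q : algC -> algR), (forall z, 0 <= q z) /\ [/\ basis x y, 0 < q x, q x ^+ 2 <= 4 * `|d|%:~R,
 (forall n : int, 4 * (q x * q (y + n%:~R * x)) <= 4 * `|d|%:~R + (2 * `|n|%:~R + 1) ^+ 2 * q x ^+ 2) &
 forall (x y : algC) a j, basis x y -> form x y a -> (j < 4)%N -> (a j)%:~R ^+ 2 * `|d|%:~R <= 4 * q x ^+ (3 - j) * q y ^+ j].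
have [l [m [l0 m0 [hl hm] hlm hd]]] := wt_pair.
pose q (x : algC) : algR := l * nsq x + m * nsq (sg d x).
pose B (x y : algC) : algR := l * ip x y + m * ip (sg d x) (sg d y).
have D0 : 0 < (`|d|%:~R : algR) by rewrite ltr0z normr_gt0 d_neq0.
have q0 x y : basis x y -> 0 < q x.
 move=> h;have x0 := basis_neq0 h;apply: ltr_pwDl;first by rewrite mulr_gt0 ?nsq_gt0.
 by rewrite mulr_ge0 ?nsq_ge0// ltW.
have qge0 x : 0 <= q x by rewrite addr_ge0// mulr_ge0 ?nsq_ge0// ltW.
have qD x y : basis x y -> q x * q y - B x y ^+ 2 = `|d|%:~R.
 move=> [Kx Ky _ h];apply: algR_eq.
 have hlm' : algRval l * algRval m * e%:~R ^+ 2 = 1 by have := congr1 algRval hlm;rewrite !algRE.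
 have Ksx := K_sg fd Kx;have Ksy := K_sg fd Ky.
 rewrite /q /B /nsq !algRE !ipE (conj_K Kx) (conj_K Ky) (conj_K Ksx) (conj_K Ksy) !sgK//.
 case: ifP => d0.
  transitivity (algRval l * algRval m * (x * sg d y - y * sg d x) ^+ 2);first by field.
  by rewrite h mulrA hlm' mul1r ger0_norm.
 have dn : d < 0 by lia.
 rewrite -(hd dn) in hlm' *.
 transitivity (- (algRval l * algRval l * (x * sg d y - y * sg d x) ^+ 2));first by field.
 by rewrite h mulrA hlm' mul1r ltr0_norm// intrN.
have B_add x y (n : int) : basis x y -> B x (y + n%:~R * x) = B x y + n%:~R * q x.
 move=> [Kx Ky _ _];have Kn : K (n%:~R * x) by apply: KM => //;exact: K_int.
 apply: algR_eq;rewrite /q /B /nsq !algRE !ipE sgD// sgM ?sg_int//;last exact: K_int.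
 ring.
have [x [y [h hq hB]]] := reduce_basis (add := fun y x n => y + n%:~R * x) D0 q0 qD (@basis_sw) basis_add B_add basis0.
exists x, y, q;split;first exact: qge0.
split => //;first exact: q0 h.
 move=> n;have h' := basis_add n h;have := qD _ _ h';rewrite B_add// => e1.
 have -> : q x * q (y + n%:~R * x) = `|d|%:~R + (B x y + n%:~R * q x) ^+ 2 by lra.
 by rewrite mulrDr lerD2l intr_norm;apply: shift_bound => //;exact: q0 h.
move=> {x y h hq hB} x y a j h ha j4;have [Kx Ky _ _] := h.
have s2 : nsq s = `|d|%:~R.
 have [d0|d0] := ltP d 0;apply: algR_eq;rewrite nsqE algRE (conj_K (K_sq d)).
  by rewrite leNgt d0 sg_sq// mulrN sq2 ltr0_norm// intrN.
 by rewrite d0 (sq2 d) ger0_norm.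
rewrite -s2 -nsq_int -nsqM -ha//;letr (nsqB _ _).
have bd (t : algR) (z w u : algC) : 0 < t -> t ^+ 3 * nsq u = 1 -> (t * nsq z <= q x) -> (t * nsq w <= q y) ->
  nsq (z ^+ (3 - j) * w ^+ j / u) <= q x ^+ (3 - j) * q y ^+ j.
 move=> t0 tu hz hw;have u0 : nsq u != 0 by apply/eqP => u0;move: tu;rewrite u0 mulr0 => /esym/eqP;rewrite oner_eq0.
 have -> : nsq (z ^+ (3 - j) * w ^+ j / u) = (t * nsq z) ^+ (3 - j) * (t * nsq w) ^+ j.
  rewrite !nsqM !nsqX nsqV !exprMn;have -> : (nsq u)^-1 = t ^+ 3 by apply: (mulIf u0);rewrite mulVf.
  have -> : t ^+ 3 = t ^+ (3 - j) * t ^+ j by rewrite -exprD subnK.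
  ring.
 have z0 : 0 <= t * nsq z by rewrite mulr_ge0 ?nsq_ge0// ltW.
 have w0 : 0 <= t * nsq w by rewrite mulr_ge0 ?nsq_ge0// ltW.
 by apply: ler_pM;rewrite ?exprn_ge0//;apply: lerXn2r;rewrite ?nnegrE.
have p1 z : l * nsq z <= q z by rewrite lerDl mulr_ge0 ?nsq_ge0// ltW.
have p2 z : m * nsq (sg d z) <= q z by rewrite lerDr mulr_ge0 ?nsq_ge0// ltW.
have b1 := bd l x y dl l0 hl (p1 x) (p1 y).
have b2 := bd m _ _ _ m0 hm (p2 x) (p2 y).
rewrite -mulrA (sg_coef _ h);move: b1 b2;rewrite -/(coef _ _ _);set A := nsq _;set A' := nsq _;set Z := _ * _;lra.
Qed.

End Data.
End Cubic.

(** * The coefficient box at level T = 2^j, where T^2 P^2 is between D and 4D *)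

Section Box.
Variables (F : realFieldType) (P R D T : F).
Hypotheses (P0 : 0 < P) (R0 : 0 <= R) (D0 : 0 < D) (T0 : 0 < T).
Hypotheses (hPR : P * R <= 5 * D) (hPT : T ^+ 2 * P ^+ 2 <= 4 * D) (hDT : D <= T ^+ 2 * P ^+ 2).

Lemma sqr_cancel (a W B C : F) : 0 <= W -> a ^+ 2 * D <= B -> B ^+ 2 * W <= C * D ^+ 3 -> a ^+ 4 * W <= C * D.
move=> W0 h1 h2;have D2 : 0 < D ^+ 2 by pos.
rewrite -(ler_pM2r D2);via (B ^+ 2 * W);last lra.
have -> : a ^+ 4 * W * D ^+ 2 = (a ^+ 2 * D) ^+ 2 * W by ring.
by apply: ler_wpM2r => //;apply: lerXn2r;rewrite ?nnegrE//;[|apply: le_trans h1];rewrite mulr_ge0 ?sqr_ge0 ?ltW.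
Qed.

Variable C : F.
Hypotheses (C1 : 10000 <= C) (C2 : 16 * 5 ^+ 6 <= C).

Lemma powers n : [/\ (P * R) ^+ n <= 5 ^+ n * D ^+ n, (T ^+ 2 * P ^+ 2) ^+ n <= 4 ^+ n * D ^+ n,
 D ^+ n <= (T ^+ 2 * P ^+ 2) ^+ n & 0 <= D ^+ n].
have D0' := ltW D0;have h : 0 <= T ^+ 2 * P ^+ 2 by pos.
have [-> ->] : 5 ^+ n * D ^+ n = (5 * D) ^+ n /\ 4 ^+ n * D ^+ n = (4 * D) ^+ n by rewrite !exprMn.
rewrite exprn_ge0//;split => //;apply: lerXn2r;rewrite ?nnegrE//;try exact: mulr_ge0.
pos.
Qed.

Lemma box0 a : a ^+ 2 * D <= 4 * P ^+ 3 -> a ^+ 4 * T ^+ 6 <= C * D.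
move=> h;apply: (sqr_cancel _ h);first pos.
have -> : (4 * P ^+ 3) ^+ 2 * T ^+ 6 = 16 * (T ^+ 2 * P ^+ 2) ^+ 3 by ring.
have [_ h3 _ D3] := powers 3;
have : 10000 * D ^+ 3 <= C * D ^+ 3 by rewrite ler_wpM2r.
lra.
Qed.

Lemma box1 a : a ^+ 2 * D <= 4 * P ^+ 2 * R -> a ^+ 4 * T ^+ 2 <= C * D.
move=> h;apply: (sqr_cancel _ h);first by rewrite exprn_ge0 ?ltW.
have -> : (4 * P ^+ 2 * R) ^+ 2 * T ^+ 2 = 16 * ((P * R) ^+ 2 * (T ^+ 2 * P ^+ 2)) by ring.
have [h2 _ _ _] := powers 2;have [_ _ _ D3] := powers 3.
have : (P * R) ^+ 2 * (T ^+ 2 * P ^+ 2) <= (5 ^+ 2 * D ^+ 2) * (4 * D) by apply: ler_pM => //;[exact: sqr_ge0|rewrite mulr_ge0 ?sqr_ge0].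
have -> : (5 ^+ 2 * D ^+ 2) * (4 * D) = 100 * D ^+ 3 by ring.
have : 10000 * D ^+ 3 <= C * D ^+ 3 by rewrite ler_wpM2r.
by move: D3;lra.
Qed.

Lemma box2 a : a ^+ 2 * D <= 4 * P * R ^+ 2 -> a ^+ 4 <= C * D * T ^+ 2.
move=> h;have T2 : 0 < T ^+ 2 by pos.
rewrite -ler_pdivrMr//;apply: (sqr_cancel _ h);first pos.
rewrite ler_pdivrMr// -(ler_pM2r D0).
via ((4 * P * R ^+ 2) ^+ 2 * (T ^+ 2 * P ^+ 2)).
 by apply: ler_wpM2l => //;exact: sqr_ge0.
have -> : (4 * P * R ^+ 2) ^+ 2 * (T ^+ 2 * P ^+ 2) = 16 * (P * R) ^+ 4 * T ^+ 2 by ring.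
have -> : C * D ^+ 3 * T ^+ 2 * D = C * D ^+ 4 * T ^+ 2 by ring.
apply: ler_wpM2r;first exact: ltW.
have [h4 _ _ D4] := powers 4;have : 10000 * D ^+ 4 <= C * D ^+ 4 by rewrite ler_wpM2r.
lra.
Qed.

Lemma box3 a : a ^+ 2 * D <= 4 * R ^+ 3 -> a ^+ 4 <= C * D * T ^+ 6.
move=> h;have T2 : 0 < T ^+ 6 by pos.
rewrite -ler_pdivrMr//;apply: (sqr_cancel _ h);first pos.
have D3 : 0 < D ^+ 3 by pos.
rewrite ler_pdivrMr// -(ler_pM2r D3).
via ((4 * R ^+ 3) ^+ 2 * (T ^+ 2 * P ^+ 2) ^+ 3).
 by have [_ _ h3 _] := powers 3;apply: ler_wpM2l h3;exact: sqr_ge0.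
have -> : (4 * R ^+ 3) ^+ 2 * (T ^+ 2 * P ^+ 2) ^+ 3 = 16 * (P * R) ^+ 6 * T ^+ 6 by ring.
have -> : C * D ^+ 3 * T ^+ 6 * D ^+ 3 = C * D ^+ 6 * T ^+ 6 by ring.
apply: ler_wpM2r;first exact: ltW.
have [h6 _ _ D6] := powers 6;have h7 : (16 * 5 ^+ 6) * D ^+ 6 <= C * D ^+ 6 by rewrite ler_wpM2r.
lra.
Qed.
End Box.

(** Forms with nonzero leading coefficient in the box of level j: the first two sides shrink by
    2^(3j/2) and 2^(j/2), and the last two grow by the inverse factors. *)
Definition fm (d : int) (j : nat) (v : int * int * int * int) : Prop :=
 let: (a, b, c, e) := v in
 [/\ a != 0 /\ disc a b c e = d, a ^+ 4 * 2 ^+ (6 * j) <= 2 ^+ 18 * `|d|, b ^+ 4 * 2 ^+ (2 * j) <= 2 ^+ 18 * `|d|,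
   c ^+ 4 <= 2 ^+ 18 * `|d| * 2 ^+ (2 * j) & e ^+ 4 <= 2 ^+ 18 * `|d| * 2 ^+ (6 * j)].

Section Cubic.
Variable d : int.
Hypothesis fd : fundamental_discriminant d.
Notation K := (quadratic_field d).
Notation cl := (ideal_class K).
Notation G := (class_group K).
Notation one := (class_one K).
Notation gt3 := (gtor G (@class_mul) one 3).

Definition rec_rel (t : algC) (v : int * int * int * int) : Prop :=
 let: (a, b, c, e) := v in let t' := sg d t in
 [/\ c%:~R = (t + t') * b%:~R - t * t' * a%:~R :> algC,
   e%:~R = (t + t') * c%:~R - t * t' * b%:~R :> algC & b%:~R ^+ 2 - a%:~R * c%:~R != 0 :> algC].

(** The two linear relations have a nonzero determinant, so the form determines the trace and the
    norm of the ratio t. *)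
Lemma rec_rel_inj t t' v : rec_rel t v -> rec_rel t' v -> t' = t \/ t' = sg d t.
case: v => [[[a b] c] e] [h1 h2 h0] [h1' h2' _].
set A := a%:~R in h1 h0 h1';set B := b%:~R in h1 h2 h0 h1' h2';set C := c%:~R in h1 h2 h0 h1' h2'.
pose Dt := (t' + sg d t') - (t + sg d t);pose Dn := t' * sg d t' - t * sg d t.
have e1 : Dt * B = Dn * A by apply/eqP;rewrite -subr_eq0;apply/eqP;transitivity (((t' + sg d t') * B - t' * sg d t' * A) - ((t + sg d t) * B - t * sg d t * A));[rewrite /Dt /Dn;ring|rewrite -h1 -h1' subrr].
have e2 : Dt * C = Dn * B by apply/eqP;rewrite -subr_eq0;apply/eqP;transitivity (((t' + sg d t') * C - t' * sg d t' * B) - ((t + sg d t) * C - t * sg d t * B));[rewrite /Dt /Dn;ring|rewrite -h2 -h2' subrr].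
have Dt0 : Dt = 0.
 apply: (mulIf h0);rewrite mul0r;transitivity ((Dt * B) * B - A * (Dt * C));first ring.
 by rewrite e1 e2;ring.
have Dn0 : Dn = 0.
 apply: (mulIf h0);rewrite mul0r;transitivity (B * (Dn * B) - (Dn * A) * C);first ring.
 by rewrite -e1 -e2;ring.
have : (t' - t) * (t' - sg d t) == 0.
 have -> : (t' - t) * (t' - sg d t) = t' * Dt - Dn by rewrite /Dt /Dn;ring.
 by rewrite Dt0 Dn0 mulr0 subr0.
by rewrite mulf_eq0 !subr_eq0 => /orP[/eqP ->|/eqP ->];[left|right].
Qed.

(** The largest admissible power of 2; a short first vector P means a high level. *)
Lemma pow2_level (P D : algR) : 0 < P -> P ^+ 2 <= 4 * D -> exists j : nat,
 ((2 ^+ j) ^+ 2 * P ^+ 2 <= 4 * D) /\ (D <= (2 ^+ j) ^+ 2 * P ^+ 2).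
move=> P0 h;have P2 : 0 < P ^+ 2 by pos.
pose Q (j : nat) := (2 ^+ j) ^+ 2 * P ^+ 2 <= 4 * D.
have Q0 : exists j, Q j by exists 0%N;rewrite /Q expr0 expr1n mul1r.
have Qb j : Q j -> (j <= Num.bound (4 * D / P ^+ 2))%N.
 rewrite /Q -ler_pdivlMr// => hj;have h0 : 0 <= 4 * D / P ^+ 2 by apply: le_trans hj;exact: sqr_ge0.
 have := le_lt_trans hj (archi_boundP h0);rewrite -natrX -natrX ltr_nat => /ltnW;apply: leq_trans.
 by letr (ltnW (ltn_expl j (isT : 1 < 2)%N));rewrite -{1}[(2 ^ j)%N]expn1 leq_pexp2l// expn_gt0.
have [j Qj jmax] := ex_maxnP Q0 Qb;exists j;split => //.
rewrite leNgt;apply/negP => lt;have : Q j.+1.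
 rewrite /Q (_ : (2 ^+ j.+1) ^+ 2 * P ^+ 2 = 4 * ((2 ^+ j) ^+ 2 * P ^+ 2));last by rewrite (exprS 2 j);ring.
 lra.
by move/jmax;rewrite ltnn.
Qed.

(** The forms come from the bases x, y + nx for n < 2^j. All satisfy q(x) q(y + nx) <= 5|d|, so they
    lie in the box, and they are distinct because the second coefficient changes by n a_0 with a_0
    nonzero, by [principal]. *)
Lemma class_forms c : G c -> gexp (@class_mul) one c 3 = one -> c <> one ->
 exists (j : nat) (phi : nat -> int * int * int * int) (t : nat -> algC),
 [/\ forall n, (n < 2 ^ j)%N -> fm d j (phi n), forall n n', phi n = phi n' -> n = n',
   forall n, c = cl (lat 1 (t n)) & forall n, rec_rel (t n) (phi n)].
move=> Gc c3 cn1;have [e [b [f [dl [cd ec]]]]] := cdata_ex fd Gc c3.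
have [x [y [q [hq0 [h P0 P4 hR hco]]]]] := adapted_basis fd cd.
set D : algR := `|d|%:~R in P4 hR hco;have D0 : 0 < D by rewrite ltr0z normr_gt0 d_neq0.
have [j [hj1 hj2]] := pow2_level P0 P4.
pose yn (n : nat) := y + (n%:Z)%:~R * x.
have hb n : basis d e b x (yn n) by exact: basis_add.
pose an n := projT1 (cid (form_ex fd cd (hb n))).
have ha n : form d dl x (yn n) (an n) := projT2 (cid (form_ex fd cd (hb n))).
pose phi n := (an n 0%N, an n 1%N, an n 2%N, an n 3%N).
have an0 n : an n 0%N != 0 by apply/eqP => a0;apply: cn1;rewrite ec;exact: (principal fd cd (hb n) (ha n) a0).
exists j, phi, (fun n => ratio x (yn n));split => [n nj|n n'|n|n].
- have lez (u v : int) : u%:~R <= v%:~R :> algR -> u <= v by rewrite ler_int.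
 pose T : algR := 2 ^+ j;have T0 : 0 < T by pos.
 have PR : q x * q (yn n) <= 5 * D.
  have := hR n;rewrite -/(yn n);have nT : (2 * `|n%:Z|%:~R + 1) ^+ 2 <= (2 * T) ^+ 2 :> algR.
   have n1 : (`|n%:Z|%:~R + 1 : algR) <= T by rewrite /T -natrX natr1 ler_nat.
   apply: lerXn2r;rewrite ?nnegrE;[by rewrite addr_ge0// mulr_ge0// ler0z|by rewrite mulr_ge0// ltW|lra].
  have : (2 * `|n%:Z|%:~R + 1) ^+ 2 * q x ^+ 2 <= (2 * T) ^+ 2 * q x ^+ 2 by apply: ler_wpM2r => //;exact: sqr_ge0.
  have -> : (2 * T) ^+ 2 * q x ^+ 2 = 4 * (T ^+ 2 * q x ^+ 2) by ring.
  have gen (A B C' D' : algR) : B <= 4 * D' -> A <= 4 * B -> 4 * C' <= 4 * D' + A -> C' <= 5 * D' by lra.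
  exact: gen hj1.
 have R0 : 0 <= q (yn n) by [].
 have [C1 C2] : (10000 : algR) <= 2 ^+ 18 /\ (16 * 5 ^+ 6 : algR) <= 2 ^+ 18 by split;lra.
 have c0 := hco _ _ _ 0%N (hb n) (ha n) isT;have c1 := hco _ _ _ 1%N (hb n) (ha n) isT.
 have c2 := hco _ _ _ 2%N (hb n) (ha n) isT;have c3' := hco _ _ _ 3%N (hb n) (ha n) isT.
 rewrite /= !expr0 ?mulr1 in c0 c1 c2 c3'.
 have tp m : T ^+ m = (2 ^+ (m * j))%:~R by rewrite intrX /T -exprM mulnC.
 have eD : 2 ^+ 18 * D = (2 ^+ 18 * `|d|)%:~R by ring.
 split;first by split;[exact: an0|exact: (form_disc fd cd (hb n) (ha n))].
 + by apply: lez;have := box0 P0 R0 D0 T0 PR hj1 hj2 C1 c0;rewrite tp eD -intrX -intrM.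
 + by apply: lez;have := box1 P0 R0 D0 T0 PR hj1 hj2 C1 c1;rewrite tp eD -intrX -intrM.
 + by apply: lez;have := box2 P0 R0 D0 T0 PR hj1 hj2 C1 c2;rewrite tp eD -intrX -intrM.
 + by apply: lez;have := box3 P0 R0 D0 T0 PR hj1 hj2 C2 c3';rewrite tp eD -intrX -intrM.
- pose u0 := coef dl x y 0;pose u1 := coef dl x y 1.
 have s0 := sq_neq0 fd;have [Kx Ky _ _] := h;have [_ _ Kdl _ _] := cd.
 have Kd : K dl^-1 by exact: KV.
 have h0 m : (an m 0%N)%:~R * sq d = u0 - sg d u0 by rewrite -(ha m).
 have h1 m : (an m 1%N)%:~R * sq d = u1 - sg d u1 + m%:~R * (u0 - sg d u0).
  rewrite -(ha m 1%N isT);have -> : coef dl x (yn m) 1 = u1 + m%:~R * u0 by rewrite /u1 /u0 /coef /yn;ring.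
  have Ku0 : K u0 by apply: KM => //;apply: KM;exact: KX.
  have Ku1 : K u1 by apply: KM => //;apply: KM;exact: KX.
  have Km : K m%:~R by exact: K_int.
  by rewrite (sgD fd Ku1 (KM Km Ku0)) (sgM fd Km Ku0) sg_int//;ring.
 rewrite /phi => -[_ e1 _ _];have := h1 n;rewrite e1 h1 => /addrI/mulIf.
 have u00 : u0 - sg d u0 != 0 by rewrite -(h0 0%N) mulf_neq0// intr_eq0.
 by move=> /(_ u00)/eqP;rewrite eqr_int => /eqP[].
- by rewrite ec;exact: (basis_cl fd cd (hb n)).
- exact: (form_rec fd cd (hb n) (ha n)).
Qed.

(** The trivial class accounts for 1. Levels are below L because the leading coefficient is a
    nonzero integer. *)
Lemma gt3_levels (F : realFieldType) (M : nat -> nat) (L : nat) : 2 ^+ 18 * `|d| < 2 ^+ (6 * L) ->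
 (forall j, bnd (fm d j) (M j)) ->
 forall t : seq (set (set algC)), uniq t -> (forall c, c \in t -> gt3 c) -> (size t)%:R <= 1 + \sum_(j < L) 2 * (M j)%:R / 2 ^+ j :> F.
move=> hL hM t ut ht.
pose ok c (w : nat * (nat -> int * int * int * int) * (nat -> algC)) := let: (j, phi, th) := w in
 [/\ forall n, (n < 2 ^ j)%N -> fm d j (phi n), forall n n', phi n = phi n' -> n = n',
   forall n, c = cl (lat 1 (th n)) & forall n, rec_rel (th n) (phi n)].
have okx c : c \in t -> c <> one -> exists w, ok c w.
 move=> /ht[Gc c3] c1;have [j [phi [th h]]] := class_forms Gc c3 c1;by exists (j, phi, th).
pose w c := if pselect (exists w, ok c w) is left h then projT1 (cid h) else (0%N, fun=> (0, 0, 0, 0), fun=> 0).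
have hw c : c \in t -> c <> one -> ok c (w c) by move=> ct c1;rewrite /w;case: pselect => [h|[]];[exact: (projT2 (cid h))|exact: okx].
pose lv c := (w c).1.1;pose phi c := (w c).1.2;pose th c := (w c).2.
have lvL c : c \in t -> c <> one -> (lv c < L)%N.
 move=> ct c1;have := hw c ct c1;rewrite /lv;case: (w c) => [[j p] u]/= [h _ _ _].
 have := h 0%N (expn_gt0 _ _);case: (p 0%N) => [[[a b] c'] e] [[a0 _] ha _ _ _].
 have a4 : 1 <= a ^+ 4 by have : 0 < a ^+ 4 by lia.
 have h2 : (2 : int) ^+ (6 * j) < 2 ^+ (6 * L) by apply: le_lt_trans hL;apply: le_trans ha;rewrite ler_peMl// exprn_ge0.
 by move: h2;rewrite ltr_eXn2l// ltn_mul2l.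
(* Double count of the pairs (class, n) with n < 2^j: a form determines the ratio t up to
   conjugation, and t determines the class. *)
have cnt j : ((size [seq c <- t | (c != one) && (lv c == j)]) * 2 ^ j <= M j * 2)%N.
 set tj := filter _ t;have utj : uniq tj by exact: filter_uniq.
 have htj c : c \in tj -> [/\ c \in t, c <> one & lv c = j] by rewrite mem_filter => /andP[/andP[/eqP ? /eqP ?] ?].
 have := size_allpairs (fun (c : set (set algC)) (n : nat) => (c, n)) tj (iota 0 (2 ^ j));rewrite size_iota => <-.
 pose A (x : set (set algC) * nat) := x.1 \in tj /\ (x.2 < 2 ^ j)%N.
 apply: (bnd_fiber (A := A) (f := fun x => phi x.1 x.2) (B := fm d j)) => //.
 - move=> [c n] [/= /htj[ct c1 cj] nj];have := hw c ct c1;move: cj;rewrite /lv /phi;case: (w c) => [[j' p] u]/= -> [h _ _ _];exact: h.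
 - move=> v s0 us hs;case: s0 us hs => // [[c0 n0] s0] us hs.
  have fact x : x \in (c0, n0) :: s0 -> [/\ forall n n', phi x.1 n = phi x.1 n' -> n = n', forall n, x.1 = cl (lat 1 (th x.1 n)), rec_rel (th x.1 x.2) v & phi x.1 x.2 = v].
   move=> /hs[[/htj[ct c1 cj] nj] <-];have := hw _ ct c1;rewrite /phi /th;case: (w x.1) => [[j' p] u]/= [_ h2 h3 h4];by split.
  have [_ _ r0 _] := fact _ (mem_head _ _);rewrite -(size_map fst).
  have us' : uniq (map fst ((c0, n0) :: s0)).
   rewrite map_inj_in_uniq// => -[c n] [c' n'] /fact[h1 _ _ h2] /fact[_ _ _ h3]/= ec;rewrite /= in h1 h2 h3.
   by congr (_, _) => //;apply: h1;rewrite h2 {1}ec.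
  rewrite -card_bool;apply: (bnd_fin (A := fun c => c \in map fst ((c0, n0) :: s0)) (f := fun bb : bool => cl (lat 1 (if bb then th c0 n0 else sg d (th c0 n0))))) us' _ => //.
  move=> c /mapP[x /fact[_ hcl rx _] ->];have [e|e] := rec_rel_inj r0 rx;[exists true|exists false];by rewrite [RHS](hcl x.2) e.
 - by apply: allpairs_uniq;rewrite ?iota_uniq// => -[? ?] [? ?] _ _.
 - by move=> [c n] /allpairsP[[c' n'] [/= h1 h2 [-> ->]]];split => //=;move: h2;rewrite mem_iota.
have tot : (size t <= 1 + \sum_(j < L) size [seq c <- t | (c != one) && (lv c == j)])%N.
 rewrite -(count_predC (pred1 one)) -size_filter;apply: leq_add.
  rewrite size_filter count_uniq_mem;lia.
 have -> : count (predC (pred1 one)) t = count [pred c | (c != one) && (lv c < L)%N] t by apply: eq_in_count => c ct/=;case: eqP => //= c1;rewrite lvL.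
 elim: (t) => //= c t' IH;apply: leq_trans (_ : (((c != one) && (lv c < L)) + \sum_(j < L) size [seq x <- t' | (x != one) && (lv x == j)] <= _)%N);first by rewrite leq_add2l.
 case: (boolP (_ && _)) => [/andP[c1 cL]|_]/=;last first.
  by apply: leq_sum => j _;case: ifP => //= _;exact: leqnSn.
 rewrite (bigD1 (Ordinal cL))//= [leqRHS](bigD1 (Ordinal cL))//= c1 eqxx/= addnA;apply: leq_add => //.
 by apply: leq_sum => j _;case: ifP => //= _;exact: leqnSn.
via ((1 + \sum_(j < L) size [seq c <- t | (c != one) && (lv c == j)])%:R);first by rewrite ler_nat.
rewrite natrD lerD2l natr_sum;lesum j.
rewrite ler_pdivlMr ?exprn_gt0// -natrX -!natrM ler_nat;have := cnt j;lia.
Qed.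
End Cubic.

(** * Distinct classes of order two for negative discriminants *)

Definition sqfree (n : nat) := forall p, prime p -> ~~ (p ^ 2 %| n)%N.

Lemma sqfree_dvd m n : (m %| n)%N -> sqfree n -> sqfree m.
by move=> mn h p pp;apply: contra (h p pp) => pm;exact: dvdn_trans mn. Qed.

Lemma sqfree_sqr a b m : (0 < a)%N -> (0 < b)%N -> sqfree a -> sqfree b -> (a * b = m ^ 2)%N -> a = b.
move=> a0 b0 sa sb e;apply: eqn_from_log => // p.
have [pp|np] := boolP (prime p);last by rewrite lognE (negbTE np)/= lognE (negbTE np).
have la c : (0 < c)%N -> sqfree c -> (logn p c < 2)%N by move=> c0 sc;rewrite ltnNge -pfactor_dvdn//;exact: sc.
have := congr1 (logn p) e;rewrite lognM// lognX;have := la a a0 sa;have := la b b0 sb.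
lia.
Qed.

Section Lower.
Variable n : nat.
Hypotheses (n4 : (4 < n)%N) (n3 : (n %% 4 = 3)%N) (sn : sqfree n).
Let d : int := - n%:Z.

Lemma fd_lower : fundamental_discriminant d.
left;split;[by rewrite /d;lia|by move=> p pp;rewrite /d abszN;exact: sn|by rewrite /d;lia].
Qed.
Notation fd := fd_lower.
Notation K := (quadratic_field d).
Notation O := (ring_of_integers K).
Notation cl := (ideal_class K).
Notation G := (class_group K).
Notation one := (class_one K).
Notation J := (J d).

(** The condition e^2 < n selects one divisor from each pair e, n/e, whose ideals are equivalent. *)
Definition okd (e : nat) := [&& (0 < e)%N, (e %| n)%N & (e * e < n)%N].

Lemma okd_eq e : okd e -> exists f : int, e%:Z ^+ 2 - d = 4 * (e%:Z * f).
move=> /and3P[e0 /dvdnP[e1 en] _].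
have od : odd n by lia.
have h4 : (4 %| e + e1)%N.
 have : ((e1 * e) %% 4 = 3)%N by lia.
 rewrite -modnMm;have : (e %% 4 < 4)%N by lia.
 have : (e1 %% 4 < 4)%N by lia.
 rewrite /dvdn -modnDm;move: (e %% 4)%N (e1 %% 4)%N => u v.
 by case: u => [|[|[|[|//]]]];case: v => [|[|[|[|//]]]].
have [q hq] := dvdnP h4;exists q%:Z;rewrite /d opprK en PoszM.
lia.
Qed.

Lemma okd_sq e : okd e -> ideal_mul (J e%:Z e%:Z) (J e%:Z e%:Z) = scal (e%:Z)%:~R O.
move=> he;have [f hf] := okd_eq he;have e0 : 0 < e%:Z by lia.
rewrite -(J_norm fd e0 hf);congr (ideal_mul _ _).
by rewrite -(@J_shift d e%:Z (- e%:Z) 1);congr (J _ _);ring.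
Qed.

Lemma unit_pm v w : O v -> O w -> v * w = 1 -> v = 1 \/ v = -1.
move=> Ov Ow vw.
have norm x : O x -> exists A B m : int, [/\ x = oint d A B, 0 <= m, 4 * m = A ^+ 2 + n%:Z * B ^+ 2 & x * sg d x = m%:~R].
 move=> Ox;have [A [B [_ ex]]] := (O_oint fd x).1 Ox.
 have [q eq _] := Nm_rat fd (O_K Ox).
 have [m em] : exists m : int, q = m%:~R by apply: (@O_rat d);rewrite -eq;exact: (O_M Ox (O_sg fd Ox)).
 have e1 : x * sg d x = m%:~R by rewrite eq em ratr_int.
 have e4 : 4 * m = A ^+ 2 + n%:Z * B ^+ 2.
  apply: (@intr_inj algC);rewrite [RHS]intrD (intrM _ n%:Z) !intrX (intrM _ 4) -e1 ex (sg_oint fd) /oint intrN.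
  have -> : (n%:Z)%:~R = - (sq d * sq d) :> algC by rewrite (sq2 d) /d intrN opprK.
  by field.
 by exists A, B, m;split => //;have := sqr_ge0 A;have := sqr_ge0 B;move: (A ^+ 2) (B ^+ 2) e4 => a b;nia.
have [A [B [m [ev m0 hm Nv]]]] := norm v Ov;have [_ [_ [m' [_ m'0 _ Nw]]]] := norm w Ow.
have mm : m * m' = 1.
 apply: (@intr_inj algC);rewrite intrM -Nv -Nw;transitivity (v * w * (sg d v * sg d w));first ring.
 by rewrite -(sgM fd (O_K Ov) (O_K Ow)) vw (sg1 fd) mulr1.
have m1 : m = 1.
 have /eqP : (`|m| * `|m'| = 1)%N by lia.
 by rewrite muln_eq1 => /andP[/eqP h1 _];clear -h1 m0;lia.
have B0 : B = 0 by lia.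
have : A = 2 \/ A = -2.
 have : (A - 2) * (A + 2) == 0 by lia.
 by rewrite mulf_eq0 subr_eq0 addr_eq0 => /orP[/eqP|/eqP];[left|right].
by rewrite ev B0 /oint mul0r => -[->|->];[left|right;rewrite intrN];field.
Qed.

(** If J_e = x J_e', then x^2 e' = e or -e, the only units being 1 and -1. Hence x is rational or a
    rational multiple of sqrt d: in the first case ee' is a square and e = e'; in the second e' =
    n/e, impossible as both squares are below n. *)
Lemma okd_inj e e' : okd e -> okd e' -> cl (J e%:Z e%:Z) = cl (J e'%:Z e'%:Z) -> e = e'.
move=> he he' /(cl_eq fd)[x [Kx x0 hx]].
have /and3P[e0 ed el] := he;have /and3P[e0' ed' el'] := he'.
have eC : (e%:Z)%:~R != 0 :> algC by pos.
have eC' : (e'%:Z)%:~R != 0 :> algC by pos.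
have h2 : scal (e%:Z)%:~R O = scal (x * x * (e'%:Z)%:~R) O by rewrite -(okd_sq he) hx scal_mul okd_sq// scalA.
have y0 : x * x * (e'%:Z)%:~R != 0 by pos.
have [v Ov hv] : scal (e%:Z)%:~R O (x * x * (e'%:Z)%:~R) by rewrite h2;exists 1;[exact: O_1|rewrite mulr1].
have [w Ow hw] : scal (x * x * (e'%:Z)%:~R) O (e%:Z)%:~R by rewrite -h2;exists 1;[exact: O_1|rewrite mulr1].
have vw : v * w = 1 by apply: (mulfI eC);rewrite mulrA hv hw mulr1.
have [eps [heps ex2]] : exists eps : int, (eps = 1 \/ eps = -1) /\ x * x = ratr (eps%:~R * e%:R / e'%:R).
 have [ev|ev] := unit_pm Ov Ow vw;[exists 1|exists (-1)];(split;first by [left|right]);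
 by apply: (mulIf eC');rewrite -hv ev fmorph_div rmorphM/=;field.
have [p [q exq]] := Kx;have {exq}exq : x = emb d p q := exq.
move: ex2;rewrite exq embM -(emb_rat d) => /(emb_inj fd)[h1 h3].
have eQ : (e%:R : rat) != 0 by pos.
have eQ' : (e'%:R : rat) != 0 by pos.
have sqk (r : rat) (k : nat) : r ^+ 2 = k%:R -> exists m : nat, k = (m ^ 2)%N.
 move=> hr;have [z hz] : exists z : int, r = z%:~R by apply: (@rat_sqr_int _ k%:Z).
 exists `|z|%N;apply/eqP;rewrite -(@eqr_nat rat) -hr hz natrX -[(_ ^+ 2 : rat)]intrX -sqr_absz intrX//.
have epsQ (ep : int) (r : rat) (k : nat) : ep = 1 \/ ep = -1 -> r ^+ 2 = ep%:~R * k%:R -> exists m : nat, k = (m ^ 2)%N.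
 case=> ->;first by rewrite mul1r;exact: sqk.
 rewrite mulN1r => hr;exists 0%N;have := sqr_ge0 r;rewrite hr oppr_ge0 lern0 => /eqP ->.
 by [].
have : p * q = 0 by lra.
move/eqP;rewrite mulf_eq0 => /orP[/eqP p0|/eqP q0];last first.
 have [m hm] : exists m, (e * e' = m ^ 2)%N.
  apply: (epsQ eps (p * e'%:R)) => //;rewrite natrM exprMn;move: h1;rewrite q0 !mul0r addr0 -expr2 => ->.
  by field.
 by apply: sqfree_sqr hm => //;[exact: sqfree_dvd ed sn|exact: sqfree_dvd ed' sn].
exfalso;have [e1 en] := dvdnP ed.
have e10 : (0 < e1)%N by move: n4;rewrite en;case: e1 {en} => //.
have [m hm] : exists m, (e1 * e' = m ^ 2)%N.
 apply: (epsQ (- eps) (q * n%:R * e'%:R / e%:R));first by case: heps => ->;[right|left;rewrite opprK].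
 have hq : q ^+ 2 * n%:R = - (eps%:~R * e%:R / e'%:R) by rewrite -h1 p0 intrN;ring.
 transitivity (q ^+ 2 * n%:R * n%:R * e'%:R ^+ 2 / e%:R ^+ 2);first by field.
 by rewrite hq en;field;rewrite eQ eQ'.
have ee : e1 = e' by apply: sqfree_sqr hm => //;[apply: sqfree_dvd sn;rewrite en dvdn_mulr|exact: sqfree_dvd ed' sn].
rewrite ee in en;move: el el';rewrite en;clear -e0 e0';nia.
Qed.

Lemma lower_h k : (1 <= k)%N -> (size [seq e <- iota 1 n | okd e] <= h (3 * 2 ^ k) d)%N.
move=> k1;have d0 : d < 0 by lia.
rewrite -(size_map (fun e : nat => cl (J e%:Z e%:Z)));apply: (h_ge fd d0).
 rewrite map_inj_in_uniq ?filter_uniq ?iota_uniq// => e e';rewrite !mem_filter => /andP[he _] /andP[he' _].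
 exact: okd_inj.
move=> c /mapP[e];rewrite mem_filter => /andP[he _] ->.
have [f hf] := okd_eq he;have e0 : 0 < e%:Z by lia.
have Gc := G_J fd e0 hf;split => //.
have -> : (3 * 2 ^ k = 2 * (3 * 2 ^ k.-1))%N by rewrite -{1}(prednK k1) expnS;lia.
rewrite (gexpM (G_1 d) (@G_M d) (@G_A d) (@G_1l d))//.
suff -> : gexp (@class_mul) one (cl (J e%:Z e%:Z)) 2 = one by apply: (gexp_one (G_1 d) (@G_1l d)).
rewrite /gexp/= G_1r// cl_mul// okd_sq//.
by apply: (cl_scal fd O (K_int d e%:Z));rewrite intr_eq0;lia.
Qed.
End Lower.

(** * The discriminant polynomial modulo p and modulo p^2 *)

Lemma cnt_card M (G : nat -> nat -> bool) : cnt M G = #|[set x : 'I_M * 'I_M | G x.1 x.2]|.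
by rewrite /cnt pair_big/= -sum1dep_card [RHS]big_mkcond/=;eqbig x;case: (G _ _).
Qed.

Section Prime.
Variable p : nat.
Hypothesis pp : prime p.

Lemma cnt_Fp (P : 'F_p -> 'F_p -> bool) :
 cnt p (fun i j => P i%:R j%:R) = #|[set x : 'F_p * 'F_p | P x.1 x.2]|.
pose h (i : 'I_p) : 'F_p := (i : nat)%:R.
have hinj : injective h.
 move=> i j /(congr1 val);rewrite /= !val_Fp_nat// !modn_small// => e;exact: val_inj.
have hbij : bijective h by apply: inj_card_bij => //;rewrite card_Fp// card_ord.
rewrite /cnt -sum1dep_card [RHS]big_mkcond/=.
rewrite -(pair_bigA _ (fun x y : 'F_p => if P x y then 1%N else 0%N))/= (reindex h)/=;last exact: onW_bij.
apply: eq_bigr => i _;rewrite [RHS](reindex h)/=;last exact: onW_bij.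
by [].
Qed.

Lemma cnt_param (P : 'F_p -> 'F_p -> bool) (f : 'F_p -> 'F_p * 'F_p) : injective f ->
 (forall x y, P x y <-> exists t, f t = (x, y)) -> cnt p (fun i j => P i%:R j%:R) = p.
move=> fi h;rewrite cnt_Fp -[RHS](card_Fp pp) -cardsT -(card_imset _ fi);apply: eq_card => -[x y].
rewrite inE/=;apply/idP/imsetP => [/h[t ft]|[t _ ft]];first by exists t;rewrite ?inE.
by apply/h;exists t.
Qed.

(** Lifting from p to p^2: there are p points modulo p, each has p lifts of i, and then at most one
    lift of j. *)
Lemma cnt_sq_le (D : nat -> nat -> int) (t : int) :
 (forall n (i i' j j' : nat), (i = i' %[mod n])%N -> (j = j' %[mod n])%N -> (D i j = D i' j' %[mod n])%Z) ->
 cnt p (fun i j => (p %| D i j)%Z) = p -> (p %| t)%Z ->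
 (forall i j j', (D i j = t %[mod (p ^ 2)%N])%Z -> (D i j' = t %[mod (p ^ 2)%N])%Z -> (j = j' %[mod p])%N -> (j = j' %[mod (p ^ 2)])%N) ->
 (cnt (p ^ 2) (fun i j => (D i j == t %[mod (p ^ 2)%N])%Z) <= p ^ 2)%N.
move=> hD hp pt hu;have p0 := prime_gt0 pp.
rewrite cnt_card;set S := [set x | _].
have dvp (u v : int) : (u = v %[mod (p ^ 2)%N])%Z -> (p %| v)%Z -> (p %| u)%Z.
 move=> /eqP;rewrite eqz_mod_dvd => h pv;rewrite -(subrK v u) rpredD//.
 by apply: dvdz_trans h;rewrite dvdzE dvdn_exp.
have hdv (i : 'I_(p ^ 2)) : (i %/ p < p)%N by rewrite ltn_divLR// mulnn.
pose f (x : 'I_(p ^ 2) * 'I_(p ^ 2)) : ('I_p * 'I_p) * 'I_p :=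
 ((Ordinal (ltn_pmod x.1 p0), Ordinal (ltn_pmod x.2 p0)), Ordinal (hdv x.1)).
rewrite -(card_in_imset (f := f));last first.
 move=> [i j] [i' j']/=;rewrite !inE/= => /eqP h1 /eqP h2 [e1 e2 e3].
 have ei : i = i' by apply: val_inj;rewrite /= (divn_eq i p) (divn_eq i' p) e1 e3.
 by rewrite -ei in h2 *;congr (_, _);apply: val_inj;have := hu _ _ _ h1 h2 e2;rewrite !modn_small.
pose T : {set ('I_p * 'I_p) * 'I_p} := finset.setX [set x : 'I_p * 'I_p | (p %| D x.1 x.2)%Z] [set: 'I_p].
apply: leq_trans (_ : (#|T| <= _)%N);last by rewrite cardsX -(cnt_card p (fun i j => (p %| D i j)%Z)) hp cardsT card_ord mulnn.
apply: subset_leq_card;apply/fintype.subsetP => _ /imsetP[[i j] + ->];rewrite !inE/= => /eqP h.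
rewrite andbT;have h1 : (p %| D i j)%Z by apply: dvp h pt.
have : (D (i %% p)%N (j %% p)%N = D i j %[mod p])%Z by apply: hD;rewrite modn_mod.
by move/eqP;rewrite eqz_mod_dvd => h2;rewrite -(subrK (D i j) (D _ _)) rpredD.
Qed.
End Prime.

Lemma Fp_dvd p (a : int) : prime p -> odd p -> ((a%:~R : 'F_p) == 0) = (p %| a)%Z.
by move=> pp po;rewrite -leg_eq0// /leg;case: ifP => //;case: ifP. Qed.

Lemma eqz_sub (m : nat) (x y : int) : (x = y %[mod m])%Z <-> (m %| x - y)%Z.
by rewrite -eqz_mod_dvd;split => [->|/eqP]. Qed.

Lemma nat_mod_int (m i j : nat) : (i = j %[mod m])%N <-> (m %| i%:Z - j%:Z)%Z.
rewrite -eqz_sub !modz_nat;split => [->//|[]].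
by [].
Qed.

Section Disc.
Variables (a b : int) (s1 s2 : nat).
(** For fixed a and b, a polynomial in the other two coefficients, shifted so that they run over
    natural numbers. *)
Definition Ddisc (i j : nat) : int := disc a b (i%:Z - s1%:Z) (j%:Z - s2%:Z).
(** The linear polynomial, with a dummy first variable, by which sums over d itself are treated as a
    special case. *)
Definition Dlin (i j : nat) : int := j%:Z - s2%:Z.

Lemma Ddisc_per (n i i' j j' : nat) : (i = i' %[mod n])%N -> (j = j' %[mod n])%N -> (Ddisc i j = Ddisc i' j' %[mod n])%Z.
move=> /nat_mod_int/dvdzP[k hk] /nat_mod_int/dvdzP[l hl];apply/eqz_sub/dvdzP.
pose u := i%:Z - i'%:Z;pose v := j%:Z - j'%:Z;pose c := i'%:Z - s1%:Z;pose e := j'%:Z - s2%:Z.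
pose X := - (6 * a * b * (e + v)) - 3 * b ^+ 2 * (2 * c + u) + 4 * a * (3 * c ^+ 2 + 3 * c * u + u ^+ 2).
pose Y := a ^+ 2 * (2 * e + v) - 6 * a * b * c + 4 * b ^+ 3.
exists (k * X + l * Y);transitivity (u * X + v * Y);last by rewrite /u /v hk hl;ring.
by rewrite /Ddisc /disc /X /Y /u /v /c /e;ring.
Qed.

Lemma Dlin_per (n i i' j j' : nat) : (i = i' %[mod n])%N -> (j = j' %[mod n])%N -> (Dlin i j = Dlin i' j' %[mod n])%Z.
move=> _ /nat_mod_int h;apply/eqz_sub.
by rewrite /Dlin (_ : _ - _ = j%:Z - j'%:Z)//;ring.
Qed.

Variable p : nat.
Hypotheses (pp : prime p) (po : odd p).
Let cz (n : nat) : (n%:Z%:~R : 'F_p) = n%:R. Proof. by []. Qed.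

Lemma Dlin_cnt1 : cnt p (fun i j => (p %| Dlin i j)%Z) = p.
transitivity (cnt p (fun i j => (j%:R - s2%:R : 'F_p) == 0)).
 by eqbig i;eqbig j;rewrite -Fp_dvd// intrB.
apply: (@cnt_param p pp (fun x y => y - s2%:R == 0) (fun t => (t, s2%:R)));first by move=> x y /(congr1 fst).
by move=> x y;rewrite subr_eq0;split => [/eqP ->|[t [_ <-]]];[exists x|].
Qed.

Lemma Dlin_cnt2 (t : int) : (p %| t)%Z -> (cnt (p ^ 2) (fun i j => (Dlin i j == t %[mod (p ^ 2)%N])%Z) <= p ^ 2)%N.
move=> pt;apply: cnt_sq_le => //;[exact: Dlin_per|exact: Dlin_cnt1|].
move=> i j j' h1 h2 _;apply/nat_mod_int.
have /eqz_sub : (Dlin i j = Dlin i j' %[mod (p ^ 2)%N])%Z by lra.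
by rewrite /Dlin (_ : _ - _ = j%:Z - j'%:Z)//;ring.
Qed.

Hypothesis pab : ~~ ((p %| a)%Z && (p %| b)%Z).

Let F2 : (2 : 'F_p) != 0.
by have := Fp_dvd 2 pp po;rewrite dvdzE/= => ->;rewrite dvdn_prime2//;case: eqP po => // ->. Qed.
Let F4 : (4 : 'F_p) != 0.
by rewrite (_ : 4 = 2 * 2) ?mulf_neq0//;ring. Qed.

(** If p divides a, the equation is linear in e. Otherwise a^2 disc = E^2 + 4C^3 with C and E affine
    coordinates, a cuspidal cubic parametrised by C = -t^2, E = 2t^3. *)
Lemma Ddisc_cnt1 : cnt p (fun i j => (p %| Ddisc i j)%Z) = p.
pose A : 'F_p := a%:~R;pose B : 'F_p := b%:~R.
pose Q (c e : 'F_p) := A ^+ 2 * e ^+ 2 - 6 * A * B * c * e - 3 * B ^+ 2 * c ^+ 2 + 4 * A * c ^+ 3 + 4 * B ^+ 3 * e.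
pose u1 : 'F_p := s1%:R;pose u2 : 'F_p := s2%:R.
transitivity (cnt p (fun i j => Q (i%:R - u1) (j%:R - u2) == 0)).
 eqbig i;eqbig j;rewrite -Fp_dvd// /Ddisc /disc;congr (nat_of_bool (_ == _)).
 have -> : i%:R - u1 = (i%:Z - s1%:Z)%:~R by ring.
 have -> : j%:R - u2 = (j%:Z - s2%:Z)%:~R by ring.
 by move: ((i : nat)%:Z - s1%:Z) ((j : nat)%:Z - s2%:Z) => c e;rewrite /Q /A /B !(intrD, intrB, intrX, intrM);ring.
have [A0|A0] := eqVneq A 0.
 have B0 : B != 0 by apply: contra pab => B0;rewrite -!Fp_dvd// -/A -/B A0 B0 eqxx.
 apply: (@cnt_param p pp (fun x y => Q (x - u1) (y - u2) == 0) (fun t => (t + u1, 3 * t ^+ 2 / (4 * B) + u2))).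
  by move=> x y /(congr1 fst)/= /addIr.
 move=> x y;split => [/eqP h|[t [<- <-]]].
  exists (x - u1);rewrite subrK;congr (_, _);apply: (addIr (- u2));rewrite addrK.
  have B3 : 4 * B ^+ 3 != 0 by pos.
  apply: (mulfI B3);move: h;rewrite /Q A0;set c := x - u1;set e := y - u2 => h.
  transitivity (3 * B ^+ 2 * c ^+ 2);first by field;rewrite ?B0.
  by apply/eqP;rewrite -subr_eq0;apply/eqP;rewrite -[RHS]oppr0 -h;ring.
 by rewrite /Q A0;apply/eqP;field;rewrite ?F4 ?B0.
pose c1 t := (- t ^+ 2 + B ^+ 2) / A;pose e1 t := (2 * t ^+ 3 + 3 * A * B * c1 t - 2 * B ^+ 3) / A ^+ 2.
apply: (@cnt_param p pp (fun x y => Q (x - u1) (y - u2) == 0) (fun t => (c1 t + u1, e1 t + u2))).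
 move=> t t' h;have/= /addIr h1 := congr1 fst h;have/= /addIr h2 := congr1 snd h.
 have et2 : t ^+ 2 = t' ^+ 2.
  have ec u : u ^+ 2 = B ^+ 2 - A * c1 u by rewrite /c1;field;rewrite A0.
  by rewrite (ec t) (ec t') h1.
 have et3 : t ^+ 3 = t' ^+ 3.
  have hA2 : A ^+ 2 != 0 by pos.
  apply: (mulfI F2);transitivity (A ^+ 2 * e1 t - 3 * A * B * c1 t + 2 * B ^+ 3);first by rewrite /e1;field;rewrite A0.
  by rewrite h2 h1 /e1;field;rewrite A0.
 have [t0|t0] := eqVneq t 0.
  by move: et2;rewrite t0 expr0n => /esym/eqP;rewrite sqrf_eq0 => /eqP.
 by apply: (mulIf (expf_neq0 2 t0));rewrite -exprS et2.
move=> x y;split => [/eqP h|[t [<- <-]]];last first.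
 by rewrite /Q /e1 /c1;apply/eqP;field;rewrite A0.
pose c := x - u1;pose e := y - u2;pose C := A * c - B ^+ 2;pose E := A ^+ 2 * e - 3 * A * B * c + 2 * B ^+ 3.
have hCE : E ^+ 2 + 4 * C ^+ 3 = 0 by transitivity (A ^+ 2 * Q c e);[rewrite /E /C /Q;ring|rewrite h mulr0].
have fin t : - t ^+ 2 = C -> 2 * t ^+ 3 = E -> (c1 t + u1, e1 t + u2) = (x, y).
 move=> h1 h2;have hc : c1 t = c by rewrite /c1 h1 /C;field;rewrite A0.
 by rewrite /e1 hc h2 /E;congr (_, _);[rewrite /c;ring|rewrite /e;field;rewrite A0].
have [C0|C0] := eqVneq C 0.
 have E0 : E = 0 by move: hCE;rewrite C0 expr0n mulr0 addr0 => /eqP;rewrite sqrf_eq0 => /eqP.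
 by exists 0;apply: fin;rewrite expr0n ?oppr0 ?mulr0.
have hE : E ^+ 2 = - (4 * C ^+ 3) by apply/eqP;rewrite -subr_eq0 opprK hCE.
exists (- E / (2 * C));apply: fin.
 by transitivity (- (E ^+ 2 / (4 * C ^+ 2)));[field;rewrite ?C0 ?F2 ?F4|rewrite hE;field;rewrite ?C0 ?F2 ?F4].
by transitivity (- (E ^+ 2 * E / (4 * C ^+ 3)));[field;rewrite ?C0 ?F2 ?F4|rewrite hE;field;rewrite ?C0 ?F2 ?F4].
Qed.

(** Two solutions differing only in j satisfy (j - j') w = 0 modulo p^2. If p divided w, the point
    would be the cusp E = C = 0 modulo p, where p^2 divides the discriminant, contrary to the choice
    of t. *)
Lemma Ddisc_cnt2 (t : int) : (p %| t)%Z -> ~~ ((p ^ 2)%N %| t)%Z ->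
 (cnt (p ^ 2) (fun i j => (Ddisc i j == t %[mod (p ^ 2)%N])%Z) <= p ^ 2)%N.
move=> pt p2t;apply: cnt_sq_le => //;[exact: Ddisc_per|exact: Ddisc_cnt1|].
move=> i j j' h1 h2 /nat_mod_int hj;apply/nat_mod_int.
have dvM u v : (p %| u * v)%Z = (p %| u)%Z || (p %| v)%Z by rewrite !dvdzE abszM/= Euclid_dvdM.
pose c := i%:Z - s1%:Z;pose e := j%:Z - s2%:Z;pose e' := j'%:Z - s2%:Z.
pose w := a ^+ 2 * (e + e') - 6 * a * b * c + 4 * b ^+ 3.
have p2 : ((p ^ 2)%N : int) = p%:Z ^+ 2 by [].
have : (Ddisc i j = Ddisc i j' %[mod (p ^ 2)%N])%Z by lra.
move/eqz_sub;have -> : Ddisc i j - Ddisc i j' = (j%:Z - j'%:Z) * w by rewrite /Ddisc -/c -/e -/e' (_ : j%:Z - j'%:Z = e - e');[rewrite /disc /w;ring|rewrite /e /e';ring].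
suff pw : ~~ (p %| w)%Z by rewrite mulrC Gauss_dvdzr /coprimez coprimeXl || (rewrite !dvdzE abszM Gauss_dvdl//= coprimeXl// prime_coprime //).
have p_odd2 u : (p %| 2 * u)%Z = (p %| u)%Z by rewrite dvM -(Fp_dvd 2)// (negbTE F2).
have ew : w = 2 * (a ^+ 2 * e - 3 * a * b * c + 2 * b ^+ 3) - a ^+ 2 * (j%:Z - j'%:Z) by rewrite (_ : j%:Z - j'%:Z = e - e');[rewrite /w;ring|rewrite /e /e';ring].
pose E := a ^+ 2 * e - 3 * a * b * c + 2 * b ^+ 3;pose C := a * c - b ^+ 2.
apply/negP => pw;have pE : (p %| E)%Z.
 rewrite -p_odd2 (_ : 2 * E = w + a ^+ 2 * (j%:Z - j'%:Z));last by rewrite ew /E;ring.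
 by rewrite rpredD// dvdz_mull.
have [pa|pa] := boolP (p %| a)%Z.
 move: pab;rewrite pa/= => /negP;apply.
 have : (p %| 2 * b ^+ 3)%Z.
  rewrite (_ : 2 * b ^+ 3 = E + a * (3 * b * c - a * e));last by rewrite /E;ring.
  by rewrite rpredD// dvdz_mulr.
 by rewrite p_odd2 exprS dvM (@dvdz_prime_sqr p)// orbb.
have hCE : a ^+ 2 * Ddisc i j = E ^+ 2 + 4 * C ^+ 3 by rewrite /Ddisc -/c -/e /disc /E /C;ring.
have pD : (p %| Ddisc i j)%Z.
 move/eqz_sub: h1 => h1;rewrite -(subrK t (Ddisc i j)) rpredD//.
 by apply: dvdz_trans h1;rewrite dvdzE dvdn_exp.
have pC : (p %| C)%Z.
 have : (p %| 2 * (2 * C ^+ 3))%Z.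
  rewrite (_ : 2 * (2 * C ^+ 3) = a ^+ 2 * Ddisc i j - E ^+ 2);last lra.
  by rewrite rpredB ?dvdz_mull// (@dvdz_prime_sqr p).
 by rewrite !p_odd2 exprS dvM (@dvdz_prime_sqr p)// orbb.
have [E' eE] := dvdzP pE;have [C' eC] := dvdzP pC.
have : ((p ^ 2)%N %| a ^+ 2 * Ddisc i j)%Z by rewrite hCE eE eC;apply/dvdzP;exists (E' ^+ 2 + 4 * C' ^+ 3 * p);ring.
have ca : coprime (p ^ 2) (`|a| ^ 2) by rewrite coprimeXl// coprimeXr// prime_coprime.
rewrite dvdzE abszM abszX/= Gauss_dvdr// => p2D.
move/negP: p2t;apply;move/eqz_sub: h1 => h1.
rewrite -[t](subKr (Ddisc i j)) rpredB// dvdzE//.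
Qed.
End Disc.

(** * The 2^k-torsion as a weight *)

Lemma Kc_gt0 z (A s : pset z) : (0 < Kc A s)%N.
rewrite /Kc card_gt0;apply/set0Pn;exists finset.set0;rewrite inE finset.sub0set/=.
by apply/forall_inP => p _;rewrite inE big_set0.
Qed.

Section Gnum.
Variable k : nat.
Hypothesis k1 : (1 <= k)%N.
Notation gt2k d := (gtor (class_group (quadratic_field d)) (@class_mul) (class_one (quadratic_field d)) (2 ^ k)).

(* The least bound for the number of 2^k-torsion classes. *)
Definition gnum (d : int) : nat :=
 if pselect (exists n, `[< bnd (gt2k d) n >]) is left h then ex_minn h else 0%N.

Lemma gnum_le d n : bnd (gt2k d) n -> (gnum d <= n)%N.
by move=> h;rewrite /gnum;case: pselect => // ex;case: ex_minnP => m _;apply;apply/asboolP.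
Qed.

Lemma bnd_gnum d n : bnd (gt2k d) n -> bnd (gt2k d) (gnum d).
move=> h;rewrite /gnum;case: pselect => [ex|[]];last by exists n;apply/asboolP.
by case: ex_minnP => m /asboolP.
Qed.

Section Fd.
Variable d : int.
Hypothesis fd : fundamental_discriminant d.

(** [bnd_2pow] with the bounds [bnd_gt2] and [bnd_gt2_sq], all constants being absorbed into powers
    of 32^k. This is the shape required by [core] with m = k. *)
Lemma bnd_core z (A : pset z) : odd_primes A ->
 (forall p, p \in A -> (p %| `|d|%N)%N && ~~ (p ^ 2 %| `|d|)%N) ->
 bnd (gt2k d) ((32 ^ k) ^ (omout A d).+1 * 2 ^ #|A| * Kc A (sset A d) ^ k).
move=> oA hA;have h2 := bnd_gt2 fd oA hA;have hS := bnd_gt2_sq fd oA hA.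
have := bnd_2pow (k := k.-1) (G_1 d) (@G_M d) (@G_A d) (@G_C d) (@G_1l d) (G_V fd) h2 hS.
rewrite prednK//;apply: bnd_leq.
have K0 := Kc_gt0 A (sset A d);move: (Kc _ _) (omout _ _) (2 ^ #|A|)%N K0 => K o w K0.
have -> : ((32 ^ k) ^ o.+1 * w * K ^ k = (32 * 32 ^ o * K) ^ k.-1 * (32 * 32 ^ o * w * K))%N.
 rewrite -expnM mulnS expnD mulnC [(k * o)%N]mulnC expnM -[in LHS](prednK k1) !expnS !expnMn -!expnM.
 lia.
have h232 : (2 ^ o <= 32 ^ o)%N by apply: leq_exp2r_wk.
apply: leq_mul;first by apply: leq_exp2r_wk;rewrite leq_mul2r leq_mul2l h232 !orbT.
via (32 * 32 ^ o * w)%N;last by rewrite leq_pmulr.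
by rewrite leq_mul2r;apply/orP;right;apply: leq_mul.
Qed.

Lemma bnd_gnum' : bnd (gt2k d) (gnum d).
apply: (@bnd_gnum _ ((32 ^ k) ^ (omout (finset.set0 : {set 'I_1}) d).+1 * 2 ^ #|(finset.set0 : {set 'I_1})| * Kc finset.set0 (sset finset.set0 d) ^ k)).
by apply: bnd_core => [|p];[apply/forall_inP => p|];rewrite inE.
Qed.
End Fd.
End Gnum.

(** * Boxes of cubic forms *)

Definition r4 (x : nat) : nat := \max_(i < x.+1 | (i ^ 4 <= x)%N) i.

Lemma r4_le x : (r4 x ^ 4 <= x)%N.
rewrite /r4;elim/big_ind: _ => //.
lia.
Qed.

Lemma le_r4 n x : (n ^ 4 <= x)%N -> (n <= r4 x)%N.
move=> h;have nx : (n < x.+1)%N.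
 rewrite ltnS;apply: leq_trans h;case: n => // n;rewrite -{1}[n.+1]expn1 leq_pexp2l//.
exact: (leq_bigmax_cond (Ordinal nx)).
Qed.

(** The factors u and v cancel, so the volume of the box does not depend on the level. *)
Lemma r4_prod (P u v : nat) : (0 < u)%N -> (0 < v)%N -> (r4 (P %/ u) * r4 (P %/ v) * r4 (P * v) * r4 (P * u) <= P)%N.
move=> u0 v0;rewrite -(@leq_exp2r _ _ 4)// !expnMn.
have k1 := leq_trans (leq_mul (r4_le (P %/ u)) (leqnn u)) (leq_trunc_div _ _).
have k2 := leq_trans (leq_mul (r4_le (P %/ v)) (leqnn v)) (leq_trunc_div _ _).
have k3 := r4_le (P * v);have k4 := r4_le (P * u).
rewrite -(leq_pmul2r (_ : 0 < u * v)%N) ?muln_gt0 ?u0//.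
have := leq_mul (leq_mul k1 k2) (leq_mul k3 k4).
lia.
Qed.

(* Locked, so that no computation unfolds this unary numeral. *)
Definition c18 : nat := locked (2 ^ 18)%N.

Section Forms.
Variables (N j : nat).
Definition bA := r4 (c18 * N %/ 2 ^ (6 * j)).
Definition bB := r4 (c18 * N %/ 2 ^ (2 * j)).
Definition bC := r4 (c18 * N * 2 ^ (2 * j)).
Definition bE := r4 (c18 * N * 2 ^ (6 * j)).
Definition sgz (b : bool) (n : nat) : int := (-1) ^+ b * n%:Z.
Definition ftype : Type := bool * bool * 'I_bA.+1 * 'I_bB.+1 * 'I_(2 * bC).+1 * 'I_(2 * bE).+1.
Definition fD (x : ftype) : int := let: (s, t, a, b, i, l) := x in Ddisc (sgz s a) (sgz t b) bC bE i l.
Definition fpos (x : ftype) : bool := let: (s, t, a, b, i, l) := x in (0 < a)%N.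

(** A form is encoded by the signs and absolute values of a and b, and by c and e shifted by half
    the side of the box. *)
Lemma bnd_fm d : (`|d| <= N)%N -> bnd (fm d j) #|[pred x : ftype | fpos x && (fD x == d)]|.
move=> dN.
pose f (v : int * int * int * int) : ftype := let: (a, b, c, e) := v in
 (a < 0, b < 0, inord `|a|, inord `|b|, inord `|(c + bC%:Z)%R|%N, inord `|(e + bE%:Z)%R|%N).
pose g (x : ftype) : int * int * int * int := let: (s, t, a, b, i, l) := x in (sgz s a, sgz t b, i%:Z - bC%:Z, l%:Z - bE%:Z).
have N4 (x : int) : x ^+ 4 = (`|x| ^ 4)%N%:Z by lia.
have p2 m : (2 : int) ^+ m = (2 ^ m)%N%:Z by rewrite -natrX natz.
have c18E : (2 ^ 18)%N = c18 by rewrite /c18 -lock.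
have dn : `|d| = `|d|%N%:Z by [].
have lin v : fm d j v -> let: (a, b, c, e) := v in [/\ (0 < `|a|)%N, (`|a| < bA.+1)%N, (`|b| < bB.+1)%N,
  (`|c| <= bC)%N & (`|e| <= bE)%N].
 case: v => [[[a b] c] e] [[a0 _]];rewrite !N4 !p2 c18E dn -!PoszM !lez_nat => h1 h2 h3 h4.
 have NN (x y : nat) : (x * y <= c18 * `|d|)%N -> (x * y <= c18 * N)%N by move=> h;letr h;rewrite leq_mul2l dN orbT.
 have NM (x y : nat) : (x <= c18 * `|d| * y)%N -> (x <= c18 * N * y)%N by move=> h;letr h;rewrite leq_mul2r leq_mul2l dN !orbT.
 split;first by rewrite absz_gt0.
 - by rewrite ltnS;apply: le_r4;rewrite leq_divRL ?expn_gt0//;exact: NN.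
 - by rewrite ltnS;apply: le_r4;rewrite leq_divRL ?expn_gt0//;exact: NN.
 - by apply: le_r4;exact: NM.
 - by apply: le_r4;exact: NM.
have gf v : fm d j v -> g (f v) = v.
 move=> /lin;case: v => [[[a b] c] e] [a0 aA bB' cC eE];rewrite /g /f /sgz.
 have hc : (`|(c + bC%:Z)%R|%N < (2 * bC).+1)%N by lia.
 have he : (`|(e + bE%:Z)%R|%N < (2 * bE).+1)%N by lia.
 rewrite !inordK// -!intEsign;congr (_, _, _, _).
  lia.
 lia.
apply: (bnd_inj (f := f) (B := fun x => fpos x && (fD x == d))).
- move=> v hv;have := gf v hv;have := lin v hv;move: hv;case: v => [[[a b] c] e] [[a0 hd] _ _ _ _] [a0' aA _ _ _].
 rewrite /f /g /fpos /fD => -[e1 e2 e3 e4];rewrite inordK// a0'/= /Ddisc e3 e4 e2.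
 by move: e1;rewrite inordK// => ->;rewrite hd.
- by move=> v v' hv hv' e;rewrite -(gf v hv) e gf.
by apply: bnd_pred => x.
Qed.

Lemma prod_box : (bA * bB * bC * bE <= c18 * N)%N.
by apply: r4_prod;rewrite expn_gt0. Qed.
End Forms.

(** * Averages of the weight over polynomial values *)

Section Core.
Variables (R : realType) (k : nat).
Hypothesis k1 : (1 <= k)%N.

Definition goodN (N : nat) (d : int) : bool := `[< fundamental_discriminant d >] && (`|d| <= N)%N.

(** With E = k + 24, z is the integral part of N^(1/(4E)): then z^E is at most the sides of the box,
    which are at least N^(1/4), and N is at most z^(8E). *)
Lemma core_gnum : exists2 C : R, 0 < C & exists N0 : nat, forall (N M L1 L2 : nat) (D : nat -> nat -> int),
 (N0 <= N)%N -> (0 < M)%N -> (2 %| M)%N ->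
 (forall (n i i' j j' : nat), (i = i' %[mod n])%N -> (j = j' %[mod n])%N -> (D i j = D i' j' %[mod n])%Z) ->
 (forall p, prime p -> ~~ (p %| M)%N -> cnt p (fun i j => (p %| D i j)%Z) = p) ->
 (forall p, prime p -> ~~ (p %| M)%N -> forall t : int, (p %| t)%Z -> ~~ ((p ^ 2)%N %| t)%Z ->
  (cnt (p ^ 2) (fun i j => (D i j == t %[mod (p ^ 2)%N])%Z) <= p ^ 2)%N) ->
 (N <= L1 ^ 4)%N -> (N <= L2 ^ 4)%N ->
 \sum_(i < L1) \sum_(j < L2) (if goodN N (D i j) then (gnum k (D i j))%:R else 0) <=
  C * ((2 * 32 ^ k) ^ size (primes M))%:R * (L1 * L2)%:R * ln N%:R.
pose E := (k + 24)%N;pose kappa := (8 * E)%N.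
have C10 : (0 < 32 ^ k)%N by lia.
have [C C0 [z0 hC]] := @core R k kappa (32 ^ k) k1 C10.
exists C => //;exists ((z0 + 2) ^ (4 * E))%N => N M L1 L2 D N0 M0 M2 Dper Dc1 Dc2 hL1 hL2.
have E0 : (0 < 4 * E)%N by lia.
have Npos : (0 < N)%N by lia.
have [z /and4P[z1 zN zE Ez]] := root_ex (4 * E).-1 Npos.
rewrite prednK// in zE Ez.
have zz : (z0 + 2 <= z)%N by rewrite -ltnS -(ltn_exp2r _ _ E0);apply: leq_ltn_trans N0 Ez.
have z2 : (2 <= z)%N by lia.
have zL L : (N <= L ^ 4)%N -> (z ^ E <= L)%N by move=> h;rewrite -(@leq_exp2r _ _ 4)// -expnM mulnC;exact: leq_trans h.
have podd p : prime p -> ~~ (p %| M)%N -> odd p by move=> pp pM;case: (boolP (odd p)) => // /(prime_oddPn pp) e;rewrite e M2 in pM.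
letr (hC M L1 L2 z D (fun i j => goodN N (D i j)) (fun i j => (gnum k (D i j))%:R) M0 M2 Dper Dc1 Dc2 _ (zL _ hL1) (zL _ hL2) _ _).
- by apply: leq_trans zz;rewrite leq_addr.
- move=> i j /andP[/asboolP fd dN];split;first exact: d_neq0 fd.
  letr dN;apply: ltnW;letr Ez.
  rewrite (_ : kappa = 2 * (4 * E))%N;last lia.
  rewrite [(z ^ _)%N]expnM leq_exp2r//;move: z2;clear;rewrite -mulnn;nia.
 by move=> p pp pM;apply: fd_odd;[exact: fd|exact: pp|exact: podd].
- move=> i j /andP[/asboolP fd dN] A oA hA;rewrite ler_nat;apply: gnum_le;exact: bnd_core.
apply: ler_wpM2l;first pos.
by apply: ln_nat_le;rewrite z1.
Qed.

End Core.

Lemma sum_dvd (n q : nat) : (0 < q)%N -> (\sum_(1 <= a < n.+1) (q %| a) = n %/ q)%N.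
move=> q0;elim: n => [|n IH];first by rewrite big_geq// div0n.
by rewrite big_nat_recr//= IH divnS// addnC.
Qed.

Section Sums.
Variable R : realType.
Notation sqn n := (Num.sqrt (n%:R : R)).

Lemma sqn2 n : sqn n ^+ 2 = n%:R.
by rewrite sqr_sqrtr. Qed.
Lemma sqn_gt0 n : (0 < n)%N -> 0 < sqn n.
by move=> n0;rewrite sqrtr_gt0 ltr0n. Qed.

Lemma sum_sqn n : (0 < n)%N -> \sum_(1 <= q < n.+1) sqn q / q%:R ^+ 2 <= 3 - 2 / sqn n.
case: n => // n _;elim: n => [|n IH];first by rewrite big_nat1 sqrtr1 expr1n;lra.
rewrite big_nat_recr//=;set x := sqn n.+1 in IH *;set y := sqn n.+2.
have x0 : 0 < x by exact: sqn_gt0.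
have y0 : 0 < y by exact: sqn_gt0.
have e : y ^+ 2 = x ^+ 2 + 1 by rewrite !sqn2 natr1.
rewrite -sqn2 -/y;suff : y / (y ^+ 2) ^+ 2 <= 2 / x - 2 / y by lra.
have -> : y / (y ^+ 2) ^+ 2 = (y ^+ 3)^-1 by field;rewrite gt_eqF.
rewrite -(ler_pM2l (_ : 0 < x * y ^+ 3));last pos.
have -> : x * y ^+ 3 / y ^+ 3 = x by field;rewrite gt_eqF.
have -> : x * y ^+ 3 * (2 / x - 2 / y) = 2 * y ^+ 2 * (y - x) by field;rewrite !gt_eqF.
have xy : x <= y by rewrite ler_sqrt ?ler0n// ler_nat.
have h : (y - x) * (y + x) = 1 by lra.
have yx : 0 < y - x by nra.
have : (y - x) * (y + x) <= (y - x) * (2 * y) by apply: ler_wpM2l;lra.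
rewrite h => h2;have : y * 1 <= y * ((y - x) * (2 * y)) by apply: ler_wpM2l => //;exact: ltW.
nra.
Qed.

(** Bound sqrt(gcd(a, b)) by the sum of sqrt q over common divisors q; the pairs divisible by q
    number at most al be / q^2, and the sum of q^(-3/2) is at most 3. *)
Lemma sum_gcd (al be : nat) : \sum_(1 <= a < al.+1) \sum_(1 <= b < be.+1) sqn (gcdn a b) <= 3 * (al * be)%:R.
case: (posnP al) => [->|al0];first by rewrite big_geq// mul0n mulr0.
via (\sum_(1 <= a < al.+1) \sum_(1 <= b < be.+1) \sum_(1 <= q < al.+1) sqn q * (q %| a)%N%:R * (q %| b)%N%:R).
 rewrite big_nat_cond [leRHS]big_nat_cond;apply: ler_sum => a /andP[/andP[a1 aal] _].
 rewrite big_nat_cond [leRHS]big_nat_cond;apply: ler_sum => b /andP[/andP[b1 _] _].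
 have g0 : (0 < gcdn a b)%N by rewrite gcdn_gt0 a1.
 rewrite (bigD1_seq (gcdn a b)) ?iota_uniq//=;last first.
  by rewrite mem_index_iota g0;apply: leq_ltn_trans aal;apply: dvdn_leq => //;exact: dvdn_gcdl.
 by rewrite dvdn_gcdl dvdn_gcdr !mulr1 lerDl sumr_ge0// => q _;rewrite !mulr_ge0 ?sqrtr_ge0.
via (\sum_(1 <= q < al.+1) (al * be)%:R * (sqn q / q%:R ^+ 2));last first.
 rewrite -mulr_sumr mulrC;apply: ler_wpM2r => //;letr (sum_sqn al0).
 by rewrite gerBl divr_ge0 ?sqrtr_ge0.
under eq_bigr => a _ do rewrite exchange_big/=.
rewrite exchange_big/= big_nat_cond [leRHS]big_nat_cond;apply: ler_sum => q /andP[/andP[q1 _] _].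
under eq_bigr => a _ do rewrite -mulr_sumr -natr_sum sum_dvd//.
rewrite -mulr_suml -mulr_sumr -natr_sum sum_dvd//.
have qR : 0 < q%:R :> R by pos.
have hd n : ((n %/ q)%N%:R : R) <= n%:R / q%:R by rewrite ler_pdivlMr// -natrM ler_nat leq_trunc_div.
rewrite -mulrA;have -> : (al * be)%:R * (sqn q / q%:R ^+ 2) = sqn q * ((al%:R / q%:R) * (be%:R / q%:R)) by lra.
by apply: ler_wpM2l;[exact: sqrtr_ge0|apply: ler_pM].
Qed.

Lemma sum_gcd0 (al be : nat) : (al <= be)%N -> \sum_(1 <= a < al.+1) \sum_(0 <= b < be.+1) sqn (gcdn a b) <= 4 * (al * be)%:R.
move=> ab;under eq_bigr => a _ do rewrite big_nat_recl//= gcdn0.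
have e a : \sum_(0 <= b < be) sqn (gcdn a b.+1) = \sum_(1 <= b < be.+1) sqn (gcdn a b) by rewrite big_add1.
under eq_bigr => a _ do rewrite e.
rewrite big_split/=;have := sum_gcd al be.
have : \sum_(1 <= a < al.+1) sqn a <= (al * be)%:R;last lra.
via (\sum_(1 <= a < al.+1) be%:R);last first.
 by rewrite sumr_const_nat subSS subn0 -mulrnA mulnC.
rewrite big_nat_cond [leRHS]big_nat_cond;apply: ler_sum => a /andP[/andP[a1 aal] _].
via (a%:R);last by rewrite ler_nat;lia.
rewrite -[leRHS]sqn2 expr2 ler_peMl ?sqrtr_ge0// -[leLHS]sqrtr1 ler_sqrt ?ler1n//.
Qed.

(** The constant of [core_gnum] depends on the bad primes as B^omega(2g); [omega_pow_le] for B^2,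
    followed by a square root, leaves sqrt g. *)
Lemma weight_le (B g : nat) : (0 < g)%N -> ((B ^ size (primes (2 * g)))%:R : R) <= sqn ((B ^ 2) ^ (B ^ 2) * 2) * sqn g.
move=> g0;rewrite -sqrtrM// -natrM -[leLHS]ger0_norm// -sqrtr_sqr ler_sqrt// -natrX ler_nat.
by rewrite -expnM mulnC expnM -mulnA;apply: omega_pow_le;rewrite muln_gt0.
Qed.
End Sums.

Lemma r4_mono x y : (x <= y)%N -> (r4 x <= r4 y)%N.
by move=> h;apply: le_r4;apply: leq_trans (r4_le x) h. Qed.

Section Upper.
Variables (R : realType) (k : nat).
Hypothesis k1 : (1 <= k)%N.
Let B := (2 * 32 ^ k)%N.

Lemma sum_pair (I J : finType) (f : I * J -> R) : \sum_x f x = \sum_i \sum_j f (i, j).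
by rewrite pair_bigA;apply: eq_bigr => -[]. Qed.

(** For fixed signs, a and b, [core_gnum] applies to the other two coefficients, the bad primes
    dividing 2 gcd(a, b). The dependence on the gcd is averaged by [sum_gcd0], and the total volume
    is O(N) by [prod_box]. *)
Lemma level_sum : exists2 C : R, 0 < C & exists N0 : nat, forall N j, (N0 <= N)%N -> (0 < N)%N ->
 \sum_(x : ftype N j | fpos x) (if goodN N (fD x) then (gnum k (fD x))%:R else 0) <= C * N%:R * ln N%:R :> R.
have [C C0 [N0 hC]] := core_gnum R k1.
pose K1 : R := Num.sqrt ((B ^ 2) ^ (B ^ 2) * 2)%:R.
have K10 : 0 <= K1 by pos.
exists (144 * C * (K1 + 1) * c18%:R).
 by rewrite !mulr_gt0 ?ltr_wpDl// ltr0n /c18 -lock expn_gt0.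
exists N0 => N j N0N Npos.
have c0 : (0 < c18)%N by rewrite /c18 -lock expn_gt0.
have lnN : 0 <= ln N%:R :> R by pos.
case: (posnP (bA N j)) => [A0|A0].
 rewrite big1 => [|[[[[[s t] a] b] i] l]/= apos];last first.
  by exfalso;have := leq_trans apos (leq_ord a);rewrite [X in (_ <= X)%N]A0.
 pos.
have AB : (bA N j <= bB N j)%N by apply: r4_mono;apply: leq_div2l;rewrite ?expn_gt0// leq_pexp2l// leq_mul2r orbT.
have P0 : (0 < c18 * N)%N by lia.
have big m : (N <= (2 * r4 (c18 * N * 2 ^ m)).+1 ^ 4)%N.
 set r := r4 _;via (r.+1 ^ 4)%N;last lia.
 rewrite leqNgt;apply/negP => h;have : (r.+1 <= r)%N;last lia.
 apply: le_r4;letr (ltnW h);letr (leq_pmull N c0).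
 by rewrite leq_pmulr// expn_gt0.
have pos m : (0 < r4 (c18 * N * 2 ^ m))%N by apply: le_r4;rewrite muln_gt0 P0 expn_gt0.
have hL1 : (N <= (2 * bC N j).+1 ^ 4)%N by exact: big.
have hL2 : (N <= (2 * bE N j).+1 ^ 4)%N by exact: big.
pose L := (((2 * bC N j).+1 * (2 * bE N j).+1)%N%:R : R).
pose F (s t : bool) (a : 'I_(bA N j).+1) (b : 'I_(bB N j).+1) (i : 'I_(2 * bC N j).+1) (l : 'I_(2 * bE N j).+1) : R :=
 let D := Ddisc (sgz s a) (sgz t b) (bC N j) (bE N j) i l in if goodN N D then (gnum k D)%:R else 0.
have -> : \sum_(x : ftype N j | fpos x) (if goodN N (fD x) then (gnum k (fD x))%:R else 0 : R) =
 \sum_(s : bool) \sum_(t : bool) \sum_(a < (bA N j).+1 | (0 < a)%N) \sum_b \sum_i \sum_l F s t a b i l.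
 rewrite big_mkcond/=.
 rewrite 5!sum_pair/=.
 eqbig s;eqbig t;rewrite [RHS]big_mkcond/=;eqbig a.
 case: ifP => a0;first by [].
 by rewrite big1// => b _;rewrite big1// => i _;rewrite big1.
have inner s t (a : 'I_(bA N j).+1) (b : 'I_(bB N j).+1) : (0 < (a : nat))%N ->
 \sum_i \sum_l F s t a b i l <= C * K1 * L * ln N%:R * Num.sqrt (gcdn a b)%:R.
 move=> a0;pose M := (2 * gcdn a b)%N;have g0 : (0 < gcdn a b)%N by rewrite gcdn_gt0 a0.
 have az u n : `|sgz u n|%N = n by rewrite /sgz abszMsign.
 have pab p : prime p -> ~~ (p %| M)%N -> odd p /\ ~~ ((p %| sgz s a)%Z && (p %| sgz t b)%Z).
  move=> pp pM;split;first by case: (boolP (odd p)) => // /(prime_oddPn pp) e;rewrite e dvdn_mulr in pM.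
  by apply: contra pM;rewrite !dvdzE !az -dvdn_gcd => h;rewrite dvdn_mull.
 letr (hC N M _ _ (Ddisc (sgz s a) (sgz t b) (bC N j) (bE N j)) N0N _ _ _ _ _ hL1 hL2).
 - by rewrite muln_gt0.
 - by rewrite dvdn_mulr.
 - exact: Ddisc_per.
 - by move=> p pp /(pab p pp)[po h];exact: Ddisc_cnt1.
 - by move=> p pp /(pab p pp)[po h];exact: Ddisc_cnt2.
 have := weight_le R B g0;rewrite -/K1 -/M -/L;set w := (_ ^ _)%:R => hw.
 have -> : C * K1 * L * ln N%:R * Num.sqrt (gcdn a b)%:R = C * L * ln N%:R * (K1 * Num.sqrt (gcdn a b)%:R) by ring.
 have -> : C * w * L * ln N%:R = C * L * ln N%:R * w by ring.
 by apply: ler_wpM2l => //;rewrite !mulr_ge0// ltW.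
pose S : R := \sum_(1 <= a < (bA N j).+1) \sum_(0 <= b < (bB N j).+1) Num.sqrt (gcdn a b)%:R.
have hS : S <= 4 * (bA N j * bB N j)%:R by exact: sum_gcd0.
pose Q := C * K1 * L * ln N%:R;have Q0 : 0 <= Q by pos.
via (\sum_(s : bool) \sum_(t : bool) Q * S).
 lesum s;lesum t;rewrite /S big_nat1_ord mulr_sumr;apply: ler_sum => a a0.
 rewrite big_mkord mulr_sumr;lesum b;exact: inner.
rewrite !sumr_const card_bool -mulrnA -[leLHS]mulr_natr.
have L9 : L <= 9 * (bC N j * bE N j)%:R.
 have h1 : (0 < bC N j)%N by exact: pos.
 have h2 : (0 < bE N j)%N by exact: pos.
 by rewrite -natrM ler_nat;move: h1 h2;clear;nia.
have hprod : (bA N j * bB N j)%:R * (bC N j * bE N j)%:R <= c18%:R * N%:R :> R by rewrite -!natrM ler_nat mulnA;exact: prod_box.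
have AB0 : 0 <= (bA N j * bB N j)%:R :> R by [].
have CE0 : 0 <= (bC N j * bE N j)%:R :> R by [].
have h1 : Q * S <= (C * K1 * ln N%:R) * (36 * (c18%:R * N%:R)).
 have -> : Q * S = (C * K1 * ln N%:R) * (L * S) by rewrite /Q;ring.
 apply: ler_wpM2l;first pos.
 via ((9 * (bC N j * bE N j)%:R) * (4 * (bA N j * bB N j)%:R)).
  by apply: ler_pM => //;apply: sumr_ge0 => a _;apply: sumr_ge0 => b _;exact: sqrtr_ge0.
 lra.
via (4 * ((C * K1 * ln N%:R) * (36 * (c18%:R * N%:R))));first by rewrite mulrC;move: h1;set u := Q * S;lra.
have -> : 144 * C * (K1 + 1) * c18%:R * N%:R * ln N%:R = 4 * (C * K1 * ln N%:R * (36 * (c18%:R * N%:R))) + 144 * C * c18%:R * N%:R * ln N%:R by ring.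
by rewrite lerDl !mulr_ge0// ltW.
Qed.

End Upper.

(** * Summation over fundamental discriminants: the upper bound *)

Definition fdseq (N : nat) : seq int :=
 [seq d <- [seq Dlin N 0 l | l <- index_iota 0 (2 * N).+1] | `[< fundamental_discriminant d >]].

Lemma fdseq_uniq N : uniq (fdseq N).
rewrite filter_uniq// map_inj_uniq ?iota_uniq// => l l';rewrite /Dlin => /addIr h.
lia.
Qed.

Lemma mem_fdseq N (d : int) : (d \in fdseq N) = goodN N d.
rewrite mem_filter /goodN;apply: andb_id2l => _;apply/idP/idP => [/mapP[l]|dN].
 by rewrite mem_index_iota /Dlin => hl ->;move: hl;clear;lia.
apply/mapP;exists `|(d + N%:Z)%R|%N;first by rewrite mem_index_iota;move: dN;clear;lia.
by rewrite /Dlin gez0_abs;[ring|move: dN;clear;lia].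
Qed.

Section UpperBound.
Variables (R : realType) (k : nat).
Hypothesis k1 : (1 <= k)%N.

Lemma big_fdseq N (F : int -> R) : \sum_(d <- fdseq N) F d = \sum_(l < (2 * N).+1) (if goodN N (Dlin N 0 l) then F (Dlin N 0 l) else 0).
rewrite big_filter big_map big_mkord big_mkcond;eqbig l;rewrite /goodN.
suff -> : (`|Dlin N 0 l| <= N)%N by rewrite andbT.
by have := ltn_ord l;rewrite /Dlin;move: (nat_of_ord l) => m;clear;lia.
Qed.

(** [core_gnum] for [Dlin]; the dummy first variable has N + 1 values, which cancel in the end. *)
Lemma gnum_sum : exists2 C : R, 0 < C & exists N0 : nat, forall N, (N0 <= N)%N -> (0 < N)%N ->
 \sum_(d <- fdseq N) (gnum k d)%:R <= C * N%:R * ln N%:R :> R.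
have [C C0 [N0 hC]] := core_gnum R k1.
have p2M (p : nat) : prime p -> ~~ (p %| 2)%N -> odd p by move=> pp pM;case: (boolP (odd p)) => // /(prime_oddPn pp) e;rewrite e in pM.
exists (3 * C * (2 * 32 ^ k)%:R).
 pos.
exists N0 => N N0N Npos.
have r4N n : (N < n)%N -> (N <= n ^ 4)%N by move=> h;letr (ltnW h);rewrite -{1}[n]expn1 leq_pexp2l// (leq_trans _ h).
have h1 n i i' j j' : (i = i' %[mod n])%N -> (j = j' %[mod n])%N -> (Dlin N i j = Dlin N i' j' %[mod n])%Z by exact: Dlin_per.
have h2 p : prime p -> ~~ (p %| 2)%N -> cnt p (fun i j => (p %| Dlin N i j)%Z) = p.
 by move=> pp /(p2M p pp) po;exact: Dlin_cnt1.
have h3 p : prime p -> ~~ (p %| 2)%N -> forall t : int, (p %| t)%Z -> ~~ ((p ^ 2)%N %| t)%Z ->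
  (cnt (p ^ 2) (fun i j => (Dlin N i j == t %[mod (p ^ 2)%N])%Z) <= p ^ 2)%N.
 by move=> pp /(p2M p pp) po t pt _;exact: Dlin_cnt2.
have lt2N : (N < (2 * N).+1)%N by lia.
have := hC N 2%N N.+1 (2 * N).+1 (Dlin N) N0N isT isT h1 h2 h3 (r4N _ (ltnSn N)) (r4N _ lt2N).
have -> : \sum_(i < N.+1) \sum_(j < (2 * N).+1) (if goodN N (Dlin N i j) then (gnum k (Dlin N i j))%:R else 0) =
 (\sum_(d <- fdseq N) (gnum k d)%:R) *+ N.+1 :> R.
 by rewrite (big_fdseq N (fun d => (gnum k d)%:R)) -[in RHS](card_ord N.+1) -sumr_const.
rewrite expn1 -mulr_natr (natrM _ N.+1) => h.
have N1 : 0 < N.+1%:R :> R by [].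
rewrite -(ler_pM2r N1);letr h.
have -> : 3 * C * (2 * 32 ^ k)%:R * N%:R * ln N%:R * N.+1%:R = C * (2 * 32 ^ k)%:R * (N.+1%:R * (3 * N%:R)) * ln N%:R by ring.
apply: ler_wpM2r;first exact: ln_nat_ge0.
apply: ler_wpM2l;first pos.
by apply: ler_wpM2l => //;rewrite -natrM ler_nat;move: Npos;clear;lia.
Qed.

(** The 3-torsion is bounded through the number of forms of discriminant d at each level, the
    2^k-torsion by [gnum]. *)
Lemma h_gnum N d (L : nat) : goodN N d -> (N + 4 <= L)%N ->
 (h (3 * 2 ^ k) d)%:R <= (1 + \sum_(j < L) 2 * (#|[pred x : ftype N j | fpos x && (fD x == d)]|%:R) / 2 ^+ j) * (gnum k d)%:R :> R.
case/andP => /asboolP fd dN NL;set b : R := 1 + _.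
have b0 : 0 <= b by pos.
have hb : bnd (gtor (class_group (quadratic_field d)) class_mul (class_one (quadratic_field d)) 3) (Num.truncn b).
 move=> t ut ht;rewrite truncn_ge_nat//;apply: (@gt3_levels d fd R (fun j => #|[pred x : ftype N j | fpos x && (fD x == d)]|) L _ (fun j => @bnd_fm N j d dN) t ut ht).
 have -> : `|d| = `|d|%N%:Z by [].
 have p2 m : (2 : int) ^+ m = (2 ^ m)%N%:Z by rewrite -natrX natz.
 rewrite !p2 -PoszM ltz_nat;via (2 ^ 18 * 2 ^ N)%N.
  by rewrite ltn_pmul2l//;apply: leq_ltn_trans dN (ltn_expl _ _).
 by rewrite -expnD leq_pexp2l;move: NL;clear;lia.
have := h_le (bnd_3_2pow (G_1 d) (@G_M d) (@G_A d) (@G_C d) (@G_1l d) (G_V fd) hb (bnd_gnum' k1 fd)).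
rewrite -(ler_nat R) natrM => h;letr h;apply: ler_wpM2r => //.
by rewrite truncn_le.
Qed.

Lemma sum_half (L : nat) : \sum_(j < L) (2 : R) / 2 ^+ j = 4 - 4 / 2 ^+ L.
elim: L => [|L IH];first by rewrite big_ord0 expr0 divr1 subrr.
by rewrite big_ord_recr/= exprS;lra.
Qed.

(** After exchanging sums, each level contributes 2/2^j times O(N log N), and the sum of the 2/2^j
    is at most 4. *)
Lemma upper_large : exists2 C : R, 0 < C & exists N0 : nat, forall N, (N0 <= N)%N -> (0 < N)%N ->
 \sum_(d <- fdseq N) (h (3 * 2 ^ k) d)%:R <= C * N%:R * ln N%:R :> R.
have [C1 C10 [N1 h1]] := gnum_sum;have [C2 C20 [N2 h2]] := level_sum R k1.
exists (C1 + 4 * C2);first lra.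
exists (maxn N1 N2) => N;rewrite geq_max => /andP[NN1 NN2] Npos.
pose m j d : R := #|[pred x : ftype N j | fpos x && (fD x == d)]|%:R.
have T0 : 0 <= N%:R * ln N%:R :> R by pos.
have hm j : \sum_(d <- fdseq N) m j d * (gnum k d)%:R <= C2 * N%:R * ln N%:R.
 apply: le_trans (h2 N j NN2 Npos);apply: eqler.
 transitivity (\sum_(d <- fdseq N) \sum_(x : ftype N j | fpos x) if fD x == d then (gnum k d)%:R else 0 : R).
  by eqbig d;rewrite -big_mkcondr sumr_const mulr_natl.
 rewrite exchange_big/=;eqbig x;rewrite -mem_fdseq.
 case: ifP => hx.
  rewrite (bigD1_seq (fD x)) ?fdseq_uniq//= eqxx big1 ?addr0// => d.
  by rewrite eq_sym => /negPf ->.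
 rewrite big_seq big1// => d hd;case: eqP => // e;by rewrite e hd in hx.
via (\sum_(d <- fdseq N) ((gnum k d)%:R + \sum_(j < N + 4) 2 / 2 ^+ j * (m j d * (gnum k d)%:R))).
 rewrite big_seq [leRHS]big_seq;apply: ler_sum => d;rewrite mem_fdseq => hd.
 letr (h_gnum hd (leqnn _));rewrite mulrDl mul1r lerD2l mulr_suml.
 by apply: eqler;eqbig j;rewrite /m;ring.
rewrite big_split/= exchange_big/= -[(C1 + _) * _ * _]mulrA mulrDl.
apply: lerD;first by have := h1 N NN1 Npos;rewrite mulrA.
via (\sum_(j < N + 4) 2 / 2 ^+ j * (C2 * N%:R * ln N%:R)).
 lesum j;rewrite -mulr_sumr;apply: ler_wpM2l (hm j).
 pos.
rewrite -mulr_suml sum_half -mulrA [4 * C2 * _]mulrA -[4 * C2 * _ * _]mulrA -[4 * C2 * _]mulrA.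
apply: ler_wpM2r;first pos.
by rewrite gerBl divr_ge0// exprn_ge0.
Qed.

Lemma NlnN_ge1 (N : nat) : (3 <= N)%N -> 1 <= N%:R * ln N%:R :> R.
move=> N3;have := ln2_ge R;have := @ln_nat_le R 2 N;rewrite (leq_trans _ N3)// => /(_ isT) a b.
have n3 : 3 <= N%:R :> R by rewrite ler_nat.
have c : 1 / 2 <= ln N%:R :> R by lra.
by nra.
Qed.

Lemma upper : exists2 C : R, 0 < C & forall N, (3 <= N)%N ->
 \sum_(d <- fdseq N) (h (3 * 2 ^ k) d)%:R <= C * (N%:R * ln N%:R) :> R.
have [C C0 [N0 hC]] := upper_large;pose S N : R := \sum_(d <- fdseq N) (h (3 * 2 ^ k) d)%:R.
have S0 N : 0 <= S N by pos.
have T0 : 0 <= \sum_(N < N0) S N by pos.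
exists (C + \sum_(N < N0) S N);first lra.
move=> N N3;have h := NlnN_ge1 N3;rewrite mulrDl;case: (leqP N0 N) => hN.
 letr (hC N hN (leq_trans _ N3)) => //;rewrite -mulrA lerDl mulr_ge0;lra.
via (\sum_(N < N0) S N).
 by rewrite (bigD1 (Ordinal hN))//= lerDl sumr_ge0.
rewrite -[leLHS]add0r;apply: lerD;first pos.
by rewrite ler_peMr.
Qed.
End UpperBound.

(** * Counting factorisations for the lower bound *)

Definition m4 (r f : nat) : bool := (f %% 4 == r)%N.
Definition q3 (e f : nat) : bool := m4 ((3 * e) %% 4) f.

Lemma sum_mod4 (F r : nat) : odd r -> (r < 4)%N -> (\sum_(1 <= f < F.+1) m4 r f = (F + 4 - r) %/ 4)%N.
move=> ro r4;elim: F => [|F IH];first by rewrite big_geq;move: ro r4;clear;lia.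
rewrite big_nat_recr//= IH /m4;case: eqP => h;move: h ro r4;clear;lia.
Qed.

Lemma modn4_odd (q m r : nat) : odd q -> (((q * m) %% 4 == r) = (m %% 4 == (q * r) %% 4) && (r < 4))%N.
lia.
Qed.

Section Count.
Variable R : realType.
Variables N S : nat.
Hypotheses (SN : (S * S <= N)%N) (NS : (N < S.+1 * S.+1)%N) (S3 : (3 <= S)%N).

Definition Hodd (q : nat) : R := \sum_(1 <= e < S.+1) (odd e && (q %| e)%N)%:R / e%:R.

Lemma Hodd_le q : odd q -> Hodd q <= Hodd 1 / q%:R.
move=> qo;have q0 : (0 < q)%N by case: q qo.
rewrite /Hodd;have -> : \sum_(1 <= e < S.+1) (odd e && (q %| e)%N)%:R / e%:R = \sum_(1 <= e < S.+1 | (q %| e)%N) (odd e)%:R / e%:R :> R.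
 by rewrite [RHS]big_mkcond/=;eqbig e;case: (q %| e)%N;rewrite ?andbT ?andbF ?mul0r.
rewrite (sum_mult (fun e => (odd e)%:R / e%:R))// mulr_suml.
via (\sum_(1 <= m < (S %/ q).+1) (odd m && (1 %| m)%N)%:R / m%:R / q%:R).
 apply: eqler;eqbig m.
 by rewrite dvd1n andbT oddM qo/= natrM invfM mulrA mulrAC.
rewrite [leRHS](big_cat_nat (n := (S %/ q).+1))//=;last by rewrite ltnS leq_div.
by rewrite lerDl sumr_ge0// => m _;rewrite !mulr_ge0 ?invr_ge0.
Qed.

Lemma Hodd_ge : ln (N%:R : R) <= 4 * Hodd 1.
pose H : R := \sum_(1 <= e < S.+1) (e%:R)^-1.
have hH : ln S.+1%:R <= H by exact: harmonic_ge.
have hN : ln (N%:R : R) <= 2 * ln S.+1%:R.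
 have -> : 2 * ln (S.+1%:R : R) = ln ((S.+1 * S.+1)%N%:R : R) by rewrite natrM lnM ?posrE//;ring.
 by apply: ln_nat_le;rewrite (ltnW NS) andbT;apply: leq_trans SN;rewrite muln_gt0 (leq_trans _ S3).
suff : H <= 2 * Hodd 1 by lra.
have e : H = Hodd 1 + \sum_(1 <= e < S.+1 | (2 %| e)%N) (e%:R)^-1.
 rewrite /H /Hodd [X in _ + X]big_mkcond -big_split/=;eqbig e.
 by rewrite dvd1n dvdn2;case: (odd e);rewrite /= ?mul1r ?mul0r ?addr0 ?add0r.
have : \sum_(1 <= e < S.+1 | (2 %| e)%N) (e%:R)^-1 <= H / 2;last lra.
rewrite (sum_mult (fun e => (e%:R)^-1))// mulr_suml.
rewrite [leRHS](big_cat_nat (n := (S %/ 2).+1))//=;last lia.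
rewrite -[leLHS]addr0;apply: lerD;last pos.
by apply: eqler;eqbig m;rewrite natrM invfM mulrC.
Qed.

Lemma Kq_le (F r q : nat) : odd r -> odd q -> (r < 4)%N ->
 \sum_(1 <= f < F.+1) (m4 r f && (q %| f)%N)%:R <= F%:R / (4 * q%:R) + 1 :> R.
move=> ro qo r4;have q0 : (0 < q)%N by case: q qo.
have -> : \sum_(1 <= f < F.+1) (m4 r f && (q %| f)%N)%:R = \sum_(1 <= f < F.+1 | (q %| f)%N) (m4 r f)%:R :> R by rewrite [RHS]big_mkcond/=;eqbig e;case: (q %| e)%N;rewrite ?andbT ?andbF.
rewrite (sum_mult (fun f => (m4 r f)%:R))//.
under eq_bigr => m _ do rewrite /m4 modn4_odd// r4 andbT -/(m4 _ _).
rewrite -natr_sum sum_mod4 ?ltn_pmod//;last first.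
 by have := odd_mod (q * r) (erefl : odd 4 = false);rewrite oddM qo ro.
have qR : 0 < q%:R :> R by rewrite ltr0n.
set x := ((q * r) %% 4)%N;have x1 : (1 <= x)%N by have := odd_mod (q * r) (erefl : odd 4 = false);rewrite oddM qo ro -/x;case: x.
via (((F %/ q) %/ 4)%N%:R + 1).
 by rewrite natr1 ler_nat;move: x1;move: (F %/ q)%N => y;clear;lia.
rewrite lerD2r -divnMA mulnC ler_pdivlMr ?mulr_gt0// -!natrM ler_nat leq_trunc_div//.
Qed.

(** Pairs with e odd and at most S, ef at most N, ef = 3 mod 4, and a dividing e, b dividing f. The
    condition f = 3e mod 4 expresses ef = 3 mod 4. *)
Definition T (a b : nat) : R := \sum_(1 <= e < S.+1) (odd e && (a %| e)%N)%:R *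
 \sum_(1 <= f < (N %/ e).+1) (q3 e f && (b %| f)%N)%:R.

Lemma odd3 e : odd e -> odd ((3 * e) %% 4).
by move=> eo;have := odd_mod (3 * e) (erefl : odd 4 = false);rewrite oddM eo. Qed.

Lemma T_le a b : odd a -> odd b -> T a b <= N%:R * Hodd 1 / (4 * (a * b)%:R) + S%:R.
move=> ao bo;have a0 : (0 < a)%N by case: a ao.
have b0 : (0 < b)%N by case: b bo.
have aR : 0 < a%:R :> R by rewrite ltr0n.
have bR : 0 < b%:R :> R by rewrite ltr0n.
via (\sum_(1 <= e < S.+1) (N%:R / (4 * b%:R) * ((odd e && (a %| e)%N)%:R / e%:R) + 1)).
 apply: sumr_le_nat => e /andP[e0 _] _;case: (boolP (odd e)) => [eo|_];last by rewrite /= !mul0r mulr0 add0r.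
 case: (a %| e)%N;last by rewrite /= !mul0r mulr0 add0r.
 have eR : 0 < e%:R :> R by rewrite ltr0n.
 rewrite /= !mul1r;letr (Kq_le (N %/ e) (odd3 eo) bo (ltn_pmod (3 * e) (isT : (0 < 4)%N))).
 rewrite lerD2r mulrAC ler_wpM2r ?invr_ge0 ?mulr_ge0// ler_pdivlMr// -natrM ler_nat leq_trunc_div//.
rewrite big_split/= -mulr_sumr -/(Hodd a) sumr_const_nat subSS subn0 lerD2r.
via (N%:R / (4 * b%:R) * (Hodd 1 / a%:R)).
 by apply: ler_wpM2l (Hodd_le ao);rewrite mulr_ge0// invr_ge0 mulr_ge0.
by apply: eqler;rewrite natrM;field;rewrite !gt_eqF.
Qed.

Lemma T_ge : N%:R * Hodd 1 / 4 - S%:R <= T 1 1.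
rewrite lerBlDr;via (\sum_(1 <= e < S.+1) ((odd e && (1 %| e)%N)%:R *
 \sum_(1 <= f < (N %/ e).+1) (q3 e f && (1 %| f)%N)%:R + 1));last first.
 by rewrite big_split/= sumr_const_nat subSS subn0.
rewrite mulrAC mulr_sumr;apply: sumr_le_nat => e /andP[e0 _] _;rewrite dvd1n andbT.
case: (boolP (odd e)) => [eo|_];last by rewrite /= !mul0r mulr0 add0r.
rewrite /= !mul1r;under eq_bigr => f _ do rewrite dvd1n andbT /q3.
have eR : 0 < e%:R :> R by rewrite ltr0n.
rewrite -natr_sum sum_mod4 ?odd3 ?ltn_pmod// natr1 ler_pdivrMr// ler_pdivrMr// -!natrM ler_nat.
set x := ((3 * e) %% 4)%N;have x4 : (x < 4)%N by rewrite ltn_pmod.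
have h : (N < (N %/ e).+1 * e)%N by exact: ltn_ceil.
have : ((N %/ e).+1 <= ((N %/ e + 4 - x) %/ 4).+1 * 4)%N by move: x4;clear;lia.
by move=> h2;letr (ltnW h);rewrite mulnAC leq_mul2r h2 orbT.
Qed.

(** For e at most S, the condition f > S ensures e < f, that is, e^2 < ef. *)
Definition gpair (e f : nat) : bool :=
 [&& odd e, q3 e f, (S < f)%N & `[< sqfree (e * f) >]].

(** If ef is not squarefree, some odd q at least 3 has q^2 | e, q^2 | f, or q dividing both; such a
    q is at most S because q^2 <= N. *)
Lemma gpair_ge e f : (1 <= e)%N -> (1 <= f)%N -> (e * f <= N)%N ->
 (odd e && q3 e f)%:R - (odd e)%:R * (f <= S)%N%:R
  - \sum_(3 <= q < S.+1 | odd q) ((odd e && (q ^ 2 %| e)%N)%:R * (q3 e f && (1 %| f)%N)%:R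
   + (odd e && (1 %| e)%N)%:R * (q3 e f && (q ^ 2 %| f)%N)%:R
   + (odd e && (q %| e)%N)%:R * (q3 e f && (q %| f)%N)%:R) <= (gpair e f)%:R :> R.
move=> e0 f0 efN;set s := \sum_(_ <= _ < _ | _) _.
have s0 : 0 <= s by pos.
rewrite /gpair;case: (boolP (odd e)) => [eo|_];last by rewrite mul0r;lra.
case: (boolP (q3 e f)) => [fe|_];last by rewrite mul1r;have : 0 <= (f <= S)%N%:R :> R by [];lra.
rewrite /= mul1r;case: (leqP f S) => fS/=;first lra.
case: asboolP => ns/=;first lra.
suff : 1 <= s by lra.
have fo : odd f by have := odd3 eo;rewrite -(eqP fe) odd_mod.
have [p pp pef] : exists2 p, prime p & (p ^ 2 %| e * f)%N by apply: contrapT => h;apply: ns => p pp;apply/negP => h2;apply: h;exists p.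
have p2N : (p ^ 2 <= N)%N by apply: leq_trans efN;apply: dvdn_leq => //;rewrite muln_gt0 e0.
have pS : (p < S.+1)%N by rewrite -ltn_sqr (leq_ltn_trans p2N)// -mulnn.
have po : odd p.
 have : (p %| e * f)%N by apply: dvdn_trans pef;rewrite expnS dvdn_mulr.
 by move/dvdn_odd => ->  //;rewrite oddM eo.
have p3 : (3 <= p)%N by move: (prime_gt1 pp) po;case: p {pp pef p2N pS} => [|[|[|]]].
rewrite /s big_mkcond (bigD1_seq p) ?iota_uniq ?mem_index_iota ?p3 ?pS//=.
via (1 + 0);first lra.
apply: lerD;last by apply: sumr_ge0 => q _;case: ifP => // _;rewrite !addr_ge0// mulr_ge0.
rewrite po eo fe/= !dvd1n !mul1r !mulr1.
have [pe|pe] := boolP (p %| e)%N;have [pf|pf] := boolP (p %| f)%N.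
- by rewrite mulr1 lerDr addr_ge0.
- move: pef;rewrite mulnC Gauss_dvdr;last by rewrite coprimeXl// prime_coprime.
 by move=> ->;rewrite mulr0 addr0 lerDl.
- move: pef;rewrite Gauss_dvdr;last by rewrite coprimeXl// prime_coprime.
 by move=> ->;rewrite mul0r addr0 lerDr.
- by move: pef => /(dvdn_trans (dvdn_exp (isT : 0 < 2)%N (dvdnn p)));rewrite Euclid_dvdM// (negPf pe) (negPf pf).
Qed.

Lemma sum_inv_odd : \sum_(3 <= q < S.+1 | odd q) (q%:R ^+ 2)^-1 <= 1 / 4 :> R.
have h m : \sum_(3 <= q < (2 * m).+3 | odd q) (q%:R ^+ 2)^-1 <= 1 / 4 - (4 * m.+1%:R)^-1 :> R.
 elim: m => [|m IH];first by rewrite big_geq// mulr1 div1r subrr.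
 have -> : ((2 * m.+1).+3 = (2 * m).+3.+2)%N by lia.
 have rec n (F : nat -> R) : (3 <= n)%N -> \sum_(3 <= q < n.+1 | odd q) F q = \sum_(3 <= q < n | odd q) F q + (if odd n then F n else 0) by move=> n3;rewrite big_mkcond big_nat_recr//= -big_mkcond.
 rewrite rec// rec//= oddM/= addr0.
 have p : 0 < m.+1%:R :> R by [].
 have -> : (2 * m).+3%:R = 2 * m.+1%:R + 1 :> R by lra.
 rewrite -[m.+2]addn1 natrD;move: IH p;set x := m.+1%:R => IH p.
 suff : ((2 * x + 1) ^+ 2)^-1 <= (4 * x)^-1 - (4 * (x + 1))^-1 by move: IH;set a := (4 * x)^-1;set b := (4 * (x + 1))^-1;set c := (_ ^+ 2)^-1;set d := \sum_(_ <= _ < _ | _) _;lra.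
 have -> : (4 * x)^-1 - (4 * (x + 1))^-1 = (4 * x * (x + 1))^-1 by field;rewrite !gt_eqF//;lra.
 by rewrite lef_pV2 ?posrE;[nra|apply: exprn_gt0;lra|rewrite !mulr_gt0;lra].
apply: le_trans (_ : _ <= \sum_(3 <= q < (2 * S).+3 | odd q) (q%:R ^+ 2)^-1) _.
 have [i1 i2] : (3 <= S.+1)%N /\ (S.+1 <= (2 * S).+3)%N by lia.
 rewrite [leRHS](big_cat_nat i1 i2)/=.
 by rewrite lerDl sumr_ge0// => q _;rewrite invr_ge0 exprn_ge0.
by letr (h S);rewrite gerBl invr_ge0 mulr_ge0.
Qed.

(** The main term is NH/4. Each odd q removes about 3NH/(4q^2), in total at most 3NH/16 by
    [sum_inv_odd], which leaves NH/16; the error terms are O(N). *)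
Lemma gpair_sum : N%:R * Hodd 1 / 16 - 5 * N%:R <= \sum_(1 <= e < S.+1) \sum_(1 <= f < (N %/ e).+1) (gpair e f)%:R.
have H0 : 0 <= Hodd 1 by pos.
have S1 : 1 <= S%:R :> R by rewrite ler1n;exact: leq_trans S3.
have SSN : S%:R * S%:R <= N%:R :> R by rewrite -natrM ler_nat.
pose B q := T (q ^ 2) 1 + T 1 (q ^ 2) + T q q.
have hB q : odd q -> (3 <= q)%N -> B q <= 3 / 4 * N%:R * Hodd 1 * (q%:R ^+ 2)^-1 + 3 * S%:R.
 move=> qo q3;have qR : 0 < q%:R :> R by rewrite ltr0n (leq_trans _ q3).
 have q2 : odd (q ^ 2) by lia.
 have := T_le q2 (isT : odd 1);have := T_le (isT : odd 1) q2;have := T_le qo qo.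
 rewrite muln1 mul1n mulnn natrX /B.
 lra.
have hBs : \sum_(3 <= q < S.+1 | odd q) B q <= 3 / 16 * N%:R * Hodd 1 + 3 * N%:R.
 via (\sum_(3 <= q < S.+1 | odd q) (3 / 4 * N%:R * Hodd 1 * (q%:R ^+ 2)^-1 + 3 * S%:R)).
  by apply: sumr_le_nat => q /andP[q3 _] qo;exact: hB.
 rewrite big_split/= -mulr_sumr;apply: lerD.
  have := ler_wpM2l (_ : 0 <= 3 / 4 * N%:R * Hodd 1) sum_inv_odd.
  by rewrite !mulr_ge0 ?invr_ge0// => /(_ isT) h;letr h;lra.
 via (\sum_(3 <= q < S.+1) 3 * S%:R).
  rewrite big_mkcond;lesum q;case: (odd q) => //;lra.
 rewrite sumr_const_nat -mulr_natr.
 have : (S.+1 - 3)%N%:R <= S%:R :> R by rewrite ler_nat;lia.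
 move: S1 SSN;set x := (_ - _)%:R;have : 0 <= x by [];set y := S%:R;nra.
have h : T 1 1 - S%:R * S%:R - \sum_(3 <= q < S.+1 | odd q) B q <= \sum_(1 <= e < S.+1) \sum_(1 <= f < (N %/ e).+1) (gpair e f)%:R.
 via (\sum_(1 <= e < S.+1) \sum_(1 <= f < (N %/ e).+1) ((odd e && q3 e f)%:R - (odd e)%:R * (f <= S)%N%:R
  - \sum_(3 <= q < S.+1 | odd q) ((odd e && (q ^ 2 %| e)%N)%:R * (q3 e f && (1 %| f)%N)%:R
   + (odd e && (1 %| e)%N)%:R * (q3 e f && (q ^ 2 %| f)%N)%:R
   + (odd e && (q %| e)%N)%:R * (q3 e f && (q %| f)%N)%:R)));last first.
  apply: sumr_le_nat => e /andP[e0 _] _;apply: sumr_le_nat => f /andP[f0 fN] _.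
  by apply: gpair_ge => //;rewrite mulnC -leq_divRL.
 under [leRHS]eq_bigr => e _ do rewrite !big_split/= !sumrN.
 rewrite !big_split/= !sumrN;apply: lerB;first apply: lerB.
 - rewrite /T;apply: eqler;eqbig e;rewrite dvd1n andbT mulr_sumr.
  by eqbig f;rewrite dvd1n andbT -natrM mulnb.
 - via (\sum_(1 <= e < S.+1) S%:R);last first.
   by rewrite sumr_const_nat subSS subn0 mulr_natr.
  apply: sumr_le_nat => e _ _.
  via (\sum_(1 <= f < (N %/ e).+1) (f <= S)%N%:R).
   by lesum f;case: (odd e);rewrite ?mul1r ?mul0r.
  rewrite -natr_sum ler_nat;elim: (N %/ e)%N => [|m IH];first by rewrite big_geq.
  have h n : (\sum_(1 <= f < n.+1) (f <= S)%N = minn n S)%N.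
   elim: n => [|n IHn];first by rewrite big_geq// min0n.
   by rewrite big_nat_recr//=;case: leqP;lia.
  by rewrite h geq_minr.
 apply: eqler.
 transitivity (\sum_(1 <= e < S.+1) \sum_(3 <= q < S.+1 | odd q) ((odd e && (q ^ 2 %| e)%N)%:R * \sum_(1 <= f < (N %/ e).+1) (q3 e f && (1 %| f)%N)%:R
   + (odd e && (1 %| e)%N)%:R * \sum_(1 <= f < (N %/ e).+1) (q3 e f && (q ^ 2 %| f)%N)%:R
   + (odd e && (q %| e)%N)%:R * \sum_(1 <= f < (N %/ e).+1) (q3 e f && (q %| f)%N)%:R : R)).
  by eqbig e;rewrite exchange_big;eqbig q;rewrite !big_split/= -!mulr_sumr.
 by rewrite exchange_big -!big_split;eqbig q;rewrite !big_split.
have := T_ge;have : S%:R <= N%:R :> R by apply: le_trans SSN;rewrite ler_peMr.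
lra.
Qed.

End Count.

Lemma ler_sum_subseq (R : numDomainType) (T : eqType) (s t : seq T) (F : T -> R) :
 uniq s -> uniq t -> {subset s <= t} -> (forall x, 0 <= F x) -> \sum_(x <- s) F x <= \sum_(x <- t) F x.
move=> us ut st F0;have p : perm_eq s [seq x <- t | x \in s].
 apply: uniq_perm;rewrite ?filter_uniq// => x;rewrite mem_filter.
 by case: (boolP (x \in s)) => //= /st ->.
rewrite (perm_big _ p)/= big_filter big_mkcond/=;lesum x.
by case: (x \in s).
Qed.

(** * From factorisations to torsion classes: the lower bound *)

Section LowerBound.
Variables (R : realType) (k : nat).
Hypothesis k1 : (1 <= k)%N.

Definition okn (n : nat) : bool := [&& (4 < n)%N, (n %% 4 == 3)%N & `[< sqfree n >]].

Lemma gpair_ok S e f : (1 <= e <= S)%N -> (3 <= S)%N -> gpair S e f -> okn (e * f) && okd (e * f) e.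
move=> /andP[e1 eS] S3 /and4P[eo /eqP h Sf sq].
have m : ((e * f) %% 4 = 3)%N.
 rewrite -modnMm h;have : (e %% 4 = 1 \/ e %% 4 = 3)%N by move: eo;clear;lia.
 by rewrite -(modnMmr 3 e);case=> ->.
have g4 : (4 <= e * f)%N by apply: leq_trans (leq_pmull f e1);apply: leq_ltn_trans Sf.
rewrite /okn /okd m eqxx sq e1 dvdn_mulr//= andbT ltn_pmul2l// (leq_ltn_trans eS Sf) andbT.
by rewrite ltn_neqAle g4 andbT;apply/eqP => e4;rewrite -e4 in m.
Qed.

(** The pair (e, f) is regarded as the divisor e of n = ef; [lower_h] counts these divisors for d =
    -n. *)
Lemma sum_gpair N S : (3 <= S)%N ->
 \sum_(1 <= e < S.+1) \sum_(1 <= f < (N %/ e).+1) (gpair S e f)%:R <= \sum_(d <- fdseq N) (h (3 * 2 ^ k) d)%:R :> R.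
move=> S3;pose s := [seq - n%:Z | n <- [seq n <- index_iota 1 N.+1 | okn n]].
have hs n : n \in [seq n <- index_iota 1 N.+1 | okn n] -> [/\ (n <= N)%N, (4 < n)%N, (n %% 4 = 3)%N & sqfree n] by rewrite mem_filter mem_index_iota => /andP[/and3P[h1 /eqP h2 /asboolP h3] /andP[_ h4]].
via (\sum_(d <- s) (h (3 * 2 ^ k) d)%:R);last first.
 apply: ler_sum_subseq => //;last 1 first.
 - move=> d /mapP[n /hs[nN n4 n3 sn] ->];rewrite mem_fdseq /goodN abszN nN andbT.
  by apply/asboolP;exact: fd_lower.
 - by rewrite map_inj_uniq ?filter_uniq ?iota_uniq// => a b /oppr_inj[].
 exact: fdseq_uniq.
rewrite big_map.
via (\sum_(n <- [seq n <- index_iota 1 N.+1 | okn n]) \sum_(1 <= e < S.+1) (okd n e)%:R);last first.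
 rewrite big_seq [leRHS]big_seq;apply: ler_sum => n /hs[nN n4 n3 sn].
 via ((size [seq e <- iota 1 n | okd n e])%:R);last by rewrite ler_nat;exact: lower_h.
 rewrite -natr_sum ler_nat;have -> : (\sum_(1 <= e < S.+1) okd n e = size [seq e <- iota 1 S | okd n e])%N by rewrite size_filter -sum1_count /index_iota subSS subn0 [RHS]big_mkcond;eqbig e;case: okd.
 apply: uniq_leq_size;first by rewrite filter_uniq ?iota_uniq.
 move=> e;rewrite !mem_filter !mem_iota => /andP[/and3P[e0 en een] _];rewrite /okd e0 en een/= add1n ltnS.
 by apply: dvdn_leq => //;apply: leq_trans n4.
rewrite big_filter [leRHS]big_mkcond/=.
via (\sum_(1 <= n < N.+1) \sum_(1 <= e < S.+1) (okn n && okd n e)%:R);last first.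
 by lesum n;case: (okn n) => //=;rewrite big1.
rewrite exchange_big/=;apply: sumr_le_nat => e /andP[e1 eS] _.
via (\sum_(1 <= n < N.+1 | (e %| n)%N) (okn n && okd n e)%:R);last first.
 by rewrite big_mkcond;lesum n;case: (e %| n)%N.
rewrite (sum_mult (fun n => (okn n && okd n e)%:R))//;lesum f.
by rewrite ler_nat;case: (boolP (gpair S e f)) => // hg;rewrite (gpair_ok _ S3 hg)// e1.
Qed.

Lemma fd_m3 : fundamental_discriminant (-3).
left;split => // p pp;apply/negP => /(dvdn_leq (isT : (0 < 3)%N)).
by rewrite leqNgt (@leq_trans (2 ^ 2))// leq_exp2r// prime_gt1.
Qed.

Lemma h3_ge1 : (1 <= h (3 * 2 ^ k) (-3))%N.
have fd := fd_m3.
apply: (@h_ge _ fd _ [:: class_one (quadratic_field (-3))]) => // c;rewrite inE => /eqP ->.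
split;first exact: G_1.
exact: (gexp_one (G_1 (-3)) (@G_1l (-3))).
Qed.

Lemma sum_h_ge1 N : (3 <= N)%N -> 1 <= \sum_(d <- fdseq N) (h (3 * 2 ^ k) d)%:R :> R.
move=> N3;via (\sum_(d <- [:: -3]) (h (3 * 2 ^ k) d)%:R).
 by rewrite big_seq1 ler1n h3_ge1.
apply: ler_sum_subseq => //;first exact: fdseq_uniq.
move=> d;rewrite inE => /eqP ->;rewrite mem_fdseq /goodN N3 andbT;apply/asboolP;exact: fd_m3.
Qed.

(** By [Hodd_ge] the count is at least N log N / 64 - 5N, which exceeds N log N / 128 once log N is
    at least 640. For smaller N the discriminant -3 alone gives a sum at least 1. *)
Lemma lower : exists2 c : R, 0 < c & forall N, (3 <= N)%N ->
 c * (N%:R * ln N%:R) <= \sum_(d <- fdseq N) (h (3 * 2 ^ k) d)%:R :> R.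
pose N1 := maxn 9 (Num.truncn (expR (640 : R))).+1.
have L1 : 0 <= N1%:R * ln N1%:R :> R by pos.
pose c : R := (128 + N1%:R * ln N1%:R)^-1.
have D0 : 0 < 128 + N1%:R * ln N1%:R :> R by lra.
have c0 : 0 < c by pos.
exists c => // N N3;have T0 : 0 <= N%:R * ln N%:R :> R by pos.
case: (leqP N1 N) => hN;last first.
 apply: le_trans (sum_h_ge1 N3);rewrite /c mulrC ler_pdivrMr// mul1r.
 via (N1%:R * ln N1%:R);last lra.
 apply: ler_pM => //;first exact: ln_nat_ge0.
  by rewrite ler_nat ltnW.
 by apply: ln_nat_le;rewrite (ltnW hN) andbT (leq_trans _ N3).
have N9 : (9 <= N)%N by apply: leq_trans hN;rewrite leq_maxl.
have lnN : 640 <= ln N%:R :> R.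
 rewrite -[640]expRK ler_ln ?posrE ?expR_gt0 ?ltr0n ?(leq_trans _ N3)//.
 apply: ltW;apply: lt_le_trans (truncnS_gt _) _;rewrite ler_nat;apply: leq_trans hN;exact: leq_maxr.
have [S /and4P[S1 _ SN NS]] := root_ex 1 (leq_trans (isT : 0 < 3)%N N3).
rewrite -!mulnn in SN NS.
have S3 : (3 <= S)%N by rewrite leqNgt;apply/negP => S3;move: (leq_trans N9 (ltnW NS)) S3;clear -NS N9;nia.
via (N%:R * ln N%:R / 128).
 by rewrite mulrC;apply: ler_wpM2l => //;rewrite /c lef_pV2 ?posrE// lerDl.
apply: le_trans (sum_gpair N S3);apply: le_trans (gpair_sum R SN NS S3).
have := Hodd_ge R SN NS S3;set H := Hodd R S 1;move: lnN;set l := ln _;move=> h1 h2.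
have N0 : 0 <= N%:R :> R by [].
have h3 : N%:R * l <= 4 * (N%:R * H) by rewrite mulrCA;exact: ler_wpM2l.
have h4 : N%:R * 640 <= N%:R * l by exact: ler_wpM2l.
move: (N%:R * l) (N%:R * H) h3 h4 => u v;move: N%:R => x;clear;lra.
Qed.
End LowerBound.

(** * Passage from integers N to real X *)

Local Open Scope classical_set_scope.

Lemma sum_fdseq (R : realType) (F : int -> R) (X : R) : 0 <= X ->
 \sum_(d \in [set d : int | fundamental_discriminant d /\ (`|d|%:~R : R) <= X]) F d = \sum_(d <- fdseq (Num.truncn X)) F d.
move=> X0;rewrite [RHS](fsbig_seq _ F (fdseq_uniq _)).
suff -> : [set d : int | fundamental_discriminant d /\ (`|d|%:~R : R) <= X] = [set` fdseq (Num.truncn X)] by [].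
apply/seteqP;split => d/=;rewrite mem_fdseq /goodN truncn_ge_nat//.
 by move=> [fd];rewrite -abszE => dX;apply/andP;split => //;apply/asboolP.
by move=> /andP[/asboolP fd dX];split => //;rewrite -abszE.
Qed.

Theorem theorem1p2 (R : realType) (k : nat) (hk : (1 <= k)%N) :
 exists c' C' : R, [/\ 0 < c', 0 < C' &
  forall X : R, 3 <= X ->
   c' * X * ln X
    <= \sum_(d \in [set d : int | fundamental_discriminant d /\
                   (`|d|%:~R : R) <= X])
       ((h (3 * 2 ^ k)%N d)%:R : R)
    <= C' * X * ln X].
have [C C0 hC] := upper R hk;have [c c0 hc] := lower R hk.
exists (c / 4), C;split => // [|X X3];first lra.
have X0 : 0 <= X by lra.
(* The sum depends only on the integral part N of X. Since X <= 2N and log X <= 2 log N, the lower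
   constant loses a factor 4. *)
rewrite sum_fdseq//;set N := Num.truncn X.
have /andP[NX XN] := truncn_itv X0;rewrite -/N in NX XN.
have N3 : (3 <= N)%N by rewrite /N truncn_ge_nat.
have N0 : 0 < N%:R :> R by lra.
have lN : ln N%:R <= ln X by rewrite ler_ln ?posrE//;lra.
have lN0 : 0 <= ln (N%:R : R) by pos.
apply/andP;split;last first.
 letr (hC N N3);rewrite -mulrA;apply: ler_wpM2l;[exact: ltW|exact: ler_pM].
apply: le_trans (hc N N3);rewrite -!mulrA;apply: ler_wpM2l;first exact: ltW.
have X2 : X <= 2 * N%:R by lra.
have : ln X <= 2 * ln N%:R.
 have -> : 2 * ln (N%:R : R) = ln (N%:R * N%:R) by rewrite lnM ?posrE//;ring.
 rewrite ler_ln ?posrE ?mulr_gt0//;last lra.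
 letr X2;apply: ler_wpM2r;first exact: ltW.
 lra.
move=> l2;have : X * ln X <= (2 * N%:R) * (2 * ln N%:R) by apply: ler_pM => //;apply: le_trans lN.
lra.
Qed.
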